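(* Let $X$ be Brox's diffusion in the two-sided Brownian environment $W$, with local time process $L_X$, and for $\alpha>0$ let $m_\alpha=m_\alpha(W)$ be the bottom of the standard $\alpha$-valley of $W$. Let $K>0$ and $r\in(0,1)$. For all $\delta>0$, $$\lim_{\alpha\to+\infty}\mathbb{P}\left(\sup_{-K\le x\le K}\left|\frac{L_X(e^{\alpha},m_\alpha+x)}{e^{\alpha}}\cdot\frac{\int_{a_{\alpha r}}^{b_{\alpha r}}e^{-W_{m_\alpha}(y)}\,dy}{e^{-W_{m_\alpha}(x)}}-1\right|\le\delta\right)=1,$$ where $W_{m_\alpha}(\cdot):=W(m_\alpha+\cdot)-W(m_\alpha)$ and, for any $\theta>0$, $a_\theta=a_\theta(W_{m_\alpha}):=\sup\{x\le0:\ W_{m_\alpha}(x)\ge\theta\}$ and $b_\theta=b_\theta(W_{m_\alpha}):=\inf\{x\ge0:\ W_{m_\alpha}(x)\ge\theta\}$.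
   Context: Probability space: $\mathcal{W}$ is the space of continuous functions $W:\mathbb{R}\to\mathbb{R}$ with $W(0)=0$, with the $\sigma$-field generated by the topology of uniform convergence on compact sets and the Wiener measure $\mathcal{P}$ under which the coordinate process $W$ is a two-sided Brownian motion. $\Omega:=C([0,+\infty),\mathbb{R})$ carries the probability measure $P$ under which the coordinate process $B$ is a standard Brownian motion. $\mathbb{P}:=\mathcal{P}\otimes P$ on $\mathcal{W}\times\Omega$. Diffusion: $X=X(W,\cdot):=S_W^{-1}\circ B\circ T_W^{-1}$, where $S_W(x):=\int_0^x e^{W(y)}\,dy$ for $x\in\mathbb{R}$, and $T_W(t):=\int_0^t e^{-2W(S_W^{-1}(B(s)))}\,ds$ for $t\ge0$ (well defined for $\mathcal{P}$-a.e. $W$). Given $W$, $X$ is a diffusion started at $0$ with generator $\frac12 e^{W(x)}\frac{d}{dx}\big(e^{-W(x)}\frac{d}{dx}\big)$. Local time: $(L_X(t,x),\ t\ge0,\ x\in\mathbb{R})$ is the $\mathbb{P}$-a.s. unique jointly continuous process such that for any bounded Borel $f$ and any $t\ge0$, $\int_0^t f(X(s))\,ds=\int_{\mathbb{R}}f(x)L_X(t,x)\,dx$. Valleys: for $h>0$, $W$ admits an $h$-minimum at $x_0$ if there exist $\xi<x_0<\zeta$ with $W(\xi)\ge W(x_0)+h$, $W(\zeta)\ge W(x_0)+h$ and $W(x)\ge W(x_0)$ for all $x\in[\xi,\zeta]$; $W$ admits an $h$-maximum at $x_0$ if $-W$ admits an $h$-minimum at $x_0$. $M_h(W)$ is the set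 of points of $h$-minimum or $h$-maximum. $\mathcal{P}$-a.s., $M_h$ has no accumulation point, $h$-maxima and $h$-minima alternate, and there is exactly one triple $(p_h,m_h,q_h)$ of successive elements of $M_h$ such that $m_h$ and $0$ lie in $[p_h,q_h]$, $p_h,q_h$ are $h$-maxima and $m_h$ is an $h$-minimum. This triple is the standard $h$-valley of $W$, and $m_h$ is its bottom. *)

(* Defs.v *)
From HB Require Import structures.
From mathcomp Require Import all_boot all_order all_algebra.
From mathcomp Require Import all_classical all_reals all_analysis.

Set Implicit Arguments.
Unset Strict Implicit.
Unset Printing Implicit Defensive.

Import Order.TTheory GRing.Theory Num.Theory.
Import numFieldNormedType.Exports.

Local Open Scope classical_set_scope.
Local Open Scope ring_scope.

(* The open sets of T for the topology of uniform convergence on compact sets,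
   when T is a space of functions from U to R through e. *)
Definition compact_cvg_open (R : realType) (U : topologicalType) (T : Type)
    (e : T -> U -> R) : set (set T) :=
  [set (e : T -> {family compact, U -> R}) @^-1` O
     | O in @open {family compact, U -> R}].

Record env_path (R : realType) := EnvPath {
  env_fun :> R -> R ;
  env_continuous : continuous env_fun ;
  env_at0 : env_fun 0 = 0 }.

HB.instance Definition _ (R : realType) := gen_eqMixin (env_path R).
HB.instance Definition _ (R : realType) := gen_choiceMixin (env_path R).
Definition env_path0 (R : realType) : env_path R :=
  @EnvPath R (cst 0) (@cst_continuous R R 0) erefl.
HB.instance Definition _ (R : realType) :=
  isPointed.Build (env_path R) (env_path0 R).

Definition env (R : realType) : Type :=
  g_sigma_algebraType (compact_cvg_open (@env_fun R)).
HB.instance Definition _ (R : realType) := Measurable.on (env R).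

Definition half_line (R : realType) : set R := `[0, +oo[.
Arguments half_line : clear implicits.

Record omega_path (R : realType) := OmegaPath {
  omega_fun : half_line R -> R ;
  omega_continuous : continuous omega_fun }.

HB.instance Definition _ (R : realType) := gen_eqMixin (omega_path R).
HB.instance Definition _ (R : realType) := gen_choiceMixin (omega_path R).
Definition omega_path0 (R : realType) : omega_path R :=
  @OmegaPath R (cst 0) (@cst_continuous (half_line R) R 0).
HB.instance Definition _ (R : realType) :=
  isPointed.Build (omega_path R) (omega_path0 R).

Definition omega (R : realType) : Type :=
  g_sigma_algebraType (compact_cvg_open (@omega_fun R)).
HB.instance Definition _ (R : realType) := Measurable.on (omega R).

(* B(s) for s : R; only the values at s >= 0 are meaningful, the others are 0. *)
Definition omega_eval (R : realType) (B : omega R) : R -> R :=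
  'valL_(0 : R) (omega_fun B).

Definition indep_gaussian_increments (R : realType) (d : measure_display)
    (T : measurableType d) (P : probability T R) (D : set R)
    (X : T -> R -> R) : Prop :=
  forall (n : nat) (t : nat -> R) (A : nat -> set R),
    (forall i, (i <= n)%N -> D (t i)) ->
    (forall i, (i < n)%N -> t i < t i.+1) ->
    (forall i, (i < n)%N -> measurable (A i)) ->
    P [set w | forall i, (i < n)%N -> A i (X w (t i.+1) - X w (t i))] =
    (\prod_(i < n) normal_prob 0 (Num.sqrt (t i.+1 - t i)) (A i))%E.

(* Continuity and W(0) = 0 are part of the type env R; independent Gaussian
   increments over all real times then say that (W(x))_{x >= 0} and
   (W(- x))_{x >= 0} are independent standard Brownian motions. *)
Definition two_sided_wiener (R : realType) (P : probability (env R) R) : Prop :=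
  indep_gaussian_increments P setT (fun W : env R => env_fun W).

Definition standard_wiener (R : realType) (P : probability (omega R) R) :
    Prop :=
  P [set B | omega_eval B 0 = 0] = 1%E /\
  indep_gaussian_increments P (half_line R) (@omega_eval R).

Definition scale (R : realType) (W : R -> R) (x : R) : R :=
  if 0 <= x then \int[lebesgue_measure]_(y in `[0, x]) expR (W y)
  else - \int[lebesgue_measure]_(y in `[x, 0]) expR (W y).

Definition scale_inv (R : realType) (W : R -> R) : R -> R :=
  'pinv_(fun=> 0) setT (scale W).

Definition clock (R : realType) (W B : R -> R) (t : R) : R :=
  \int[lebesgue_measure]_(s in `[0, t]) expR (- 2 * W (scale_inv W (B s))).

Definition clock_inv (R : realType) (W B : R -> R) : R -> R :=
  'pinv_(fun=> 0) (half_line R) (clock W B).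

Definition brox (R : realType) (w : env R * omega R) (t : R) : R :=
  scale_inv (env_fun w.1)
    (omega_eval w.2 (clock_inv (env_fun w.1) (omega_eval w.2) t)).

Definition is_local_time (R : realType) (d : measure_display)
    (T : measurableType d) (P : probability T R) (X : T -> R -> R)
    (L : T -> R -> R -> R) : Prop :=
  (forall t x, 0 <= t -> measurable_fun setT (fun w => L w t x)) /\
  {ae P, forall w,
    {within [set p : R * R | 0 <= p.1],
      continuous (fun p : R * R => L w p.1 p.2)} /\
    (forall (f : R -> R) (t : R), measurable_fun setT f ->
      [bounded f x | x in setT] -> 0 <= t ->
      (\int[lebesgue_measure]_(s in `[0%R, t]) (f (X w s))%:E =
       \int[lebesgue_measure]_x (f x * L w t x)%:E)%E)}.

Definition h_minimum (R : realType) (h : R) (W : R -> R) (x0 : R) : Prop :=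
  exists xi zeta, [/\ xi < x0 < zeta, W x0 + h <= W xi, W x0 + h <= W zeta &
    forall x, xi <= x <= zeta -> W x0 <= W x].

Definition h_maximum (R : realType) (h : R) (W : R -> R) (x0 : R) : Prop :=
  h_minimum h (fun x => - W x) x0.

Definition h_extrema (R : realType) (h : R) (W : R -> R) : set R :=
  [set x | h_minimum h W x \/ h_maximum h W x].

Definition successive (R : realType) (M : set R) (x y : R) : Prop :=
  [/\ M x, M y, x < y & forall z, x < z < y -> ~ M z].

Definition standard_valley (R : realType) (h : R) (W : R -> R)
    (v : R * R * R) : Prop :=
  let: (p, m, q) := v in
  [/\ successive (h_extrema h W) p m, successive (h_extrema h W) m q,
      p <= 0 <= q &
      [/\ h_maximum h W p, h_minimum h W m & h_maximum h W q]].

(* Almost surely there is exactly one standard valley; on the exceptional null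
   set xget returns an unspecified one, or the default. *)
Definition valley_bottom (R : realType) (h : R) (W : R -> R) : R :=
  (xget (0, 0, 0) [set v | standard_valley h W v]).1.2.

Definition recentered (R : realType) (W : R -> R) (m : R) (x : R) : R :=
  W (m + x) - W m.

Definition left_hit (R : realType) (V : R -> R) (theta : R) : R :=
  sup [set x | x <= 0 /\ theta <= V x].

Definition right_hit (R : realType) (V : R -> R) (theta : R) : R :=
  inf [set x | 0 <= x /\ theta <= V x].

Definition normalized_local_time (R : realType)
    (L : env R * omega R -> R -> R -> R) (r alpha : R) (w : env R * omega R)
    (x : R) : R :=
  let W := env_fun w.1 in
  let m := valley_bottom alpha W in
  let V := recentered W m in
  let a := left_hit V (alpha * r) in
  let b := right_hit V (alpha * r) in
  L w (expR alpha) (m + x) / expR alpha *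
  ((\int[lebesgue_measure]_(y in `[a, b]) expR (- V y)) / expR (- V x)).

(* This event belongs to the completed sigma-field only: the valley is well
   defined, and L is continuous, almost surely.
   The supremum is taken in \bar R because the real sup of an unbounded set
   is 0. *)
Definition local_time_event (R : realType)
    (L : env R * omega R -> R -> R -> R) (K r delta alpha : R) :
    set (env R * omega R) :=
  [set w | (ereal_sup
     [set (`|normalized_local_time L r alpha w x - 1|%R)%:E
        | x in (`[(- K)%R, K] : set R)] <= delta%:E)%E].

(* Main.v *)
(* X is the Brownian motion B read in the scale S_W with the clock T_W. Let V be
   the environment recentered at the bottom m of the alpha-valley, [a, b] the
   interval delimited by the hitting times of alpha r, I the integral of e^(-V)
   over it, tau the first time when B hits S_W (max 0 (m + a)), and
   lambda = e^(alpha + W m) / I. By the strong Markov property, the path b' that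
   follows B after tau, rescaled by lambda, is again a Brownian motion; at this
   scale S_W maps [m + a, m + b] to a neighbourhood of a point, so that the local
   time l' of b' is nearly constant there. Hence at the time s = T_W (tau +
   lambda^2 v), L_X (s, m + x) is close to e^alpha e^(- V x) l' (v, 0) / I, and
   the sum over x gives s close to e^alpha l' (v, 0): l' (v, 0) is close to 1
   when s = e^alpha. What is spent outside [m + a, m + b] and before tau is
   exponentially small as soon as the valley has some margins, measured by
   rational parameters (right_valley); some choice of parameters suits almost
   every environment at level 1, and Brownian scaling carries a finite number of
   choices, of large probability, to every level alpha.

   B has a jointly continuous local time because L provides one in almost every
   environment; it is recurrent at 0 because the probability that it vanishes at
   all times is scale invariant. *)
Require Import Defs.
From HB Require Import structures.
From mathcomp Require Import all_boot all_order all_algebra.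
From mathcomp Require Import all_classical all_reals all_analysis.
From mathcomp Require Import measurable_realfun ring lra zify.
Set Implicit Arguments.
Unset Strict Implicit.
Unset Printing Implicit Defensive.
Import Order.TTheory GRing.Theory Num.Theory.
Import numFieldNormedType.Exports.

Local Open Scope classical_set_scope.
Local Open Scope ring_scope.

(** * Path spaces *)

(** The restart point max 0 (m + a) is at least K to the left of the bottom. At the points m + x of
    the statement B has therefore no local time before tau: what happens before tau is felt only
    through the clock. The obstacle is the clock spent at the low points met between 0 and the
    valley, where e^(-W) may be huge. The way from 0 to the restart point is cut into blocks of
    length kap. A point y of a block collects local time only once the start y_i of the block is
    hit. From there B is restarted once more, at scale S_W (max 0 (m + a)) - S_W y_i, and e^(-W y)
    times this scale is at most e^(alpha - 2 eta), up to the width of the valley, because W never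
    rises by more than alpha - 3 eta on the way. So all that is asked of B, in a given environment,
    is that at most M + 1 restarted and rescaled copies of it satisfy one and the same event [good].
    Its probability depends neither on the scale nor on the environment. M does not depend on alpha
    either, since the length of the way and that of a block are both multiplied by alpha^2. A union
    bound then suffices, and no Brownian estimate has to be uniform in alpha. *)

Definition coord_sets (R : realType) (D : set R) : set (set (env_path R)) :=
  [set [set f : env_path R | f t <= d] | t in D & d in [set: R]].

(* The carrier does not depend on D: only the sigma-field does, and it ignores
   the values of the path outside D. *)
Definition pathD (R : realType) (D : set R) : Type :=
  g_sigma_algebraType (coord_sets D).
HB.instance Definition _ (R : realType) (D : set R) :=
  Measurable.on (pathD D).

Section path_space.
Context {R : realType}.
Implicit Types D : set R.

Lemma measurable_fun_rays d (T : measurableType d) (f : T -> R) :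
  (forall c, measurable [set x | f x <= c]) -> measurable_fun setT f.
Proof.
move=> mf; apply: (measurability _ (RGenOInfty.measurableE R)) => _ [_ [c ->] <-].
rewrite setTI (_ : _ @^-1` _ = ~` [set x | f x <= c]); first exact: measurableC.
by apply/seteqP; split=> x /=; rewrite in_itv/= andbT ltNge => /negP.
Qed.

Lemma measurable_ray d (T : measurableType d) (f : T -> R) c :
  measurable_fun setT f -> measurable [set x | f x <= c].
Proof.
move=> mf; have := mf measurableT `]-oo, c]%classic (measurable_itv _).
by rewrite setTI.
Qed.

Lemma measurable_coord D t : D t ->
  measurable_fun setT (fun f : pathD D => env_fun f t).
Proof.
move=> Dt; apply: measurable_fun_rays => c.
by apply: sub_sigma_algebra; exists t => //; exists c.
Qed.

Lemma measurable_to_path d (T : measurableType d) D (Y : T -> pathD D) :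
  (forall t, D t -> measurable_fun setT (fun x => env_fun (Y x) t)) ->
  measurable_fun setT Y.
Proof.
move=> mY; apply: (@measurability _ _ _ _ setT Y (coord_sets D)) => // _ [_ [t Dt [c _ <-]] <-].
rewrite setTI; exact: (measurable_ray c (mY t Dt)).
Qed.

Definition cyl (l : seq (R * R)) : set (env_path R) :=
  [set f | forall p, p \in l -> f p.1 <= p.2].

Definition cyls D : set (set (env_path R)) :=
  [set cyl l | l in [set l : seq (R * R) | forall p, p \in l -> D p.1]].

Lemma cyl_cat l l' : cyl (l ++ l') = cyl l `&` cyl l'.
Proof.
apply/seteqP; split=> f /=.
  by move=> h; split=> p pl; apply: h; rewrite mem_cat pl ?orbT.
by move=> [h1 h2] p; rewrite mem_cat => /orP[/h1|/h2].
Qed.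

Lemma measurable_cyl d (T : measurableType d) (X : T -> env_path R) l :
  (forall p, p \in l -> measurable_fun setT (fun x => X x p.1)) ->
  measurable (X @^-1` cyl l).
Proof.
elim: l => [|p l ih] mX.
  by rewrite (_ : _ @^-1` _ = setT) //; apply/seteqP; split.
rewrite -cat1s cyl_cat preimage_setI; apply: measurableI; last first.
  by apply: ih => q ql; apply: mX; rewrite inE ql orbT.
rewrite (_ : _ @^-1` _ = [set x | X x p.1 <= p.2]).
  by apply: measurable_ray; apply: mX; rewrite inE eqxx.
apply/seteqP; split=> x /=; first by apply; rewrite inE.
by move=> h q; rewrite inE => /eqP ->.
Qed.

Lemma measurable_path_cyls D : @measurable _ (pathD D) = <<s cyls D >>.
Proof.
rewrite eqEsubset; split.
  apply: smallest_sub; first exact: smallest_sigma_algebra.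
  move=> _ [t Dt [c _ <-]]; apply: sub_sigma_algebra; exists [:: (t, c)].
    by move=> p; rewrite inE => /eqP ->.
  apply/seteqP; split=> f /=; first by move=> /(_ (t, c)); rewrite inE; apply.
  by move=> h p; rewrite inE => /eqP ->.
apply: smallest_sub; first exact: sigma_algebra_measurable.
move=> _ [l lD <-]; apply: (@measurable_cyl _ (pathD D) id) => p pl.
by apply: measurable_coord; exact: lD.
Qed.

(** Concatenation of lists makes the cylinders stable under intersection, hence a pi-system
    generating the sigma-field. *)
Lemma cyl_unique D (P Q : {measure set (pathD D) -> \bar R}) :
  (P setT < +oo)%E ->
  (forall l, (forall p, p \in l -> D p.1) -> P (cyl l) = Q (cyl l)) ->
  forall A, measurable A -> P A = Q A.
Proof.
move=> Poo PQ A mA.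
have cT : cyl [::] = setT by apply/seteqP; split.
apply: (@measure_unique _ R (pathD D) (cyls D) (fun=> setT)) => //.
- exact: measurable_path_cyls.
- move=> _ _ [l lD <-] [l' lD' <-]; exists (l ++ l'); last exact: cyl_cat.
  by move=> p; rewrite mem_cat => /orP[/lD|/lD'].
- by move=> _; exists [::] => //; rewrite -cT.
- by apply/seteqP; split=> // x _; exists 0%N.
- by move=> _ [l lD <-]; exact: PQ.
Qed.

(* Values at finitely many times are sums of increments between consecutive
   times of a partition containing 0. *)
Lemma inc_unique D (D0 : D 0) (P Q : {measure set (pathD D) -> \bar R}) :
  (P setT < +oo)%E ->
  (forall (n : nat) (t : nat -> R) (A : nat -> set R),
    (forall i, (i <= n)%N -> D (t i)) ->
    (forall i, (i < n)%N -> t i < t i.+1) ->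
    (forall i, (i < n)%N -> measurable (A i)) ->
    P [set f | forall i, (i < n)%N -> A i (env_fun f (t i.+1) - env_fun f (t i))] =
    Q [set f | forall i, (i < n)%N -> A i (env_fun f (t i.+1) - env_fun f (t i))]) ->
  forall A, measurable A -> P A = Q A.
Proof.
move=> Poo PQ; apply: cyl_unique => // l lD.
pose ts := sort <=%R (undup (0 :: map fst l)).
have ts_uniq : uniq ts by rewrite sort_uniq undup_uniq.
have ts0 : 0 \in ts by rewrite mem_sort mem_undup inE eqxx.
have tsl p : p \in l -> p.1 \in ts.
  by move=> pl; rewrite mem_sort mem_undup inE map_f ?orbT.
have tsD t : t \in ts -> D t.
  rewrite mem_sort mem_undup inE => /orP[/eqP->//|/mapP[p pl ->]].
  exact: lD.
have : (0 < size ts)%N by case: (ts) ts0.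
move sE : (size ts) => [//|n] _.
pose t i := nth 0 ts i.
have tD i : (i <= n)%N -> D (t i).
  by move=> ni; apply: tsD; apply: mem_nth; rewrite sE ltnS.
have tlt i : (i < n)%N -> t i < t i.+1.
  move=> ni; rewrite /t lt_neqAle nth_uniq ?sE ?ltnS ?(ltnW ni)//.
  rewrite (ltn_eqF (ltnSn i)) andTb.
  have : sorted <=%R ts by exact: sort_le_sorted.
  move=> /(sorted_leq_nth le_trans lexx 0); apply.
  - by rewrite inE sE ltnS ltnW.
  - by rewrite inE sE ltnS.
  - exact: leqnSn.
pose E (A : nat -> set R) : set (env_path R) :=
  [set f | forall i, (i < n)%N -> A i (f (t i.+1) - f (t i))].
(* With the partition frozen, the sets [E A] are stable under intersection, which events on
   increments over varying partitions are not. *)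
pose G := [set E A | A in [set A | forall i, (i < n)%N -> measurable (A i)]].
have EG i : (i < n)%N -> measurable_fun setT
    (fun f : g_sigma_algebraType G => env_fun f (t i.+1) - env_fun f (t i)).
  move=> ni; apply: measurable_fun_rays => c; apply: sub_sigma_algebra.
  exists (fun j => if j == i then `]-oo, c]%classic else setT).
    by move=> j _ /=; case: ifP.
  apply/seteqP; split=> f /= h.
    by move: (h i ni); rewrite eqxx/= in_itv.
  by move=> j nj; case: eqP => // -> /=; rewrite in_itv.
have m0 i : (i <= n)%N -> measurable_fun setT
    (fun f : g_sigma_algebraType G => env_fun f (t i) - env_fun f (t 0%N)).
  elim: i => [|i ih] ni.
    by under eq_fun do rewrite subrr; exact: measurable_cst.
  have -> : (fun f : g_sigma_algebraType G => env_fun f (t i.+1) - env_fun f (t 0%N)) =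
    (fun f => (env_fun f (t i.+1) - env_fun f (t i)) + (env_fun f (t i) - env_fun f (t 0%N))).
    by apply/funext => f; rewrite addrA subrK.
  by apply: measurable_funD; [exact: EG|apply: ih; exact: ltnW].
have mts s : s \in ts ->
    measurable_fun setT (fun f : g_sigma_algebraType G => env_fun f s).
  move=> sts.
  have idx u : u \in ts -> exists2 i, (i <= n)%N & u = t i.
    move=> uts; exists (index u ts); last by rewrite /t nth_index.
    by rewrite -ltnS -sE index_mem.
  have [i ni ->] := idx s sts; have [k nk k0] := idx 0 ts0.
  have -> : (fun f : g_sigma_algebraType G => env_fun f (t i)) =
    (fun f => (env_fun f (t i) - env_fun f (t 0%N)) - (env_fun f (t k) - env_fun f (t 0%N))).
    by apply/funext => f; rewrite -k0 env_at0; ring.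
  by apply: measurable_funB; exact: m0.
have GD : G `<=` @measurable _ (pathD D).
  move=> _ [A mA <-]; have -> : E A = \bigcap_(i in `I_n)
      ((fun f : pathD D => env_fun f (t i.+1) - env_fun f (t i)) @^-1` A i) by [].
  apply: fin_bigcap_measurable; first exact: finite_II.
  move=> i /= ni; rewrite -[X in measurable X]setTI.
  apply: measurable_funB => //; first by apply: measurable_coord; exact: tD.
    by apply: measurable_coord; apply: tD; exact: ltnW.
  exact: mA.
have ET : E (fun=> setT) = setT by apply/seteqP; split.
apply: (@g_sigma_algebra_measure_unique _ R (pathD D) G _ (fun=> setT)) => //.
- by move=> _; exists (fun=> setT).
- by apply/seteqP; split=> // x _; exists 0%N.
- move=> _ _ [A mA <-] [A' mA' <-]; exists (fun i => A i `&` A' i).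
    by move=> i ni; apply: measurableI; [exact: mA|exact: mA'].
  apply/seteqP; split=> f /= h.
    by split=> i /h [].
  by move=> i ni; split; [exact: h.1|exact: h.2].
- by move=> _ [A mA <-]; apply: PQ.
- by apply: (@measurable_cyl _ (g_sigma_algebraType G) id) => p /tsl/mts.
Qed.

End path_space.

(** * Wiener measures *)

(* Taking mY as an argument allows law P mY to be inferred to be a probability. *)
Definition law d d' (T : measurableType d) (T' : measurableType d')
    (R : realType) (P : set T -> \bar R) (Y : T -> T')
    (mY : measurable_fun setT Y) : set T' -> \bar R := pushforward P Y.

Section law_measure.
Context d d' (T : measurableType d) (T' : measurableType d') (R : realType).
Variables (P : {measure set T -> \bar R}) (Y : T -> T').
Hypothesis mY : measurable_fun setT Y.

Let law0 : law P mY set0 = 0%E.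
Proof. by rewrite /law /pushforward preimage_set0 measure0. Qed.

Let law_ge0 A : (0 <= law P mY A)%E.
Proof. exact: measure_ge0. Qed.

Let law_sigma_additive : semi_sigma_additive (law P mY).
Proof.
move=> F mF tF mUF; rewrite /law /pushforward preimage_bigcup.
apply: measure_semi_sigma_additive.
- by move=> n; rewrite -[X in measurable X]setTI; exact: mY.
- apply/trivIsetP => /= i j _ _ ij; rewrite -preimage_setI.
  by move/trivIsetP : tF => /(_ _ _ _ _ ij) ->//; rewrite preimage_set0.
- by rewrite -preimage_bigcup -[X in measurable X]setTI; exact: mY.
Qed.

HB.instance Definition _ := isMeasure.Build _ _ _ (law P mY)
  law0 law_ge0 law_sigma_additive.

End law_measure.

Section law_probability.
Context d d' (T : measurableType d) (T' : measurableType d') (R : realType).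
Variables (P : probability T R) (Y : T -> T').
Hypothesis mY : measurable_fun setT Y.

Let law_setT : law P mY setT = 1%E.
Proof. by rewrite /law /pushforward preimage_setT probability_setT. Qed.

HB.instance Definition _ :=
  Measure_isProbability.Build _ _ _ (law P mY) law_setT.
End law_probability.

Section gaussian_scaling.
Context {R : realType}.
Local Notation leb := (@lebesgue_measure R).

Definition mulc (c : R) : measurableTypeR R -> measurableTypeR R := fun x => c * x.

Lemma measurable_mulc (c : R) : measurable_fun setT (mulc c).
Proof. exact: measurable_funM. Qed.

Lemma lebesgue_mulc (c : R) (A : set R) : c != 0 -> measurable A ->
  leb A = (`|c|%:E * leb (mulc c @^-1` A))%E.
Proof.
move=> c0 mA.
have c_gt0 : 0 < `|c| by rewrite normr_gt0.
pose mu := mscale (NngNum (ltW c_gt0)) (law leb (measurable_mulc c)).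
rewrite (@lebesgue_measure_unique R mu) // => _ [[a b]] _ <-.
change (leb `]a, b]%classic = `|c|%:E * leb (mulc c @^-1` `]a, b]%classic))%E.
have [cp|cn] : 0 < c \/ c < 0.
  by move: c0; rewrite neq_lt => /orP[]; [right|left].
- rewrite (_ : mulc c @^-1` _ = `]a / c, b / c]%classic); last first.
    apply/seteqP; split=> x /=; rewrite /mulc !in_itv/= ltr_pdivrMr// ler_pdivlMr//.
      by rewrite ![_ * c]mulrC.
    by rewrite ![_ * c]mulrC.
  rewrite !lebesgue_measure_itv/= !lte_fin ltr_pM2r ?invr_gt0//.
  case: ifPn => _; last by rewrite mule0.
  rewrite -!EFinD -EFinM gtr0_norm// -mulrBl.
  by rewrite mulrCA divff ?gt_eqF// mulr1.
- rewrite (_ : mulc c @^-1` _ = `[b / c, a / c[%classic); last first.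
    apply/seteqP; split=> x /=; rewrite /mulc !in_itv/= ler_ndivrMr// ltr_ndivlMr//.
      by rewrite ![_ * c]mulrC andbC.
    by rewrite ![_ * c]mulrC andbC.
  rewrite !lebesgue_measure_itv/= !lte_fin ltr_nM2r ?invr_lt0//.
  case: ifPn => _; last by rewrite mule0.
  rewrite -!EFinD -EFinM ltr0_norm//.
  by congr EFin; field.
Qed.

Lemma gauss_exponent_scale (a c s : R) : c != 0 -> s != 0 ->
  - a / (s ^+ 2 *+ 2) = - (c ^+ 2 * a) / (c ^+ 2 * s ^+ 2 *+ 2).
Proof. by move=> c0 s0; field; rewrite c0 s0. Qed.

Lemma normal_prob_mulc (c s : R) (A : set R) : c != 0 -> 0 < s -> measurable A ->
  normal_prob 0 s (mulc c @^-1` A) = normal_prob 0 (`|c| * s) A.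
Proof.
move=> c0 s0 mA.
have c_gt0 : 0 < `|c| by rewrite normr_gt0.
rewrite /normal_prob.
have mpdf t : measurable_fun setT (fun x : R => (normal_pdf 0 t x)%:E).
  by apply/measurable_EFinP; exact: measurable_normal_pdf.
pose mu := mscale (NngNum (ltW c_gt0)) (law leb (measurable_mulc c)).
have -> : (\int[leb]_(x in A) (normal_pdf 0 (`|c| * s) x)%:E =
   \int[mu]_(x in A) (normal_pdf 0 (`|c| * s) x)%:E)%E.
  by apply: eq_measure_integral => //= B mB _; exact: lebesgue_mulc.
rewrite ge0_integral_mscale//; last 2 first.
- by apply: measurable_funTS; exact: mpdf.
- by move=> x _; rewrite lee_fin normal_pdf_ge0.
rewrite /law ge0_integral_pushforward//; last 3 first.
- exact: measurable_mulc.
- by apply: measurable_funTS; exact: mpdf.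
- by move=> x _; rewrite lee_fin normal_pdf_ge0.
rewrite -ge0_integralZl//; last 3 first.
- by rewrite -[X in measurable X]setTI; exact: measurable_mulc.
- apply: measurable_funTS; apply: (measurableT_comp (mpdf _)).
  exact: measurable_mulc.
- by move=> x _; rewrite lee_fin normal_pdf_ge0.
apply: eq_integral => x _; rewrite /= -EFinM; congr EFin.
have sn : s != 0 by rewrite gt_eqF.
have csn : `|c| * s != 0 by rewrite mulf_neq0// gt_eqF.
rewrite !normal_pdfE// /normal_peak /normal_fun /mulc mulrA; congr (_ * expR _).
  have key (p : R) : (Num.sqrt ((`|c| * s) ^+ 2 * p *+ 2))^-1 =
      `|c|^-1 * (Num.sqrt (s ^+ 2 * p *+ 2))^-1.
    rewrite exprMn -mulrA -mulrnAr sqrtrM ?sqr_ge0// sqrtr_sqr normr_id.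
    by rewrite invfM.
  by rewrite key mulrA divff ?mul1r// gt_eqF.
rewrite !subr0 !exprMn real_normK ?num_real//.
exact: gauss_exponent_scale.
Qed.

Lemma normal_prob1 (s x : R) : normal_prob 0 s [set x] = 0%E.
Proof.
have /null_content_dominatesP h := @normal_prob_dominates R 0 s.
by apply: h => //; exact: lebesgue_measure_set1.
Qed.

(** Both half-lines have the same mass by symmetry, and 0 is not an atom. *)
Lemma normal_prob_le0 (s : R) : 0 < s ->
  normal_prob 0 s `]-oo, 0] = (2^-1)%:E.
Proof.
move=> s0.
have mN : measurable (`]-oo, 0]%classic : set R) by exact: measurable_itv.
have mP : measurable (`[0, +oo[%classic : set R) by exact: measurable_itv.
have E : normal_prob 0 s `]-oo, 0] = normal_prob 0 s `[0, +oo[.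
  rewrite -[in LHS](mul1r s) -(normr1 R) -normrN -normal_prob_mulc//.
  congr (normal_prob 0 s _); apply/seteqP; split=> x /=;
    by rewrite /mulc !in_itv/= andbT mulN1r oppr_le0.
pose Po : set R := `]0, +oo[%classic.
have mPo : measurable Po by exact: measurable_itv.
have T : (normal_prob 0 s setT = normal_prob 0 s `]-oo, 0%R] + normal_prob 0 s Po)%E.
  rewrite -measureU//; last first.
    apply/seteqP; split=> // x [] /=; rewrite /Po/= !in_itv/= andbT => x0.
    by rewrite ltNge x0.
  congr (normal_prob 0 s _); apply/seteqP; split=> x //= _.
  by rewrite /Po/= !in_itv/= andbT; case: (leP x 0); [left|right].
have E2 : normal_prob 0 s `[0, +oo[ = normal_prob 0 s Po.
  have -> : (`[0, +oo[%classic : set R) = [set 0] `|` Po.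
    apply/seteqP; split=> x /=; rewrite /Po/= !in_itv/= !andbT.
      by rewrite le_eqVlt => /orP[/eqP <-|]; [left|right].
    by case=> [->//|/ltW].
  rewrite measureU//.
    change (normal_prob 0%R s [set 0%R] + normal_prob 0%R s Po = normal_prob 0%R s Po)%E.
    by rewrite normal_prob1 add0e.
  by apply/seteqP; split=> // x [] /= ->; rewrite /Po/= in_itv/= ltxx.
move: T; rewrite probability_setT -E2 -E.
have : normal_prob 0 s `]-oo, 0] \is a fin_num by apply: fin_num_measure.
move/fineK => <-; rewrite -EFinD => -[] h; congr EFin; lra.
Qed.

End gaussian_scaling.

Section wiener.
Context {R : realType}.
Implicit Types D : set R.

Definition wiener D (P : probability (pathD D) R) : Prop :=
  indep_gaussian_increments P D (fun f : pathD D => env_fun f).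

Lemma wiener_unique D (P Q : probability (pathD D) R) : D 0 ->
  wiener P -> wiener Q -> forall A, measurable A -> P A = Q A.
Proof.
move=> D0 wP wQ; apply: inc_unique => //.
  by apply: (@le_lt_trans _ _ 1%E); [exact: probability_le1|exact: ltry].
move=> n t A tD tlt mA; apply: etrans (wP n t A tD tlt mA) _; exact/esym/(wQ n t A tD tlt mA).
Qed.

Lemma aff_continuous (c t : R) (f : env_path R) :
  continuous (fun x => c^-1 * (f (t + c ^+ 2 * x) - f t)).
Proof.
move=> x; apply: cvgM; first exact: cvg_cst.
apply: cvgB; last exact: cvg_cst.
apply: (@cvg_comp _ _ _ (fun x => t + c ^+ 2 * x) f); last exact: env_continuous.
by apply: cvgD; [exact: cvg_cst|apply: cvgM; [exact: cvg_cst|exact: cvg_id]].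
Qed.

Lemma aff_at0 (c t : R) (f : env_path R) :
  c^-1 * (f (t + c ^+ 2 * 0) - f t) = 0.
Proof. by rewrite mulr0 addr0 subrr mulr0. Qed.

(* aff (-1) 0 f is - f. *)
Definition aff (c t : R) (f : env_path R) : env_path R :=
  EnvPath (@aff_continuous c t f) (aff_at0 c t f).

Lemma measurable_aff D D' c t : D t ->
  (forall x, D' x -> D (t + c ^+ 2 * x)) ->
  measurable_fun setT (aff c t : pathD D -> pathD D').
Proof.
move=> Dt DD'; apply: measurable_to_path => x D'x /=.
apply: measurable_funM => //; apply: measurable_funB; apply: measurable_coord => //.
exact: DD'.
Qed.

(** Restarting at a fixed time, Brownian scaling and change of sign are all instances of [aff], so
    that the invariance of the law is proved once. *)
Lemma wiener_aff D D' c t (Dt : D t)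
    (DD' : forall x, D' x -> D (t + c ^+ 2 * x)) (P : probability (pathD D) R) :
  c != 0 -> wiener P -> wiener (law P (measurable_aff Dt DD')).
Proof.
move=> c0 wP n u A uD ult mA.
have c2 : 0 < c ^+ 2 by rewrite exprn_even_gt0.
have E : aff c t @^-1` [set f | forall i, (i < n)%N ->
    A i (env_fun f (u i.+1) - env_fun f (u i))] =
  [set f | forall i, (i < n)%N -> (mulc c^-1 @^-1` A i)
     (env_fun f (t + c ^+ 2 * u i.+1) - env_fun f (t + c ^+ 2 * u i))].
  by apply/seteqP; split=> f h i ni; move: (h i ni) => /=;
    rewrite /mulc -mulrBr opprB addrA subrK.
apply: etrans (congr1 (P : set (pathD D) -> \bar R) E) _.
apply: etrans (wP n (fun i => t + c ^+ 2 * u i) (fun i => mulc c^-1 @^-1` A i) _ _ _) _; last first.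
- apply: eq_bigr => i _.
  have du : t + c ^+ 2 * u i.+1 - (t + c ^+ 2 * u i) = c ^+ 2 * (u i.+1 - u i).
    by rewrite opprD addrACA subrr add0r -mulrBr.
  have s0 : 0 < Num.sqrt (t + c ^+ 2 * u i.+1 - (t + c ^+ 2 * u i)).
    by rewrite du sqrtr_gt0 mulr_gt0// subr_gt0 ult.
  have ci : c^-1 != 0 by rewrite invr_eq0.
  apply: etrans (normal_prob_mulc ci s0 (mA i (ltn_ord i))) _.
  suff -> : `|c^-1| * Num.sqrt (t + c ^+ 2 * u i.+1 - (t + c ^+ 2 * u i)) =
    Num.sqrt (u i.+1 - u i) by [].
  rewrite du sqrtrM ?sqr_ge0// sqrtr_sqr normrV ?unitfE// mulrA mulVf ?mul1r//.
  by rewrite normr_eq0.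
- by move=> i ni; rewrite -[X in measurable X]setTI; apply: measurable_mulc => //; exact: mA.
- by move=> i ni; rewrite ltrD2l ltr_pM2l// ult.
- by move=> i ni; apply: DD'; exact: uD.
Qed.

Lemma refl_continuous (f : env_path R) : continuous (fun x => f (- x)).
Proof.
by move=> x; apply: (@cvg_comp _ _ _ -%R f); [exact: (@oppr_continuous R R)|exact: env_continuous].
Qed.

Lemma refl_at0 (f : env_path R) : f (- 0) = 0.
Proof. by rewrite oppr0 env_at0. Qed.

Definition refl (f : env_path R) : env_path R :=
  EnvPath (@refl_continuous f) (refl_at0 f).

Lemma measurable_refl :
  measurable_fun setT (refl : pathD (@setT R) -> pathD (@setT R)).
Proof. by apply: measurable_to_path => x _ /=; exact: measurable_coord. Qed.

(** Time reversal turns the increments over a partition into the opposites of those over the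
    reversed partition, whence the index [n - i.+1] and the factor -1. *)
Lemma wiener_refl (P : probability (pathD (@setT R)) R) :
  wiener P -> wiener (law P measurable_refl).
Proof.
move=> wP n u A uD ult mA.
have E : refl @^-1` [set f | forall i, (i < n)%N ->
    A i (env_fun f (u i.+1) - env_fun f (u i))] =
  [set f | forall i, (i < n)%N -> (mulc (-1) @^-1` A (n - i.+1)%N)
     (env_fun f (- u (n - i.+1)%N) - env_fun f (- u (n - i)%N))].
  apply/seteqP; split=> f h i ni; have jn : (n - i.+1 < n)%N by lia.
    have e : (n - i.+1).+1 = (n - i)%N by lia.
    by have := h _ jn; rewrite /= /mulc mulN1r opprB e.
  have e1 : (n - (n - i.+1).+1 = i)%N by lia.
  have e2 : (n - (n - i.+1) = i.+1)%N by lia.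
  by have := h _ jn; rewrite /= /mulc mulN1r opprB e1 e2.
apply: etrans (congr1 (P : set (pathD setT) -> \bar R) E) _.
apply: etrans (wP n (fun i => - u (n - i)%N) (fun i => mulc (-1) @^-1` A (n - i.+1)%N) _ _ _) _; last first.
- rewrite [RHS](reindex_inj rev_ord_inj)/=; apply: eq_bigr => i _.
  have ni := ltn_ord i.
  have N1 : -1 != 0 :> R by rewrite oppr_eq0 oner_eq0.
  have du : - u (n - i.+1)%N - - u (n - i)%N = u (n - i.+1).+1 - u (n - i.+1)%N.
    by rewrite opprK addrC -subSn// subSS.
  have s0 : 0 < Num.sqrt (- u (n - i.+1)%N - - u (n - i)%N).
    by rewrite du sqrtr_gt0 subr_gt0 ult//; lia.
  have mAi : measurable (A (n - i.+1)%N) by apply: mA; lia.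
  apply: etrans (normal_prob_mulc N1 s0 mAi) _.
  by rewrite normrN normr1 mul1r du.
- move=> i ni; rewrite -[X in measurable X]setTI; apply: measurable_mulc => //.
  by apply: mA; lia.
- move=> i ni; rewrite ltrN2.
  by have := ult (n - i.+1)%N; rewrite -subSn// subSS; apply; lia.
- by [].
Qed.

End wiener.

(** * The canonical spaces and the Markov property *)

Section canonical_paths.
Context {R : realType}.

Lemma family_eval_continuous (U : topologicalType) (x : U) :
  continuous (fun g : {family compact, U -> R} => (g : U -> R) x).
Proof.
move=> f W /=; rewrite -[in X in X -> _]nbhs_entourageE => -[E entE EW].
have := @fam_nbhs U R compact [set x] E f entE (@compact_set1 U x).
by apply: filterS => g /(_ x erefl) Eg; apply: EW; exact/xsectionP.
Qed.

(** Points are compact, so evaluation at a point is continuous for this topology. This carries the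
    two given measures to the path spaces [pathD], whose sigma-field is generated by coordinates. *)
Lemma measurable_eval (U : topologicalType) (T : pointedType) (e : T -> U -> R) (x : U) :
  measurable_fun setT (fun w : g_sigma_algebraType (compact_cvg_open e) => e w x).
Proof.
apply: measurable_fun_rays => c.
rewrite (_ : [set _ | _] = ~` [set w | c < e w x]); last first.
  by apply/seteqP; split=> w /=; rewrite leNgt => /negP.
apply: measurableC; apply: sub_sigma_algebra.
exists [set g : {family compact, U -> R} | c < (g : U -> R) x] => //.
have := @open_comp _ _ (fun g : {family compact, U -> R} => (g : U -> R) x)
  [set y | c < y].
by apply; [move=> f _; exact: family_eval_continuous|exact: open_gt].
Qed.

Definition env_to_path (W : env R) : pathD (@setT R) := W.

Lemma measurable_env_to_path : measurable_fun setT env_to_path.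
Proof.
apply: measurable_to_path => t _.
exact: (@measurable_eval R (env_path R) (@env_fun R) t).
Qed.

Lemma wiener_env (PW : probability (env R) R) :
  two_sided_wiener PW -> wiener (law PW measurable_env_to_path).
Proof. by move=> wP n t A tD tlt mA; rewrite /law /pushforward -wP. Qed.

Lemma half_line_ge0 (x : R) : half_line R x -> 0 <= x.
Proof. by rewrite /half_line/= in_itv/= andbT. Qed.

Lemma ge0_half_line (x : R) : 0 <= x -> half_line R x.
Proof. by rewrite /half_line/= in_itv/= andbT. Qed.

Lemma max0_half_line (x : R) : Num.max 0 x \in half_line R.
Proof. by rewrite inE /half_line/= in_itv/= andbT le_max lexx. Qed.

Definition to_half_line (x : R) : half_line R :=
  exist (fun y => y \in half_line R) _ (max0_half_line x).

Lemma continuous_to_half_line : continuous to_half_line.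
Proof.
apply: continuous_comp_initial => x /=.
by apply: (@continuous_max R R (cst 0) id); [exact: cvg_cst|exact: cvg_id].
Qed.

Lemma omega_eval_max0 (B : omega R) (x : R) :
  omega_eval B (Num.max 0 x) = omega_fun B (to_half_line x).
Proof.
have := valLK 0 (omega_fun B); move=> /(congr1 (fun f => f (to_half_line x))).
by [].
Qed.

Lemma bev_continuous (B : omega R) :
  continuous (fun x : R => omega_eval B (Num.max 0 x) - omega_eval B 0).
Proof.
move=> x; apply: cvgB; last exact: cvg_cst.
have E : (fun x : R => omega_eval B (Num.max 0 x)) = omega_fun B \o to_half_line.
  by apply/funext => y; rewrite omega_eval_max0.
have : continuous (omega_fun B \o to_half_line).
  move=> y; apply: continuous_comp; first exact: continuous_to_half_line.
  exact: omega_continuous.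
by rewrite -E => /(_ x).
Qed.

Lemma bev_at0 (B : omega R) : omega_eval B (Num.max 0 0) - omega_eval B 0 = 0.
Proof. by rewrite maxxx subrr. Qed.

(** B is extended to negative times by a constant, and its value at 0, almost surely null, is
    subtracted so that every B gives a path vanishing at 0. *)
Definition bev (B : omega R) : pathD (half_line R) :=
  EnvPath (@bev_continuous B) (@bev_at0 B).

Lemma bevE (B : omega R) x : 0 <= x ->
  env_fun (bev B) x = omega_eval B x - omega_eval B 0.
Proof. by move=> x0 /=; rewrite (max_idPr x0). Qed.

Lemma measurable_omega_eval (x : R) : 0 <= x ->
  measurable_fun setT (fun B : omega R => omega_eval B x).
Proof.
move=> x0.
have := @measurable_eval _ (omega_path R) (@omega_fun R) (to_half_line x).
by under eq_fun do rewrite -omega_eval_max0 (max_idPr x0).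
Qed.

Lemma measurable_bev : measurable_fun setT bev.
Proof.
apply: measurable_to_path => t /half_line_ge0 t0.
under eq_fun do rewrite bevE//.
by apply: measurable_funB; exact: measurable_omega_eval.
Qed.

Lemma wiener_omega (PB : probability (omega R) R) :
  standard_wiener PB -> wiener (law PB measurable_bev).
Proof.
move=> [_ wP] n t A tD tlt mA; rewrite /law /pushforward -wP//.
congr (PB _); apply/seteqP; split=> B h i ni; have := h i ni;
  have /half_line_ge0 a := tD i (ltnW ni); have /half_line_ge0 b := tD i.+1 ni;
  by rewrite /= (max_idPr a) (max_idPr b) opprB addrA subrK.
Qed.

End canonical_paths.

Section markov.
Context {R : realType}.
Variable P : probability (pathD (half_line R)) R.
Hypothesis wP : wiener P.

Local Notation inc n t A := [set f : env_path R | forall i, (i < n)%N ->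
  A i (f (t i.+1) - f (t i))].

Lemma half_line0 : half_line R 0.
Proof. by rewrite /half_line/= in_itv/= lexx. Qed.

Lemma half_lineD t x : 0 <= t -> half_line R x -> half_line R (t + 1 ^+ 2 * x).
Proof.
by rewrite /half_line/= !in_itv/= !andbT expr1n mul1r => *; exact: addr_ge0.
Qed.

Let multi (n : nat) (t : nat -> R) (A : nat -> set R) : \bar R :=
  (\prod_(i < n) normal_prob 0 (Num.sqrt (t i.+1 - t i)) (A i))%E.

Lemma eprod_split (F : nat -> \bar R) n m :
  (\prod_(i < n + m) F i = \prod_(i < n) F i * \prod_(i < m) F (n + i)%N)%E.
Proof. by rewrite big_split_ord. Qed.

Lemma eprod_recr (F : nat -> \bar R) n :
  (\prod_(i < n.+1) F i = \prod_(i < n) F i * F n)%E.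
Proof. by rewrite big_ord_recr. Qed.

(** Both events are read on one partition, [u] followed by [t + v]. If [u n < t + v 0], an increment
    subject to no condition, of probability 1, bridges the gap. Otherwise the two times coincide,
    since [u n <= t <= t + v 0], and are merged. *)
Lemma inc_cat (t : R) (n : nat) (u : nat -> R) (A : nat -> set R)
    (m : nat) (v : nat -> R) (A' : nat -> set R) :
  0 <= t ->
  (forall i, (i <= n)%N -> 0 <= u i <= t) ->
  (forall i, (i < n)%N -> u i < u i.+1) ->
  (forall i, (i < n)%N -> measurable (A i)) ->
  (forall i, (i <= m)%N -> half_line R (v i)) ->
  (forall i, (i < m)%N -> v i < v i.+1) ->
  (forall i, (i < m)%N -> measurable (A' i)) ->
  P (inc n u A `&` (aff 1 t @^-1` (inc m v A'))) =
  (P (inc n u A) * P (inc m v A'))%E.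
Proof.
move=> t0 uD ult mA vD vlt mA'.
have vge i : (i <= m)%N -> 0 <= v i.
  by move=> /vD; rewrite /half_line/= in_itv/= andbT.
have uge i : (i <= n)%N -> half_line R (u i).
  by move=> /uD /andP[h _]; rewrite /half_line/= in_itv/= h.
have r1 : P (inc n u A) = multi n u A := wP uge ult mA.
have r2 : P (inc m v A') = multi m v A' := wP vD vlt mA'.
apply: etrans _ (esym (congr2 mule r1 r2)).
have tvsub i : t + v i.+1 - (t + v i) = v i.+1 - v i by ring.
have affE (f : env_path R) i : aff 1 t f (v i.+1) - aff 1 t f (v i) =
    f (t + v i.+1) - f (t + v i).
  by rewrite /= invr1 !mul1r expr1n !mul1r; ring.
have [gap|nogap] := ltP (u n) (t + v 0%N).
- pose w i := if (i <= n)%N then u i else t + v (i - n.+1)%N.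
  pose C i := if (i < n)%N then A i else if i == n then setT else A' (i - n.+1)%N.
  have wu i : (i <= n)%N -> w i = u i by rewrite /w => ->.
  have wv i : w (n.+1 + i)%N = t + v i by rewrite /w ifF ?addKn//; lia.
  have Cu i : (i < n)%N -> C i = A i by rewrite /C => ->.
  have Cn : C n = setT by rewrite /C ltnn eqxx.
  have Cv i : C (n.+1 + i)%N = A' i.
    by rewrite /C ifF; [rewrite ifF ?addKn//; lia|lia].
  clearbody w C.
  have -> : inc n u A `&` (aff 1 t @^-1` (inc m v A')) = inc (n.+1 + m)%N w C.
    apply/seteqP; split=> f.
      move=> [h1 h2] i im /=; case: (ltngtP i n) => [ni|ni|->].
      + by rewrite Cu// !wu//; [exact: h1|exact: ltnW].
      + have -> : i = (n.+1 + (i - n.+1))%N by lia.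
        rewrite Cv -addnS !wv -affE; apply: h2; lia.
      + by rewrite Cn.
    move=> h; split=> i im.
      have := h i; rewrite Cu// !wu//; last exact: ltnW.
      apply; lia.
    by have := h (n.+1 + i)%N; rewrite Cv -addnS !wv -affE; apply; lia.
  apply: etrans (wP (n := (n.+1 + m)%N) _ _ _) _; last first.
  + pose F i := normal_prob 0 (Num.sqrt (w i.+1 - w i)) (C i).
    apply: etrans (eprod_split F n.+1 m) _; rewrite eprod_recr.
    have -> : F n = 1%E by rewrite /F Cn; exact: probability_setT.
    have h1 : (\prod_(i < n) F i)%E = multi n u A.
      apply: eq_bigr => i _; rewrite /F.
      have ni := ltn_ord i; have e1 := Cu _ ni; have e2 := wu _ ni.
      have e3 := wu _ (ltnW ni); by rewrite e1 e2 e3.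
    have h2 : (\prod_(i < m) F (n.+1 + i)%N)%E = multi m v A'.
      by apply: eq_bigr => i _; rewrite /F Cv -addnS !wv tvsub.
    exact: (congr2 mule (etrans (mule1 _) h1) h2).
  + move=> i im; case: (ltngtP i n) => [ni|ni|->].
    * by rewrite Cu//; exact: mA.
    * have -> : i = (n.+1 + (i - n.+1))%N by lia.
      by rewrite Cv; apply: mA'; lia.
    * by rewrite Cn.
  + move=> i im; case: (ltngtP i n) => [ni|ni|->].
    * by rewrite !wu//; [exact: ult|exact: ltnW].
    * have -> : i = (n.+1 + (i - n.+1))%N by lia.
      by rewrite -addnS !wv ltrD2l vlt//; lia.
    * by rewrite wu// -[n.+1]addn0 wv.
  + move=> i; case: (leqP i n) => ni im; first by rewrite wu//; exact: uge.
    have -> : i = (n.+1 + (i - n.+1))%N by lia.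
    rewrite wv /half_line/= in_itv/= andbT addr_ge0// vge//; lia.
- have unt : u n = t + v 0%N.
    apply/eqP; rewrite eq_le nogap andbT (@le_trans _ _ t)//.
      by have /andP[] := uD n (leqnn n).
    by rewrite lerDl vge.
  pose w i := if (i <= n)%N then u i else t + v (i - n)%N.
  pose C i := if (i < n)%N then A i else A' (i - n)%N.
  have wu i : (i <= n)%N -> w i = u i by rewrite /w => ->.
  have wv i : w (n + i)%N = t + v i.
    rewrite /w; case: leqP => [ni|ni]; last by rewrite addKn.
    have -> : i = 0%N by lia.
    by rewrite addn0.
  have Cu i : (i < n)%N -> C i = A i by rewrite /C => ->.
  have Cv i : C (n + i)%N = A' i.
    by rewrite /C ifF ?addKn//; lia.
  clearbody w C.
  have -> : inc n u A `&` (aff 1 t @^-1` (inc m v A')) = inc (n + m)%N w C.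
    apply/seteqP; split=> f.
      move=> [h1 h2] i im /=; case: (ltnP i n) => ni.
      + by rewrite Cu// !wu//; [exact: h1|exact: ltnW].
      + have -> : i = (n + (i - n))%N by lia.
        rewrite Cv -addnS !wv -affE; apply: h2; lia.
    move=> h; split=> i im.
      have := h i; rewrite Cu// !wu//; last exact: ltnW.
      apply; lia.
    by have := h (n + i)%N; rewrite Cv -addnS !wv -affE; apply; lia.
  apply: etrans (wP (n := (n + m)%N) _ _ _) _; last first.
  + pose F i := normal_prob 0 (Num.sqrt (w i.+1 - w i)) (C i).
    apply: etrans (eprod_split F n m) _.
    have h1 : (\prod_(i < n) F i)%E = multi n u A.
      apply: eq_bigr => i _; rewrite /F.
      have ni := ltn_ord i; have e1 := Cu _ ni; have e2 := wu _ ni.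
      have e3 := wu _ (ltnW ni); by rewrite e1 e2 e3.
    have h2 : (\prod_(i < m) F (n + i)%N)%E = multi m v A'.
      by apply: eq_bigr => i _; rewrite /F Cv -addnS !wv tvsub.
    exact: (congr2 mule h1 h2).
  + move=> i im; case: (ltnP i n) => ni.
    * by rewrite Cu//; exact: mA.
    * have -> : i = (n + (i - n))%N by lia.
      by rewrite Cv; apply: mA'; lia.
  + move=> i im; case: (ltnP i n) => ni.
    * by rewrite !wu//; [exact: ult|exact: ltnW].
    * have -> : i = (n + (i - n))%N by lia.
      by rewrite -addnS !wv ltrD2l vlt//; lia.
  + move=> i; case: (leqP i n) => ni im; first by rewrite wu//; exact: uge.
    have -> : i = (n + (i - n))%N by lia.
    rewrite wv /half_line/= in_itv/= andbT addr_ge0// vge//; lia.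
Qed.

Definition past (t : R) : set R := `[0, t]%classic.

Definition to_past (t : R) : pathD (half_line R) -> pathD (past t) := id.

Lemma measurable_to_past t : measurable_fun setT (to_past t).
Proof.
apply: measurable_to_path => x; rewrite /past/= in_itv/= => /andP[x0 _].
by apply: measurable_coord; rewrite /half_line/= in_itv/= x0.
Qed.

Lemma measurable_past t (A : set (pathD (past t))) : measurable A ->
  measurable (A : set (pathD (half_line R))).
Proof.
by move=> mA; rewrite -[X in measurable X]setTI; exact: measurable_to_past.
Qed.

Definition shift (t : R) : pathD (half_line R) -> pathD (half_line R) := aff 1 t.

Lemma measurable_shift t : 0 <= t -> measurable_fun setT (shift t).
Proof.
move=> t0; apply: measurable_aff; first by rewrite /half_line/= in_itv/= t0.
by move=> x; exact: half_lineD.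
Qed.

Lemma measurable_inc D n (u : nat -> R) (A : nat -> set R) :
  (forall i, (i <= n)%N -> D (u i)) ->
  (forall i, (i < n)%N -> measurable (A i)) ->
  measurable (inc n u A : set (pathD D)).
Proof.
move=> uD mA; have -> : inc n u A = \bigcap_(i in `I_n)
    ((fun f : pathD D => env_fun f (u i.+1) - env_fun f (u i)) @^-1` A i) by [].
apply: fin_bigcap_measurable; first exact: finite_II.
move=> i /= ni; rewrite -[X in measurable X]setTI.
apply: measurable_funB => //; last exact: mA.
  by apply: measurable_coord; exact: uD.
by apply: measurable_coord; apply: uD; exact: ltnW.
Qed.

(** Two applications of uniqueness by increments: the past varies while the future is an increment
    event, then the future varies while the past is an arbitrary fixed event. Each time a
    restriction of P is compared with a multiple of P. *)
Lemma markov t (A : set (pathD (past t))) (C : set (pathD (half_line R))) :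
  0 <= t -> measurable A -> measurable C ->
  P (A `&` (shift t @^-1` C)) = (P A * P C)%E.
Proof.
move=> t0 mA mC.
have mS (E : set (pathD (half_line R))) : measurable E ->
    measurable (shift t @^-1` E).
  by move=> mE; rewrite -[X in measurable X]setTI; exact: measurable_shift.
have fin (E : set (pathD (half_line R))) : measurable E -> P E = (fine (P E))%:E.
  by move=> mE; rewrite fineK// fin_num_measure.
have ge (E : set (pathD (half_line R))) : 0 <= fine (P E) by exact: fine_ge0.
have step1 m v (A' : nat -> set R) (B : set (pathD (past t))) :
    (forall i, (i <= m)%N -> half_line R (v i)) ->
    (forall i, (i < m)%N -> v i < v i.+1) ->
    (forall i, (i < m)%N -> measurable (A' i)) -> measurable B ->
    P (B `&` (shift t @^-1` inc m v A')) = (P B * P (inc m v A'))%E.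
  move=> vD vlt mA' mB.
  have mI : measurable (inc m v A' : set (pathD (half_line R))).
    exact: measurable_inc.
  pose mu1 := law (mrestr P (mS _ mI)) (@measurable_to_past t).
  pose mu2 := mscale (NngNum (ge (inc m v A'))) (law P (@measurable_to_past t)).
  have mu2E X : mu2 X = (P (inc m v A') * P X)%E :=
    congr1 (fun z => z * P X)%E (esym (fin _ mI)).
  have eq12 : mu1 B = mu2 B.
    apply: (@inc_unique R (past t) _ mu1 mu2 _ _ B mB) => //.
    - by rewrite /past/= in_itv/= lexx.
    - apply: (@le_lt_trans _ _ 1%E); last exact: ltry.
      apply: (@probability_le1 _ _ _ P).
      by apply: measurableI; [exact: measurableT|exact: (mS _ mI)].
    - move=> n u B' uD ult mB'; apply: etrans (inc_cat t0 _ ult mB' vD vlt mA') _.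
        by move=> i /uD; rewrite /past/= in_itv.
      exact: etrans (muleC _ _) (esym (mu2E _)).
  exact: etrans (eq12 : P (B `&` _) = _) (etrans (mu2E _) (muleC _ _)).
pose mu1 := law (mrestr P (measurable_past mA)) (measurable_shift t0).
pose mu2 := mscale (NngNum (ge A)) P.
have mu2E X : mu2 X = (P A * P X)%E :=
  congr1 (fun z => z * P X)%E (esym (fin _ (measurable_past mA))).
have eq12 : mu1 C = mu2 C.
  apply: (@inc_unique R (half_line R) _ mu1 mu2 _ _ C mC) => //.
  - exact: half_line0.
  - apply: (@le_lt_trans _ _ 1%E); last exact: ltry.
    apply: (@probability_le1 _ _ _ P).
    by apply: measurableI; [exact: mS|exact: measurable_past].
  - move=> n u B' uD ult mB'.
    transitivity (P (A `&` shift t @^-1` inc n u B')).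
      by rewrite setIC.
    exact: etrans (step1 _ _ _ _ uD ult mB' mA) (esym (mu2E _)).
rewrite setIC; exact: etrans (eq12 : P (_ `&` A) = _) (mu2E _).
Qed.

End markov.

(** * Monotone limits of events *)

Section prob_tools.
Context {R : realType} d {T : measurableType d} (P : probability T R).

(** Reverse Fatou lemma for sets: the unions of the tails decrease to the upper limit. *)
Lemma prob_limsup_ge (F : (set T)^nat) (p : \bar R) :
  (forall n, measurable (F n)) -> (forall n, (p <= P (F n))%E) ->
  (p <= P (lim_sup_set F))%E.
Proof.
move=> mF pF.
have cv : P (\bigcup_(k >= n) F k) @[n --> \oo] --> P (lim_sup_set F).
  apply: lim_sup_set_cvg => //; apply: (@le_lt_trans _ _ 1%E); last exact: ltry.
  by apply: probability_le1; apply: bigcup_measurable => k _; exact: mF.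
have := cvg_lim (@ereal_hausdorff R) cv => <-.
apply: lime_ge; first by apply/cvg_ex; eexists; exact: cv.
apply: nearW => n; apply: (le_trans (pF n)).
apply: le_measure; rewrite ?inE//.
  by apply: bigcup_measurable => k _; exact: mF.
by apply: bigcup_sup => /=.
Qed.

Lemma prob_bigcap_ge (F : (set T)^nat) (p : \bar R) :
  (forall n, measurable (F n)) -> (forall m n, (m <= n)%N -> F n `<=` F m) ->
  (forall n, (p <= P (F n))%E) -> (p <= P (\bigcap_n F n))%E.
Proof.
move=> mF dF pF; apply: (le_trans (prob_limsup_ge mF pF)).
apply: le_measure; rewrite ?inE.
- apply: bigcap_measurable => // n _.
  by apply: bigcup_measurable => k _; exact: mF.
- exact: bigcap_measurable.
- by move=> x h n _; have [k /= nk Fk] := h n I; exact: dF nk _ Fk.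
Qed.

Lemma prob_bigcup_le (F : (set T)^nat) (p : \bar R) :
  (forall n, measurable (F n)) -> (forall m n, (m <= n)%N -> F m `<=` F n) ->
  (forall n, (P (F n) <= p)%E) -> (P (\bigcup_n F n) <= p)%E.
Proof.
move=> mF dF pF.
have cv : P (F n) @[n --> \oo] --> P (\bigcup_n F n).
  apply: nondecreasing_cvg_mu => //; first exact: bigcupT_measurable.
  by move=> m n mn; apply/subsetPset; exact: dF.
have := cvg_lim (@ereal_hausdorff R) cv => <-.
apply: lime_le; first by apply/cvg_ex; eexists; exact: cv.
by apply: nearW => n; exact: pF.
Qed.

End prob_tools.

(** * Reduction to rational points, and evaluation at random times *)

Section grid.
Context {R : realType}.

Lemma continuous_le_rat (g : R -> R) c : continuous g ->
  (forall q : rat, g (ratr q) <= c) -> forall x, g x <= c.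
Proof.
move=> cg gc x; rewrite leNgt; apply/negP => gx.
have o : open (g @^-1` [set y | c < y]).
  by apply: open_comp; [move=> y _; exact: cg|exact: open_gt].
have [z [/= h [q _ qz]]] := @dense_rat R _ (ex_intro _ x gx) o.
by move: h; rewrite -qz ltNge gc.
Qed.

(** Clamped rationals are countable and dense in [a, b] even when a = b, so that they turn a
    condition on all points of [a, b] into a countable one. *)
Definition clamp (a b x : R) : R := Num.min b (Num.max a x).

Lemma clamp_itv a b x : a <= b -> a <= clamp a b x <= b.
Proof.
by move=> ab; rewrite /clamp ge_min lexx le_min ab le_max lexx.
Qed.

Lemma clamp_id a b x : a <= x <= b -> clamp a b x = x.
Proof. by case/andP=> ax xb; rewrite /clamp (max_idPr ax) (min_idPr xb). Qed.

Lemma continuous_clamp a b : continuous (clamp a b).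
Proof.
move=> x; apply: (@continuous_min R R (cst b) (fun x => Num.max a x)).
  exact: cvg_cst.
by apply: (@continuous_max R R (cst a) id); [exact: cvg_cst|exact: cvg_id].
Qed.

Lemma continuous_comp_clamp (g : R -> R) a b : continuous g ->
  continuous (g \o clamp a b).
Proof. by move=> cg x; apply: continuous_comp; [exact: continuous_clamp|exact: cg]. Qed.

Lemma le_itv_rat (g : R -> R) a b c : continuous g -> a <= b ->
  (forall x, a <= x <= b -> g x <= c) <->
  (forall q : rat, g (clamp a b (ratr q)) <= c).
Proof.
move=> cg ab; split=> [h q|h x axb]; first by apply: h; exact: clamp_itv.
have := @continuous_le_rat (g \o clamp a b) c (continuous_comp_clamp cg) h x.
by rewrite /= clamp_id.
Qed.

Lemma EVT_max_cont (g : R -> R) a b : continuous g -> a <= b ->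
  exists2 x, a <= x <= b & forall y, a <= y <= b -> g y <= g x.
Proof.
move=> cg ab; have [x xab xm] := EVT_max ab (continuous_subspaceT cg).
by exists x => // y yab; apply: xm; rewrite in_itv.
Qed.

Lemma EVT_min_cont (g : R -> R) a b : continuous g -> a <= b ->
  exists2 x, a <= x <= b & forall y, a <= y <= b -> g x <= g y.
Proof.
move=> cg ab; have [x xab xm] := EVT_min ab (continuous_subspaceT cg).
by exists x => // y yab; apply: xm; rewrite in_itv.
Qed.

(** The maximum over [a, b] is attained, so the strict inequality holds with a margin 1 / (j +
    1). *)
Lemma lt_itv_rat (g : R -> R) a b c : continuous g -> a <= b ->
  (forall x, a <= x <= b -> g x < c) <->
  (exists j : nat, forall q : rat, g (clamp a b (ratr q)) <= c - j.+1%:R^-1).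
Proof.
move=> cg ab; split=> [h|[j h] x xab].
  have [x xab xm] := EVT_max_cont cg ab.
  have cx : 0 < c - g x by rewrite subr_gt0 h.
  have [j jc] : exists j : nat, j.+1%:R^-1 < c - g x.
    exists (Num.truncn (c - g x)^-1); rewrite invf_plt ?posrE//.
    exact: truncnS_gt.
  exists j; apply: (le_itv_rat _ cg ab).1 => y yab.
    by rewrite lerBrDl -lerBrDr (le_trans (ltW jc))// lerB// xm.
have := (le_itv_rat _ cg ab).2 h x xab => gx; apply: (le_lt_trans gx).
by rewrite ltrBlDr ltrDl invr_gt0 ltr0n.
Qed.

Lemma env_path_eq (f g : env_path R) : env_fun f =1 env_fun g -> f = g.
Proof.
case: f => f cf f0; case: g => g cg g0 /= /funext fg.
by subst g; congr EnvPath; exact: Prop_irrelevance.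
Qed.

Lemma cvg_floor_grid (x : R) :
  ((Num.floor (x * n.+1%:R))%:~R / n.+1%:R : R) @[n --> \oo] --> x.
Proof.
apply/cvgrPdist_le => e e0; near=> n.
have n0 : 0 < n.+1%:R :> R by rewrite ltr0n.
have /andP[h1 h2] := floor_itv (x * n.+1%:R).
have : n.+1%:R^-1 <= e.
  near: n; exists (Num.truncn e^-1) => // n /= en.
  rewrite invf_ple ?posrE ?ltr0n// ltW// (lt_le_trans (truncnS_gt _))//.
  by rewrite ler_nat.
apply: le_trans; rewrite ger0_norm; last by rewrite subr_ge0 ler_pdivrMr.
rewrite lerBlDr -[X in X + _]mul1r -mulrDl ler_pdivlMr//.
by apply: ltW; move: h2; rewrite intrD addrC.
Unshelve. all: by end_near. Qed.

(** By continuity, [tau] may be replaced by its approximations on the grids of mesh 1 / (n + 1),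
    which take countably many values. [D] holds the times at which [F] is known to be measurable,
    and the approximations must stay in it. *)
Lemma measurable_eval_at d (T : measurableType d) (D : set R)
    (F : T -> R -> R) (tau : T -> R) :
  (forall x, D x -> measurable_fun setT (F ^~ x)) ->
  (forall w, continuous (F w)) -> measurable_fun setT tau ->
  (forall w (n : nat), D ((Num.floor (tau w * n.+1%:R))%:~R / n.+1%:R)) ->
  measurable_fun setT (fun w => F w (tau w)).
Proof.
move=> mF cF mtau Dtau.
pose g n w := F w ((Num.floor (tau w * n.+1%:R))%:~R / n.+1%:R).
apply: (@measurable_fun_cvg _ _ _ _ g); last first.
  move=> w _; apply: (@cvg_comp _ _ _ _ (F w)); last exact: cF.
  exact: cvg_floor_grid.
move=> n; apply: measurable_fun_rays => c.
pose A (k : int) : set T := [set w | Num.floor (tau w * n.+1%:R) = k].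
rewrite (_ : [set _ | _] = \bigcup_(k : int) (A k `&` [set w | F w (k%:~R / n.+1%:R) <= c])); last first.
  apply/seteqP; split=> w /=.
    by move=> h; exists (Num.floor (tau w * n.+1%:R)).
  by move=> [k _ [/= Ak]]; rewrite /g Ak.
apply: countable_bigcupT_measurable => // k.
have mA : measurable (A k).
  have mt : measurable_fun setT (fun w => tau w * n.+1%:R) by exact: measurable_funM.
  have := mt measurableT `[k%:~R, (k + 1)%:~R[%classic (measurable_itv _).
  rewrite setTI; congr measurable; apply/seteqP; split=> w /=; rewrite in_itv/=.
    by move=> /floor_def; rewrite /A/= => ->.
  by rewrite /A/= => <-; exact: floor_itv.
have [Dk|nDk] := pselect (D (k%:~R / n.+1%:R)).
  by apply: measurableI => //; exact: measurable_ray (mF _ Dk).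
rewrite (_ : _ `&` _ = set0) //; apply/seteqP; split=> // w [/= Ak _].
by apply: nDk; rewrite -Ak.
Qed.

Lemma measurable_eval_T d (T : measurableType d) (F : T -> R -> R) (tau : T -> R) :
  (forall x, measurable_fun setT (F ^~ x)) ->
  (forall w, continuous (F w)) -> measurable_fun setT tau ->
  measurable_fun setT (fun w => F w (tau w)).
Proof. by move=> mF cF mt; apply: (@measurable_eval_at _ _ setT). Qed.

Lemma measurable_eval_half d (T : measurableType d) (F : T -> R -> R) (tau : T -> R) :
  (forall x, 0 <= x -> measurable_fun setT (F ^~ x)) ->
  (forall w, continuous (F w)) -> measurable_fun setT tau ->
  (forall w, 0 <= tau w) -> measurable_fun setT (fun w => F w (tau w)).
Proof.
move=> mF cF mt t0; apply: (@measurable_eval_at _ _ [set x | 0 <= x]) => // w n /=.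
rewrite divr_ge0// ler0z floor_ge0.
by rewrite mulr_ge0.
Qed.

Lemma bigcapT_measurable_rat d (T : measurableType d) (F : rat -> set T) :
  (forall q, measurable (F q)) -> measurable (\bigcap_q F q).
Proof.
move=> mF; rewrite -[X in measurable X]setCK setC_bigcap; apply: measurableC.
by apply: bigcupT_measurable_rat => q; exact: measurableC.
Qed.

End grid.

(** * Hitting times and the strong Markov property *)

Section hitting.
Context {R : realType}.
Local Notation half := (half_line R).

Definition reaches (c s : R) : set (env_path R) :=
  [set f | exists2 u, 0 <= u <= s & c <= f u].

Definition hits (c : R) : set (env_path R) :=
  [set f | exists2 u, 0 <= u & c <= f u].

Definition hit (c : R) (f : env_path R) : R := inf [set u | 0 <= u /\ c <= f u].

Lemma reachesN c s (f : env_path R) : ~ reaches c s f <->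
  (forall u, 0 <= u <= s -> f u < c).
Proof.
split=> [h u us|h [u us]]; last by rewrite leNgt h.
by rewrite ltNge; apply/negP => cu; apply: h; exists u.
Qed.

(** This is the stopping time property of [hit c]: whether c is reached by time s depends on the
    past only. *)
Lemma measurable_reaches c s t : s <= t -> measurable (reaches c s : set (pathD (past t))).
Proof.
move=> st; have [s0|s0] := ltP s 0.
  rewrite (_ : reaches c s = set0)//; apply/seteqP; split=> // f [u /andP[u0 us] _].
  by have := lt_le_trans s0 (le_trans u0 us); rewrite ltxx.
rewrite -[X in measurable X]setCK; apply: measurableC.
rewrite (_ : ~` _ = \bigcup_j \bigcap_(q : rat)
    [set f : pathD (past t) | env_fun f (clamp 0 s (ratr q)) <= c - j.+1%:R^-1]).
  apply: bigcupT_measurable => j; apply: bigcapT_measurable_rat => q.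
  apply: measurable_ray; apply: measurable_coord; rewrite /past/= in_itv/=.
  by have /andP[-> h] := clamp_itv (ratr q) s0; rewrite (le_trans h st).
apply/seteqP; split=> f.
  move=> /reachesN/(lt_itv_rat _ (@env_continuous R f) s0)[j h].
  by exists j => // q _; exact: h.
move=> [j _ h]; apply/reachesN/(lt_itv_rat _ (@env_continuous R f) s0).
by exists j => q; exact: h.
Qed.

Lemma measurable_reaches_half c s : measurable (reaches c s : set (pathD half)).
Proof. exact: (@measurable_past R s _ (measurable_reaches c (lexx s))). Qed.

Lemma hitsE c : hits c = \bigcup_n reaches c n%:R.
Proof.
apply/seteqP; split=> f [u].
  move=> u0 cu; exists (Num.truncn u).+1 => //; exists u => //.
  by rewrite u0 ltW// truncnS_gt.
by move=> _ [v /andP[v0 _] cv]; exists v.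
Qed.

Lemma measurable_hits c : measurable (hits c : set (pathD half)).
Proof.
by rewrite hitsE; apply: bigcupT_measurable => n; exact: measurable_reaches_half.
Qed.

Section hit_props.
Variables (c : R) (f : env_path R).
Hypothesis fc : hits c f.

Let lb0 : has_lbound [set u | 0 <= u /\ c <= f u].
Proof. by exists 0 => u []. Qed.

Let ne : [set u | 0 <= u /\ c <= f u] !=set0.
Proof. by case: fc => u u0 cu; exists u. Qed.

Lemma hit_ge0 : 0 <= hit c f.
Proof. by apply: lb_le_inf => // u []. Qed.

Lemma lt_hit s : 0 <= s -> s < hit c f -> f s < c.
Proof.
move=> s0 sh; rewrite ltNge; apply/negP => cs.
by have := ge_inf lb0 (conj s0 cs); rewrite leNgt sh.
Qed.

Lemma le_hit : c <= f (hit c f).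
Proof.
rewrite leNgt; apply/negP => fh.
have o : open (env_fun f @^-1` [set y | y < c]).
  by apply: open_comp; [move=> y _; exact: env_continuous|exact: open_lt].
move: (o); rewrite openE => /(_ _ fh)/nbhs_ballP[e /= e0 eh].
have [u [u0 cu] ue] := inf_adherent e0 (conj ne lb0).
have hu : hit c f <= u by exact: ge_inf.
have := eh u; rewrite /ball/= distrC ger0_norm ?subr_ge0// ltrBlDl => /(_ ue).
by rewrite ltNge cu.
Qed.

Lemma hit_reaches s : reaches c s f <-> hit c f <= s.
Proof.
split=> [[u /andP[u0 us] cu]|hs]; first by apply: le_trans us; exact: ge_inf.
by exists (hit c f); [rewrite hit_ge0|exact: le_hit].
Qed.

Lemma hitE : 0 <= c -> f (hit c f) = c.
Proof.
move=> c0; apply/eqP; rewrite eq_le le_hit andbT leNgt; apply/negP => cf.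
have := hit_ge0; rewrite le_eqVlt => /orP[/eqP h0|h0].
  by move: cf; rewrite -h0 env_at0 ltNge c0.
have [x xi xc] : exists2 x, x \in `[0, hit c f] & f x = c.
  apply: IVT; first exact: ltW.
    by apply: continuous_subspaceT; exact: env_continuous.
  by rewrite env_at0 ge_min c0/= le_max (ltW cf) orbT.
move: xi; rewrite in_itv/= => /andP[x0]; rewrite le_eqVlt => /orP[/eqP xh|xh].
  by move: cf; rewrite -xh xc ltxx.
by have := lt_hit x0 xh; rewrite xc ltxx.
Qed.

End hit_props.

Lemma hit_ge0' c f : 0 <= hit c f.
Proof.
have [h|h] := pselect (hits c f); first exact: hit_ge0.
rewrite /hit (_ : [set _ | _] = set0) ?inf0//.
by apply/seteqP; split=> // u [u0 cu]; apply: h; exists u.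
Qed.

Lemma measurable_hit c : measurable_fun setT (hit c : pathD half -> R).
Proof.
apply: measurable_fun_rays => s; have [s0|s0] := ltP s 0.
  rewrite (_ : [set _ | _] = set0)//; apply/seteqP; split=> // f /= h.
  by have := lt_le_trans s0 (le_trans (hit_ge0' c f) h); rewrite ltxx.
(* A path that never reaches c has [hit c f = 0], the infimum of the empty set, hence the second
   set. *)
rewrite (_ : [set _ | _] = reaches c s `|` ~` hits c).
  by apply: measurableU; [exact: measurable_reaches_half|
    apply: measurableC; exact: measurable_hits].
apply/seteqP; split=> f /=.
  have [h|h] := pselect (hits c f); last by right.
  by move=> /(hit_reaches h)?; left.
case=> [h|h]; first by apply/hit_reaches => //; case: h => u /andP[u0 _]; exists u.
rewrite /hit (_ : [set _ | _] = set0) ?inf0//.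
by apply/seteqP; split=> // u [u0 cu]; apply: h; exists u.
Qed.

Definition post (c lam : R) (f : env_path R) : env_path R := aff lam (hit c f) f.

Lemma measurable_post c lam :
  measurable_fun setT (post c lam : pathD half -> pathD half).
Proof.
apply: measurable_to_path => x /half_line_ge0 x0 /=.
apply: measurable_funM => //; apply: measurable_funB.
  apply: (@measurable_eval_half _ _ _ (fun f : pathD half => env_fun f)
     (fun f => hit c f + lam ^+ 2 * x)).
  - by move=> y /ge0_half_line; exact: measurable_coord.
  - by move=> f; exact: env_continuous.
  - by apply: measurable_funD => //; exact: measurable_hit.
  - by move=> f; rewrite addr_ge0 ?hit_ge0'// mulr_ge0// sqr_ge0.
apply: (@measurable_eval_half _ _ _ (fun f : pathD half => env_fun f) (hit c)).
- by move=> y /ge0_half_line; exact: measurable_coord.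
- by move=> f; exact: env_continuous.
- exact: measurable_hit.
- by move=> f; exact: hit_ge0'.
Qed.

End hitting.

Section strong_markov.
Context {R : realType}.
Local Notation half := (half_line R).
Variable P : probability (pathD half) R.
Hypothesis wP : wiener P.

Lemma wiener_scale c (C : set (pathD half)) : c != 0 -> measurable C ->
  P (aff c 0 @^-1` C) = P C.
Proof.
move=> c0 mC.
have D0 := @half_line0 R.
have DD x : half x -> half (0 + c ^+ 2 * x).
  by move=> /half_line_ge0 x0; apply: ge0_half_line; rewrite add0r mulr_ge0// sqr_ge0.
exact: (@wiener_unique R half (law P (measurable_aff D0 DD)) P D0
  (wiener_aff D0 DD c0 wP) wP C mC).
Qed.

Lemma measurable_scale c : measurable_fun setT (aff c 0 : pathD half -> pathD half).
Proof.
apply: measurable_aff; first exact: half_line0.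
by move=> x /half_line_ge0 x0; apply: ge0_half_line; rewrite add0r mulr_ge0// sqr_ge0.
Qed.

Lemma wiener_shift t (C : set (pathD half)) : 0 <= t -> measurable C ->
  P (shift t @^-1` C) = P C.
Proof.
move=> t0 mC; have := markov wP t0 (@measurableT _ _) mC.
by rewrite setTI => ->; rewrite [X in (X * _)%E](probability_setT P) mul1e.
Qed.

Variable c : R.
Hypothesis Phits : P (hits c) = 1%E.

Let E (n k : nat) : set (env_path R) := reaches c (k%:R / n.+1%:R).
Let A (n : nat) := seqDU (E n).
Let tn (n k : nat) : R := k%:R / n.+1%:R.

Let mA n k : measurable (A n k : set (pathD (past (tn n k)))).
Proof.
rewrite /A /seqDU; apply: measurableD; first exact: measurable_reaches.
apply: bigsetU_measurable => j _; apply: measurable_reaches.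
by rewrite /tn ler_pM2r ?invr_gt0 ?ltr0n// ler_nat; exact: ltnW.
Qed.

(** The path restarted at the first multiple of 1 / (n + 1) not before the hitting time is in K.
    This grid time takes countably many values, and the Markov property at each of them gives this
    event the probability of K. *)
Let D (K : set (env_path R)) (n : nat) := \bigcup_k (A n k `&` (shift (tn n k) @^-1` K)).

Let tn_ge0 n k : 0 <= tn n k.
Proof. by rewrite /tn divr_ge0. Qed.

Let mshift n k (K : set (pathD half)) : measurable K -> measurable (shift (tn n k) @^-1` K).
Proof. by move=> mK; rewrite -[X in measurable X]setTI; exact: measurable_shift. Qed.

Let mD K n : measurable (K : set (pathD half)) -> measurable (D K n : set (pathD half)).
Proof.
move=> mK; apply: bigcupT_measurable => k; apply: measurableI; last exact: mshift.
exact: (@measurable_past R (tn n k) _ (@mA n k)).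
Qed.

Let bigcup_E n : \bigcup_k E n k = hits c.
Proof.
apply/seteqP; split=> f.
  by move=> [k _ [u /andP[u0 _] cu]]; exists u.
move=> [u u0 cu]; exists (Num.truncn (u * n.+1%:R)).+1 => //; exists u => //.
by rewrite u0/= ler_pdivlMr ?ltr0n// ltW// truncnS_gt.
Qed.

Let PD K n : measurable (K : set (pathD half)) -> P (D K n) = P K.
Proof.
move=> mK; rewrite measure_semi_bigcup; last 3 first.
- move=> k; apply: measurableI; last exact: mshift.
  exact: (@measurable_past R (tn n k) _ (@mA n k)).
- apply: trivIset_setIr; exact: trivIset_seqDU.
- exact: mD.
have fK : (fine (P K))%:E = P K by rewrite fineK// fin_num_measure.
transitivity (\sum_(k <oo) ((fine (P K))%:E * P (A n k)))%E.
  apply: eq_eseriesr => k _.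
  by rewrite fK muleC; exact: (markov wP (tn_ge0 n k) (@mA n k) mK).
rewrite nneseriesZl//.
suff -> : (\sum_(k <oo) P (A n k) = 1)%E by rewrite fK mule1.
rewrite -Phits -(bigcup_E n) seqDU_bigcup_eq measure_semi_bigcup; last 3 first.
- by move=> k; exact: (@measurable_past R (tn n k) _ (@mA n k)).
- exact: trivIset_seqDU.
- by apply: bigcupT_measurable => k; exact: (@measurable_past R (tn n k) _ (@mA n k)).
by [].
Qed.

(** Sequential closedness for pointwise convergence on the half-line, phrased on the complement. *)
Definition limit_closed (K : set (env_path R)) :=
  forall (fn : nat -> env_path R) f,
    (forall x, 0 <= x -> env_fun (fn n) x @[n --> \oo] --> env_fun f x) ->
    ~ K f -> \forall n \near \oo, ~ K (fn n).

(** The grid times converge to the hitting time, so the paths restarted there converge pointwise to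
    the path restarted at the hitting time. If infinitely many of them are in K, so is the limit. *)
Lemma post_closed_ge (K : set (pathD half)) : measurable K -> limit_closed K ->
  (P K <= P (post c 1 @^-1` K))%E.
Proof.
move=> mK cK.
have mD' n : measurable (D K n : set (pathD half)) by exact: mD.
have h : (P K <= P (lim_sup_set (D K)))%E.
  by apply: prob_limsup_ge => // n; rewrite PD.
have mpost : measurable (post c 1 @^-1` K : set (pathD half)).
  by rewrite -[X in measurable X]setTI; exact: measurable_post.
apply: (le_trans h); apply: le_measure; rewrite ?inE//.
  apply: bigcap_measurable => // n _.
  by apply: bigcup_measurable => k _; exact: mD'.
move=> f Df.
have [n0 _ [k0 _ [[[u /andP[u0 _] cu] _] _]]] := Df 0%N I.
have fc : hits c f by exists u.
have /choice[k kA] : forall n, exists k, A n k f.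
  move=> n; have : (\bigcup_k E n k) f by rewrite bigcup_E.
  by rewrite seqDU_bigcup_eq => -[k _ Ak]; exists k.
have kh n : hit c f <= tn n (k n).
  by have [+ _] := kA n; move=> /(hit_reaches fc).
have kh' n : tn n (k n) - n.+1%:R^-1 <= hit c f.
  have [_ nk] := kA n; move: nk; case: (k n) => [|j] nk.
    by rewrite /tn mul0r sub0r (le_trans _ (hit_ge0 fc))// oppr_le0 invr_ge0.
  rewrite /tn -natr1 mulrDl mul1r addrK leNgt; apply/negP => hj; apply: nk.
  rewrite -bigcup_mkord; exists j => //=; apply/(hit_reaches fc); exact: ltW.
have tnh : tn n (k n) @[n --> \oo] --> hit c f.
  apply/cvgrPdist_le => e e0; near=> n.
  have : n.+1%:R^-1 <= e.
    near: n; exists (Num.truncn e^-1) => // n /= en.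
    rewrite invf_ple ?posrE ?ltr0n// ltW// (lt_le_trans (truncnS_gt _))//.
    by rewrite ler_nat.
  apply: le_trans; rewrite distrC ger0_norm ?subr_ge0//.
  by rewrite lerBlDr -lerBlDl.
apply: contrapT => nK.
have [|N _ hN] := cK (fun n => shift (tn n (k n)) f) (post c 1 f) _ nK.
  move=> x x0 /=; apply: cvgM; first exact: cvg_cst.
  apply: cvgB; last by apply: (@cvg_comp _ _ _ _ (env_fun f)); [exact: tnh|exact: env_continuous].
  apply: (@cvg_comp _ _ _ (fun n => tn n (k n) + 1 ^+ 2 * x) (env_fun f)); last exact: env_continuous.
  by apply: cvgD; [exact: tnh|exact: cvg_cst].
have [n /= Nn [k' _ [Ak' Kk']]] := Df N I.
apply: (hN n Nn).
suff -> : k n = k' by [].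
apply: (@trivIset_seqDU _ (E n)) => //; by exists f; split; [exact: kA|exact: Ak'].
Unshelve. all: by end_near. Qed.

Let open_cyl (l : seq (R * R)) (e : R) : set (env_path R) :=
  [set f | forall p, p \in l -> f p.1 < p.2 + e].

Let open_cyl_closed l e : (forall p, p \in l -> half p.1) ->
  limit_closed (~` open_cyl l e).
Proof.
move=> lh fn f cf /= /contrapT.
elim: l lh => [|p l ih] lh fl.
  by apply: nearW => n h; apply: h => p; rewrite in_nil.
have h1 : \forall n \near \oo, env_fun (fn n) p.1 < p.2 + e.
  apply: (cvgr_lt (env_fun f p.1)); last by apply: fl; rewrite inE eqxx.
  by apply: cf; apply: half_line_ge0; apply: lh; rewrite inE eqxx.
have h2 : \forall n \near \oo, ~ ~ open_cyl l e (fn n).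
  apply: ih => [q ql|q ql]; first by apply: lh; rewrite inE ql orbT.
  by apply: fl; rewrite inE ql orbT.
near=> n; move=> h; apply: h => q; rewrite inE => /orP[/eqP ->|ql].
  by near: n.
have /contrapT : ~ ~ open_cyl l e (fn n) by near: n.
exact.
Unshelve. all: by end_near. Qed.

Let cyl_closed l : (forall p, p \in l -> half p.1) -> limit_closed (cyl l).
Proof.
move=> lh fn f cf.
move=> /existsNP[p /not_implyP[pl /negP]]; rewrite -ltNge => fp.
have := cf p.1 (half_line_ge0 (lh p pl)) => /(cvgr_gt _)/(_ _ fp).
apply: filterS => n; rewrite /= => h1 h2.
by have := h2 p pl; rewrite leNgt h1.
Qed.

Let mopen l e : (forall p, p \in l -> half p.1) ->
  measurable (open_cyl l e : set (pathD half)).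
Proof.
elim: l => [|p l ih] lh.
  by rewrite (_ : open_cyl _ _ = setT) //; apply/seteqP; split.
rewrite (_ : open_cyl _ _ = ~` [set f : env_path R | p.2 + e <= f p.1] `&` open_cyl l e).
  apply: measurableI; last by apply: ih => q ql; apply: lh; rewrite inE ql orbT.
  apply: measurableC.
  have := @measurable_ray _ _ _ (fun f : pathD half => - env_fun f p.1) (- (p.2 + e)).
  rewrite (_ : [set _ | _] = [set f : pathD half | p.2 + e <= env_fun f p.1]).
    apply; apply: measurableT_comp => //; apply: measurable_coord.
    by apply: lh; rewrite inE eqxx.
  by apply/seteqP; split=> f /=; rewrite lerN2.
apply/seteqP; split=> f /= h.
  split; first by apply/negP; rewrite -ltNge; apply: h; rewrite inE eqxx.
  by move=> q ql; apply: h; rewrite inE ql orbT.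
move=> q; rewrite inE => /orP[/eqP ->|]; last exact: h.2.
by rewrite ltNge; apply/negP/h.1.
Qed.

(** Cylinders are closed, which gives one inequality. They are also decreasing intersections of open
    cylinders, and the inequality for the closed complements of these gives the other one. *)
Lemma post_law1 (C : set (pathD half)) : measurable C -> P (post c 1 @^-1` C) = P C.
Proof.
have mp := @measurable_post R c 1.
pose Q : probability (pathD half) R := law P mp.
apply: (@cyl_unique R half Q P).
  by apply: (@le_lt_trans _ _ 1%E); [exact: (probability_le1 Q)|exact: ltry].
move=> l lh; apply/eqP; rewrite eq_le; apply/andP; split; last first.
  apply: post_closed_ge; last exact: cyl_closed.
  by apply: (@measurable_cyl _ _ (pathD half) id) => p pl; apply: measurable_coord; exact: lh.
have cylE : cyl l = \bigcap_n open_cyl l n.+1%:R^-1.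
  apply/seteqP; split=> f h.
    by move=> n _ p pl; rewrite (le_lt_trans (h p pl))// ltrDl invr_gt0 ltr0n.
  move=> p pl; apply/ler_addgt0Pl => e e0; rewrite addrC.
  have := h (Num.truncn e^-1) I p pl => /ltW/le_trans; apply.
  by rewrite lerD2l invf_ple ?posrE ?ltr0n// ltW// truncnS_gt.
rewrite [in X in (_ <= P X)%E]cylE; apply: prob_bigcap_ge.
- by move=> n; exact: mopen.
- move=> m n mn f h p pl; apply: (lt_le_trans (h p pl)).
  by rewrite lerD2l lef_pV2 ?posrE ?ltr0n// ler_nat ltnS.
move=> n; set U := open_cyl l _.
have mU : measurable (U : set (pathD half)) by exact: mopen.
apply: (@le_trans _ _ (Q U)).
  apply: le_measure; rewrite ?inE//.
    by apply: (@measurable_cyl _ _ (pathD half) id) => p pl; apply: measurable_coord; exact: lh.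
  by rewrite cylE => f; apply.
have := @post_closed_ge (~` U) (measurableC mU) (open_cyl_closed lh).
have -> : post c 1 @^-1` (~` U) = ~` (post c 1 @^-1` U) by [].
have mU' : measurable (post c 1 @^-1` U : set (pathD half)).
  by have := mp measurableT U mU; rewrite setTI.
rewrite !probability_setC//.
have fP : P U \is a fin_num by exact: fin_num_measure.
have fQ : P (post c 1 @^-1` U) \is a fin_num by exact: fin_num_measure.
move=> h; change (P (post c 1 @^-1` U) <= P U)%E.
by move: h; rewrite -(fineK fP) -(fineK fQ) -!EFinB !lee_fin; lra.
Qed.

Lemma strong_markov lam (C : set (pathD half)) : lam != 0 -> measurable C ->
  P (post c lam @^-1` C) = P C.
Proof.
move=> l0 mC.
have mC' : measurable (aff lam 0 @^-1` C : set (pathD half)).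
  by rewrite -[X in measurable X]setTI; exact: measurable_scale.
have -> : post c lam @^-1` C = post c 1 @^-1` (aff lam 0 @^-1` C).
  apply/seteqP; split=> f /=; congr (C _); apply: env_path_eq => x /=;
    by rewrite invr1 expr1n !mul1r !add0r addr0 subrr subr0.
by rewrite post_law1// wiener_scale.
Qed.

End strong_markov.

(** * Almost sure properties of Brownian paths *)

Section ae_tools.
Context {R : realType} d {T : measurableType d} (P : probability T R).

Lemma ae_imp (A B : T -> Prop) : (forall x, A x -> B x) ->
  {ae P, forall x, A x} -> {ae P, forall x, B x}.
Proof. by move=> AB [N [mN PN sN]]; exists N; split => // x /= nB; apply: sN => /= /AB. Qed.

Lemma prob_ae_le (A B : set T) : measurable A -> measurable B ->
  {ae P, forall x, A x -> B x} -> (P A <= P B)%E.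
Proof.
move=> mA mB [N [mN PN sN]].
have : (P A <= P (B `|` N))%E.
  apply: le_measure; rewrite ?inE//; first exact: measurableU.
  move=> x Ax; have [Bx|nBx] := pselect (B x); [by left|right].
  by apply: sN => /= h; apply: nBx; exact: h.
move=> /le_trans; apply; apply: (le_trans (measureU2 _ mB mN)).
by rewrite [X in (_ + X)%E]PN adde0.
Qed.

Lemma prob_ae_eq (A B : set T) : measurable A -> measurable B ->
  {ae P, forall x, A x <-> B x} -> P A = P B.
Proof.
move=> mA mB h; apply/eqP; rewrite eq_le !prob_ae_le//;
  by apply: filterS h => x [].
Qed.

Lemma prob1_ae (A : set T) : measurable A -> P A = 1%E -> {ae P, forall x, A x}.
Proof.
move=> mA PA; exists (~` A); split => //; first exact: measurableC.
by rewrite probability_setC// PA subee.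
Qed.

Lemma prob0_ae (A : set T) : measurable A -> P A = 0%E -> {ae P, forall x, ~ A x}.
Proof. by move=> mA PA; exists A; split => // x /= /contrapT. Qed.

Lemma ae_prob1 (A : set T) : measurable A -> {ae P, forall x, A x} -> P A = 1%E.
Proof.
move=> mA h; rewrite -(probability_setT P); apply: prob_ae_eq => //.
by apply: filterS h => x.
Qed.

Lemma ae_prob0 (A : set T) : measurable A -> {ae P, forall x, ~ A x} -> P A = 0%E.
Proof.
move=> mA h; rewrite -(measure0 P); apply: prob_ae_eq => //.
by apply: filterS h => x.
Qed.

Lemma ae_all_nat (Q : nat -> T -> Prop) :
  (forall n, {ae P, forall x, Q n x}) -> {ae P, forall x, forall n, Q n x}.
Proof.
move=> h; have := @negligible_bigcup _ _ _ P (fun n => ~` [set x | Q n x]) h.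
by move=> /negligibleS; apply => x /= /existsNP [n nQ]; exists n.
Qed.

Lemma ae_all_count (I : countType) (Q : I -> T -> Prop) :
  (forall i, {ae P, forall x, Q i x}) -> {ae P, forall x, forall i, Q i x}.
Proof.
move=> h.
have : {ae P, forall x, forall n, (fun n x => if unpickle n is Some i then Q i x else True) n x}.
  apply: ae_all_nat => n; case: unpickle => [i|]; first exact: h.
  exact: aeW.
by apply: filterS => x hx i; have := hx (pickle i); rewrite pickleK.
Qed.

End ae_tools.

Lemma ae_law d d' (T : measurableType d) (T' : measurableType d') (R : realType)
    (P : probability T R) (Y : T -> T') (mY : measurable_fun setT Y) (Q : T' -> Prop) :
  {ae law P mY, forall y, Q y} -> {ae P, forall x, Q (Y x)}.
Proof.
move=> [N [mN PN sN]]; exists (Y @^-1` N); split => //.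
  by have := mY measurableT N mN; rewrite setTI.
by move=> x /= h; apply: sN.
Qed.

Section as_half.
Context {R : realType}.
Local Notation half := (half_line R).
Variable P : probability (pathD half) R.
Hypothesis wP : wiener P.

Lemma ae_scale c (Q : env_path R -> Prop) : c != 0 ->
  {ae P, forall f, Q f} -> {ae P, forall f, Q (aff c 0 f)}.
Proof.
move=> c0 [N [mN PN sN]]; exists (aff c 0 @^-1` N); split.
- by rewrite -[X in measurable X]setTI; exact: measurable_scale.
- by rewrite wiener_scale.
- by move=> x /= h; apply: sN.
Qed.

(** By scaling, P (G <= r^n) is the same for all integers n, positive or negative. Letting n go to
    both ends, {G < +oo} and {G <= 0} have the same probability. *)
Lemma zero_infty_law (c r : R) (G : env_path R -> \bar R) : c != 0 -> 0 < r < 1 ->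
  measurable_fun setT (G : pathD half -> \bar R) ->
  {ae P, forall f, G (aff c 0 f) = (r%:E * G f)%E} ->
  {ae P, forall f, ~ (0 < G f < +oo)%E}.
Proof.
move=> c0 /andP[r0 r1] mG Gs.
pose A (a : R) : set (pathD half) := [set f | (G f <= a%:E)%E].
have mA a : measurable (A a).
  by have := emeasurable_fun_infty_c measurableT mG a%:E; rewrite setTI.
have PA a : P (A a) = P (A (r^-1 * a)).
  rewrite -(wiener_scale wP c0 (mA a)); apply: prob_ae_eq => //.
    by rewrite -[X in measurable X]setTI; apply: measurable_scale.
  apply: ae_imp Gs => f; rewrite /A/= => ->.
  by rewrite EFinM lee_pdivlMl.
have PAn n a : P (A (r ^- n * a)) = P (A a).
  elim: n a => [|n ih] a; first by rewrite expr0 invr1 mul1r.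
  by rewrite exprS invfM -mulrA -PA ih.
have PAn' n a : P (A (r ^+ n * a)) = P (A a).
  by rewrite -(PAn n) mulrA mulVf ?mul1r// expf_neq0// gt_eqF.
pose U0 := \bigcup_n A (r ^- n * 1); pose I0 := \bigcap_n A (r ^+ n * 1).
have le1 : (P U0 <= P (A 1%R))%E.
  apply: prob_bigcup_le => // [m n mn f /le_trans|n]; last by rewrite PAn.
  apply; rewrite lee_fin !mulr1 lef_pV2 ?posrE ?exprn_gt0//.
  by rewrite ler_wiXn2l// ltW.
have ge1 : (P (A 1%R) <= P I0)%E.
  apply: prob_bigcap_ge => // [m n mn f /le_trans|n]; last by rewrite PAn'.
  by apply; rewrite lee_fin !mulr1 ler_wiXn2l// ltW.
have mU : measurable U0 by exact: bigcupT_measurable.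
have mI : measurable I0 by exact: bigcap_measurable.
have IU : I0 `<=` U0.
  by move=> f h; exists 0%N => //; have := h 0%N I; rewrite /A/= !expr0 invr1.
have PD : P (U0 `\` I0) = 0%E.
  rewrite measureD//; last first.
    by apply: (@le_lt_trans _ _ 1%E); [exact: probability_le1|exact: ltry].
  rewrite setIidr//; apply/eqP; rewrite eq_le; apply/andP; split.
    by rewrite leeBlDr ?fin_num_measure// add0e (le_trans le1).
  by rewrite sube_ge0 ?fin_num_measure// le_measure ?inE.
have := prob0_ae (measurableD mU mI) PD.
have rn (x : R) : 0 < x -> exists n, r ^+ n < x.
  move=> x0; have : (r ^+ n) @[n --> \oo] --> (0 : R).
    by apply: cvg_expr; rewrite ger0_norm ?ltW.
  by move=> /(cvgr_lt _)/(_ _ x0)[n _ h]; exists n; apply: h => /=.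
apply: ae_imp => f nf /andP[]; move: nf.
case Gf : (G f) => [g| |]// nf g0 _; apply: nf; rewrite /U0/I0/A; split.
  have g0' : 0 < g^-1 by rewrite invr_gt0 -lte_fin.
  have [n rg] := rn _ g0'; exists n => //=.
  by rewrite Gf lee_fin mulr1 -(invrK g) lef_pV2 ?posrE ?exprn_gt0// ltW.
have g0' : 0 < g by rewrite -lte_fin.
move=> h; have [n rg] := rn _ g0'.
by have := h n I; rewrite /= Gf lee_fin mulr1 leNgt rg.
Qed.

Definition below (a s : R) : set (env_path R) := [set f | forall x, 0 <= x <= s -> f x <= a].

Lemma measurable_below a s : measurable (below a s : set (pathD half)).
Proof.
have [s0|s0] := ltP s 0.
  rewrite (_ : below a s = setT)//; apply/seteqP; split=> // f _ x /andP[x0 xs].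
  by have := lt_le_trans s0 (le_trans x0 xs); rewrite ltxx.
rewrite (_ : below a s = \bigcap_(q : rat) [set f : env_path R | f (clamp 0 s (ratr q)) <= a]).
  apply: bigcapT_measurable_rat => q; apply: measurable_ray; apply: measurable_coord.
  by apply: ge0_half_line; have /andP[] := clamp_itv (ratr q) s0.
apply/seteqP; split=> f.
  by move=> /(le_itv_rat _ (@env_continuous R f) s0) h q _; exact: h.
by move=> h; apply/(le_itv_rat _ (@env_continuous R f) s0) => q; exact: h.
Qed.

Definition bounded_by (a : R) : set (env_path R) := [set f | forall x, 0 <= x -> f x <= a].

Lemma bounded_byE a : bounded_by a = \bigcap_n below a n%:R.
Proof.
apply/seteqP; split=> f h; first by move=> n _ x /andP[x0 _]; exact: h.
move=> x x0; apply: (h (Num.truncn x).+1 I); rewrite x0 ltW//; exact: truncnS_gt.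
Qed.

Lemma measurable_bounded_by a : measurable (bounded_by a : set (pathD half)).
Proof.
rewrite bounded_byE; apply: bigcap_measurable => // n _; exact: measurable_below.
Qed.

Lemma aff0E c (f : env_path R) x : aff c 0 f x = c^-1 * f (c ^+ 2 * x).
Proof. by rewrite /= add0r env_at0 subr0. Qed.

Lemma prob_bounded_by a c : 0 < c -> P (bounded_by a) = P (bounded_by (c * a)).
Proof.
move=> c0; have cn0 : c != 0 by rewrite gt_eqF.
rewrite -(wiener_scale wP cn0 (measurable_bounded_by a)).
congr (P _); apply/seteqP; split=> f h x x0.
  have := h (x / c ^+ 2); rewrite aff0E mulrCA divff ?expf_neq0// mulr1.
  by rewrite ler_pdivrMl//; apply; rewrite divr_ge0// sqr_ge0.
by rewrite aff0E ler_pdivrMl//; apply: h; rewrite mulr_ge0// sqr_ge0.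
Qed.

Definition bounded_above : set (env_path R) := \bigcup_n bounded_by n.+1%:R.

Lemma measurable_bounded_above : measurable (bounded_above : set (pathD half)).
Proof. by apply: bigcupT_measurable => n; exact: measurable_bounded_by. Qed.

Lemma bounded_by_sub a b : a <= b -> bounded_by a `<=` bounded_by b.
Proof. by move=> ab f h x /h fa; exact: le_trans ab. Qed.

(** The probability of staying below a is the same for all a > 0 by scaling; a tends to 0 and to
    infinity. *)
Lemma ae_bounded_above_le0 : {ae P, forall f, bounded_above f -> bounded_by 0 f}.
Proof.
have le1 : (P bounded_above <= P (bounded_by 1))%E.
  apply: prob_bigcup_le => [n|m n mn|n]; first exact: measurable_bounded_by.
    by apply: bounded_by_sub; rewrite ler_nat.
  by rewrite (@prob_bounded_by 1 n.+1%:R)// mulr1.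
have E : bounded_by 0 = \bigcap_n bounded_by n.+1%:R^-1.
  apply/seteqP; split=> f h.
    by move=> n _ x /h fx; rewrite (le_trans fx)// invr_ge0.
  move=> x x0; apply/ler_addgt0Pl => e e0; rewrite addr0.
  apply: (le_trans (h (Num.truncn e^-1) I x x0)).
  by rewrite invf_ple ?posrE ?ltr0n// ltW// truncnS_gt.
have ge1 : (P (bounded_by 1) <= P (bounded_by 0))%E.
  rewrite E; apply: prob_bigcap_ge => [n|m n mn|n]; first exact: measurable_bounded_by.
    by apply: bounded_by_sub; rewrite lef_pV2 ?posrE ?ltr0n// ler_nat ltnS.
  by rewrite (@prob_bounded_by 1 n.+1%:R^-1)// mulr1.
have m0 := measurable_bounded_by 0; have mU := measurable_bounded_above.
have PD : P (bounded_above `\` bounded_by 0) = 0%E.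
  have sub : bounded_by 0 `<=` bounded_above.
    by move=> f h; exists 0%N => //; exact: bounded_by_sub h.
  rewrite measureD//; last first.
    by apply: (@le_lt_trans _ _ 1%E); [exact: probability_le1|exact: ltry].
  rewrite setIidr//; apply/eqP; rewrite eq_le; apply/andP; split.
    by rewrite leeBlDr ?fin_num_measure// add0e (le_trans le1).
  by rewrite sube_ge0 ?fin_num_measure// le_measure ?inE.
apply: ae_imp (prob0_ae (measurableD mU m0) PD) => f nf fU.
by apply: contrapT => f0; apply: nf; split.
Qed.

Lemma ae_shift t (Q : env_path R -> Prop) : 0 <= t ->
  {ae P, forall f, Q f} -> {ae P, forall f, Q (shift t f)}.
Proof.
move=> t0 [N [mN PN sN]]; exists (shift t @^-1` N); split.
- by rewrite -[X in measurable X]setTI; exact: measurable_shift.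
- by rewrite wiener_shift.
- by move=> x /= h; apply: sN.
Qed.

Lemma shiftE t (f : env_path R) x : env_fun (shift t f) x = f (t + x) - f t.
Proof. by rewrite /= invr1 mul1r expr1n mul1r. Qed.

Lemma prob_decreasing n :
  P [set f | forall i, (i < n)%N -> `]-oo, 0]%classic (env_fun f i.+1%:R - env_fun f i%:R)] =
  ((2^-1) ^+ n)%:E.
Proof.
apply: etrans (wP (n := n) (t := fun i => i%:R) (A := fun=> `]-oo, 0]%classic) _ _ _) _.
- by move=> i _; apply: ge0_half_line.
- by move=> i _; rewrite ltr_nat.
- by move=> i _; exact: measurable_itv.
elim: n => [|n ih]; first by rewrite big_ord0 expr0.
have step : normal_prob 0 (Num.sqrt (n.+1%:R - n%:R)) `]-oo, 0] = (2^-1)%:E :> \bar R.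
  apply: normal_prob_le0; rewrite sqrtr_gt0 subr_gt0 ltr_nat; exact: ltnSn.
apply: etrans (big_ord_recr _ _) _.
exact: (etrans (congr2 mule ih step) (esym (etrans (congr1 EFin (exprSr _ _)) (EFinM _ _)))).
Qed.

(** If the path is bounded above, so are its restarts at integer times, which must then stay below
    0. The path does not increase over any of the first n unit intervals, an event of probability
    2^-n. *)
Lemma ae_unbounded : {ae P, forall f, ~ bounded_above f}.
Proof.
have h1 : {ae P, forall f, forall k : nat,
    bounded_above (shift k%:R f) -> bounded_by 0 (shift k%:R f)}.
  apply: ae_all_nat => k.
  by apply: (ae_shift (Q := fun f => bounded_above f -> bounded_by 0 f)) => //; exact: ae_bounded_above_le0.
apply: prob0_ae; first exact: measurable_bounded_above.
apply/eqP; rewrite eq_le measure_ge0 andbT.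
apply/lee_addgt0Pr => e e0; rewrite add0e.
have [n ne] : exists n, (2^-1) ^+ n < e.
  have : ((2^-1) ^+ n) @[n --> \oo] --> (0 : R).
    by apply: cvg_expr; rewrite ger0_norm ?invr_ge0// invf_lt1// ltr1n.
  by move=> /(cvgr_lt _)/(_ _ e0)[n _ h]; exists n; apply: h => /=.
apply: (@le_trans _ _ ((2^-1) ^+ n)%:E); last by rewrite lee_fin ltW.
rewrite -prob_decreasing; apply: prob_ae_le.
- exact: measurable_bounded_above.
- apply: (@measurable_inc R half n (fun i => i%:R) (fun=> `]-oo, 0]%classic)).
    by move=> i _; exact: ge0_half_line.
  by move=> i _; exact: measurable_itv.
apply: ae_imp h1 => f hf [m _ fm] i _ /=; rewrite in_itv/=.
have := hf i _ 1; rewrite shiftE natr1; apply; last exact: ler01.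
exists (Num.truncn (m.+1%:R - f i%:R)) => // x x0; rewrite shiftE.
rewrite (le_trans _ (ltW (truncnS_gt _)))// lerB//.
by apply: fm; rewrite addr_ge0.
Qed.

Lemma ae_hits : {ae P, forall f, forall c, hits c f}.
Proof.
apply: ae_imp ae_unbounded => f nb c; apply: contrapT => nh; apply: nb.
exists (Num.truncn c) => // x x0; rewrite (le_trans _ (ltW (truncnS_gt _)))//.
by apply: ltW; rewrite ltNge; apply/negP => cx; apply: nh; exists x.
Qed.

Lemma prob_hits c : P (hits c) = 1%E.
Proof.
by apply: ae_prob1; [exact: measurable_hits|apply: ae_imp ae_hits => f; apply].
Qed.

Lemma ae_hits_opp : {ae P, forall f, forall c, exists2 u, 0 <= u & env_fun f u <= c}.
Proof.
have N1 : -1 != 0 :> R by rewrite oppr_eq0 oner_eq0.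
apply: ae_imp (ae_scale N1 ae_hits) => f h c; have [u u0] := h (- c).
by rewrite aff0E sqrrN expr1n mul1r invrN invr1 mulN1r lerN2; exists u.
Qed.

(** By scaling, the probability of staying below 0 up to time s does not depend on s > 0, and it
    tends to that of staying below 0 forever, which is null. *)
Lemma ae_not_below : {ae P, forall f, forall s, 0 < s -> ~ below 0 s f}.
Proof.
have Pb s c : 0 < c -> P (below 0 s) = P (below 0 (c ^+ 2 * s)).
  move=> c0; have cn0 : c != 0 by rewrite gt_eqF.
  have c2 : 0 < c ^+ 2 by rewrite exprn_gt0.
  rewrite -(wiener_scale wP cn0 (measurable_below 0 s)).
  congr (P _); apply/seteqP; split=> f h x /andP[x0 xs].
    have := h (x / c ^+ 2); rewrite aff0E mulrCA divff ?expf_neq0// mulr1.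
    rewrite ler_pdivrMl// mulr0; apply; rewrite divr_ge0 ?sqr_ge0//=.
    by rewrite ler_pdivrMr// mulrC.
  rewrite aff0E ler_pdivrMl// mulr0; apply: h; rewrite mulr_ge0 ?sqr_ge0//=.
  by rewrite ler_pM2l.
have h n : {ae P, forall f, ~ below 0 n.+1%:R^-1 f}.
  apply: prob0_ae; first exact: measurable_below.
  apply/eqP; rewrite eq_le measure_ge0 andbT.
  have P0 : P (bounded_by 0) = 0%E.
    apply: ae_prob0; first exact: measurable_bounded_by.
    apply: ae_imp ae_unbounded => f nb f0; apply: nb.
    by exists 0%N => //; exact: bounded_by_sub f0.
  rewrite -P0 bounded_byE; apply: prob_bigcap_ge.
  - by move=> k; exact: measurable_below.
  - move=> k m km f hf x /andP[x0 xk]; apply: hf; rewrite x0/= (le_trans xk)//.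
    by rewrite ler_nat.
  move=> k; pose c : R := Num.sqrt (n.+1%:R * k.+1%:R).
  have c0 : 0 < c by rewrite sqrtr_gt0 mulr_gt0.
  rewrite (Pb _ c c0) sqr_sqrtr ?mulr_ge0// mulrAC divff// mul1r.
  apply: le_measure; rewrite ?inE; [exact: measurable_below..|].
  move=> f hf x /andP[x0 xk]; apply: hf; rewrite x0/= (le_trans xk)//.
  by rewrite ler_nat.
apply: ae_imp (ae_all_nat h) => f hf s s0 fs; apply: (hf (Num.truncn s^-1)).
move=> x /andP[x0 xs]; apply: fs; rewrite x0/= (le_trans xs)//.
by rewrite invf_ple ?posrE ?ltr0n// ltW// truncnS_gt.
Qed.

Lemma ae_not_above : {ae P, forall f, forall s, 0 < s ->
  exists2 x, 0 <= x <= s & env_fun f x < 0}.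
Proof.
have N1 : -1 != 0 :> R by rewrite oppr_eq0 oner_eq0.
apply: ae_imp (ae_scale N1 ae_not_below) => f h s s0.
apply: contrapT => nx; apply: (h s s0) => x xs.
rewrite aff0E sqrrN expr1n mul1r invrN invr1 mulN1r oppr_le0 leNgt.
by apply/negP => fx; apply: nx; exists x.
Qed.

End as_half.

(** * Extrema over intervals and local extrema *)

Section extrema.
Context {R : realType}.
Implicit Type f : R -> R.

Definition maxon (a b : R) f : R := sup [set f x | x in [set x | a <= x <= b]].

Lemma maxonE a b f x : a <= x <= b -> (forall y, a <= y <= b -> f y <= f x) ->
  maxon a b f = f x.
Proof.
move=> xab fx; apply/eqP; rewrite eq_le; apply/andP; split.
  by apply: ge_sup => [|_ [y yab <-]]; [exists (f x), x|exact: fx].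
by apply: ub_le_sup; [exists (f x) => _ [y yab <-]; exact: fx|exists x].
Qed.

Lemma maxon_le a b f c : continuous f -> a <= b ->
  maxon a b f <= c <-> (forall x, a <= x <= b -> f x <= c).
Proof.
move=> cf ab; have [x xab fx] := EVT_max_cont cf ab.
rewrite (maxonE xab fx); split=> [fc y yab|]; last exact.
exact: le_trans (fx y yab) fc.
Qed.

(* The maximum of f on [a, b] if s = false, its minimum if s = true. *)
Definition ext (s : bool) (a b : R) f : R :=
  (-1) ^+ s * maxon a b (fun x => (-1) ^+ s * f x).

Lemma extE (s : bool) a b f x : a <= x <= b ->
  (forall y, a <= y <= b -> (-1) ^+ s * f y <= (-1) ^+ s * f x) ->
  ext s a b f = f x.
Proof. by move=> xab fx; rewrite /ext (maxonE xab fx) mulrA -signr_addb addbb mul1r. Qed.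

Lemma continuous_sign (s : bool) f : continuous f -> continuous (fun x => (-1) ^+ s * f x).
Proof. by move=> cf x; apply: cvgM; [exact: cvg_cst|exact: cf]. Qed.

Lemma ext_attained (s : bool) a b f : continuous f -> a <= b ->
  exists2 x, a <= x <= b & forall y, a <= y <= b -> (-1) ^+ s * f y <= (-1) ^+ s * f x.
Proof. by move=> cf ab; apply: EVT_max_cont => //; exact: continuous_sign. Qed.

Lemma measurable_ext d (T : measurableType d) (X : T -> env_path R) (s : bool) a b : a <= b ->
  (forall x, a <= x <= b -> measurable_fun setT (fun w => X w x)) ->
  measurable_fun setT (fun w => ext s a b (X w)).
Proof.
move=> ab mX; apply: measurable_funM => //; apply: measurable_fun_rays => c.
rewrite (_ : [set _ | _] = \bigcap_(q : rat)
    [set w | (-1) ^+ s * X w (clamp a b (ratr q)) <= c]).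
  apply: bigcapT_measurable_rat => q; apply: measurable_ray.
  by apply: measurable_funM => //; apply: mX; exact: clamp_itv.
have cX w : continuous (fun x => (-1) ^+ s * X w x).
  by apply: continuous_sign; exact: env_continuous.
apply/seteqP; split=> w.
  by move=> /(maxon_le _ (cX w) ab)/(le_itv_rat _ (cX w) ab) h q _; exact: h.
by move=> h; apply/(maxon_le _ (cX w) ab)/(le_itv_rat _ (cX w) ab) => q; exact: h.
Qed.

Lemma ext_shift (s : bool) t a b (f : env_path R) : a <= b ->
  ext s (t + a) (t + b) f - f t = ext s a b (shift t f).
Proof.
move=> ab; have tab : t + a <= t + b by rewrite lerD2l.
have [x xab fx] := ext_attained s (@env_continuous R f) tab.
have h1 : a <= x - t <= b by rewrite lerBrDl lerBlDl.
have h2 y : a <= y <= b ->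
    (-1) ^+ s * env_fun (shift t f) y <= (-1) ^+ s * env_fun (shift t f) (x - t).
  have e : t + (x - t) = x by ring.
  move=> yab; rewrite !shiftE e !mulrBr lerD2r; apply: fx.
  by rewrite !lerD2l.
by rewrite (extE xab fx) (extE h1 h2) shiftE; congr (f _ - _); ring.
Qed.

(** As in [ext], the sign is [true] for a minimum. Plateaus count as extrema. *)
Definition locext f (x : R) : Prop := exists2 e, 0 < e &
  exists s : bool, forall y, `|y - x| < e -> (-1) ^+ s * f y <= (-1) ^+ s * f x.

End extrema.

Section independence.
Context {R : realType} d (T : measurableType d) (P : probability T R).

Lemma ae_and (A B : T -> Prop) : {ae P, forall x, A x} -> {ae P, forall x, B x} ->
  {ae P, forall x, A x /\ B x}.
Proof.
move=> hA hB.
have h : {ae P, forall x, forall b : bool, if b then A x else B x}.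
  by apply: ae_all_count => -[].
by apply: ae_imp h => x hx; split; [exact: (hx true)|exact: (hx false)].
Qed.

(** The joint law is the product of the laws, and by Fubini the probability is an integral of the
    masses given to points by the law of B. *)
Lemma indep_sum_no_atom (A B : T -> R) (mA : measurable_fun setT A)
    (mB : measurable_fun setT B) y :
  (forall E F : set R, measurable E -> measurable F ->
    P ((A @^-1` E) `&` (B @^-1` F)) = (P (A @^-1` E) * P (B @^-1` F))%E) ->
  (forall v, P [set w | B w = v] = 0%E) ->
  P [set w | A w + B w = y] = 0%E.
Proof.
move=> AB B0.
have mAB : measurable_fun setT (fun w => (A w, B w)) by exact/measurable_fun_pair.
pose D : set (R * R) := [set p | p.1 + p.2 = y].
have mD : measurable D.
  rewrite (_ : D = (fun p => p.1 + p.2) @^-1` [set y]) //.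
  rewrite -[X in measurable X]setTI; apply: measurable_funD => //.
have e := @product_measure_unique _ _ _ _ R (law P mA) (law P mB) (law P mAB) AB D mD.
apply: etrans (_ : _ = law P mAB D) _ => //; rewrite -e.
rewrite /product_measure1; apply: integral0_eq => x _.
rewrite /= (_ : xsection D x = [set y - x]); first exact: B0.
apply/seteqP; split=> z; rewrite /xsection/= inE /D/=.
  by move=> <-; rewrite addrC addKr.
by move=> ->; rewrite addrC subrK.
Qed.

End independence.

(** * Brownian local extrema and time spent above 0 *)

Section as_extrema.
Context {R : realType}.
Local Notation half := (half_line R).
Variable P : probability (pathD half) R.
Hypothesis wP : wiener P.

Lemma indep_shift t (A : env_path R -> R) (B : env_path R -> R) : 0 <= t ->
  measurable_fun setT (A : pathD (past t) -> R) ->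
  measurable_fun setT (B : pathD half -> R) ->
  forall E F : set R, measurable E -> measurable F ->
    P ((A @^-1` E) `&` ((B \o shift t) @^-1` F)) =
    (P (A @^-1` E) * P ((B \o shift t) @^-1` F))%E.
Proof.
move=> t0 mA mB E F mE mF.
have mAE : measurable (A @^-1` E : set (pathD (past t))).
  by have := mA measurableT E mE; rewrite setTI.
have mBF : measurable (B @^-1` F : set (pathD half)).
  by have := mB measurableT F mF; rewrite setTI.
by rewrite comp_preimage (markov wP t0 mAE mBF) (wiener_shift wP t0 mBF).
Qed.

Lemma measurable_half_past t (A : env_path R -> R) :
  measurable_fun setT (A : pathD (past t) -> R) ->
  measurable_fun setT (A : pathD half -> R).
Proof.
move=> mA _ E mE; rewrite setTI; apply: (@measurable_past R t (A @^-1` E)).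
by have := mA measurableT E mE; rewrite setTI.
Qed.

Lemma coord_no_atom t v : 0 < t -> P [set f | env_fun f t = v] = 0%E.
Proof.
move=> t0; rewrite -(normal_prob1 (Num.sqrt (t - 0)) v).
pose u (i : nat) : R := if i is 0%N then 0 else t.
apply: etrans (_ : _ = P [set f | forall i, (i < 1)%N -> [set v] (env_fun f (u i.+1) - env_fun f (u i))]) _.
  congr (P _); apply/seteqP; split=> f /=.
    by move=> <- [|//] _; rewrite /u/= env_at0 subr0.
  by move=> /(_ 0%N isT); rewrite /u/= env_at0 subr0.
apply: etrans (wP (n := 1%N) (t := u) (A := fun=> [set v]) _ _ _) _.
- by case=> [|i] _; apply: ge0_half_line => //=; exact: ltW.
- by case.
- by [].
by apply: etrans (big_ord1 _ _) _.
Qed.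

(** The extremum is f a plus the extremum of the path restarted at a, which is independent of f a;
    and f a is Gaussian. *)
Lemma ext_no_atom (s : bool) a b v : 0 < a -> a <= b ->
  P [set f | ext s a b (env_fun f) = v] = 0%E.
Proof.
move=> a0 ab; have a0' := ltW a0.
have ab0 : 0 <= b - a by rewrite subr_ge0.
have mA : measurable_fun setT (fun f : pathD (past a) => env_fun f a).
  by apply: measurable_coord; rewrite /past/= in_itv/= a0'/=.
pose Z (f : env_path R) := ext s 0 (b - a) f.
have mZ : measurable_fun setT (Z : pathD half -> R).
  apply: (@measurable_ext _ _ (pathD half) id) => // x /andP[x0 _].
  by apply: measurable_coord; exact: ge0_half_line.
have mZ' : measurable_fun setT (Z \o shift a : pathD half -> R).
  by apply: measurableT_comp => //; exact: measurable_shift.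
have mA' := measurable_half_past mA.
have h := @indep_sum_no_atom _ _ (pathD half) P _ _ mZ' mA' v.
rewrite -[RHS]h.
- congr (P _); apply/seteqP; split=> f /=;
    by rewrite /Z -ext_shift// addr0 subrKC subrK.
- move=> E F mE mF; rewrite setIC muleC.
  exact: (indep_shift a0' mA mZ mF mE).
- by move=> w; exact: coord_no_atom.
Qed.

(** Cut at time b: the difference is f b minus the first extremum, which depends on the past, plus
    an extremum of the restarted path over [c - b, d - b]. The latter is independent of the past and
    has no atom because c - b > 0. *)
Lemma ext_diff_no_atom (s s' : bool) a b c d v : 0 <= a -> a <= b -> b < c -> c <= d ->
  P [set f | ext s' c d (env_fun f) - ext s a b (env_fun f) = v] = 0%E.
Proof.
move=> a0 ab bc cd.
pose t := b.
have t0 : 0 <= t by exact: le_trans ab.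
pose A (f : env_path R) := f t - ext s a b f.
pose B (f : env_path R) := ext s' (c - t) (d - t) f.
have cdt : c - t <= d - t by rewrite lerD2r.
have ct : 0 < c - t by rewrite subr_gt0.
have mA : measurable_fun setT (A : pathD (past t) -> R).
  apply: measurable_funB.
    by apply: measurable_coord; rewrite /past/= in_itv/= t0/=.
  apply: (@measurable_ext _ _ (pathD (past t)) id) => // x /andP[ax xb].
  by apply: measurable_coord; rewrite /past/= in_itv/= (le_trans a0 ax).
have mB : measurable_fun setT (B : pathD half -> R).
  apply: (@measurable_ext _ _ (pathD half) id) => // x /andP[x0 _].
  by apply: measurable_coord; apply: ge0_half_line; rewrite (le_trans (ltW ct)).
have mB' : measurable_fun setT (B \o shift t : pathD half -> R).
  by apply: measurableT_comp => //; exact: measurable_shift.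
have mA' := measurable_half_past mA.
rewrite -[RHS](@indep_sum_no_atom _ _ (pathD half) P _ _ mA' mB' v).
- congr (P _); apply/seteqP; split=> f /=; rewrite /A /B -ext_shift// !subrKC;
    by move=> <-; ring.
- exact: indep_shift.
- move=> w; have mBw : measurable (B @^-1` [set w] : set (pathD half)).
    by have := mB measurableT [set w] (measurable_set1 w); rewrite setTI.
  apply: etrans (wiener_shift wP t0 mBw) _.
  exact: ext_no_atom.
Qed.

(** Two local extrema x < y are extrema over disjoint intervals with rational endpoints, so that
    countably many differences without atoms have to be considered. *)
Lemma ae_locext_diff v : {ae P, forall f, forall x y, 0 < x -> x < y ->
  locext (env_fun f) x -> locext (env_fun f) y -> env_fun f y - env_fun f x <> v}.
Proof.
pose Q (i : bool * bool * rat * rat * rat * rat) (f : pathD half) :=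
  let: (s, s', a, b, c, d) := i in
  0 <= ratr a :> R -> ratr a <= ratr b :> R -> ratr b < ratr c :> R -> ratr c <= ratr d :> R ->
  ext s' (ratr c) (ratr d) (env_fun f) - ext s (ratr a) (ratr b) (env_fun f) <> v.
have : {ae P, forall f, forall i, Q i f}.
  apply: ae_all_count => -[[[[[s s'] a] b] c] d].
  have [a0|a0] := leP 0 (ratr a : R); last by apply: aeW => f /= h; rewrite leNgt a0 in h.
  have [ab|ab] := leP (ratr a : R) (ratr b); last by apply: aeW => f /= _ h; rewrite leNgt ab in h.
  have [bc|bc] := ltP (ratr b : R) (ratr c); last by apply: aeW => f /= _ _ h; rewrite ltNge bc in h.
  have [cd|cd] := leP (ratr c : R) (ratr d); last by apply: aeW => f /= _ _ _ h; rewrite leNgt cd in h.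
  have mE s1 a1 b1 : 0 <= a1 -> a1 <= b1 -> measurable_fun setT (fun f : pathD half => ext s1 a1 b1 (env_fun f)).
    move=> a10 ab1; apply: (@measurable_ext _ _ (pathD half) id) => // x /andP[x0 _].
    by apply: measurable_coord; apply: ge0_half_line; rewrite (le_trans a10).
  have c0 : 0 <= ratr c :> R by rewrite (le_trans a0)// (le_trans ab)// ltW.
  have m : measurable [set f : pathD half | ext s' (ratr c) (ratr d) (env_fun f) - ext s (ratr a) (ratr b) (env_fun f) = v].
    have := measurable_funB (mE s' _ _ c0 cd) (mE s _ _ a0 ab).
    by move=> /(_ measurableT [set v] (measurable_set1 v)); rewrite setTI.
  apply: ae_imp (prob0_ae m (ext_diff_no_atom s s' v a0 ab bc cd)) => f h _ _ _ _.
  exact: h.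
apply: ae_imp => f hf x y x0 xy [e e0 [s fx]] [e' e'0 [s' fy]].
pose mid := (x + y) / 2.
have xm : x < mid by rewrite /mid; lra.
have my : mid < y by rewrite /mid; lra.
have e1 : Num.max 0 (x - e) < x by rewrite gt_max x0 ltrBlDr ltrDl.
have e2 : x < Num.min mid (x + e) by rewrite lt_min xm ltrDl.
have e3 : Num.max mid (y - e') < y by rewrite gt_max my ltrBlDr ltrDl.
have e4 : y < y + e' by rewrite ltrDl.
have [a] := rat_in_itvoo e1; rewrite in_itv/= gt_max => /andP[/andP[a0 ax] ax'].
have [b] := rat_in_itvoo e2; rewrite in_itv/= lt_min => /andP[bx /andP[bm be]].
have [c] := rat_in_itvoo e3; rewrite in_itv/= gt_max => /andP[/andP[mc ce] cy].
have [d] := rat_in_itvoo e4; rewrite in_itv/= => /andP[yd de].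
have := hf (s, s', a, b, c, d) (ltW a0) _ _ _.
rewrite (@extE _ s' _ _ _ y) ?(ltW cy) ?(ltW yd)//; last first.
  by move=> z /andP[cz zd]; apply: fy; rewrite ltr_distl; apply/andP; split; lra.
rewrite (@extE _ s _ _ _ x) ?(ltW ax') ?(ltW bx)//; last first.
  by move=> z /andP[cz zd]; apply: fx; rewrite ltr_distl; apply/andP; split; lra.
by apply; lra.
Qed.

Lemma measurable_joint :
  measurable_fun setT (fun p : pathD half * measurableTypeR R => env_fun p.1 (Num.max 0 p.2)).
Proof.
apply: (@measurable_eval_half _ _ _ (fun p : pathD half * measurableTypeR R => env_fun p.1)
  (fun p => Num.max 0 p.2)).
- move=> x x0; apply: (measurableT_comp (f := fun f : pathD half => env_fun f x)) => //.
  by apply: measurable_coord; exact: ge0_half_line.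
- by move=> p; exact: env_continuous.
- by apply: measurable_maxr => //.
- by move=> p; rewrite le_max lexx.
Qed.

(** The time spent above 0 is divided by 4 when the path is scaled by 2, so it is 0 or infinite. It
    is not 0, because an unbounded path is positive somewhere, hence on an interval. This is what
    makes the scale function onto. *)
Lemma ae_occupation_infinite :
  {ae P, forall f, lebesgue_measure [set x | 0 <= x /\ 0 <= env_fun f x] = +oo%E}.
Proof.
pose A : set (pathD half * measurableTypeR R) := [set p | 0 <= p.2] `&` [set p | 0 <= env_fun p.1 (Num.max 0 p.2)].
have mA : measurable A.
  have m2 : measurable_fun setT (fun p : pathD half * measurableTypeR R => - p.2).
    by apply: measurableT_comp.
  have m1 : measurable_fun setT (fun p : pathD half * measurableTypeR R => - env_fun p.1 (Num.max 0 p.2)).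
    by apply: measurableT_comp => //; exact: measurable_joint.
  have := measurableI _ _ (measurable_ray 0 m2) (measurable_ray 0 m1).
  by congr measurable; apply/seteqP; split=> p [] /=; rewrite !oppr_le0.
pose G (f : env_path R) : \bar R := lebesgue_measure (xsection A (f : pathD half)).
have GE f : G f = lebesgue_measure [set x | 0 <= x /\ 0 <= env_fun f x].
  rewrite /G; congr lebesgue_measure; apply/seteqP; split=> x; rewrite /xsection/= inE /A/=.
    by move=> [x0]; rewrite (max_idPr x0).
  by move=> [x0]; rewrite (max_idPr x0).
have mG : measurable_fun setT (G : pathD half -> \bar R).
  exact: (measurable_fun_xsection (@lebesgue_measure R) mA).
have mS (f : env_path R) : measurable [set x | 0 <= x /\ 0 <= env_fun f x].
  have -> : [set x | 0 <= x /\ 0 <= env_fun f x] = xsection A (f : pathD half).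
    apply/seteqP; split=> x; rewrite /xsection/= inE /A/=.
      by move=> [x0]; rewrite (max_idPr x0).
    by move=> [x0]; rewrite (max_idPr x0).
  exact: measurable_xsection.
have n2 : 2 != 0 :> R by [].
have r2 : 0 < (4^-1 : R) < 1 by apply/andP; split; lra.
have Gs : {ae P, forall f, G (aff 2 0 f) = (4^-1%:E * G f)%E}.
  apply: aeW => f; rewrite !GE.
  have n4 : 4 != 0 :> R by [].
  rewrite (lebesgue_mulc n4 (mS f)) muleA -EFinM ger0_norm// mulVf// mul1e.
  congr lebesgue_measure; apply/seteqP; split=> x /= [x0]; rewrite /mulc add0r env_at0 subr0 -natrX pmulr_rge0//.
    by move=> h; split => //; rewrite mulr_ge0.
  by move=> h; split => //; rewrite -(pmulr_rge0 _ (_ : 0 < 4 :> R)).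
apply: ae_imp (_ : {ae P, forall f, ~ (0 < G f < +oo)%E /\ ~ bounded_above f}).
  move=> f [h nb]; rewrite -GE; apply/eqP; rewrite eq_le leey/= leNgt.
  apply/negP => Goo; apply: h; rewrite Goo andbT lt0e measure_ge0 andbT.
  apply/negP => /eqP G0; apply: nb; exists 0%N => // x x0.
  rewrite leNgt; apply/negP => fx1.
  have o : open (env_fun f @^-1` [set y | 0 < y]).
    by apply: open_comp; [move=> y _; exact: env_continuous|exact: open_gt].
  have fx : 0 < f x by apply: lt_trans fx1.
  move: (o); rewrite openE => /(_ _ fx)/nbhs_ballP[e /= e0 eh].
  pose I0 : set R := `[x, x + e / 2]%classic.
  have : (lebesgue_measure I0 <= G f)%E.
    rewrite GE; apply: le_measure; rewrite ?inE; [exact: measurable_itv|exact: mS|].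
    move=> z; rewrite /I0/= in_itv/= => /andP[xz zx]; split; first exact: le_trans xz.
    apply: ltW; apply: (eh z); rewrite /ball/= distrC ger0_norm ?subr_ge0//; lra.
  rewrite G0 /I0 lebesgue_measure_itv/= lte_fin ltrDl divr_gt0//.
  by rewrite -EFinB lee_fin addrAC subrr add0r leNgt divr_gt0.
apply: ae_and; first exact: (zero_infty_law wP n2 r2 mG Gs).
exact: ae_unbounded.
Qed.

End as_extrema.

(** * Integrals and primitives of continuous functions *)

Section primitives.
Context {R : realType}.
Local Notation leb := (@lebesgue_measure R).
Implicit Types f g F : R -> R.

Definition cint (a b : R) f : R := \int[leb]_(x in `[a, b]) f x.

Lemma cont_integrable f a b : continuous f -> leb.-integrable `[a, b] (EFin \o f).
Proof.
move=> cf; apply: continuous_compact_integrable; first exact: segment_compact.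
exact: continuous_subspaceT.
Qed.

Lemma cint_chasles f a b c : continuous f -> a <= c -> c <= b ->
  cint a b f = cint a c f + cint c b f.
Proof.
move=> cf ac cb; rewrite /cint.
have := Rintegral_itvB (a := BLeft a) (b := BRight b) (x := c) (cont_integrable _ _ cf).
rewrite !bnd_simp => /(_ ac cb) h.
have e : \int[leb]_(x in `]c, b]) f x = \int[leb]_(x in `[c, b]) f x.
  apply: Rintegral_itv_obnd_cbnd.
  apply: (integrableS _ _ _ (cont_integrable c b cf)) => //.
  by move=> x /=; rewrite !in_itv/= => /andP[/ltW -> ->].
by rewrite -e -h addrCA subrr addr0.
Qed.

Lemma cint_le f g a b : continuous f -> continuous g ->
  (forall x, a <= x <= b -> f x <= g x) -> cint a b f <= cint a b g.
Proof.
move=> cf cg fg; apply: le_Rintegral.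
- exact: measurable_itv.
- exact: cont_integrable.
- exact: cont_integrable.
- by move=> x /=; rewrite in_itv/=; exact: fg.
Qed.

Lemma eq_cint f g a b : (forall x, a <= x <= b -> f x = g x) -> cint a b f = cint a b g.
Proof. by move=> fg; apply: eq_Rintegral => x; rewrite inE/= in_itv/=; exact: fg. Qed.

Lemma cint_cst (k a b : R) : a <= b -> cint a b (fun=> k) = k * (b - a).
Proof.
move=> ab; rewrite /cint Rintegral_cst; last exact: measurable_itv.
have h : leb `[a, b] = (if (a < b)%R then (b - a)%:E else 0%E).
  by rewrite lebesgue_measure_itv/= lte_fin.
congr (_ * _); apply: etrans (congr1 fine h) _.
by case: ltgtP ab => // -> _; rewrite subrr.
Qed.

Lemma cint_ge0 f a b : (forall x, a <= x <= b -> 0 <= f x) -> 0 <= cint a b f.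
Proof. by move=> f0; apply: Rintegral_ge0 => x /=; rewrite in_itv/=; exact: f0. Qed.

Lemma cint_gt f a b x : continuous f -> (forall y, a <= y <= b -> 0 <= f y) ->
  a < x < b -> 0 < f x -> 0 < cint a b f.
Proof.
move=> cf f0 /andP[ax xb] fx.
have o : open (f @^-1` [set y | f x / 2 < y]).
  by apply: open_comp; [move=> y _; exact: cf|exact: open_gt].
have fx2 : f x / 2 < f x by lra.
move: (o); rewrite openE => /(_ _ fx2)/nbhs_ballP[e /= e0 eh].
pose d := Num.min (e / 2) (b - x).
have d0 : 0 < d by rewrite lt_min subr_gt0 xb divr_gt0.
have de : d <= e / 2 by rewrite ge_min lexx.
have db : d <= b - x by rewrite ge_min lexx orbT.
have xd : x <= x + d by rewrite lerDl ltW.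
have xdb : x + d <= b by lra.
rewrite (cint_chasles cf (ltW ax) (ltW xb)) (cint_chasles cf xd xdb).
have p1 : 0 <= cint a x f.
  by apply: cint_ge0 => y /andP[ay yx]; apply: f0; rewrite ay (le_trans yx (ltW xb)).
have p3 : 0 <= cint (x + d) b f.
  by apply: cint_ge0 => y /andP[ay yx]; apply: f0; rewrite yx andbT; lra.
have p2 : 0 < cint x (x + d) f.
  apply: (@lt_le_trans _ _ (cint x (x + d) (fun=> f x / 2))).
    rewrite cint_cst// mulr_gt0//; lra.
  apply: cint_le => // [y|y /andP[xy yd]]; first exact: cst_continuous.
  by apply: ltW; apply: (eh y); rewrite /ball/= distrC ger0_norm ?subr_ge0//; lra.
lra.
Qed.

Definition prim f (x : R) : R := if 0 <= x then cint 0 x f else - cint x 0 f.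

Lemma prim_itv f a b : continuous f -> a <= b -> cint a b f = prim f b - prim f a.
Proof.
move=> cf ab; rewrite /prim; have [a0|a0] := leP 0 a.
  rewrite (le_trans a0 ab) (cint_chasles cf a0 ab); ring.
have [b0|b0] := leP 0 b; first by rewrite (cint_chasles cf (ltW a0) b0); ring.
rewrite (cint_chasles cf ab (ltW b0)); ring.
Qed.

Lemma prim0 f : prim f 0 = 0.
Proof. by rewrite /prim lexx /cint set_itv1 Rintegral_set1. Qed.

Lemma is_derive_prim f (x : R) : continuous f -> is_derive x (1 : R) (prim f) (f x).
Proof.
move=> cf; have x1 : x < x + 1 by lra.
pose F y := \int[leb]_(t in [set` `[x - 1, y]]) f t.
have ax : x - 1 < x by lra.
have [dF eF] := @continuous_FTC1_closed R f (x - 1) x (x + 1) x1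
  (cont_integrable _ _ cf) ax (cf x).
have isF : is_derive x (1 : R) F (f x) by exact: (DeriveDef dF (etrans (esym (derive1E _ _)) eF)).
have isG : is_derive x (1 : R) (F + cst (prim f (x - 1))) (f x + 0).
  by apply: is_deriveD.
rewrite -[f x]addr0; apply: (near_eq_is_derive _ isG).
near=> y.
have xy : x - 1 <= y by apply: ltW; near: y; exact: lt_nbhsr.
rewrite /= fctE/=.
by have := prim_itv cf xy; rewrite /cint /F => ->; rewrite subrK.
Unshelve. all: by end_near. Qed.

Lemma is_derive_continuous F (g : R -> R) : (forall x : R, is_derive x (1 : R) F (g x)) -> continuous F.
Proof.
move=> dF x; apply: differentiable_continuous; apply/derivable1_diffP.
exact: (@ex_derive _ _ _ _ _ _ _ (dF x)).
Qed.

Lemma prim_continuous f : continuous f -> continuous (prim f).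
Proof. by move=> cf; apply: (@is_derive_continuous _ f) => x; exact: is_derive_prim. Qed.

Lemma is_derive_inj F f (x : R) : (forall x : R, is_derive x (1 : R) F (f x)) ->
  (forall x : R, is_derive x (1 : R) (prim f) (f x)) -> F x = F 0 + prim f x.
Proof.
move=> dF df.
have h (y : R) : is_derive y (1 : R) (F - prim f) 0.
  by rewrite -(subrr (f y)); apply: is_deriveB.
have := is_derive_0_is_cst x 0 h; rewrite !fctE prim0 subr0 => <-.
by rewrite subrK.
Qed.

Lemma cint_derive F f a b : continuous f -> (forall x : R, is_derive x (1 : R) F (f x)) ->
  a <= b -> cint a b f = F b - F a.
Proof.
move=> cf dF ab; have dp (x : R) : is_derive x (1 : R) (prim f) (f x) by exact: is_derive_prim.
have eb := is_derive_inj b dF dp; have ea := is_derive_inj a dF dp.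
by rewrite (prim_itv cf ab) eb ea opprD addrACA subrr add0r.
Qed.

Lemma cint_subst F f g a b : continuous f -> continuous g ->
  (forall x : R, is_derive x (1 : R) F (f x)) -> a <= b -> F a <= F b ->
  cint a b (fun x => g (F x) * f x) = cint (F a) (F b) g.
Proof.
move=> cf cg dF ab Fab.
have cF : continuous F by exact: is_derive_continuous dF.
have cGf : continuous (fun x => g (F x) * f x).
  move=> x; apply: cvgM; last exact: cf.
  by apply: (@cvg_comp _ _ _ F g); [exact: cF|exact: cg].
have dG (x : R) : is_derive x (1 : R) (prim g \o F) (g (F x) * f x).
  by have dg := is_derive_prim (F x) cg; exact: is_derive1_comp.
by rewrite (prim_itv cg Fab); exact: cint_derive cGf dG ab.
Qed.

Lemma prim_lt f x y : continuous f -> (forall z, 0 < f z) -> x < y -> prim f x < prim f y.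
Proof.
move=> cf f0 xy; rewrite -subr_gt0 -(prim_itv cf (ltW xy)).
apply: (@cint_gt _ _ _ ((x + y) / 2)) => // [z _|]; first exact: ltW.
by apply/andP; split; lra.
Qed.

Lemma continuous_left_inv f g x : continuous f -> {homo f : x y / x < y} ->
  cancel f g -> {for f x, continuous g}.
Proof.
move=> cf fi fg; apply/cvgrPdist_le => e e0; rewrite fg.
have h1 : f (x - e) < f x by apply: fi; lra.
have h2 : f x < f (x + e) by apply: fi; lra.
near=> s.
have s1 : f (x - e) < s by near: s; exact: lt_nbhsr.
have s2 : s < f (x + e) by near: s; exact: lt_nbhsl.
have [c ci <-] : exists2 c, c \in `[x - e, x + e] & f c = s.
  apply: IVT; [lra|exact: continuous_subspaceT|].
  by rewrite ge_min (ltW s1)/= le_max (ltW s2) orbT.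
by rewrite fg ler_distlC; move: ci; rewrite in_itv.
Unshelve. all: by end_near. Qed.

End primitives.

(** * From the local time of the diffusion to that of the Brownian motion *)

Lemma continuous_pairing (T U V : topologicalType) (f : T -> U) (g : T -> V) :
  continuous f -> continuous g -> continuous (fun x => (f x, g x)).
Proof. by move=> cf cg x; exact: (cvg_pair (cf x) (cg x)). Qed.

Lemma continuous_fst (U V : topologicalType) : continuous (@fst U V).
Proof. by move=> [a b]; exact: cvg_fst. Qed.

Lemma continuous_snd (U V : topologicalType) : continuous (@snd U V).
Proof. by move=> [a b]; exact: cvg_snd. Qed.

Lemma continuous_max0 (R : realType) : continuous (Num.max 0 : R -> R).
Proof. by move=> x; apply: (@continuous_max R _ (cst 0) id); [exact: cvg_cst|exact: cvg_id]. Qed.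

Lemma continuous_compo (T U V : topologicalType) (f : T -> U) (g : U -> V) :
  continuous f -> continuous g -> continuous (fun x => g (f x)).
Proof. by move=> cf cg x; apply: continuous_comp; [exact: cf|exact: cg]. Qed.

Section local_time_of_brox.
Context {R : realType}.
Local Notation leb := (@lebesgue_measure R).

(* l is a jointly continuous occupation density of beta; only times u >= 0
   matter. *)
Definition is_lt (beta : R -> R) (l : R -> R -> R) : Prop :=
  continuous (fun p : R * R => l (Num.max 0 p.1) p.2) /\
  forall (u M : R) (phi : R -> R), 0 <= u -> 0 <= M -> continuous phi ->
    (forall z, M <= `|z| -> phi z = 0) ->
    cint 0 u (phi \o beta) = cint (- M) M (fun z => phi z * l u z).

Lemma cintE (g : R -> R) a b : continuous g ->
  (\int[leb]_(x in `[a, b]) (g x)%:E)%E = (cint a b g)%:E.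
Proof.
move=> cg; rewrite /cint /Rintegral fineK//.
apply: integrable_fin_num => //; exact: cont_integrable.
Qed.

Lemma continuous_expR_comp (g : R -> R) : continuous g -> continuous (fun x => expR (g x)).
Proof. by move=> cg x; apply: (@cvg_comp _ _ _ g expR); [exact: cg|exact: continuous_expR]. Qed.

Variable W : env_path R.
Local Notation S := (scale W).
Local Notation Sinv := (scale_inv W).

Lemma scaleE : S = prim (fun y => expR (W y)).
Proof. by []. Qed.

Lemma continuous_expW : continuous (fun y => expR (W y)).
Proof. by apply: continuous_expR_comp; exact: env_continuous. Qed.

Lemma scale0 : S 0 = 0. Proof. by rewrite scaleE prim0. Qed.

Lemma scale_lt x y : x < y -> S x < S y.
Proof. by rewrite scaleE; apply: prim_lt; [exact: continuous_expW|move=> z; exact: expR_gt0]. Qed.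

Lemma scale_inj : injective S.
Proof.
move=> x y e; apply/eqP; rewrite eq_le; apply/andP; split;
  by rewrite leNgt; apply/negP => /scale_lt; rewrite e ltxx.
Qed.

Lemma scale_le x y : x <= y -> S x <= S y.
Proof. by rewrite le_eqVlt => /predU1P[->//|/scale_lt/ltW]. Qed.

Lemma scale_le_iff x y : (S x <= S y) = (x <= y).
Proof.
by have [xy|xy] := leP x y; [rewrite scale_le|apply/negbTE; rewrite -ltNge scale_lt].
Qed.

Lemma is_derive_scale (x : R) : is_derive x (1 : R) S (expR (W x)).
Proof. by rewrite scaleE; apply: is_derive_prim; exact: continuous_expW. Qed.

Lemma continuous_scale : continuous S.
Proof. by rewrite scaleE; apply: prim_continuous; exact: continuous_expW. Qed.

Lemma scaleK : cancel S Sinv.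
Proof.
move=> x; rewrite /scale_inv pinvKV ?inE// => a b _ _; exact: scale_inj.
Qed.

Hypothesis Ssurj : forall z, exists x, S x = z.

Lemma scale_invK : cancel Sinv S.
Proof. by move=> z; have [x <-] := Ssurj z; rewrite scaleK. Qed.

Lemma continuous_scale_inv : continuous Sinv.
Proof.
move=> z; have [x <-] := Ssurj z; apply: continuous_left_inv.
- exact: continuous_scale.
- by move=> a b; exact: scale_lt.
- exact: scaleK.
Qed.

Variable beta : env_path R.
Variable B : R -> R.
Hypothesis BE : forall s, 0 <= s -> B s = beta s.

Definition speed (s : R) : R := expR (- 2 * W (Sinv (beta s))).

Lemma continuous_speed : continuous speed.
Proof.
apply: continuous_expR_comp => s; apply: cvgM; first exact: cvg_cst.
apply: (@cvg_comp _ _ _ (Sinv \o beta) W); last exact: env_continuous.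
apply: (@cvg_comp _ _ _ beta Sinv); first exact: env_continuous.
exact: continuous_scale_inv.
Qed.

Lemma speed_gt0 s : 0 < speed s. Proof. exact: expR_gt0. Qed.

Definition tclock : R -> R := prim speed.

Lemma clockE t : 0 <= t -> clock W B t = tclock t.
Proof.
move=> t0; rewrite /tclock /prim t0; apply: eq_cint => s /andP[s0 _].
by rewrite /speed BE.
Qed.

Lemma tclock_lt s t : s < t -> tclock s < tclock t.
Proof. by apply: prim_lt; [exact: continuous_speed|exact: speed_gt0]. Qed.

Lemma tclock0 : tclock 0 = 0. Proof. exact: prim0. Qed.

Lemma tclock_le s t : s <= t -> tclock s <= tclock t.
Proof. by rewrite le_eqVlt => /predU1P[->//|/tclock_lt/ltW]. Qed.

Lemma tclock_ge0 s : 0 <= s -> 0 <= tclock s.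
Proof. by move=> s0; rewrite -tclock0 tclock_le. Qed.

Lemma tclock_inj : injective tclock.
Proof.
move=> x y e; apply/eqP; rewrite eq_le; apply/andP; split;
  by rewrite leNgt; apply/negP => /tclock_lt; rewrite e ltxx.
Qed.

Lemma continuous_tclock : continuous tclock.
Proof. by apply: prim_continuous; exact: continuous_speed. Qed.

Lemma clock_invK u : 0 <= u -> clock_inv W B (tclock u) = u.
Proof.
move=> u0; rewrite /clock_inv -clockE// pinvKV ?inE//; last exact: ge0_half_line.
move=> a b; rewrite !inE => /half_line_ge0 a0 /half_line_ge0 b0.
by rewrite !clockE//; exact: tclock_inj.
Qed.

Definition xpath (t : R) : R := Sinv (B (clock_inv W B t)).

Lemma xpathE u : 0 <= u -> xpath (tclock u) = Sinv (beta u).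
Proof. by move=> u0; rewrite /xpath clock_invK// BE. Qed.

Lemma tclock_range u t : 0 <= u -> 0 <= t <= tclock u ->
  exists2 v, 0 <= v <= u & tclock v = t.
Proof.
move=> u0 /andP[t0 tu].
have [v vi <-] : exists2 v, v \in `[0, u] & tclock v = t.
  apply: IVT => //; first by apply: continuous_subspaceT; exact: continuous_tclock.
  by rewrite tclock0 ge_min t0/= le_max tu orbT.
by exists v => //; move: vi; rewrite in_itv.
Qed.

(* A globally continuous version of xpath on [0, tclock u]. *)
Definition xcont (u t : R) : R :=
  Sinv (beta (xget 0 [set v | tclock v = clamp 0 (tclock u) t])).

Lemma xget_tclock v : xget 0 [set w | tclock w = tclock v] = v.
Proof. by case: xgetP => [w _ /= /tclock_inj//|/(_ v) /= h]; exfalso; exact: h. Qed.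

Lemma continuous_xcont u : 0 <= u -> continuous (xcont u).
Proof.
move=> u0 t.
have : {for clamp 0 (tclock u) t, continuous (fun s => xget 0 [set v | tclock v = s])}.
  have [v _ <-] := tclock_range u0 (clamp_itv t (tclock_ge0 u0)).
  apply: continuous_left_inv.
  - exact: continuous_tclock.
  - by move=> a b; exact: tclock_lt.
  - exact: xget_tclock.
move=> h; apply: (@cvg_comp _ _ _ (fun t => beta (xget 0 [set v | tclock v = clamp 0 (tclock u) t])) Sinv); last exact: continuous_scale_inv.
apply: (@cvg_comp _ _ _ (fun t => xget 0 [set v | tclock v = clamp 0 (tclock u) t]) beta); last exact: env_continuous.
by apply: (@cvg_comp _ _ _ (clamp 0 (tclock u)) (fun s => xget 0 [set v | tclock v = s])); [exact: continuous_clamp|exact: h].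
Qed.

Lemma xcontE u v : 0 <= v <= u -> xcont u (tclock v) = Sinv (beta v).
Proof.
move=> /andP[v0 vu]; rewrite /xcont clamp_id ?xget_tclock//.
by rewrite tclock_ge0//= tclock_le.
Qed.

Variable l : R -> R -> R.
Hypothesis lcont : {within [set p : R * R | 0 <= p.1],
  continuous (fun p : R * R => l p.1 p.2)}.
Hypothesis locc : forall (f : R -> R) (t : R), measurable_fun setT f ->
  [bounded f x | x in setT] -> 0 <= t ->
  (\int[leb]_(s in `[0%R, t]) (f (xpath s))%:E = \int[leb]_x (f x * l t x)%:E)%E.

Lemma continuous_l : continuous (fun p : R * R => l (Num.max 0 p.1) p.2).
Proof.
have h : continuous (fun p : R * R => (Num.max 0 p.1, p.2)).
  apply: continuous_pairing; last exact: continuous_snd.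
  by apply: continuous_compo; [exact: continuous_fst|exact: continuous_max0].
move=> p.
have /subspace_continuousP := lcont.
move=> /(_ (Num.max 0 p.1, p.2)) /=; rewrite le_max lexx => /(_ isT) c.
have hc : (Num.max 0 q.1, q.2) @[q --> p] --> within [set p : R * R | 0 <= p.1] (nbhs (Num.max 0 p.1, p.2)).
  move=> A /= wA; have := h p _ wA; rewrite /nbhs/=.
  apply: filterS => q; apply => /=; by rewrite le_max lexx.
exact: (cvg_comp _ _ hc c).
Qed.

Lemma continuous_l_at t : 0 <= t -> continuous (l t).
Proof.
move=> t0 x.
have := @continuous_l (t, x) => /= h.
have e : l t = (fun p : R * R => l (Num.max 0 p.1) p.2) \o (fun y => (t, y)).
  by apply/funext => y /=; rewrite (max_idPr t0).
have : {for x, continuous ((fun p : R * R => l (Num.max 0 p.1) p.2) \o (fun y => (t, y)))}.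
  apply: continuous_comp; last exact: h.
  by apply: continuous_pairing => y; [exact: cvg_cst|exact: cvg_id].
by rewrite -e.
Qed.

(** The classical identity L_X (T u, x) = e^(-W x) L_B (u, S x), read backwards as a definition of
    L_B. *)
Definition lbeta (u z : R) : R := expR (W (Sinv z)) * l (tclock (Num.max 0 u)) (Sinv z).

Lemma integral_supported (g : R -> R) a b : continuous g ->
  (forall x, ~ (a <= x <= b) -> g x = 0) ->
  (\int[leb]_x (g x)%:E)%E = (cint a b g)%:E.
Proof.
move=> cg g0; rewrite -cintE// [RHS]integral_mkcond.
apply: eq_integral => x _; rewrite patchE; case: ifPn => // /negP.
by rewrite inE/= in_itv/= => /g0 ->.
Qed.

Lemma cont_bounded (g : R -> R) a b : continuous g -> a <= b ->
  (forall x, ~ (a <= x <= b) -> g x = 0) -> [bounded g x | x in setT].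
Proof.
move=> cg ab g0.
have cn : continuous (fun x => `|g x|).
  by move=> x; apply: (@cvg_comp _ _ _ g Num.norm); [exact: cg|exact: norm_continuous].
have [x xab gx] := EVT_max_cont cn ab.
exists `|g x|; split; first exact: num_real.
move=> y xy z _; apply: ltW; apply: le_lt_trans xy.
have [zab|zab] := pselect (a <= z <= b); first exact: gx.
by rewrite g0// normr0.
Qed.

Lemma lbeta_is_lt : is_lt beta lbeta.
Proof.
split.
  have h1 : continuous (fun p : R * R => expR (W (Sinv p.2))).
    move=> p; apply: (@cvg_comp _ _ _ (fun p : R * R => W (Sinv p.2)) expR); last exact: continuous_expR.
    apply: (@cvg_comp _ _ _ (fun p : R * R => Sinv p.2) W); last exact: env_continuous.
    by apply: (@cvg_comp _ _ _ snd Sinv); [exact: cvg_snd|exact: continuous_scale_inv].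
  have h2 : continuous (fun p : R * R => (tclock (Num.max 0 p.1), Sinv p.2)).
    apply: continuous_pairing; last first.
      by apply: continuous_compo; [exact: continuous_snd|exact: continuous_scale_inv].
    apply: (continuous_compo (g := tclock)); last exact: continuous_tclock.
    by apply: continuous_compo; [exact: continuous_fst|exact: continuous_max0].
  move=> p; apply: cvgM; first exact: h1.
  have E : (fun q : R * R => l (tclock (Num.max 0 (Num.max 0 q.1))) (Sinv q.2)) =
      (fun p : R * R => l (Num.max 0 p.1) p.2) \o
      (fun p : R * R => (tclock (Num.max 0 p.1), Sinv p.2)).
    apply/funext => q /=.
    by rewrite (max_idPr (tclock_ge0 _)) ?le_max ?lexx// maxA maxxx.
  have := continuous_comp (h2 p) (@continuous_l _).
  by rewrite -E.
move=> u M phi u0 M0 cphi phi0.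
(* The factor e^(2 W) cancels the density of the clock when time is changed; the substitution z = S
   x then uses up one factor e^W and leaves the other one to [lbeta]. *)
pose f x := phi (S x) * expR (2 * W x).
have cf : continuous f.
  move=> x; apply: cvgM.
    by apply: (@cvg_comp _ _ _ S phi); [exact: continuous_scale|exact: cphi].
  apply: (@continuous_expR_comp (fun x => 2 * W x)) => y.
  by apply: cvgM; [exact: cvg_cst|exact: env_continuous].
pose a := Sinv (- M); pose b := Sinv M.
have Sa : S a = - M by rewrite /a scale_invK.
have Sb : S b = M by rewrite /b scale_invK.
have ab : a <= b by rewrite -scale_le_iff Sa Sb; lra.
have f0 x : ~ (a <= x <= b) -> f x = 0.
  move=> xab; rewrite /f phi0 ?mul0r// leNgt; apply/negP.
  rewrite ltr_norml -Sa -Sb => /andP[h1 h2]; apply: xab.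
  by rewrite -(scale_le_iff a) -(scale_le_iff _ b) !ltW.
have T0 := tclock_ge0 u0.
have mf : measurable_fun setT f by exact: continuous_measurable_fun.
have := locc mf (cont_bounded cf ab f0) T0.
have -> : (\int[leb]_(s in `[0%R, tclock u]) (f (xpath s))%:E)%E = (cint 0 u (phi \o beta))%:E.
  have cfx : continuous (f \o xcont u).
    by move=> t; apply: (@cvg_comp _ _ _ (xcont u) f); [exact: continuous_xcont|exact: cf].
  have -> : (\int[leb]_(s in `[0%R, tclock u]) (f (xpath s))%:E)%E =
     (\int[leb]_(s in `[0%R, tclock u]) ((f \o xcont u) s)%:E)%E.
    apply: eq_integral => s; rewrite inE/= in_itv/= => sT.
    have [v vu <-] := tclock_range u0 sT.
    by rewrite xcontE// xpathE//; case/andP: vu.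
  rewrite cintE//; congr EFin.
  have := cint_subst continuous_speed cfx (fun x => is_derive_prim x continuous_speed) u0.
  rewrite -/tclock tclock0 => /(_ T0) <-; apply: eq_cint => v vu.
  rewrite /= xcontE// /f scale_invK /speed -mulrA -expRD.
  by rewrite mulNr subrr expR0 mulr1.
have cl := continuous_l_at T0.
have cfl : continuous (fun x => f x * l (tclock u) x).
  by move=> x; apply: cvgM; [exact: cf|exact: cl].
rewrite (integral_supported (a := a) (b := b) cfl); last first.
  by move=> x xab; rewrite f0// mul0r.
move=> [->].
have cg : continuous (fun z => phi z * lbeta u z).
  move=> z; apply: cvgM; first exact: cphi.
  apply: cvgM.
    apply: (@continuous_expR_comp (W \o Sinv)) => y.
    by apply: (@cvg_comp _ _ _ Sinv W); [exact: continuous_scale_inv|exact: env_continuous].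
  rewrite (max_idPr u0).
  by apply: (@cvg_comp _ _ _ Sinv (l (tclock u))); [exact: continuous_scale_inv|exact: cl].
rewrite -Sa -Sb -(cint_subst continuous_expW cg is_derive_scale ab (scale_le ab)).
apply: eq_cint => x _; rewrite /f /lbeta scaleK (max_idPr u0).
have -> : expR (2 * W x) = expR (W x) * expR (W x) by rewrite -expRD; congr expR; ring.
by rewrite !mulrA (mulrAC _ (expR _) (l _ _)).
Qed.

End local_time_of_brox.

(** * Properties of a continuous occupation density *)

Section local_time_facts.
Context {R : realType}.
Implicit Types (f : R -> R) (l : R -> R -> R).

Lemma cintZ (k a b : R) f : continuous f -> cint a b (fun x => k * f x) = k * cint a b f.
Proof.
move=> cf; apply: RintegralZl; first exact: measurable_itv.
exact: cont_integrable.
Qed.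

Lemma cint_shrink a a' b' b f : continuous f -> a <= a' -> a' <= b' -> b' <= b ->
  (forall x, a <= x <= a' -> f x = 0) -> (forall x, b' <= x <= b -> f x = 0) ->
  cint a b f = cint a' b' f.
Proof.
move=> cf aa ab bb f1 f2.
rewrite (cint_chasles cf aa (le_trans ab bb)) (cint_chasles cf ab bb).
rewrite (eq_cint (g := fun=> 0) f1) (eq_cint (g := fun=> 0) f2) !cint_cst//.
by rewrite !mul0r add0r addr0.
Qed.

Lemma continuous_mul (f g : R -> R) : continuous f -> continuous g ->
  continuous (fun x => f x * g x).
Proof. by move=> cf cg x; apply: cvgM; [exact: cf|exact: cg]. Qed.

Lemma continuous_cstR (k : R) : continuous (fun _ : R => k).
Proof. by move=> x; exact: cvg_cst. Qed.

Lemma continuous_affine (a b : R) : continuous (fun x : R => a + b * x).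
Proof.
move=> x; apply: cvgD; first exact: cvg_cst.
by apply: cvgM; [exact: cvg_cst|exact: cvg_id].
Qed.

(** A triangular approximation of the Dirac mass at z, up to the normalization [mass]. *)
Definition tent (n : nat) (z y : R) : R := Num.max 0 (1 - n.+1%:R * `|y - z|).

Lemma tent_ge0 n z y : 0 <= tent n z y. Proof. by rewrite le_max lexx. Qed.

Lemma tent_out n z y : n.+1%:R^-1 <= `|y - z| -> tent n z y = 0.
Proof.
move=> h; apply/max_idPl; rewrite subr_le0.
by rewrite -ler_pdivrMl ?ltr0n// mulr1.
Qed.

Lemma tent_center n z : tent n z z = 1.
Proof. by rewrite /tent subrr normr0 mulr0 subr0; apply/max_idPr. Qed.

Lemma continuous_tent n z : continuous (tent n z).
Proof.
have c1 : continuous (fun y : R => 1 - n.+1%:R * `|y - z|); last first.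
  exact: (continuous_compo c1 (@continuous_max0 R)).
move=> y; apply: cvgB; first exact: cvg_cst.
apply: cvgM; first exact: cvg_cst.
by apply: cvg_norm; apply: cvgB; [exact: cvg_id|exact: cvg_cst].
Qed.

Definition mass n z : R := cint (- (`|z| + 2)) (`|z| + 2) (tent n z).

Lemma mass_gt0 n z : 0 < mass n z.
Proof.
apply: (@cint_gt _ _ _ _ z); first exact: continuous_tent.
- by move=> y _; exact: tent_ge0.
- by have := ler_norm z; have := ler_norm (- z); rewrite normrN => h1 h2; apply/andP; split; lra.
- by rewrite tent_center.
Qed.

Definition occ n u z f : R := cint 0 u (fun s => tent n z (f s)).

Lemma inv_small (e : R) : 0 < e -> \forall n \near \oo, n.+1%:R^-1 < e.
Proof.
move=> e0; exists (Num.truncn e^-1) => // n /= en.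
rewrite invf_plt ?posrE ?ltr0n// (lt_le_trans (truncnS_gt _))//.
by rewrite ler_nat.
Qed.

Section one_path.
Variables (f : R -> R) (l : R -> R -> R).
Hypothesis cf : continuous f.
Hypothesis fl : is_lt f l.

Lemma lt_continuous_z u : 0 <= u -> continuous (l u).
Proof.
move=> u0; have e : l u = (fun z => (fun p : R * R => l (Num.max 0 p.1) p.2) (u, z)).
  by apply/funext => z /=; rewrite (max_idPr u0).
rewrite e; apply: (continuous_compo (g := fun p : R * R => l (Num.max 0 p.1) p.2)); last exact: fl.1.
by apply: continuous_pairing => z; [exact: cvg_cst|exact: cvg_id].
Qed.

Lemma occ_lt n u z : 0 <= u ->
  occ n u z f = cint (- (`|z| + 2)) (`|z| + 2) (fun y => tent n z y * l u y).
Proof.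
move=> u0; apply: (fl.2 u _ _ u0); [by rewrite addr_ge0|exact: continuous_tent|].
move=> y yz; apply: tent_out; apply: (@le_trans _ _ 1).
  by rewrite invf_le1 ?ltr0n// ler1n.
have := ler_normD (y - z) z; rewrite subrK; lra.
Qed.

(** Expresses the local time through the path alone. Uniqueness, monotonicity in time and
    measurability all come from this. *)
Lemma lt_approx u z : 0 <= u -> occ n u z f / mass n z @[n --> \oo] --> l u z.
Proof.
move=> u0; apply/cvgrPdist_le => e e0.
have cl := lt_continuous_z u0.
have /cvgrPdist_le/(_ _ e0)/nbhs_ballP[d /= d0 dh] := cl z.
near=> n.
have nd : n.+1%:R^-1 < d by near: n; exact: inv_small.
have m0 := mass_gt0 n z.
have ct := @continuous_tent n z.
have key y : tent n z y * (l u z - e) <= tent n z y * l u y <= tent n z y * (l u z + e).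
  have [yd|yd] := leP (n.+1%:R^-1) `|y - z|; first by rewrite tent_out// !mul0r lexx.
  have : `|l u z - l u y| <= e.
    by apply: dh; rewrite /ball/= distrC (lt_trans yd).
  by rewrite ler_distlC => /andP[h1 h2]; rewrite !ler_wpM2l ?tent_ge0.
have cK k : continuous (fun y => tent n z y * k).
  by apply: continuous_mul => //; exact: continuous_cstR.
have cintK k : cint (- (`|z| + 2)) (`|z| + 2) (fun y => tent n z y * k) = mass n z * k.
  rewrite mulrC /mass -cintZ//; apply: eq_cint => y _; exact: mulrC.
have ctl : continuous (fun y => tent n z y * l u y) by exact: continuous_mul.
have lo : mass n z * (l u z - e) <= occ n u z f.
  by rewrite occ_lt// -cintK; apply: cint_le => // y _; case/andP: (key y).
have hi : occ n u z f <= mass n z * (l u z + e).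
  by rewrite occ_lt// -cintK; apply: cint_le => // y _; case/andP: (key y).
by rewrite ler_distlC ler_pdivlMr// ler_pdivrMr// ![_ * mass n z]mulrC lo hi.
Unshelve. all: by end_near. Qed.

Lemma continuous_tentf n z : continuous (fun s => tent n z (f s)).
Proof. by apply: continuous_compo => //; exact: continuous_tent. Qed.

Lemma lt_mono (u v z : R) : 0 <= u -> u <= v -> l u z <= l v z.
Proof.
move=> u0 uv; have v0 := le_trans u0 uv.
apply: (ler_cvg_to (@lt_approx u z u0) (@lt_approx v z v0)).
apply: nearW => n; rewrite ler_pM2r ?invr_gt0 ?mass_gt0//.
rewrite /occ (cint_chasles (@continuous_tentf n z) u0 uv) lerDl.
by apply: cint_ge0 => s _; exact: tent_ge0.
Qed.

Lemma lt_at0 z : l 0 z = 0.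
Proof.
have h := @lt_approx 0 z (lexx (0 : R)).
have e : (fun n => occ n 0 z f / mass n z) = (fun=> 0).
  by apply/funext => n; rewrite /occ /cint set_itv1 Rintegral_set1 mul0r.
move: h; rewrite e => h; apply: (cvg_unique (@Rhausdorff R) h); exact: cvg_cst.
Qed.

Lemma lt_ge0 (u z : R) : 0 <= u -> 0 <= l u z.
Proof. by move=> u0; rewrite -(lt_at0 z) lt_mono. Qed.

Lemma lt_away (u v z e : R) : 0 <= u -> u <= v -> 0 < e ->
  (forall s, u <= s <= v -> e <= `|f s - z|) -> l u z = l v z.
Proof.
move=> u0 uv e0 h; have v0 := le_trans u0 uv.
have hu := @lt_approx u z u0; have hv := @lt_approx v z v0.
apply: (cvg_unique _ hu); first exact: Rhausdorff.
apply: cvg_trans hv; apply: near_eq_cvg; near=> n.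
congr (_ / _); rewrite /occ (cint_chasles (@continuous_tentf n z) u0 uv).
rewrite (@eq_cint _ _ (fun=> 0) u v) ?cint_cst// ?mul0r ?addr0// => s us.
apply: tent_out; apply: le_trans (h s us); apply: ltW.
by near: n; exact: inv_small.
Unshelve. all: by end_near. Qed.

Lemma lt_away0 (v z e : R) : 0 <= v -> 0 < e ->
  (forall s, 0 <= s <= v -> e <= `|f s - z|) -> l v z = 0.
Proof. by move=> v0 e0 h; rewrite -(@lt_away 0 v z e) ?lt_at0. Qed.

(** For z > c the path stays away from z. The boundary case z = c follows from continuity in
    space. *)
Lemma lt_above (v z c : R) : 0 <= v -> c <= z -> (forall s, 0 <= s <= v -> f s <= c) -> l v z = 0.
Proof.
move=> v0; rewrite le_eqVlt => /predU1P[<-|cz] h; last first.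
  apply: (@lt_away0 _ _ (z - c)) => // [|s sv]; first by rewrite subr_gt0.
  by rewrite distrC ger0_norm ?subr_ge0 ?(le_trans (h s sv) (ltW cz))// lerB// h.
apply/eqP; rewrite eq_le lt_ge0// andbT.
apply/ler_addgt0Pl => e e0; rewrite addr0.
have /cvgrPdist_le/(_ _ e0)/nbhs_ballP[d /= d0 dh] := @lt_continuous_z v v0 c.
have := dh (c + d / 2); rewrite /ball/= opprD addrA subrr sub0r normrN.
rewrite gtr0_norm ?divr_gt0//.
have -> : l v (c + d / 2) = 0.
  apply: (@lt_away0 _ _ (d / 2)) => // [|s sv]; first by rewrite divr_gt0.
  have := h s sv; rewrite distrC => hs; rewrite ger0_norm; lra.
by rewrite subr0 => /(_ _)/(le_trans (ler_norm _)); apply; lra.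
Qed.

End one_path.

Lemma is_derive_affine (a b x : R) : is_derive x (1 : R) (fun x => a + b * x) b.
Proof.
have h : is_derive x (1 : R) (cst a + (b *: id) : R -> R) (0 + b *: 1).
  by apply: is_deriveD.
by move: h; rewrite add0r /GRing.scale/= mulr1.
Qed.

(** After a restart at tau and a scaling by lam in space and lam^2 in time, occupation integrals are
    divided by lam^2 and lengths by lam, hence local times by lam. *)
Lemma lt_aff (f : env_path R) l lam tau : is_lt f l -> 0 < lam -> 0 <= tau ->
  is_lt (aff lam tau f) (fun v z =>
    lam^-1 * (l (tau + lam ^+ 2 * v) (f tau + lam * z) - l tau (f tau + lam * z))).
Proof.
move=> fl lam0 tau0.
have lam2 : 0 < lam ^+ 2 by rewrite exprn_gt0.
have cf := @env_continuous R f.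
split.
  have h u : 0 <= u -> Num.max 0 u = u by move=> ?; apply/max_idPr.
  have cz : continuous (fun p : R * R => f tau + lam * p.2).
    apply: (continuous_compo (g := fun z => f tau + lam * z)); first exact: continuous_snd.
    exact: continuous_affine.
  have c1 : continuous (fun p : R * R => l (Num.max 0 (tau + lam ^+ 2 * Num.max 0 p.1)) (f tau + lam * p.2)).
    apply: (continuous_compo (f := fun p : R * R => (tau + lam ^+ 2 * Num.max 0 p.1, f tau + lam * p.2))
      (g := fun p : R * R => l (Num.max 0 p.1) p.2)); last exact: fl.1.
    apply: continuous_pairing => //.
    apply: (continuous_compo (g := fun z => tau + lam ^+ 2 * z)); last exact: continuous_affine.
    by apply: continuous_compo; [exact: continuous_fst|exact: continuous_max0].
  have c2 : continuous (fun p : R * R => l tau (f tau + lam * p.2)).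
    by apply: continuous_compo; [exact: cz|exact: lt_continuous_z fl _ tau0].
  move=> p; apply: cvgM; first exact: cvg_cst.
  apply: cvgB; last exact: c2.
  have E : (fun p : R * R => l (Num.max 0 (tau + lam ^+ 2 * Num.max 0 p.1)) (f tau + lam * p.2)) =
    (fun p : R * R => l (tau + lam ^+ 2 * Num.max 0 p.1) (f tau + lam * p.2)).
    by apply/funext => q; rewrite h// addr_ge0// mulr_ge0 ?sqr_ge0// le_max lexx.
  by have := c1 p; rewrite E.
move=> v M phi v0 M0 cphi phi0.
pose psi y := phi (lam^-1 * (y - f tau)).
have cpsi : continuous psi.
  apply: continuous_compo => // y; apply: cvgM; first exact: cvg_cst.
  by apply: cvgB; [exact: cvg_id|exact: cvg_cst].
(* A bound for the support of [psi]. In the variable of [phi] the resulting interval contains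
   [- M, M], and [cint_shrink] removes the excess. *)
pose M' := `|f tau| + lam * M.
have M'0 : 0 <= M' by rewrite addr_ge0// mulr_ge0// ltW.
have psi0 y : M' <= `|y| -> psi y = 0.
  move=> yM; apply: phi0; rewrite normrM gtr0_norm ?invr_gt0// ler_pdivlMl//.
  have := ler_normD (y - f tau) (f tau); rewrite subrK => h.
  by move: yM; rewrite /M' => yM; lra.
pose T := tau + lam ^+ 2 * v.
have tauT : tau <= T by rewrite lerDl mulr_ge0// ltW.
have T0 : 0 <= T := le_trans tau0 tauT.
have cpf : continuous (psi \o f) by move=> y; apply: continuous_comp; [exact: cf|exact: cpsi].
have e1 : cint 0 v (phi \o aff lam tau f) = lam ^- 2 * cint tau T (psi \o f).
  have := cint_subst (F := fun s => tau + lam ^+ 2 * s) (f := fun=> lam ^+ 2) (g := psi \o f)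
    (@continuous_cstR _) cpf (is_derive_affine tau (lam ^+ 2)) v0.
  rewrite mulr0 addr0 => /(_ tauT) <-.
  have -> : cint 0 v (fun x => (psi \o f) (tau + lam ^+ 2 * x) * lam ^+ 2) =
     lam ^+ 2 * cint 0 v (phi \o aff lam tau f).
    rewrite -cintZ; last first.
      by move=> y; apply: continuous_comp; [exact: env_continuous|exact: cphi].
    by apply: eq_cint => s _; rewrite mulrC.
  by rewrite mulrA mulVf ?mul1r// gt_eqF.
pose dl y := l T y - l tau y.
have cdl : continuous dl.
  by move=> y; apply: cvgB; [exact: (lt_continuous_z fl T0)|exact: (lt_continuous_z fl tau0)].
have cpl t : 0 <= t -> continuous (fun y => psi y * l t y).
  by move=> t0; apply: continuous_mul => //; exact: (lt_continuous_z fl t0).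
have e2 : cint tau T (psi \o f) = cint (- M') M' (fun y => psi y * dl y).
  have eT := fl.2 T M' psi T0 M'0 cpsi psi0.
  have et := fl.2 tau M' psi tau0 M'0 cpsi psi0.
  have := cint_chasles cpf tau0 tauT; rewrite eT et => h.
  have -> : cint (- M') M' (fun y => psi y * dl y) =
     cint (- M') M' (fun y => psi y * l T y) - cint (- M') M' (fun y => psi y * l tau y).
    rewrite /cint -RintegralB//; last 2 first.
    - by apply: cont_integrable; exact: cpl.
    - by apply: cont_integrable; exact: cpl.
    by apply: eq_Rintegral => y _; rewrite mulrBr.
  by rewrite h addrC addKr.
pose F z := f tau + lam * z.
have F1 : F (lam^-1 * (- M' - f tau)) = - M'.
  by rewrite /F mulrA divff ?gt_eqF// mul1r addrC subrK.
have F2 : F (lam^-1 * (M' - f tau)) = M'.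
  by rewrite /F mulrA divff ?gt_eqF// mul1r addrC subrK.
have z1 : lam^-1 * (- M' - f tau) <= - M.
  rewrite ler_pdivrMl// mulrN /M'; have := ler_norm (- f tau); rewrite normrN; lra.
have z2 : M <= lam^-1 * (M' - f tau).
  rewrite ler_pdivlMl// /M'; have := ler_norm (f tau); lra.
have MM : - M <= M by lra.
have z12 := le_trans (le_trans z1 MM) z2.
have cpd : continuous (fun y => psi y * dl y) by exact: continuous_mul.
have FF : F (lam^-1 * (- M' - f tau)) <= F (lam^-1 * (M' - f tau)) by rewrite F1 F2; lra.
have := cint_subst (F := F) (f := fun=> lam) (@continuous_cstR _) cpd
  (is_derive_affine (f tau) lam) z12 FF.
rewrite F1 F2 => e3; rewrite e1 e2 -e3.
have psiF z : psi (F z) = phi z.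
  by rewrite /psi /F addrC addKr mulrA mulVf ?mul1r// gt_eqF.
have cdF : continuous (fun z => dl (F z)).
  by apply: continuous_compo => //; exact: continuous_affine.
have cint1 : cint (lam^-1 * (- M' - f tau)) (lam^-1 * (M' - f tau)) (fun x => psi (F x) * dl (F x) * lam) =
    cint (- M) M (fun x => psi (F x) * dl (F x) * lam).
  apply: cint_shrink => //.
  - apply: continuous_mul; last exact: continuous_cstR.
    by apply: continuous_mul => //; apply: continuous_compo => //; exact: continuous_affine.
  - move=> x /andP[_ xM]; rewrite psiF phi0 ?mul0r//.
    by rewrite ler0_norm; lra.
  - move=> x /andP[xM _]; rewrite psiF phi0 ?mul0r//.
    by rewrite ger0_norm; lra.
rewrite cint1 -cintZ; last first.
  apply: continuous_mul; last exact: continuous_cstR.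
  by apply: continuous_mul => //; apply: continuous_compo => //; exact: continuous_affine.
apply: eq_cint => z _; rewrite psiF /dl /F -/T.
by field; rewrite gt_eqF.
Qed.

End local_time_facts.

(** * Recurrence of the Brownian local time *)

Section parametric_integrals.
Context {R : realType} d (T : measurableType d).
Local Notation leb := (@lebesgue_measure R).

Lemma measurable_param_Rintegral (g : T * measurableTypeR R -> R) (D : set (T * measurableTypeR R)) :
  measurable D -> measurable_fun setT g -> (forall p, 0 <= g p) ->
  measurable_fun setT (fun w => \int[leb]_(x in [set x | D (w, x)]) g (w, x)).
Proof.
move=> mD mg g0; rewrite /Rintegral.
pose h := (EFin \o g) \_ D.
have mh : measurable_fun setT h.
  apply/(measurable_restrictT _ mD); apply: measurable_funTS.
  by apply: measurableT_comp mg.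
have h0 p : (0 <= h p)%E.
  by rewrite /h patchE; case: ifPn => // _; rewrite lee_fin.
rewrite (_ : (fun w => _) = fine \o (fubini_F leb h)); last first.
  apply/funext => w /=; congr fine; rewrite /fubini_F [LHS]integral_mkcond.
  apply: eq_integral => x _; rewrite /h !patchE.
  by congr (if _ then _ else _); apply/idP/idP; rewrite !inE.
by apply: measurableT_comp => //; exact: measurable_fun_fubini_tonelli_F.
Qed.

End parametric_integrals.

Lemma prob_setDC0 (R : realType) d (T : measurableType d) (P : probability T R) (A B : set T) :
  measurable A -> measurable B -> P (~` A `&` B) = 0%E -> P A = P B ->
  P (A `&` ~` B) = 0%E.
Proof.
move=> mA mB e0 eAB.
have mI : measurable (A `&` B) by exact: measurableI.
have eB : (P B = P (A `&` B))%E.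
  rewrite -{1}(setTI B) -(setUv A) setIUl measureU//; last 2 first.
  - by apply: measurableI => //; exact: measurableC.
  - by rewrite setIACA setICr set0I.
  by apply: etrans (congr1 (adde _) e0) _; exact: adde0.
rewrite -setDE measureD//; last by rewrite (le_lt_trans (probability_le1 _ _))// ltry.
apply: etrans (congr1 (fun x => x - P (A `&` B))%E (etrans eAB eB)) _.
apply: subee; rewrite ge0_fin_numE; last exact: measure_ge0.
exact: le_lt_trans (probability_le1 _ mI) (ltry _).
Qed.

(* Q has full outer measure. Having a local time is an almost sure property of
   B in omega R that is not known to be measurable, so that it does not become
   an almost sure property under the law of the path, but it becomes thick. *)
Definition thick (R : realType) d (T : measurableType d) (P : set T -> \bar R)
    (Q : T -> Prop) : Prop :=
  forall M, measurable M -> (forall x, Q x -> M x) -> P M = 1%E.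

Section thick_sets.
Context {R : realType} d (T : measurableType d).
Variables (P : probability T R) (Q K : T -> Prop).
Hypothesis tQ : thick P Q.
Hypothesis aK : {ae P, forall x, K x}.

(** K holds off a null set N, so that the union of M and N contains Q and thickness applies. In this
    way, almost sure statements are proved by arguing on a path that has a local time. *)
Lemma thick_ae (M : set T) : measurable M -> (forall x, Q x -> K x -> M x) ->
  {ae P, forall x, M x}.
Proof.
move=> mM h; have [N [mN N0 KN]] := aK.
have mMN : measurable (M `|` N) by exact: measurableU.
have : P (M `|` N) = 1%E.
  apply: tQ => // x Qx; have [Nx|Nx] := pselect (N x); first by right.
  by left; apply: h => //; apply: contrapT => nK; apply: Nx; exact: KN.
move=> /(prob1_ae mMN) h1; have h2 := prob0_ae mN N0.
by apply: ae_imp (ae_and h1 h2) => x [[]].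
Qed.

Lemma thick_ae_imp (A B : set T) : measurable A -> measurable B ->
  (forall x, Q x -> K x -> A x -> B x) -> {ae P, forall x, A x -> B x}.
Proof.
move=> mA mB h; apply: ae_imp (_ : {ae P, forall x, (~` A `|` B) x}).
  by move=> x [].
apply: thick_ae; first by apply: measurableU => //; exact: measurableC.
by move=> x Qx Kx; have [Ax|Ax] := pselect (A x); [right; exact: h|left].
Qed.

Lemma thick_ae_iff (A B : set T) : measurable A -> measurable B ->
  (forall x, Q x -> K x -> (A x <-> B x)) -> {ae P, forall x, A x <-> B x}.
Proof.
move=> mA mB h.
have h1 : {ae P, forall x, A x -> B x} by apply: thick_ae_imp => // x Qx Kx /(h x Qx Kx).
have h2 : {ae P, forall x, B x -> A x} by apply: thick_ae_imp => // x Qx Kx /(h x Qx Kx).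
by apply: ae_imp (ae_and h1 h2) => x [].
Qed.

End thick_sets.

Lemma thick_law d d' (T : measurableType d) (T' : measurableType d') (R : realType)
    (P : probability T R) (Y : T -> T') (mY : measurable_fun setT Y) (Q : T' -> Prop) :
  {ae P, forall x, Q (Y x)} -> thick (law P mY) Q.
Proof.
move=> h M mM QM; apply: (@ae_prob1 _ _ _ P).
  by have := mY measurableT _ mM; rewrite setTI.
by apply: ae_imp h => x; exact: QM.
Qed.

Section local_time_functional.
Context {R : realType}.
Local Notation half := (half_line R).

Lemma lee_eq (x y : \bar R) : x = y -> (x <= y)%E. Proof. by move=> ->. Qed.

Lemma measurable_occ n (u z : R) :
  measurable_fun setT (fun f : pathD half => occ n u z (env_fun f)).
Proof.
pose D : set (pathD half * measurableTypeR R) := setT `*` `[0, u]%classic.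
pose g (p : pathD half * measurableTypeR R) := tent n z (env_fun p.1 (Num.max 0 p.2)).
have mD : measurable D by apply: measurableX => //; exact: measurable_itv.
have mg : measurable_fun setT g.
  apply: (measurableT_comp (f := tent n z)); last exact: measurable_joint.
  by apply: continuous_measurable_fun; exact: continuous_tent.
have := measurable_param_Rintegral mD mg (fun p => tent_ge0 _ _ _).
congr measurable_fun; apply/funext => f; rewrite /occ /cint.
rewrite (_ : [set x | D (f, x)] = `[0, u]%classic); last first.
  by apply/seteqP; split=> x; rewrite /D/=; [case|].
apply: eq_Rintegral => x; rewrite inE/= in_itv/= => /andP[x0 _].
by rewrite /g/= (max_idPr x0).
Qed.

(** A functional defined and measurable on all paths, equal to the local time of those that have
    one. The upper limit exists without any convergence. *)
Definition lhat (u z : R) (f : R -> R) : R :=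
  fine (limn_esup (fun n => (occ n u z f / mass n z)%:E)).

Lemma measurable_lhat u z : measurable_fun setT (fun f : pathD half => lhat u z (env_fun f)).
Proof.
apply: (measurableT_comp (f := fine)) => //.
apply: measurable_fun_limn_esup => n; apply: measurableT_comp => //.
by apply: measurable_funM => //; exact: measurable_occ.
Qed.

Lemma lhatE f l u z : is_lt f l -> 0 <= u -> lhat u z f = l u z.
Proof.
move=> fl u0; have h := @lt_approx R f l fl u z u0.
have h' : (occ n u z f / mass n z)%:E @[n --> \oo] --> (l u z)%:E.
  by apply: cvg_EFin => //; apply: nearW.
by rewrite /lhat is_cvg_limn_esupE; [rewrite (cvg_lim _ h')|apply/cvg_ex; exists (l u z)%:E].
Qed.

(** Integer times keep the event measurable; the other times follow by monotonicity. *)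
Definition lt_bounded (c z : R) : set (env_path R) := [set f | forall n : nat, lhat n%:R z f <= c].

Lemma measurable_lt_bounded c z : measurable (lt_bounded c z : set (pathD half)).
Proof.
rewrite (_ : lt_bounded c z = \bigcap_n [set f : env_path R | lhat n%:R z f <= c]).
  by apply: bigcap_measurable => // n _; apply: measurable_ray; exact: measurable_lhat.
by apply/seteqP; split=> f h; [move=> n _; exact: h|move=> n; exact: h].
Qed.

Lemma lt_boundedE (f : env_path R) l c z : is_lt f l ->
  lt_bounded c z f <-> forall u, 0 <= u -> l u z <= c.
Proof.
move=> fl; split=> h; last by move=> n; rewrite (lhatE _ fl)//; exact: h.
move=> u u0; apply: le_trans (h (Num.truncn u).+1); rewrite (lhatE _ fl)//.
apply: (lt_mono (@env_continuous _ f) fl) => //.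
exact/ltW/truncnS_gt.
Qed.

Lemma lt_bounded_scale (f : env_path R) l c k z : is_lt f l -> 0 < k ->
  lt_bounded c z (aff k 0 f) <-> lt_bounded (k * c) (k * z) f.
Proof.
move=> fl k0; rewrite (lt_boundedE _ _ (lt_aff fl k0 (lexx 0))) (lt_boundedE _ _ fl).
have e v : l (0 + k ^+ 2 * v) (f 0 + k * z) - l 0 (f 0 + k * z) = l (k ^+ 2 * v) (k * z).
  by rewrite env_at0 !add0r (lt_at0 fl) subr0.
split=> h u u0; last first.
  by rewrite e ler_pdivrMl//; apply: h; rewrite mulr_ge0// sqr_ge0.
have u0' : 0 <= u / k ^+ 2 by rewrite divr_ge0// sqr_ge0.
have := h _ u0'; rewrite e ler_pdivrMl// mulrCA divff ?mulr1//.
by rewrite expf_neq0// gt_eqF.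
Qed.

Lemma lt_at_hit (f : env_path R) l z : is_lt f l -> 0 <= z -> hits z f -> l (hit z f) z = 0.
Proof.
move=> fl z0 fz; apply: (lt_above (@env_continuous _ f) fl (hit_ge0 fz) (lexx z)).
move=> s /andP[s0]; rewrite le_eqVlt => /predU1P[->|sh]; first by rewrite hitE.
by apply: ltW; exact: lt_hit.
Qed.

(** No local time accumulates at z before z is hit. *)
Lemma lt_bounded_post (f : env_path R) l c z : is_lt f l -> 0 <= z -> hits z f ->
  lt_bounded c 0 (post z 1 f) <-> lt_bounded c z f.
Proof.
move=> fl z0 fz; have t0 := hit_ge0 fz.
rewrite (lt_boundedE _ _ (lt_aff fl ltr01 t0)) (lt_boundedE _ _ fl).
have e v : 1^-1 * (l (hit z f + 1 ^+ 2 * v) (f (hit z f) + 1 * 0) - l (hit z f) (f (hit z f) + 1 * 0)) =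
    l (hit z f + v) z.
  by rewrite expr1n invr1 !mul1r addr0 hitE// lt_at_hit// subr0.
split=> h u u0; last by rewrite e; apply: h; rewrite addr_ge0.
apply: le_trans (h u u0); rewrite e; apply: (lt_mono (@env_continuous _ f) fl) => //.
by rewrite lerDr.
Qed.

Section recurrence.
Variable P : probability (pathD half) R.
Hypothesis wP : wiener P.
Hypothesis hlt : thick P (fun f : pathD half => exists l, is_lt (env_fun f) l).
Let aT : {ae P, forall f : pathD half, True}. Proof. exact: aeW. Qed.

Let prob_scale c k z : 0 < k -> P (lt_bounded c z) = P (lt_bounded (k * c) (k * z)).
Proof.
move=> k0; have kn0 : k != 0 by rewrite gt_eqF.
have mS := measurable_scale k.
apply: etrans (esym (wiener_scale wP kn0 (measurable_lt_bounded c z))) _.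
apply: prob_ae_eq.
- by have := mS measurableT _ (measurable_lt_bounded c z); rewrite setTI.
- exact: measurable_lt_bounded.
apply: (thick_ae_iff hlt aT).
- by have := mS measurableT _ (measurable_lt_bounded c z); rewrite setTI.
- exact: measurable_lt_bounded.
- by move=> f [l fl] _; exact: lt_bounded_scale fl k0.
Qed.

Let prob_post c z : 0 <= z -> P (lt_bounded c z) = P (lt_bounded c 0).
Proof.
move=> z0.
apply: etrans (strong_markov wP (prob_hits wP z) (oner_neq0 R) (measurable_lt_bounded c 0)).
apply: prob_ae_eq.
- exact: measurable_lt_bounded.
- by have := @measurable_post R z 1 measurableT _ (measurable_lt_bounded c 0); rewrite setTI.
apply: (thick_ae_iff hlt (ae_hits wP)).
- exact: measurable_lt_bounded.
- by have := @measurable_post R z 1 measurableT _ (measurable_lt_bounded c 0); rewrite setTI.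
move=> f [l fl] fh; exact: iff_sym (lt_bounded_post c fl z0 (fh z)).
Qed.

Let A z := lt_bounded 0 z : set (pathD half).
Let mA z : measurable (A z). Proof. exact: measurable_lt_bounded. Qed.

(** The event that the local time vanishes forever at z but not at 0 is scale invariant. *)
Let prob_diff z z' : 0 < z -> 0 < z' -> P (~` A 0 `&` A z) = P (~` A 0 `&` A z').
Proof.
move=> z0 z'0.
have [k k0 kz] : exists2 k, 0 < k & k * z' = z.
  by exists (z / z'); [rewrite divr_gt0|rewrite divfK// gt_eqF].
have kn0 : k != 0 by rewrite gt_eqF.
have mD y : measurable (~` A 0 `&` A y) by apply: measurableI; [exact: measurableC|exact: mA].
apply: esym; apply: etrans (esym (wiener_scale wP kn0 (mD z'))) _.
apply: prob_ae_eq; [|exact: mD|].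
  by have := @measurable_scale R k measurableT _ (mD z'); rewrite setTI.
apply: (thick_ae_iff hlt aT); [|exact: mD|].
  by have := @measurable_scale R k measurableT _ (mD z'); rewrite setTI.
move=> f [l fl] _.
have e0 := lt_bounded_scale 0 0 fl k0; have e1 := lt_bounded_scale 0 z' fl k0.
rewrite (mulr0 k) in e0; rewrite (mulr0 k) kz in e1.
split=> -[h0 h1]; split.
- by move=> h; apply: h0; exact: e0.2 h.
- exact: e1.1 h1.
- by move=> h; apply: h0; exact: e0.1 h.
- exact: e1.2 h1.
Qed.

Let inv_n (n : nat) : 0 < (n.+1%:R^-1 : R). Proof. by rewrite invr_gt0. Qed.

(** The events for z = 1 / (n + 1) all have the same probability. On their upper limit the local
    time vanishes along a sequence tending to 0, hence at 0 by continuity, which these events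
    exclude. *)
Let prob_diff0 z : 0 < z -> P (~` A 0 `&` A z) = 0%E.
Proof.
move=> z0; apply/eqP; rewrite eq_le measure_ge0 andbT.
pose F n := ~` A 0 `&` A (n.+1%:R^-1).
have mF n : measurable (F n) by apply: measurableI; [exact: measurableC|].
have mL : measurable (lim_sup_set F).
  by apply: bigcap_measurable => // n _; exact: bigcup_measurable.
have : (P (~` A 0 `&` A z) <= P (lim_sup_set F))%E.
  apply: (prob_limsup_ge mF) => n.
  exact: (lee_eq (prob_diff z0 (inv_n n))).
suff -> : P (lim_sup_set F) = 0%E by [].
apply: ae_prob0 => //; apply: (thick_ae hlt aT (measurableC mL)) => f [l fl] _ h.
have n0 : ~ A 0 f by have [n _ [nA _]] := h 0%N I; exact nA.
apply: n0; apply/(lt_boundedE _ _ fl) => u u0.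
rewrite leNgt; apply/negP => lu.
have /cvgrPdist_lt/(_ _ lu)/nbhs_ballP[e /= e0 eh] := @lt_continuous_z R f l fl u u0 (0 : R).
have [N _ NP] := inv_small e0.
have [n /= Nn [_ An]] := h N I.
have nb : `|0 - n.+1%:R^-1| < e by rewrite sub0r normrN gtr0_norm//; exact: NP.
have := eh _ nb; have := (lt_boundedE 0 _ fl).1 An u u0 => l0.
by rewrite ger0_norm; lra.
Qed.

(** The strong Markov property at the hitting time of z gives vanishing at z and vanishing at 0
    equal probabilities. With [prob_diff0], if the local time vanishes at 0 it vanishes at all
    positive rationals, hence at all points between 1/4 and 1. But the path spends time near 1/2
    before it hits 1. *)
Lemma ae_zero_local_time : {ae P, forall f, ~ lt_bounded 0 0 f}.
Proof.
have key : {ae P, forall f, forall q : rat, 0 < (ratr q : R) -> A 0 f -> A (ratr q) f}.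
  apply: (ae_all_count (Q := fun (q : rat) f => 0 < (ratr q : R) -> A 0 f -> A (ratr q) f)) => q.
  have [q0|q0] := ltP 0 (ratr q : R); last by apply: aeW => f h; discriminate h.
  apply: ae_imp (_ : {ae P, forall f, ~ (A 0 `&` ~` A (ratr q)) f}).
    move=> f h _ A0; apply: contrapT => nA; apply h; split; [exact A0|exact nA].
  apply: prob0_ae; first by apply: measurableI; [exact: mA|apply: measurableC; exact: mA].
  apply: (prob_setDC0 (mA 0) (mA (ratr q))); first exact: prob_diff0 q0.
  by have e := prob_post 0 (ltW q0); exact: esym e.
apply: (thick_ae hlt (ae_and key (ae_hits wP)) (measurableC (mA 0))) => f [l fl] [Aq fh] A0.
have cf := @env_continuous _ f.
pose t := hit 1 f.
have t0 : 0 <= t by exact: hit_ge0'.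
have f1 : f t = 1 by rewrite /t hitE.
have ltz z : 1 / 4 < z -> z < 1 -> l t z = 0.
  move=> z1 z2; apply/eqP; rewrite eq_le (lt_ge0 cf fl _ t0) andbT leNgt.
  apply/negP => lz.
  have /cvgrPdist_lt/(_ _ lz)/nbhs_ballP[e /= e0 eh] := @lt_continuous_z R f l fl t t0 z.
  have [q] : exists q : rat, z < ratr q < z + e.
    by have [q] := @rat_in_itvoo R z (z + e) (ltac:(lra)); rewrite in_itv/= => qz; exists q.
  move=> /andP[q1 q2].
  have q0 : 0 < (ratr q : R) by lra.
  have nb : `|z - ratr q| < e by rewrite ltr0_norm; lra.
  have := eh _ nb; have := (lt_boundedE 0 _ fl).1 (Aq q q0 A0) t t0.
  by move=> lq; rewrite ger0_norm; lra.
have [s /andP[s0 st] fs] : exists2 s, 0 <= s <= t & f s = 1 / 2.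
  have c : {within `[0, t], continuous (env_fun f)} by exact: continuous_subspaceT.
  have h : Num.min (f 0) (f t) <= 1 / 2 <= Num.max (f 0) (f t).
    by rewrite env_at0 f1 min_l ?max_r//; apply/andP; split; lra.
  by have [s] := IVT t0 c h; rewrite in_itv/= => st fs; exists s.
have s0' : 0 < s.
  by rewrite lt_neqAle s0 andbT; apply/eqP => s00; move: fs; rewrite -s00 env_at0; lra.
have st' : s < t.
  by rewrite lt_neqAle st andbT; apply/eqP => s00; move: fs; rewrite s00 f1; lra.
(* [tent 3] at 1/2 is supported by [1/4, 3/4], where the local time vanishes. *)
have : 0 < occ 3 t (1 / 2) f.
  apply: (@cint_gt _ _ _ _ s); [exact: continuous_tentf|by move=> *; exact: tent_ge0| |].
  - by rewrite s0'.
  - by rewrite fs tent_center.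
rewrite (occ_lt fl)// (@eq_cint _ _ (fun=> 0)); last first.
  move=> y _; have [h|h] := leP (3.+1%:R^-1) `|y - 1 / 2|; first by rewrite tent_out// mul0r.
  by move: h; rewrite ltr_norml => /andP[h1 h2]; rewrite ltz ?mulr0//; lra.
by rewrite cint_cst ?mul0r ?ltxx//; have := normr_ge0 (1 / 2 : R); lra.
Qed.

(** By scaling the probability does not depend on c > 0; c tends to 0. *)
Lemma ae_local_time_unbounded c : 0 < c -> {ae P, forall f, ~ lt_bounded c 0 f}.
Proof.
move=> c0; apply: prob0_ae; first exact: measurable_lt_bounded.
apply/eqP; rewrite eq_le measure_ge0 andbT.
pose F (n : nat) := lt_bounded n.+1%:R^-1 0 : set (pathD half).
have mF n : measurable (F n) by exact: measurable_lt_bounded.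
have : (P (lt_bounded c 0) <= P (\bigcap_n F n))%E.
  apply: prob_bigcap_ge => //.
    move=> m n mn f h k; apply: le_trans (h k) _.
    by rewrite lef_pV2 ?posrE// ler_nat.
  move=> n; have k0 : 0 < n.+1%:R^-1 / c by rewrite divr_gt0.
  have := prob_scale c 0 k0; rewrite mulr0 divfK ?gt_eqF// => e.
  by rewrite /F -e.
suff -> : P (\bigcap_n F n) = 0%E by [].
apply: ae_prob0; first exact: bigcap_measurable.
apply: ae_imp ae_zero_local_time => f nA h; apply: nA => k.
apply/ler_addgt0Pl => e e0; rewrite addr0.
have [n _ ne] := inv_small e0.
exact: le_trans (h n I k) (ltW (ne n (leqnn n))).
Qed.

End recurrence.

(* Time V is long enough for the local time at 0 to exceed 2, and the local time
   is nearly constant in space at distance 1 / (N + 1) from 0. *)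
Definition good_lt (V : R) (N : nat) (delta : R) (f : R -> R) (l : R -> R -> R) : Prop :=
  [/\ exists2 u, 0 <= u <= V & 1 <= f u,
      forall v, 0 <= v <= V -> `|f v| <= N%:R,
      forall z, l V z <= N%:R,
      2 <= l V 0 &
      forall v, 0 <= v <= V -> forall z, - N.+1%:R^-1 <= z <= N.+1%:R^-1 -> `|l v z - l v 0| <= delta].

(** The measurable form of [good_lt], with [lhat] for the local time and clamped rationals for the
    points; [goodE] relates the two on paths that have a local time. *)
Definition good (V : R) (N : nat) (delta : R) : set (env_path R) :=
  reaches 1 V `&` (\bigcap_(q : rat) [set f : env_path R | `|f (clamp 0 V (ratr q))| <= N%:R]) `&`
  (\bigcap_(q : rat) [set f : env_path R | lhat V (ratr q) f <= N%:R]) `&`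
  [set f : env_path R | - lhat V 0 f <= - 2] `&`
  (\bigcap_(q : rat) \bigcap_(q' : rat) [set f : env_path R |
    `|lhat (clamp 0 V (ratr q)) (clamp (- N.+1%:R^-1) N.+1%:R^-1 (ratr q')) f
      - lhat (clamp 0 V (ratr q)) 0 f| <= delta]).

Lemma measurable_good V N delta : 0 <= V -> measurable (good V N delta : set (pathD half)).
Proof.
move=> V0; repeat apply: measurableI.
- exact: measurable_reaches_half.
- apply: bigcapT_measurable_rat => q; apply: measurable_ray; apply: measurableT_comp => //.
  apply: measurable_coord; apply: ge0_half_line.
  by have /andP[] := clamp_itv (ratr q) V0.
- by apply: bigcapT_measurable_rat => q; apply: measurable_ray; exact: measurable_lhat.
- by apply: measurable_ray; apply: measurableT_comp => //; exact: measurable_lhat.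
- apply: bigcapT_measurable_rat => q; apply: bigcapT_measurable_rat => q'.
  apply: measurable_ray; apply: measurableT_comp => //.
  by apply: measurable_funB; exact: measurable_lhat.
Qed.

Lemma continuous_normB (g : R -> R) k : continuous g -> continuous (fun x => `|g x - k|).
Proof.
move=> cg x; apply: cvg_norm; apply: cvgB; [exact: cg|exact: cvg_cst].
Qed.

Lemma continuous_lt_diff f l z : is_lt f l ->
  continuous (fun v : R => `|l (Num.max 0 v) z - l (Num.max 0 v) 0|).
Proof.
move=> fl; have c y : continuous (fun v : R => l (Num.max 0 v) y).
  apply: (continuous_compo (f := fun v : R => (v, y)) (g := fun p : R * R => l (Num.max 0 p.1) p.2)).
    by apply: continuous_pairing => v; [exact: cvg_id|exact: cvg_cst].
  exact: fl.1.
by move=> v; apply: cvg_norm; apply: cvgB; exact: c.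
Qed.

Lemma goodE V N delta (f : env_path R) l : 0 <= V -> is_lt f l ->
  good V N delta f <-> good_lt V N delta f l.
Proof.
move=> V0 fl; have cf := @env_continuous _ f.
have cfn : continuous (fun x => `|f x|) by move=> x; apply: cvg_norm; exact: cf.
have NN : - N.+1%:R^-1 <= N.+1%:R^-1 :> R by rewrite ge0_cp// invr_ge0.
have cV q : 0 <= clamp 0 V (ratr q) by case/andP: (clamp_itv (ratr q) V0).
split=> [[[[[h1 h2] h3] h4] h5]|[h1 h2 h3 h4 h5]].
  split=> //.
  - by apply/(le_itv_rat _ cfn V0) => q; exact: h2.
  - apply: (@continuous_le_rat _ (l V)); first exact: (lt_continuous_z fl V0).
    by move=> q; have := h3 q I; rewrite /= (lhatE _ fl).
  - by move: h4; rewrite /= (lhatE _ fl)// lerN2.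
  move=> v vV z zN.
  have c1 (w : R) : 0 <= w -> continuous (fun z => `|l w z - l w 0|).
    by move=> w0; have cw := @lt_continuous_z R f l fl w w0; exact: continuous_normB cw.
  have h6 (q : rat) (y : R) : - N.+1%:R^-1 <= y <= N.+1%:R^-1 ->
      `|l (clamp 0 V (ratr q)) y - l (clamp 0 V (ratr q)) 0| <= delta.
    move: y; apply/(le_itv_rat _ (c1 _ (cV q)) NN) => q'.
    by have := h5 q I q' I; rewrite /= !(lhatE _ fl).
  have := (le_itv_rat delta (@continuous_lt_diff f l z fl) V0).2 _ v vV.
  have -> : Num.max 0 v = v by case/andP: vV => v0 _; apply/max_idPr.
  by apply=> q; rewrite (max_idPr (cV q)); exact: h6.
split; [split; [split; [split=> //|]|]|].
- by move=> q _; exact: (le_itv_rat _ cfn V0).1 h2 q.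
- by move=> q _; rewrite /= (lhatE _ fl).
- by rewrite /= (lhatE _ fl)// lerN2.
- move=> q _ q' _ /=; rewrite !(lhatE _ fl)//; apply: h5; exact: clamp_itv.
Qed.

Lemma good_ltS V N M delta f l : (N <= M)%N -> good_lt V N delta f l -> good_lt V M delta f l.
Proof.
move=> NM [h1 h2 h3 h4 h5]; have NM' : N%:R <= M%:R :> R by rewrite ler_nat.
have iNM : M.+1%:R^-1 <= N.+1%:R^-1 :> R by rewrite lef_pV2 ?posrE// ler_nat.
split=> //.
- by move=> v vV; exact: le_trans (h2 v vV) NM'.
- by move=> z; exact: le_trans (h3 z) NM'.
- move=> v vV z /andP[z1 z2]; apply: h5 => //.
  by rewrite (le_trans z2)// (le_trans _ z1)// lerN2.
Qed.

Lemma good_lt_exists V delta (f : env_path R) l : is_lt f l -> 0 <= V -> 0 < delta ->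
  reaches 1 V f -> 2 <= l V 0 -> exists N, good_lt V N delta f l.
Proof.
move=> fl V0 d0 r1 l2; have cf := @env_continuous _ f.
have cfn : continuous (fun x => `|f x|) by move=> x; apply: cvg_norm; exact: cf.
have [M M0 hM] : exists2 M : R, 0 <= M & forall y, 0 <= y <= V -> `|f y| <= M.
  by have [x1 _ hM] := EVT_max_cont cfn V0; exists `|f x1|.
have clV := lt_continuous_z fl V0.
have MM : - (M + 1) <= M + 1 by lra.
have [x2 _ hL] := EVT_max_cont clV MM.
have bL z : l V z <= Num.max 0 (l V x2).
  have [zM|zM] := leP `|z| (M + 1).
    by rewrite le_max hL ?orbT//; move: zM; rewrite ler_norml.
  rewrite (@lt_away0 R f l cf fl V z 1) ?le_max ?lexx// => s sV.
  have := hM s sV; have := ler_normD (z - f s) (f s); rewrite subrK distrC; lra.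
have cpt : compact `[0, V]%classic by exact: segment_compact.
(* [Num.max 0 v] gives a meaning to the property on a full neighbourhood of time 0, as the covering
   argument requires. *)
pose Q (N : nat) (v : R) := forall z : R, `|z| <= N.+1%:R^-1 ->
  `|l (Num.max 0 v) z - l (Num.max 0 v) 0| <= delta.
have : \forall N \near \oo, `[0, V]%classic `<=` Q N.
  move/compact_near_coveringP : cpt; apply => v _.
  have d2 : 0 < delta / 2 by rewrite divr_gt0.
  have /cvgrPdist_le/(_ _ d2)/nbhs_ballP[e /= e0 eh] := fl.1 (v, 0).
  have near1 : \forall v' \near v, ball v e v' by exact: nbhsx_ballx.
  near=> v' N => z zN /=.
  have bv : ball v e v' by near: v'.
  have Ne : N.+1%:R^-1 < e by near: N; exact: inv_small.
  have h y : `|y| < e -> `|l (Num.max 0 v) 0 - l (Num.max 0 v') y| <= delta / 2.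
    by move=> ye; apply: (eh (v', y)); split => //=; rewrite /ball/= sub0r normrN.
  have h0 := h 0; have hz := h z (le_lt_trans zN Ne).
  rewrite normr0 in h0; have := h0 e0; rewrite distrC => h0'.
  have := ler_normD (l (Num.max 0 v') z - l (Num.max 0 v) 0) (l (Num.max 0 v) 0 - l (Num.max 0 v') 0).
  rewrite addrA subrK => h3; rewrite distrC in hz; rewrite distrC in h0'.
  by lra.
move=> [N1 _ N1P].
exists (maxn N1 (maxn (Num.truncn M).+1 (Num.truncn (Num.max 0 (l V x2))).+1)).
set N := maxn _ _.
have NN1 : (N1 <= N)%N by exact: leq_maxl.
have NM : (Num.truncn M < N)%N by rewrite !leq_max leqnn orbT.
have NL : (Num.truncn (Num.max 0%R (l V x2)) < N)%N by rewrite !leq_max leqnn !orbT.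
split=> //.
- move=> v vV; rewrite (le_trans (hM v vV))// (le_trans (ltW (truncnS_gt M)))//.
  by rewrite ler_nat.
- move=> z; rewrite (le_trans (bL z))// (le_trans (ltW (truncnS_gt _)))//.
  by rewrite ler_nat.
- move=> v vV z zN; have := N1P N NN1 v; rewrite /= in_itv/= vV => /(_ isT z).
  have -> : Num.max 0 v = v by case/andP: vV => v0 _; apply/max_idPr.
  by apply; rewrite ler_norml.
Unshelve. all: by end_near. Qed.

(** By recurrence a long enough integer time works for almost every path, and for each such time
    some N does; both choices are made uniform up to small probability by monotone limits. *)
Lemma good_exists (P : probability (pathD half) R) delta eps : wiener P ->
  thick P (fun f : pathD half => exists l, is_lt (env_fun f) l) -> 0 < delta -> 0 < eps ->
  exists n N : nat, (1 - eps%:E <= P (good n%:R N delta))%E.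
Proof.
move=> wP hlt d0 e0; have aT : {ae P, forall f : pathD half, True} by exact: aeW.
pose G n N := good n%:R N delta : set (pathD half).
have mG n N : measurable (G n N) by exact: measurable_good.
apply: contrapT => /forallNP h0.
have h n N : (P (G n N) <= 1 - eps%:E)%E.
  have /forallNP/(_ N)/negP := h0 n; rewrite -ltNge => /ltW; exact.
pose D : set (pathD half) := \bigcup_N [set f | exists l, is_lt (env_fun f) l /\ exists n, good_lt n%:R N delta (env_fun f) l].
pose E n := reaches 1 n%:R `&` [set f : env_path R | - lhat n%:R 0 f <= - 2] : set (pathD half).
have mE n : measurable (E n).
  apply: measurableI; first exact: measurable_reaches_half.
  by apply: measurable_ray; apply: measurableT_comp => //; exact: measurable_lhat.
(* [G n N] increases with N on paths having a local time only. Finite unions increase everywhere,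
   with the same probabilities. *)
pose G' n (N : nat) := \bigcup_(k < N.+1) G n k.
have mG' n N : measurable (G' n N) by apply: bigcup_measurable.
have hE n : (P (E n) <= 1 - eps%:E)%E.
  have : (P (\bigcup_N G' n N) <= 1 - eps%:E)%E.
    apply: prob_bigcup_le => //.
      by move=> k m km f [i /= ik Gi]; exists i => //=; lia.
    move=> N; apply: le_trans (h n N).
    apply: prob_ae_le => //; apply: (thick_ae_imp hlt aT) => // f [l fl] _ [k /= kN].
    move=> /(goodE _ _ (ler0n _ _) fl) gk; apply/(goodE _ _ (ler0n _ _) fl).
    by apply: good_ltS gk; lia.
  apply: le_trans; apply: prob_ae_le => //; first exact: bigcup_measurable.
  apply: (thick_ae_imp hlt aT) => //; first exact: bigcup_measurable.
  move=> f [l fl] _ [r1]; rewrite /= (lhatE _ fl)// lerN2 => l2.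
  have [N gN] := good_lt_exists fl (ler0n _ n) d0 r1 l2.
  by exists N => //; exists N => //=; apply/(goodE _ _ (ler0n _ _) fl).
pose E' (N : nat) := \bigcup_(k < N.+1) E k.
have mE' N : measurable (E' N) by apply: bigcup_measurable.
have : (P (\bigcup_N E' N) <= 1 - eps%:E)%E.
  apply: prob_bigcup_le => //.
    by move=> k m km f [i /= ik Gi]; exists i => //=; lia.
  move=> N; apply: le_trans (hE N).
  apply: prob_ae_le => //; apply: (thick_ae_imp hlt aT) => // f [l fl] _ [k /= kN] [[u /andP[u0 uk] fu]].
  have kN' : k%:R <= N%:R :> R by rewrite ler_nat; lia.
  rewrite /= (lhatE _ fl)// lerN2 => l2; split; first by exists u => //; rewrite u0 (le_trans uk).
  rewrite /= (lhatE _ fl)// lerN2 (le_trans l2)//.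
  by apply: (lt_mono (@env_continuous _ f) fl).
have -> : P (\bigcup_N E' N) = 1%E.
  apply: ae_prob1; first exact: bigcup_measurable.
  have mU : measurable (\bigcup_N E' N) by exact: bigcup_measurable.
  apply: (thick_ae hlt (ae_and (ae_local_time_unbounded wP hlt (ltr0Sn _ 1)) (ae_hits wP)) mU).
  move=> f [l fl] [nb fh].
  have /existsNP[n /negP] := nb; rewrite -ltNge (lhatE _ fl)// => l2.
  pose m := maxn n (Num.truncn (hit 1 f)).+1.
  exists m => //; exists m => //=; split.
    apply/hit_reaches => //; rewrite (le_trans (ltW (truncnS_gt _)))// ler_nat; exact: leq_maxr.
  rewrite /= (lhatE _ fl)// lerN2 (le_trans (ltW l2))//.
  by apply: (lt_mono (@env_continuous _ f) fl) => //; rewrite ler_nat; exact: leq_maxl.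
by rewrite -EFinB lee_fin; lra.
Qed.

End local_time_functional.

(** * Valleys *)

Section valleys.
Context {R : realType}.
Implicit Types W : R -> R.

Definition distinct_extrema W : Prop :=
  forall x y, x < y -> locext W x -> locext W y -> W x <> W y.

(** W comes down arbitrarily low on both sides, so that every wall hides an h-maximum. *)
Definition falls W : Prop :=
  forall c x, (exists2 y, y < x & W y <= c) /\ (exists2 y, x < y & W y <= c).

Lemma locextN W x : locext (fun y => - W y) x <-> locext W x.
Proof.
suff h V : locext V x -> locext (fun y => - V y) x.
  split; last exact: h.
  by move/h; congr locext; apply/funext => y; rewrite opprK.
move=> [e e0 [s H]]; exists e => //; exists (~~ s) => y /H.
by case: s {H} => /=; rewrite !(expr0, expr1) !mulN1r !mul1r ?opprK.
Qed.

Lemma h_minimum_locext h W x : h_minimum h W x -> locext W x.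
Proof.
move=> [xi [zeta [/andP[x1 x2] _ _ H]]].
exists (Num.min (x - xi) (zeta - x)); first by rewrite lt_min !subr_gt0 x1.
exists true => y; rewrite lt_min => /andP[y1 y2]; rewrite expr1 !mulN1r lerN2; apply: H.
by move: y1 y2; rewrite !ltr_norml => /andP[? ?] /andP[? ?]; apply/andP; split; lra.
Qed.

(** W would be constant near x, and two points of a plateau are extrema of the same height. *)
Lemma h_min_max h W x : distinct_extrema W -> h_minimum h W x -> h_maximum h W x -> False.
Proof.
move=> D [xi [zeta [/andP[x1 x2] _ _ H]]] [xi' [zeta' [/andP[x1' x2'] _ _ H']]].
pose e := Num.min (Num.min (x - xi) (zeta - x)) (Num.min (x - xi') (zeta' - x)).
have e0 : 0 < e by rewrite !lt_min !subr_gt0 x1 x2 x1' x2'.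
have E y : `|y - x| < e -> W y = W x.
  rewrite !lt_min !ltr_norml => /andP[/andP[/andP[a1 a2] /andP[a3 a4]] /andP[/andP[a5 a6] /andP[a7 a8]]].
  apply/eqP; rewrite eq_le -[W y <= _]lerN2 H ?H' //; apply/andP; split; lra.
have xy : x < x + e / 2 by rewrite ltrDl divr_gt0.
have yE : W (x + e / 2) = W x by apply: E; rewrite addrAC subrr add0r gtr0_norm ?divr_gt0//; lra.
apply: (D _ _ xy _ _ (esym yE)).
  by exists e => //; exists false => y /E ->.
exists (e / 2); first by rewrite divr_gt0.
exists false => y; rewrite ltr_norml => /andP[y1 y2]; rewrite yE E//.
by rewrite ltr_norml; apply/andP; split; lra.
Qed.

Lemma h_maximum_intro h W a b x : a < x < b -> W a + h <= W x -> W b + h <= W x ->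
  (forall y, a <= y <= b -> W y <= W x) -> h_maximum h W x.
Proof.
move=> xab wa wb H; exists a, b; split => //; [lra|lra|].
by move=> y /H; rewrite lerN2.
Qed.

(** The wall of the higher minimum, on the side of the lower one, stands between them; so the
    maximum over [x, y] exceeds both minima by h. *)
Lemma h_max_between h W x y : 0 < h -> continuous W -> distinct_extrema W -> x < y ->
  h_minimum h W x -> h_minimum h W y ->
  exists z, [/\ x < z < y, W x + h <= W z, W y + h <= W z & h_maximum h W z].
Proof.
move=> h0 cW D xy mx my.
have [z /andP[xz zy] Hz] := EVT_max_cont cW (ltW xy).
have [] : W x + h <= W z /\ W y + h <= W z.
  have : W x <> W y by exact: (D _ _ xy (h_minimum_locext mx) (h_minimum_locext my)).
  case: (ltgtP (W x) (W y)) => // wxy _.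
    have [xi [zeta [/andP[y1 y2] wxi _ H]]] := my.
    have xxi : x < xi.
      by rewrite ltNge; apply/negP => xix; have := H x; rewrite xix (ltW (lt_trans xy y2)) => /(_ isT); lra.
    by have := Hz xi; rewrite (ltW xxi) (ltW y1) => /(_ isT) => ?; split; lra.
  have [xi [zeta [/andP[x1 x2] _ wze H]]] := mx.
  have yze : zeta < y.
    by rewrite ltNge; apply/negP => xix; have := H y; rewrite xix (ltW (lt_trans x1 xy)) => /(_ isT); lra.
  by have := Hz zeta; rewrite (ltW yze) (ltW x2) => /(_ isT) => ?; split; lra.
move=> w1 w2.
have xz' : x < z by rewrite lt_neqAle xz andbT; apply/eqP => xz0; move: w1; rewrite -xz0; lra.
have zy' : z < y by rewrite lt_neqAle zy andbT; apply/eqP => xz0; move: w2; rewrite -xz0; lra.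
exists z; split=> //; first by rewrite xz'.
by apply: (@h_maximum_intro _ _ x y) => //; rewrite xz'.
Qed.

Lemma unif_cont W a b e : continuous W -> 0 < e ->
  exists N : nat, forall x z, a <= x <= b -> `|z| <= N.+1%:R^-1 -> `|W (x + z) - W x| <= e.
Proof.
move=> cW e0.
have cpt : compact `[a, b]%classic by exact: segment_compact.
pose Q (N : nat) (x : R) := forall z : R, `|z| <= N.+1%:R^-1 -> `|W (x + z) - W x| <= e.
have : \forall N \near \oo, `[a, b]%classic `<=` Q N.
  move/compact_near_coveringP : cpt; apply => x _.
  have e2 : 0 < e / 2 by rewrite divr_gt0.
  have /cvgrPdist_le/(_ _ e2)/nbhs_ballP[d /= d0 dh] := cW x.
  have d2 : 0 < d / 2 by rewrite divr_gt0.
  have near1 : \forall y \near x, ball x (d / 2) y by exact: nbhsx_ballx.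
  near=> y N => z /= zN.
  have by' : `|x - y| < d / 2 by near: y.
  have Ne : N.+1%:R^-1 < d / 2 by near: N; exact: inv_small.
  have h1 : `|W x - W y| <= e / 2 by apply: dh; rewrite /ball/=; lra.
  have h2 : `|W x - W (y + z)| <= e / 2.
    apply: dh; rewrite /ball/= (_ : x - (y + z) = (x - y) + - z); last by ring.
    apply: le_lt_trans (ler_normD _ _) _.
    by rewrite normrN [ltRHS]splitr ltrD// (le_lt_trans zN).
  rewrite (_ : W (y + z) - W y = (W (y + z) - W x) + (W x - W y)); last by ring.
  apply: le_trans (ler_normD _ _) _.
  by rewrite [leRHS]splitr lerD// distrC.
move=> [N _ NP]; exists N => x z xab zN.
by apply: (NP N (leqnn N)) => //=; rewrite in_itv.
Unshelve. all: by end_near. Qed.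

(** Between two h-maxima W goes down by h, which takes some room by uniform continuity. *)
Lemma h_max_separated h W a b : 0 < h -> continuous W -> distinct_extrema W ->
  exists2 d, 0 < d & forall x y, a <= x -> x < y -> y <= b ->
    h_maximum h W x -> h_maximum h W y -> x + d <= y.
Proof.
move=> h0 cW D; have h2 : 0 < h / 2 by rewrite divr_gt0.
have [N HN] := unif_cont a b cW h2.
exists N.+1%:R^-1 => [|x y ax xy yb mx my]; first by rewrite invr_gt0.
have cWn : continuous (fun x => - W x) by move=> z; apply: cvgN; exact: cW.
have Dn : distinct_extrema (fun x => - W x).
  by move=> p q pq /locextN lp /locextN lq /oppr_inj; exact: D.
have [z [/andP[xz zy] w1 w2 _]] := h_max_between h0 cWn Dn xy mx my.
rewrite leNgt; apply/negP => yxN.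
have zN : `|z - x| <= N.+1%:R^-1.
  by rewrite gtr0_norm ?subr_gt0// lerBlDl; exact: ltW (lt_trans zy yxN).
have axb : a <= x <= b by rewrite ax (le_trans (ltW xy) yb).
have := HN x _ axb zN; rewrite addrCA subrr addr0 ler_norml => /andP[? ?]; lra.
Qed.

Lemma separated_max (A : set R) b d : 0 < d -> A !=set0 -> (forall x, A x -> x <= b) ->
  (forall x y, A x -> A y -> x < y -> x + d <= y) ->
  exists2 a, A a & forall x, A x -> x <= a.
Proof.
move=> d0 A0 Ab sep.
have sA : has_sup A by split => //; exists b.
have [a Aa sa] := sup_adherent d0 sA.
exists a => // x Ax; rewrite leNgt; apply/negP => ax.
have := sep _ _ Aa Ax ax; have := ub_le_sup sA.2 Ax; lra.
Qed.

(** [valley_bottom] picks an arbitrary standard valley; agreement of all of them on the bottom makes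
    the choice harmless. *)
Definition is_bottom (h : R) W (m : R) : Prop :=
  (exists v, standard_valley h W v) /\ forall v, standard_valley h W v -> v.1.2 = m.

Lemma is_bottomE h W m : is_bottom h W m -> valley_bottom h W = m.
Proof.
by move=> [ex un]; apply: un; exact: (xgetPex (0, 0, 0) ex).
Qed.

(* The bottom of the h-valley lies in [s, t], to the right of 0, and W stays
   within rho of mu there; u and v lie beyond the walls of the valley. On its
   way from 0 to the bottom, the diffusion meets no barrier of height h
   (rv_draw), and the one at u is higher than all those it meets (rv_left). The
   margins in eta survive the oscillation of W at scale kap. *)
Record right_valley (h rho u s t v mu eta kap : R) W : Prop := RightValley {
  rv_u : u < 0;
  rv_s : 0 <= s;
  rv_st : s < t;
  rv_tv : t < v;
  rv_eta : 0 < eta;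
  rv_kap : 0 < kap;
  rv_lb : forall x, u <= x <= v -> mu <= W x;
  rv_min : exists2 y, s < y < t & W y < mu + eta;
  rv_outl : forall x, u <= x <= s -> mu + 4 * eta <= W x;
  rv_outr : forall x, t <= x <= v -> mu + 4 * eta <= W x;
  rv_in : forall x, s <= x <= t -> W x <= mu + rho;
  rv_Wu : mu + h + 5 * eta <= W u;
  rv_Wv : mu + h + 5 * eta <= W v;
  rv_left : forall x, 0 <= x <= t -> W x + 3 * eta <= W u;
  rv_draw : forall x y, u <= x -> x <= y -> y <= t -> W y <= W x + h - 3 * eta;
  rv_osc : forall x z, u <= x <= v -> 0 <= z <= kap -> `|W (x + z) - W x| <= eta }.

Lemma locext_itv (s : bool) a b (f : R -> R) x : a < x < b ->
  (forall y, a <= y <= b -> (-1) ^+ s * f y <= (-1) ^+ s * f x) -> locext f x.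
Proof.
move=> /andP[ax xb] H; exists (Num.min (x - a) (b - x)); first by rewrite lt_min !subr_gt0 ax.
exists s => y; rewrite lt_min !ltr_norml => /andP[/andP[? ?] /andP[? ?]].
by apply: H; apply/andP; split; lra.
Qed.

(** The valley around m is delimited by the last h-maximum before m and the first one after it,
    which exist because h-maxima are separated. As there is none in [0, m], the left one is negative
    and 0 belongs to the valley. *)
Lemma is_bottom_intro h W u v m : 0 < h -> continuous W -> distinct_extrema W -> falls W ->
  u < m < v -> 0 < m -> W m + h <= W u -> W m + h <= W v -> h_minimum h W m ->
  (forall x, 0 <= x <= m -> ~ h_maximum h W x) -> is_bottom h W m.
Proof.
move=> h0 cW D F /andP[um mv] m0 Wu Wv hm nomax.
have [x1 x1u wx1] := (F (W u - h) u).1.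
have [x2 x2v wx2] := (F (W v - h) v).2.
(* x1 is a point beyond u that lies lower than W u by h, so that a maximum over [x1, m] is an
   h-maximum. *)
have [p0 [p01 p02 hp0]] : exists p0, [/\ x1 <= p0, p0 < m & h_maximum h W p0].
  have x1m : x1 <= m by lra.
  have [p0 /andP[p1 p2] Hp] := EVT_max_cont cW x1m.
  have wp : W u <= W p0 by apply: Hp; apply/andP; split; lra.
  have p1' : x1 < p0 by rewrite lt_neqAle p1 andbT; apply/eqP => e; move: wp; rewrite -e; lra.
  have p2' : p0 < m by rewrite lt_neqAle p2 andbT; apply/eqP => e; move: wp; rewrite e; lra.
  exists p0; split=> //; apply: (@h_maximum_intro _ _ x1 m) => //; [by rewrite p1'|lra|lra].
have [q0 [q01 q02 hq0]] : exists q0, [/\ m < q0, q0 <= x2 & h_maximum h W q0].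
  have x1m : m <= x2 by lra.
  have [p /andP[p1 p2] Hp] := EVT_max_cont cW x1m.
  have wp : W v <= W p by apply: Hp; apply/andP; split; lra.
  have p1' : m < p by rewrite lt_neqAle p1 andbT; apply/eqP => e; move: wp; rewrite -e; lra.
  have p2' : p < x2 by rewrite lt_neqAle p2 andbT; apply/eqP => e; move: wp; rewrite e; lra.
  exists p; split=> //; apply: (@h_maximum_intro _ _ m x2) => //; [by rewrite p1'|lra|lra].
have [d d0 sep] := h_max_separated x1 x2 h0 cW D.
have [p [p1 pm hp] Hp] : exists2 p, [/\ x1 <= p, p < m & h_maximum h W p] &
    forall x, [/\ x1 <= x, x < m & h_maximum h W x] -> x <= p.
  apply: (separated_max (b := m) d0) => [|x [_ /ltW]//|x y [xx1 xm hx] [_ ym hy] xy].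
    by exists p0; split.
  by apply: sep => //; lra.
have [q [mq qx2 hq] Hq] : exists2 q, [/\ m < q, q <= x2 & h_maximum h W q] &
    forall x, [/\ m < x, x <= x2 & h_maximum h W x] -> q <= x.
  have [a [a1 a2 a3] Ha] : exists2 a, [/\ m < - a, - a <= x2 & h_maximum h W (- a)] &
    forall x, [/\ m < - x, - x <= x2 & h_maximum h W (- x)] -> x <= a.
    apply: (separated_max (b := - m) d0) => [|x [+ _ _]|x y [xx1 xm hx] [my ym hy] xy].
    - by exists (- q0); rewrite /= opprK.
    - by rewrite ltrNr => /ltW.
    - have := sep (- y) (- x); rewrite ltrN2 => /(_ _ xy xm hy hx); lra.
  by exists (- a) => // x [b1 b2 b3]; rewrite lerNl; apply: Ha; rewrite opprK.
have p0' : p < 0.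
  by rewrite ltNge; apply/negP => pp; apply: (nomax p) => //; rewrite pp ltW.
have nobetween x y : x < y -> h_minimum h W x -> h_minimum h W y ->
    (forall z, x < z < y -> ~ h_maximum h W z) -> False.
  move=> xy mx my no; have [z [xzy _ _ hz]] := h_max_between h0 cW D xy mx my.
  exact: no hz.
have nol z : p < z < m -> ~ h_maximum h W z.
  move=> /andP[pz zm] hz; have : z <= p by apply: Hp; split=> //; rewrite ltW// (le_lt_trans p1).
  by rewrite leNgt pz.
have nor z : m < z < q -> ~ h_maximum h W z.
  move=> /andP[pz zm] hz; have : q <= z by apply: Hq; split=> //; rewrite ltW// (lt_le_trans zm).
  by rewrite leNgt zm.
split.
  exists (p, m, q); split; [split=> //; [by right|by left|]|split=> //; [by left|by right|]| |split=> //].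
  - move=> z /andP[pz zm] [hz|hz]; last by apply: (nol z) => //; rewrite pz.
    by apply: (nobetween z m) => // y /andP[zy ym]; apply: nol; rewrite (lt_trans pz zy).
  - move=> z /andP[pz zm] [hz|hz]; last by apply: (nor z) => //; rewrite pz.
    by apply: (nobetween m z) => // y /andP[zy ym]; apply: nor; rewrite zy (lt_trans ym zm).
  - by apply/andP; split; lra.
move=> [[p' m'] q'] [[_ _ pm' nop] [_ _ mq' noq] /andP[p'0 q'0] [hp' hm' hq']] /=.
have mq0 : m <= q'.
  by rewrite leNgt; apply/negP => q'm; apply: (nomax q') => //; rewrite q'0/= ltW.
have mq2 : m < q'.
  rewrite lt_neqAle mq0 andbT; apply/eqP => e.
  by rewrite -e in hq'; exact: h_min_max D hm hq'.
have [mm|mm|//] := ltgtP m' m.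
  by exfalso; apply: (noq m); [rewrite mm|left].
by exfalso; apply: (nop m); [rewrite mm andbT; lra|left].
Qed.

Lemma right_valley_bottom h rho u s t v mu eta kap W : 0 < h -> continuous W ->
  distinct_extrema W -> falls W -> right_valley h rho u s t v mu eta kap W ->
  exists m, [/\ s < m < t, is_bottom h W m, forall x, u <= x <= v -> W m <= W x &
    forall x, u <= x <= v -> W x <= W m -> x = m].
Proof.
move=> h0 cW D F [u0 s0 st tv eta0 _ _ [y0 /andP[sy yt] wy] outl outr _ Wu Wv left_ draw _].
have uv : u <= v by lra.
have [m /andP[um mv] mmin] := EVT_min_cont cW uv.
have wm : W m < mu + eta by apply: le_lt_trans wy; apply: mmin; apply/andP; split; lra.
have sm : s < m.
  by rewrite ltNge; apply/negP => ms; have := outl m; rewrite um ms => /(_ isT); lra.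
have mt : m < t.
  by rewrite ltNge; apply/negP => ms; have := outr m; rewrite mv ms => /(_ isT); lra.
have hm : h_minimum h W m.
  by exists u, v; split=> //; [apply/andP; split; lra|lra|lra].
have inner x : u <= x <= v -> W x <= W m -> s < x < t.
  move=> /andP[ux xv] wx; rewrite !ltNge; apply/andP; split; apply/negP => h1.
    by have := outl x; rewrite ux h1 => /(_ isT); lra.
  by have := outr x; rewrite xv h1 => /(_ isT); lra.
have emin x : u <= x <= v -> W x <= W m -> locext W x.
  move=> xuv wx; have /andP[sx xt] := inner x xuv wx.
  apply: (@locext_itv true s t); first by rewrite sx.
  move=> y /andP[sy' yt']; rewrite expr1 !mulN1r lerN2; apply: le_trans wx _; apply: mmin.
  by rewrite (le_trans _ sy') ?(le_trans yt')//; lra.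
exists m; split=> //; first by rewrite sm.
  2: {
  move=> x xuv wx; have wE : W x = W m by apply/eqP; rewrite eq_le wx mmin.
  have mE : u <= m <= v by rewrite um.
  case: (ltgtP x m) => // xm; exfalso.
    exact: (D _ _ xm (emin x xuv wx) (emin m mE (lexx _))).
  exact: (D _ _ xm (emin m mE (lexx _)) (emin x xuv wx) (esym wE)). }
(* An h-maximum x has a point xi on its left lower by h. If u <= xi, [rv_draw] forbids the rise from
   xi to x; otherwise u lies between xi and x, and W u > W x by [rv_left]. *)
have nomax x : 0 <= x <= t -> ~ h_maximum h W x.
  move=> /andP[x0 xt] [xi [zeta [/andP[x1 x2] w1 w2 H]]].
  have [uxi|xiu] := leP u xi; first by have := draw xi x uxi (ltW x1) xt; lra.
  have := H u; rewrite (ltW xiu) (_ : u <= zeta); last by lra.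
  by move=> /(_ isT); have := left_ x; rewrite x0 xt => /(_ isT); lra.
apply: (is_bottom_intro h0 cW D F (u := u) (v := v)) => //; [apply/andP; split; lra|lra|lra|lra|].
by move=> x /andP[x0 xm]; apply: nomax; rewrite x0 ltW// (le_lt_trans xm).
Qed.

Lemma h_minimum_refl h W x : h_minimum h (fun y => W (- y)) x <-> h_minimum h W (- x).
Proof.
suff H V z : h_minimum h (fun y => V (- y)) z -> h_minimum h V (- z).
  split; first exact: H.
  move=> m; rewrite -[x]opprK; apply: H; move: m; congr h_minimum.
  by apply/funext => y; rewrite opprK.
move=> [xi [zeta [/andP[x1 x2] w1 w2 K]]].
exists (- zeta), (- xi); split=> //; first by rewrite !ltrN2 x2.
move=> y /andP[y1 y2]; have := K (- y); rewrite opprK; apply.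
by rewrite lerNr y2 lerNl y1.
Qed.

Lemma h_maximum_refl h W x : h_maximum h (fun y => W (- y)) x <-> h_maximum h W (- x).
Proof. exact: (h_minimum_refl h (fun y => - W y)). Qed.

Lemma standard_valley_refl h W p m q :
  standard_valley h (fun y => W (- y)) (p, m, q) -> standard_valley h W (- q, - m, - p).
Proof.
have E x : h_extrema h (fun y => W (- y)) x <-> h_extrema h W (- x).
  split=> -[H|H]; [left|right|left|right];
    [exact/h_minimum_refl|exact/h_maximum_refl|exact/h_minimum_refl|exact/h_maximum_refl].
move=> [[/E e1 /E e2 pm n1] [_ /E e3 mq n2] /andP[p0 q0] [/h_maximum_refl hp /h_minimum_refl hm /h_maximum_refl hq]].
split; [split=> //; first by rewrite ltrN2|split=> //; first by rewrite ltrN2| |split=> //].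
- move=> z /andP[z1 z2] ez; apply: (n2 (- z)); first by rewrite ltrNr z2 ltrNl z1.
  by apply/E; rewrite opprK.
- move=> z /andP[z1 z2] ez; apply: (n1 (- z)); first by rewrite ltrNr z2 ltrNl z1.
  by apply/E; rewrite opprK.
- by rewrite oppr_le0 oppr_ge0 q0.
Qed.

Lemma is_bottom_refl h W m : is_bottom h (fun y => W (- y)) m -> is_bottom h W (- m).
Proof.
move=> [[[[p m'] q] ex] un]; split; first by exists (- q, - m', - p); exact: standard_valley_refl.
move=> [[p2 m2] q2] sv /=.
have W2 : W = (fun y => (fun z => W (- z)) (- y)) by apply/funext => y; rewrite opprK.
move: sv; rewrite {1}W2 => /standard_valley_refl/un /= <-.
by rewrite opprK.
Qed.

End valleys.

(** * Construction of a valley from the first unit rises *)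

Section exits.
Context {R : realType}.
Implicit Types f : R -> R.

Lemma near_cont f x e : continuous f -> 0 < e ->
  exists2 d, 0 < d & forall y, x - d < y -> y < x + d -> f x - e < f y /\ f y < f x + e.
Proof.
move=> cf e0; have /cvgrPdist_lt/(_ _ e0)/nbhs_ballP[d /= d0 dh] := cf x.
exists d => // y y1 y2; have : `|f x - f y| < e.
  by apply: dh; rewrite /ball/= ltr_norml; apply/andP; split; lra.
by rewrite ltr_norml => /andP[? ?]; split; lra.
Qed.

Lemma rat_between (a b : R) : a < b -> exists q : rat, a < ratr q < b.
Proof. by move=> /rat_in_itvoo[q qab]; exists q; move: qab; rewrite !inE/=. Qed.

(** q is the first time at which f has risen by 1 above its past minimum, and m is a place where
    that minimum is attained. *)
Lemma first_drawup f : continuous f -> f 0 = 0 -> (exists2 y, 0 <= y & 1 <= f y) ->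
  exists q m, [/\ 0 <= m <= q, f q = f m + 1, forall x, 0 <= x <= q -> f m <= f x &
    forall x y, 0 <= x -> x <= y -> y < q -> f y < f x + 1].
Proof.
move=> cf f0 [y0 y00 fy0].
pose A := [set y | 0 <= y /\ exists2 x, 0 <= x <= y & f x + 1 <= f y].
have A0 : A !=set0.
  by exists y0; split => //; exists 0; rewrite ?lexx ?f0 ?add0r.
have Alb : has_lbound A by exists 0 => y [].
have iA : has_inf A by [].
pose q := inf A.
have q0 : 0 <= q by apply: lb_le_inf => // y [].
have draw x y : 0 <= x -> x <= y -> y < q -> f y < f x + 1.
  move=> x0 xy yq; rewrite ltNge; apply/negP => h.
  have : q <= y by apply: ge_inf => //; split; [exact: le_trans xy|exists x; rewrite ?x0].
  by rewrite leNgt yq.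
have [m /andP[m0 mq] Hm] := EVT_min_cont cf q0.
exists q, m; split=> //; first by rewrite m0.
have fmq : f m <= f q by apply: Hm; rewrite q0 lexx.
apply/eqP; rewrite eq_le; apply/andP; split.
  rewrite leNgt; apply/negP => h.
  have mq' : m < q.
    by rewrite lt_neqAle mq andbT; apply/eqP => e; move: h; rewrite e; lra.
  have e0 : 0 < f q - (f m + 1) by lra.
  have [d d0 dh] := near_cont q cf e0.
  have hd : q - d < Num.max m (q - d / 2) < q by rewrite lt_max gt_max mq'; apply/andP; split; [apply/orP; right|]; lra.
  have h1 : m <= Num.max m (q - d / 2) by rewrite le_max lexx.
  move: h1 hd; set y := Num.max _ _ => h1 /andP[hd1 hd2].
  have [h3 h4] := dh y ltac:(lra) ltac:(lra).
  have := draw m y m0 h1 hd2; lra.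
rewrite leNgt; apply/negP => h.
have e0 : 0 < (f m + 1 - f q) / 2 by lra.
have [d d0 dh] := near_cont q cf e0.
have [y [y0' [x /andP[x0 xy] fx]] yq] := inf_adherent d0 iA.
rewrite -/q in yq.
have qy : q <= y by apply: ge_inf => //; split => //; exists x; rewrite ?x0.
have [h1 h2] := dh y ltac:(lra) ltac:(lra).
 have [xq|qx] := leP x q.
  by have := Hm x; rewrite x0 xq => /(_ isT); lra.
have [h3 h4] := dh x ltac:(lra) ltac:(lra); lra.
Qed.

Lemma unif_drawup f t : continuous f -> 0 <= t ->
  (forall x y, 0 <= x -> x <= y -> y <= t -> f y < f x + 1) ->
  exists2 D, D < 1 & forall x y, 0 <= x -> x <= y -> y <= t -> f y <= f x + D.
Proof.
move=> cf t0 h.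
pose K : set (R * R) := `[0, t]%classic `*` `[0, t]%classic.
(* The maximum extends the condition on pairs x <= y to a whole square, over which the supremum is
   attained. *)
pose F (p : R * R) := f (Num.max p.1 p.2) - f p.1.
have cK : compact K by apply: compact_setX; exact: segment_compact.
have K0 : K !=set0 by exists (0, 0); split; rewrite /= in_itv/= lexx.
have cF : continuous F.
  move=> p; apply: cvgB.
    apply: (continuous_compo (f := fun p : R * R => Num.max p.1 p.2)) => //.
    have E : (fun p : R * R => Num.max p.1 p.2) = (fun p => p.1 + Num.max 0 (p.2 - p.1)).
      by apply/funext => z /=; rewrite addr_maxr addr0 addrCA subrr addr0.
    have c0 : continuous (fun z : R * R => z.2 - z.1).
      by move=> y; apply: cvgB; [exact: continuous_snd|exact: continuous_fst].
    have c1 := continuous_compo c0 (@continuous_max0 R).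
    by rewrite E => z; apply: cvgD; [exact: continuous_fst|exact: c1].
  by apply: (continuous_compo (f := @fst R R)) => //; exact: continuous_fst.
have [[x y] + HD] := compact_EVT_max K0 cK (continuous_subspaceT cF).
rewrite inE /K/= !in_itv/= => -[/andP[x0 xt] /andP[y0 yt]].
exists (F (x, y)).
  rewrite /F/=; have := h x (Num.max x y) x0; rewrite le_max lexx ge_max xt yt => /(_ isT isT); lra.
move=> x' y' x'0 xy' yt'; have := HD (x', y').
rewrite inE /K/= !in_itv/= x'0 yt' (le_trans xy' yt') (le_trans x'0 xy') => /(_ (conj isT isT)).
by rewrite /F/= [in X in X -> _](max_idPr xy'); lra.
Qed.

(** What one side of the environment shows: the first unit rise ends at q and starts from the
    minimum m, p is the highest point before m, and v is a point after q that leaves a margin above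
    the required height. *)
Record exit_data f (q m p v : R) : Prop := ExitData {
  ex_p : 0 < p; ex_pm : p < m; ex_mq : m < q; ex_qv : q < v;
  ex_q : f q = f m + 1;
  ex_min : forall x, 0 <= x <= v -> x != m -> f m < f x;
  ex_draw : forall x y, 0 <= x -> x <= y -> y < q -> f y < f x + 1;
  ex_max : forall x, 0 <= x <= m -> f x <= f p;
  ex_v : f m + 1 < f v;
  ex_m_ext : locext f m; ex_p_ext : locext f p }.

Definition differ_by f (d : R) := forall x y, 0 < x -> x < y ->
  locext f x -> locext f y -> f y - f x <> d.

Lemma exit_exists f : continuous f -> f 0 = 0 -> (exists2 y, 0 <= y & 1 <= f y) ->
  differ_by f 0 -> differ_by f 1 ->
  (forall s, 0 < s -> exists2 x, 0 <= x <= s & 0 < f x) ->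
  (forall s, 0 < s -> exists2 x, 0 <= x <= s & f x < 0) ->
  exists q m p v, exit_data f q m p v.
Proof.
move=> cf f0 hy d0 d1 up down.
have [q [m [/andP[m0 mq] fq Hm draw]]] := first_drawup cf f0 hy.
have mq' : m < q by rewrite lt_neqAle mq andbT; apply/eqP => e; move: fq; rewrite e; lra.
have q0 : 0 < q by lra.
have [x1 x1q fx1] := down q q0.
have fm : f m < 0 by exact: le_lt_trans (Hm x1 x1q) fx1.
have m0' : 0 < m by rewrite lt_neqAle m0 andbT; apply/eqP => e; move: fm; rewrite -e f0; lra.
have em : locext f m.
  apply: (@locext_itv _ true 0 q); first by rewrite m0'.
  by move=> y yq; rewrite expr1 !mulN1r lerN2; exact: Hm.
(* Within 1/2 of f q, the function stays above f m = f q - 1; this keeps m the minimum up to v. *)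
have half0 : 0 < 1 / 2 :> R by lra.
have [e e0 eh] := near_cont q cf half0.
pose e1 := Num.min (e / 2) (q - m).
have e10 : 0 < e1 by rewrite lt_min subr_gt0 mq' divr_gt0.
have e1e : e1 <= e / 2 by rewrite ge_min lexx.
have e1m : e1 <= q - m by rewrite ge_min lexx orbT.
(* Otherwise q is a local maximum whose height above the local minimum m is exactly 1, which
   [differ_by f 1] excludes. *)
have [v /andP[qv ve] fv] : exists2 v, q <= v <= q + e1 & f q < f v.
  apply: contrapT => no.
  have eq_ : locext f q.
    exists e1 => //; exists false => y; rewrite expr0 !mul1r ltr_norml => /andP[y1 y2].
    have [yq|qy] := ltP y q.
      by rewrite fq; apply: ltW; apply: draw => //; lra.
    rewrite leNgt; apply/negP => fy; apply: no; exists y => //; apply/andP; split; lra.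
  by apply: (d1 m q) => //; rewrite fq addrAC subrr add0r.
have qv' : q < v by rewrite lt_neqAle qv andbT; apply/eqP => E; move: fv; rewrite E ltxx.
have [p /andP[p0 pm] Hp] := EVT_max_cont cf m0.
have [x2 x2m fx2] := up m m0'.
have fp : 0 < f p by exact: lt_le_trans fx2 (Hp x2 x2m).
have p0' : 0 < p by rewrite lt_neqAle p0 andbT; apply/eqP => E; move: fp; rewrite -E f0; lra.
have pm' : p < m by rewrite lt_neqAle pm andbT; apply/eqP => E; move: fp; rewrite E; lra.
exists q, m, p, v; split=> //.
- move=> x /andP[x0 xv] xm; have [xq|qx] := ltP x q; last first.
    by have [? ?] := eh x ltac:(lra) ltac:(lra); lra.
  have fmx : f m <= f x by apply: Hm; rewrite x0 ltW.
  rewrite lt_neqAle fmx andbT; apply/eqP => E.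
  have x0' : 0 < x by rewrite lt_neqAle x0 andbT; apply/eqP => E'; move: fm; rewrite E -E' f0; lra.
  have ex : locext f x.
    apply: (@locext_itv _ true 0 q); first by rewrite x0'.
    by move=> y yq; rewrite expr1 !mulN1r lerN2 -E; exact: Hm.
  move: xm; rewrite neq_lt => /orP[xm|mx].
    by apply: (d0 x m) => //; rewrite E subrr.
  by apply: (d0 m x) => //; rewrite E subrr.
- by rewrite -fq.
- apply: (@locext_itv _ false 0 m); first by rewrite p0'.
  by move=> y ym; rewrite expr0 !mul1r; exact: Hp.
Qed.

(** The bound on c is the maximum of the left side up to the end of its first unit rise. A lower
    level c is reached strictly before that end, and the rise from any earlier point up to it is
    less than 1. *)
Lemma left_exit (w : env_path R) q m p v c : 0 < c ->
  exit_data (refl w) q m p v -> c < Num.max (refl w p) (refl w m + 1) ->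
  exists U c1, [/\ 0 < U, w (- U) = c, c - 1 < c1 & forall x, - U <= x <= 0 -> c1 <= w x <= c].
Proof.
move=> c0 [p0 pm mq _ wq _ draw _ _ _ _] cRl.
have [gc Uq] : hits c (refl w) /\ hit c (refl w) < q.
  move: cRl; rewrite lt_max => /orP[h|h].
    have r : reaches c p (refl w) by exists p => //; [rewrite lexx andbT ltW|exact: ltW].
    have hc : hits c (refl w) by exists p => //; exact: ltW.
    by split => //; have /(hit_reaches hc) := r; lra.
  rewrite -wq in h.
  have q0 : 0 <= q by lra.
  have r : reaches c q (refl w) by exists q => //; [rewrite lexx andbT|exact: ltW].
  have hc : hits c (refl w) by exists q => //; exact: ltW.
  split => //; have /(hit_reaches hc) h1 := r.
  rewrite lt_neqAle h1 andbT; apply/eqP => E.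
  by have := hitE hc (ltW c0); rewrite E; lra.
have gU := hitE gc (ltW c0); have U0 := hit_ge0 gc.
have ltU s : 0 <= s -> s < hit c (refl w) -> refl w s < c by exact: lt_hit.
move: Uq gU U0 ltU; set U := hit c (refl w) => Uq gU U0 ltU.
clearbody U.
have U0' : 0 < U.
  by rewrite lt_neqAle U0 andbT; apply/eqP => E; move: gU; rewrite -E env_at0; lra.
have [z0 z0U Hc1] := EVT_min_cont (@env_continuous _ (refl w)) U0.
exists U, (refl w z0); split => //.
  by case/andP: z0U => z00 z0U; have := draw z0 U z00 z0U Uq; rewrite gU; lra.
move=> x /andP[xU x0]; have xx : 0 <= - x <= U by apply/andP; split; lra.
have := Hc1 _ xx; rewrite /= opprK => -> /=.
case/andP: xx => a1; rewrite le_eqVlt => /predU1P[E|b1].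
  by move: gU; rewrite -E /= opprK => ->.
by have := ltU _ a1 b1; rewrite /= opprK => /ltW.
Qed.

Lemma right_valley_intro (rho m g u s t v : R) (w : env_path R) : 0 < rho ->
  0 < g -> g <= rho -> u < 0 -> 0 <= s -> s < m < t -> t < v ->
  (forall x, u <= x <= v -> w m <= w x) ->
  (forall x, u <= x <= s -> w m + g <= w x) ->
  (forall x, t <= x <= v -> w m + g <= w x) ->
  (forall x, s <= x <= t -> w x <= w m + rho / 2) ->
  w m + 1 + g <= w u -> w m + 1 + g <= w v ->
  (forall x, 0 <= x <= t -> w x + g <= w u) ->
  (forall x y, u <= x -> x <= y -> y <= t -> w y <= w x + 1 - g) ->
  exists (mu eta : rat) (N : nat),
    right_valley 1 rho u s t v (ratr mu) (ratr eta) N.+1%:R^-1 w.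
Proof.
move=> rho0 g0 grho u0 s0 /andP[sm mt] tv H1 H2 H3 H4 H5 H6 H7 H8.
(* The margins of [right_valley] are at most 5 eta and mu is within eta of w m, which g / 20
   accommodates. *)
have g20 : 0 < g / 20 by lra.
have [eta /andP[eta0 etag]] := rat_between g20.
have wlt : w m - ratr eta < w m by lra.
have [mu /andP[mu1 mu2]] := rat_between wlt.
have [N HN] := unif_cont u v (@env_continuous _ w) eta0.
exists mu, eta, N.
move: (ratr eta) eta0 etag wlt mu1 HN => e eta0 etag _ mu1 HN.
move: (ratr mu) mu1 mu2 => mu' mu1 mu2.
split=> //.
- exact: lt_trans mt.
- by move=> x /H1; apply: le_trans; exact: ltW.
- by exists m; [rewrite sm|clear -mu1; lra].
- by move=> x /H2; clear -mu2 etag g0; lra.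
- by move=> x /H3; clear -mu2 etag g0; lra.
- by move=> x /H4; clear -mu1 etag grho rho0; lra.
- by clear -mu2 H5 etag g0; lra.
- by clear -mu2 H6 etag g0; lra.
- by move=> x /H7; clear -etag g0; lra.
- by move=> x y ux xy yt; have := H8 x y ux xy yt; clear -etag g0; lra.
- by move=> x z xuv /andP[z0' zN]; apply: HN => //; rewrite ger0_norm.
Qed.

(** [Rr] and [Rl] are the heights that the two sides reach by the end of their first unit rises. The
    bottom is on the side with the lower one, here the right. With c halfway, u is taken close to
    the first point on the left where W reaches c: high enough to stand above everything met on the
    right, early enough for no unit rise to have occurred on the left. *)
Lemma right_params (rho : R) (w : env_path R) q m p v q' m' p' v' : 0 < rho ->
  exit_data w q m p v -> exit_data (refl w) q' m' p' v' ->
  Num.max (w p) (w m + 1) < Num.max (refl w p') (refl w m' + 1) ->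
  exists (u s t v mu eta : rat) (N : nat),
    right_valley 1 rho (ratr u) (ratr s) (ratr t) (ratr v) (ratr mu) (ratr eta) N.+1%:R^-1 w.
Proof.
move=> rho0 [p0 pm mq qv wq Hmin draw Hp wv _ _] E'.
set Rr := Num.max (w p) _; set Rl := Num.max (refl w p') _ => RrRl.
have cw := @env_continuous _ w; have w0 := @env_at0 _ w.
have [Rrp Rrm] : w p <= Rr /\ w m + 1 <= Rr by rewrite !le_max !lexx orbT.
pose c := (Rr + Rl) / 2.
have cRr : Rr < c by rewrite /c; lra.
have cRl : c < Rl by rewrite /c; lra.
have Rr0 : 0 <= Rr.
  by have := Hp 0; rewrite w0 lexx (ltW (lt_trans p0 pm)) => /(_ isT) => h; lra.
have c0 : 0 < c by lra.
have [U [c1 [U0 gU c1c left_]]] := left_exit c0 E' cRl.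
clear E'; clearbody c Rr.
have rho2 : 0 < rho / 2 by rewrite divr_gt0.
have [e e0 eh] := near_cont m cw rho2.
have [s s1] : exists s : rat, Num.max 0 (m - e) < ratr s < m.
  by apply: rat_between; rewrite gt_max; apply/andP; split; lra.
have [t t1] : exists t : rat, m < ratr t < Num.min q (m + e).
  by apply: rat_between; rewrite lt_min; apply/andP; split; lra.
move: s1 t1; rewrite gt_max lt_min => /andP[/andP[s0 se] sm] /andP[mt /andP[tq te]].
have gap1 : 0 < (c - Rr) / 2 by rewrite divr_gt0 ?subr_gt0.
have [e2 e20 e2h] := near_cont (- U) cw gap1.
have [u u1] : exists u : rat, - U < ratr u < Num.min (- U + e2) 0.
  by apply: rat_between; rewrite lt_min ltrDl e20 oppr_lt0.
have gap2 : 0 < w v - (w m + 1) by rewrite subr_gt0.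
have [e3 e30 e3h] := near_cont v cw gap2.
have [v2 v2e] : exists v2 : rat, Num.max q (v - e3) < ratr v2 < v.
  by apply: rat_between; rewrite gt_max qv/= ltrBlDl ltrDr.
move: u1 v2e; rewrite lt_min gt_max => /andP[Uu /andP[ue u0]] /andP[/andP[qv2 v2e] v2v].
exists u, s, t, v2.
move: (ratr u) (ratr s) (ratr t) (ratr v2) s0 se sm mt tq te Uu ue u0 qv2 v2e v2v => {u s t v2} u s t v2.
move=> s0 se sm mt tq te Uu ue u0 qv2 v2e v2v.
have wu : c - (c - Rr) / 2 < w u by have [+ _] := e2h u ltac:(clear -Uu e20; lra) ue; rewrite gU.
have wv2 : w m + 1 < w v2.
  have [+ _] := e3h v2 v2e ltac:(clear -v2v e30; lra); clear; lra.
have win x : s <= x <= t -> w x <= w m + rho / 2.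
  move=> /andP[sx xt]; apply: ltW.
  by have [_] := eh x (lt_le_trans se sx) (le_lt_trans xt te).
clear eh e2h e3h se te ue v2e e0 e20 e30 e e2 e3.
have wRr x : 0 <= x <= t -> w x <= Rr.
  move=> /andP[x0 xt]; have [xm|mx] := leP x m; first by apply: le_trans Rrp; apply: Hp; rewrite x0.
  apply: le_trans Rrm; apply: ltW; apply: draw; [|exact: ltW|exact: le_lt_trans tq].
  by apply: ltW; exact: lt_trans pm.
have t0 : 0 <= t by apply: ltW; apply: lt_trans mt; exact: lt_trans pm.
have [D1 D11 HD1] : exists2 D, D < 1 & forall x y, 0 <= x -> x <= y -> y <= t -> w y <= w x + D.
  by apply: unif_drawup => // x y x0 xy yt; apply: draw => //; exact: le_lt_trans tq.
have us : u <= s by apply: ltW; exact: lt_trans s0.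
have tv : t <= v2 by apply: ltW; exact: lt_trans qv2.
have uleft x : u <= x <= 0 -> c1 <= w x <= c.
  by move=> /andP[ux x0]; apply: left_; rewrite x0 (le_trans (ltW Uu)).
have [g1 g10 Hg1] : exists2 g1, 0 < g1 & forall x, u <= x <= s -> w m + g1 <= w x.
  have [z /andP[uz zs] Hz] := EVT_min_cont cw us.
  exists (w z - w m); last by move=> x /Hz; rewrite addrCA subrr addr0.
  rewrite subr_gt0; have [z00|zz] := leP z 0.
    have := uleft z; rewrite uz z00 => /(_ isT)/andP[+ _].
    by clear -c1c cRr Rrm; lra.
  apply: Hmin; last by rewrite lt_eqF// (le_lt_trans zs).
  rewrite (ltW zz)/= ltW// (le_lt_trans zs)// (lt_trans sm)// (lt_trans mt)//.
  exact: lt_trans qv.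
have [g2 g20 Hg2] : exists2 g2, 0 < g2 & forall x, t <= x <= v2 -> w m + g2 <= w x.
  have [z /andP[uz zs] Hz] := EVT_min_cont cw tv.
  exists (w z - w m); last by move=> x /Hz; rewrite addrCA subrr addr0.
  rewrite subr_gt0; apply: Hmin; last by rewrite gt_eqF// (lt_le_trans mt).
  by rewrite (le_trans t0 uz) (le_trans zs (ltW v2v)).
have key (a b : R) : 0 < a -> 0 < b -> exists g, [/\ 0 < g, g <= a & g <= b].
  by move=> a0 b0; exists (Num.min a b); rewrite lt_min a0 b0 !ge_min !lexx orbT.
have [ga [ga0 gag1 gag2]] := key _ _ g10 g20.
have [gb [gb0 gbrho gbc]] := key rho ((c - Rr) / 2) rho0 ltac:(by rewrite divr_gt0 ?subr_gt0).
have [gd [gd0 gdD gdc]] := key (1 - D1) (1 - (c - c1)) ltac:(clear -D11; lra) ltac:(clear -c1c; lra).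
have [ge [ge0 geb gev]] := key gb (w v2 - (w m + 1)) gb0 ltac:(clear -wv2; lra).
have [gf [gf0 gfa gfd]] := key _ _ ga0 gd0.
have [g [g0 gge ggf]] := key _ _ ge0 gf0.
apply: (@right_valley_intro rho m g) => //.
- exact: le_trans gge (le_trans geb gbrho).
- exact: ltW.
- by rewrite sm.
- exact: lt_trans qv2.
- move=> x /andP[ux xv].
  have [xs|sx] := leP x s.
    by apply: le_trans (Hg1 x _); [rewrite lerDl ltW|rewrite ux].
  have [->|xm] := eqVneq x m => //.
  by apply/ltW/Hmin => //; rewrite (ltW (lt_trans s0 sx)) (le_trans xv (ltW v2v)).
- by move=> x /Hg1; apply: le_trans; rewrite lerD2l (le_trans ggf (le_trans gfa gag1)).
- by move=> x /Hg2; apply: le_trans; rewrite lerD2l (le_trans ggf (le_trans gfa gag2)).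
- by clear -gge geb gbc wu Rrm; lra.
- by clear -gge gev; lra.
- by move=> x /wRr; clear -gge geb gbc wu; lra.
- move=> x y ux xy yt; have [x0|x0] := leP 0 x.
    by have := HD1 x y x0 xy yt; clear -ggf gfd gdD; lra.
  have := uleft x; rewrite ux (ltW x0) => /(_ isT)/andP[a1 a2].
  have : w y <= c; last by clear -a1 ggf gfd gdc; lra.
  have [y0|y0] := leP y 0; last first.
    by have := wRr y; rewrite (ltW y0) yt => /(_ isT)/le_trans; apply; exact: ltW.
  by have := uleft y; rewrite (le_trans ux xy) y0 => /(_ isT)/andP[].
Qed.

End exits.

Lemma measurable_bigcup_count (I : countType) d (T : measurableType d) (D : set I) (F : I -> set T) :
  (forall i, D i -> measurable (F i)) -> measurable (\bigcup_(i in D) F i).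
Proof.
move=> mF; rewrite bigcup_mkcond; apply: countable_bigcupT_measurable => [|i].
  exact: countableP.
by case: ifPn => // /set_mem; exact: mF.
Qed.

Section continuum_conditions.
Context {R : realType} d (T : measurableType d).

Lemma measurable_le_itv (X : T -> R -> R) a b c :
  (forall w, continuous (X w)) -> (forall x, measurable_fun setT (X^~ x)) ->
  measurable [set w | forall x, a <= x <= b -> X w x <= c].
Proof.
move=> cX mX; have [ab|ba] := leP a b; last first.
  rewrite (_ : [set w | _] = setT)//; apply/seteqP; split=> // w _ x /andP[ax xb].
  by have := lt_le_trans ba (le_trans ax xb); rewrite ltxx.
rewrite (_ : [set w | _] = \bigcap_(q : rat) [set w | X w (clamp a b (ratr q)) <= c]).
  by apply: bigcapT_measurable_rat => q; apply: measurable_ray.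
apply/seteqP; split=> w; first by move=> /(le_itv_rat _ (cX w) ab) h q _; exact: h.
by move=> h; apply/(le_itv_rat _ (cX w) ab) => q; exact: h.
Qed.

Lemma measurable_le_itv2 (X : T -> R -> R -> R) a b a' b' c :
  (forall w y, continuous (X w ^~ y)) -> (forall w x, continuous (X w x)) ->
  (forall x y, measurable_fun setT (fun w => X w x y)) ->
  measurable [set w | forall x y, a <= x <= b -> a' <= y <= b' -> X w x y <= c].
Proof.
move=> c1 c2 mX; have [ab|ba] := leP a' b'; last first.
  rewrite (_ : [set w | _] = setT)//; apply/seteqP; split=> // w _ x y _ /andP[ax xb].
  by have := lt_le_trans ba (le_trans ax xb); rewrite ltxx.
rewrite (_ : [set w | _] = \bigcap_(q : rat)
    [set w | forall x, a <= x <= b -> X w x (clamp a' b' (ratr q)) <= c]).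
  by apply: bigcapT_measurable_rat => q; apply: measurable_le_itv => // w; exact: c1.
apply/seteqP; split=> w; first by move=> h q _ x xab; apply: h => //; exact: clamp_itv.
move=> h x y xab; move: y; apply/(le_itv_rat _ (c2 w x) ab) => q; exact: h.
Qed.

End continuum_conditions.

Notation valley_param := (rat * rat * rat * rat * rat * rat * nat)%type.

(** * Valleys of a Brownian environment *)

Section random_valleys.
Context {R : realType}.
Local Notation pathT := (pathD (@setT R)).

Definition rv_set (rho : R) (th : valley_param) : set (env_path R) :=
  let: (u, s, t, v, mu, eta, N) := th in
  [set w : env_path R | right_valley 1 rho (ratr u) (ratr s) (ratr t) (ratr v) (ratr mu) (ratr eta) N.+1%:R^-1 w].

Lemma measurable_evalT x : measurable_fun setT (fun w : pathT => env_fun w x).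
Proof. exact: measurable_coord. Qed.

Lemma measurable_right_valley h rho u s t v mu eta kap :
  measurable [set w : pathT | right_valley h rho u s t v mu eta kap (env_fun w)].
Proof.
have [[[u0 s0 st tv] [eta0 kap0]]|no] :=
    pselect ([/\ u < 0, 0 <= s, s < t & t < v] /\ (0 < eta /\ 0 < kap)); last first.
  rewrite (_ : [set w | _] = set0)//; apply/seteqP; split=> // w [*]; exact: no.
pose A1 := [set w : pathT | forall x, u <= x <= v -> - env_fun w x <= - mu].
pose A2 := \bigcup_(q in [set q : rat | s < ratr q < t]) ~` [set w : pathT | - env_fun w (ratr q) <= - (mu + eta)].
pose A3 := [set w : pathT | forall x, u <= x <= s -> - env_fun w x <= - (mu + 4 * eta)].
pose A4 := [set w : pathT | forall x, t <= x <= v -> - env_fun w x <= - (mu + 4 * eta)].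
pose A5 := [set w : pathT | forall x, s <= x <= t -> env_fun w x <= mu + rho].
pose A6 := [set w : pathT | - env_fun w u <= - (mu + h + 5 * eta)].
pose A7 := [set w : pathT | - env_fun w v <= - (mu + h + 5 * eta)].
pose A8 := [set w : pathT | forall x, 0 <= x <= t -> env_fun w x - env_fun w u <= - (3 * eta)].
(* The maximum replaces the triangle x <= y by a square. *)
pose A9 := [set w : pathT | forall x y, u <= x <= t -> u <= y <= t ->
  env_fun w (Num.max x y) - env_fun w x <= h - 3 * eta].
pose A10 := [set w : pathT | forall x z, u <= x <= v -> 0 <= z <= kap ->
  `|env_fun w (x + z) - env_fun w x| <= eta].
have cw (w : env_path R) := @env_continuous _ w.
have cwN (w : env_path R) : continuous (fun x => - w x) by move=> x; apply: cvgN; exact: cw.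
have mN x : measurable_fun setT (fun w : pathT => - env_fun w x).
  by apply: measurableT_comp => //; exact: measurable_evalT.
have -> : [set w : pathT | right_valley h rho u s t v mu eta kap (env_fun w)] =
  A1 `&` A2 `&` A3 `&` A4 `&` A5 `&` A6 `&` A7 `&` A8 `&` A9 `&` A10.
  apply/seteqP; split=> w.
    move=> [_ _ _ _ _ _ B1 [y /andP[sy yt] wy] B3 B4 B5 B6 B7 B8 B9 B10].
    have K1 : A1 w.
      by move=> x /B1; rewrite lerN2.
    have K2 : A2 w.
      have wy0 : 0 < mu + eta - env_fun w y by lra.
      have [e e0 eh] := near_cont y (cw w) wy0.
      have ylt : Num.max s (y - e) < Num.min t (y + e).
        by rewrite gt_max !lt_min; apply/andP; split; apply/andP; split; lra.
      have [q] := rat_between ylt; rewrite gt_max lt_min => /andP[/andP[q1 q2] /andP[q3 q4]].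
      exists q; first by rewrite /= q1.
      have [_ ?] := eh _ q2 q4; rewrite /= lerN2; apply/negP; rewrite -ltNge; lra.
    have K3 : A3 w.
      by move=> x /B3; rewrite lerN2.
    have K4 : A4 w.
      by move=> x /B4; rewrite lerN2.
    have K5 : A5 w.
      exact: B5.
    have K6 : A6 w.
      by rewrite /A6/= lerN2.
    have K7 : A7 w.
      by rewrite /A7/= lerN2.
    have K8 : A8 w.
      by move=> x /B8; rewrite /=; lra.
    have K9 : A9 w.
      move=> x z /andP[ux xt] /andP[uz zt]; rewrite lerBlDl addrA; apply: B9 => //.
        by rewrite le_max lexx.
      by rewrite ge_max xt.
    have K10 : A10 w.
      exact: B10.
    exact: (conj (conj (conj (conj (conj (conj (conj (conj (conj K1 K2) K3) K4) K5) K6) K7) K8) K9) K10).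
  move=> [[[[[[[[[B1 [q /= /andP[q1 q2] wq]] B3] B4] B5] B6] B7] B8] B9] B10].
  split=> //.
  - by move=> x /B1; rewrite lerN2.
  - by exists (ratr q); [rewrite q1|move: wq => /negP; rewrite lerN2 -ltNge].
  - by move=> x /B3; rewrite lerN2.
  - by move=> x /B4; rewrite lerN2.
  - by move: B6; rewrite /A6/= lerN2.
  - by move: B7; rewrite /A7/= lerN2.
  - by move=> x /B8; lra.
  - move=> x y ux xy yt; have := B9 x y; rewrite (max_idPr xy) ux yt (le_trans xy yt) (le_trans ux xy).
    by move=> /(_ isT isT); lra.
have cshift (w : env_path R) (y : R) : continuous (fun x => w (x + y)).
  apply: continuous_compo => // x; apply: cvgD; [exact: cvg_id|exact: cvg_cst].
have cshift' (w : env_path R) (y : R) : continuous (fun x => w (y + x)).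
  apply: continuous_compo => // x; apply: cvgD; [exact: cvg_cst|exact: cvg_id].
have cmaxr (y : R) : continuous (fun x : R => Num.max x y).
  have -> : (fun x => Num.max x y) = (fun x => y + Num.max 0 (x - y)).
    by apply/funext => x; rewrite addr_maxr addr0 addrCA subrr addr0 maxC.
  move=> x; apply: cvgD; first exact: cvg_cst.
  apply: (continuous_compo (f := fun x : R => x - y) (g := Num.max 0)); last exact: continuous_max0.
  by move=> z; apply: cvgB; [exact: cvg_id|exact: cvg_cst].
have cmaxl (y : R) : continuous (fun x : R => Num.max y x).
  by rewrite (_ : (fun x => _) = (fun x => Num.max x y)) //; apply/funext => x; rewrite maxC.
repeat apply: measurableI.
- exact: measurable_le_itv.
- apply: measurable_bigcup_count => q _; apply: measurableC.
  by apply: measurable_ray.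
- exact: measurable_le_itv.
- exact: measurable_le_itv.
- by apply: measurable_le_itv => // x; exact: measurable_evalT.
- by apply: measurable_ray.
- by apply: measurable_ray.
- apply: measurable_le_itv => [w x|x]; first by apply: cvgB; [exact: cw|exact: cvg_cst].
  by apply: measurable_funB; exact: measurable_evalT.
- apply: measurable_le_itv2 => [w y x|w x y|x y].
  + by apply: cvgB; [exact: (continuous_compo (cmaxr y) (cw w))|exact: cw].
  + by apply: cvgB; [exact: (continuous_compo (cmaxl x) (cw w))|exact: cvg_cst].
  + by apply: measurable_funB; exact: measurable_evalT.
- apply: measurable_le_itv2 => [w y x|w x y|x y].
  + by apply: cvg_norm; apply: cvgB; [exact: cshift|exact: cw].
  + by apply: cvg_norm; apply: cvgB; [exact: cshift'|exact: cvg_cst].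
  + apply: measurableT_comp => //; apply: measurable_funB; exact: measurable_evalT.
Qed.

Lemma measurable_rv_set rho th : measurable (rv_set rho th : set pathT).
Proof. by move: th => [[[[[[u s] t] v] mu] eta] N]; exact: measurable_right_valley. Qed.

Lemma right_valley_scale al rho u s t v mu eta kap (w : env_path R) : 0 < al ->
  right_valley 1 rho u s t v mu eta kap (aff al 0 w) ->
  right_valley al (al * rho) (al ^+ 2 * u) (al ^+ 2 * s) (al ^+ 2 * t) (al ^+ 2 * v)
    (al * mu) (al * eta) (al ^+ 2 * kap) w.
Proof.
move=> a0 [u0 s0 st tv eta0 kap0 B1 [y syt wy] B3 B4 B5 B6 B7 B8 B9 B10].
have a2 : 0 < al ^+ 2 by rewrite exprn_gt0.
have an : al != 0 by rewrite gt_eqF.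
have E x : w x = al * aff al 0 w (al ^- 2 * x).
  by rewrite aff0E mulrA divff// mul1r mulrA divff ?mul1r// expf_neq0.
have S a b x : al ^+ 2 * a <= x <= al ^+ 2 * b -> a <= al ^- 2 * x <= b.
  by rewrite ler_pdivlMl// ler_pdivrMl.
have Pm (a b : R) : a <= b -> al * a <= al * b by rewrite ler_pM2l.
have W (x : R) : w (al ^+ 2 * x) = al * aff al 0 w x by rewrite aff0E mulrA divff// mul1r.
split.
- by rewrite pmulr_rlt0.
- by rewrite mulr_ge0// ltW.
- by rewrite ltr_pM2l.
- by rewrite ltr_pM2l.
- by rewrite mulr_gt0.
- by rewrite mulr_gt0.
- by move=> x /S/B1/Pm; rewrite -E.
- exists (al ^+ 2 * y); first by rewrite !ltr_pM2l.
  by rewrite W -mulrDr ltr_pM2l.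
- by move=> x /S/B3/Pm; rewrite -E mulrDr mulrCA.
- by move=> x /S/B4/Pm; rewrite -E mulrDr mulrCA.
- by move=> x /S/B5/Pm; rewrite -E mulrDr.
- by rewrite W; have := Pm _ _ B6; rewrite !mulrDr mulr1 mulrCA.
- by rewrite W; have := Pm _ _ B7; rewrite !mulrDr mulr1 mulrCA.
- move=> x; rewrite -[X in X <= x](mulr0 (al ^+ 2)) => /S/B8/Pm.
  by rewrite mulrDr -E W mulrCA.
- move=> x y' ux xy yt.
  have := B9 (al ^- 2 * x) (al ^- 2 * y'); rewrite ler_pdivlMl// ler_pM2l ?invr_gt0// ler_pdivrMl//.
  by move=> /(_ ux xy yt)/Pm; rewrite mulrBr mulrDr mulr1 -!E mulrCA.
- move=> x z /S xuv; rewrite -[X in X <= z](mulr0 (al ^+ 2)) => /S zk.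
  have := B10 _ _ xuv zk => /Pm; rewrite -[X in X * `|_|]gtr0_norm// -normrM mulrBr -E.
  by rewrite -mulrDr -E.
Qed.

Lemma locext_shift (a : R) (f g : R -> R) k x : (forall y, g y = f (a + y) - k) ->
  locext f (a + x) -> locext g x.
Proof.
move=> gE [e e0 [s h]]; exists e => //; exists s => y yx.
by rewrite !gE !mulrBr lerD2r; apply: h; rewrite opprD addrACA subrr add0r.
Qed.

Lemma locext_refl (w : R -> R) x : locext (fun y => w (- y)) x -> locext w (- x).
Proof.
move=> [e e0 [s h]]; exists e => //; exists s => y yx.
have := h (- y); rewrite opprK; apply.
by rewrite -opprD normrN; move: yx; rewrite opprK.
Qed.

Section almost_surely.
Variable P : probability (pathD (@setT R)) R.
Hypothesis wP : wiener P.

Lemma ae_half_line (t : R) (Q : env_path R -> Prop) :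
  (forall P' : probability (pathD (half_line R)) R, wiener P' -> {ae P', forall f, Q f}) ->
  {ae P, forall w, Q (aff 1 t w)}.
Proof.
move=> h.
have Dt : (@setT R) t by [].
have DD : forall x, half_line R x -> (@setT R) (t + 1 ^+ 2 * x) by [].
exact: ae_law (h _ (wiener_aff Dt DD (oner_neq0 R) wP)).
Qed.

Lemma ae_refl (Q : env_path R -> Prop) :
  (forall P' : probability (pathD (@setT R)) R, wiener P' -> {ae P', forall f, Q f}) ->
  {ae P, forall w, Q (refl w)}.
Proof. by move=> h; exact: ae_law (h _ (wiener_refl wP)). Qed.

Lemma aff10 (w : env_path R) : aff 1 0 w = w.
Proof. by apply: env_path_eq => x; rewrite aff0E invr1 expr1n !mul1r. Qed.

Lemma ae_half_line0 (Q : env_path R -> Prop) :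
  (forall P' : probability (pathD (half_line R)) R, wiener P' -> {ae P', forall f, Q f}) ->
  {ae P, forall w, Q w}.
Proof. by move=> h; apply: ae_imp (ae_half_line 0 h) => w; rewrite aff10. Qed.

(** Recentering at - n, with n larger than |x|, moves both points to the positive half-line. *)
Lemma ae_differ c : {ae P, forall w, forall x y, x < y ->
  locext (env_fun w) x -> locext (env_fun w) y -> env_fun w y - env_fun w x <> c}.
Proof.
have h (n : nat) : {ae P, forall w, differ_by (env_fun (aff 1 (- n%:R) w)) c}.
  by apply: (ae_half_line (- n%:R) (Q := fun f => differ_by (env_fun f) c)) => P' wP'; exact: ae_locext_diff wP' c.
apply: ae_imp (ae_all_nat h) => w {}h x y xy ex ey.
pose n := (Num.truncn `|x|).+1.
have xn : 0 < n%:R + x.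
  have := truncnS_gt `|x|; have := ler_norm (- x); rewrite normrN -/n; lra.
have E z : env_fun (aff 1 (- n%:R) w) z = w (- n%:R + z) - w (- n%:R).
  by rewrite /= invr1 expr1n !mul1r.
have K z : - n%:R + (n%:R + z) = z by rewrite addrA addNr add0r.
have := h n (n%:R + x) (n%:R + y) xn; rewrite ltrD2l => /(_ xy).
rewrite !E !K opprB addrA subrK; apply; apply: (locext_shift E); by rewrite K.
Qed.

Lemma below_far (w : env_path R) (a c : R) : (forall c, exists2 u, 0 <= u & w u <= c) ->
  exists2 y, a < y & w y <= c.
Proof.
move=> h; have [a0|a0] := ltP a 0.
  by have [u u0 wu] := h c; exists u => //; exact: lt_le_trans u0.
have [z z0 Hz] := EVT_min_cont (@env_continuous _ w) a0.
have [u u0 wu] := h (Num.min c (w z - 1)); move: wu; rewrite le_min => /andP[wc wz].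
exists u => //; rewrite ltNge; apply/negP => ua.
by have := Hz u; rewrite u0 ua => /(_ isT); lra.
Qed.

Lemma ae_falls : {ae P, forall w, falls (env_fun w)}.
Proof.
have h1 : {ae P, forall w : pathT, forall c, exists2 u, 0 <= u & env_fun w u <= c}.
  apply: (ae_half_line0 (Q := fun w => forall c, exists2 u, 0 <= u & env_fun w u <= c)) => P' wP'.
  exact: ae_hits_opp.
have h2 : {ae P, forall w : pathT, forall c, exists2 u, 0 <= u & env_fun (refl w) u <= c}.
  apply: (@ae_law _ _ _ _ _ P _ measurable_refl (fun w => forall c, exists2 u, 0 <= u & env_fun w u <= c)).
  have wr := wiener_refl wP.
  have Dt : (@setT R) (0 : R) by [].
  have DD : forall x, half_line R x -> (@setT R) (0 + 1 ^+ 2 * x) by [].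
  have := ae_law (ae_hits_opp (wiener_aff Dt DD (oner_neq0 R) wr)).
  by apply: ae_imp => w; rewrite aff10.
apply: ae_imp (ae_and h1 h2) => w [H1 H2] c x; split; last exact: below_far.
have [y y1 y2] := @below_far (refl w) (- x) c H2.
by exists (- y) => //; rewrite ltrNl.
Qed.

Definition exits (w : env_path R) : Prop := exists q m p v, exit_data w q m p v.

Lemma ae_half_exits (P' : probability (pathD (half_line R)) R) : wiener P' ->
  {ae P', forall f, exits f}.
Proof.
move=> wP'.
have h := ae_and (ae_and (ae_locext_diff wP' 0) (ae_locext_diff wP' 1))
  (ae_and (ae_hits wP') (ae_and (ae_not_below wP') (ae_not_above wP'))).
apply: ae_imp h => f [[d0 d1] [fh [up down]]].
apply: exit_exists => //; [exact: env_continuous|exact: env_at0| |].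
  exact: fh.
move=> s /up nb; apply: contrapT => no; apply: nb => x xs.
by rewrite leNgt; apply/negP => fx; apply: no; exists x.
Qed.

End almost_surely.

Lemma ae_exits (P : probability (pathD (@setT R)) R) : wiener P ->
  {ae P, forall w, exits w /\ exits (refl w)}.
Proof.
move=> wP; apply: ae_and; first by apply: (ae_half_line0 wP) => P'; exact: ae_half_exits.
apply: (ae_refl wP) => P' wP'; apply: (ae_half_line0 wP') => P''; exact: ae_half_exits.
Qed.

Definition regular (w : env_path R) : Prop := distinct_extrema w /\ falls w.

Lemma ae_regular (P : probability (pathD (@setT R)) R) : wiener P -> {ae P, forall w, regular w}.
Proof.
move=> wP; apply: ae_imp (ae_and (ae_differ wP 0) (ae_falls wP)) => w [h1 h2]; split=> //.
by move=> x y xy ex ey E; apply: (h1 x y xy ex ey); rewrite E subrr.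
Qed.

(** A tie between the heights of the two sides would make two local extrema of W, one on each side
    of 0, differ by exactly 0, 1 or -1. *)
Lemma ae_rv_set (P : probability (pathD (@setT R)) R) rho : wiener P -> 0 < rho ->
  {ae P, forall w, exists th, rv_set rho th w \/ rv_set rho th (refl w)}.
Proof.
move=> wP rho0.
have h := ae_and (ae_exits wP) (ae_and (ae_differ wP 0) (ae_and (ae_differ wP 1) (ae_differ wP (-1)))).
apply: ae_imp h => w [[[q [m [p [v E]]]] [q' [m' [p' [v' E']]]]] [d0 [d1 dN1]]].
have side (x y : R) : 0 < x -> 0 < y -> - x < y by lra.
have [p0 m0] : 0 < p /\ 0 < m by case: E => *; split => //; lra.
have [p'0 m'0] : 0 < p' /\ 0 < m' by case: E' => *; split => //; lra.
have ep := ex_p_ext E; have em := ex_m_ext E.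
have ep' := locext_refl (ex_p_ext E'); have em' := locext_refl (ex_m_ext E').
case: (ltgtP (Num.max (w p) (w m + 1)) (Num.max (refl w p') (refl w m' + 1))) => [lt|lt|].
- have [u [s [t [v2 [mu [eta [N rv]]]]]]] := right_params rho0 E E' lt.
  by exists (u, s, t, v2, mu, eta, N); left.
- have E2 : exit_data (refl (refl w)) q m p v.
    by move: E; congr exit_data; apply/funext => y /=; rewrite opprK.
  have lt2 : Num.max (refl w p') (refl w m' + 1) < Num.max (refl (refl w) p) (refl (refl w) m + 1).
    by rewrite /= !opprK.
  have [u [s [t [v2 [mu [eta [N rv]]]]]]] := right_params rho0 E' E2 lt2.
  by exists (u, s, t, v2, mu, eta, N); right.
move=> Eq; exfalso; move: Eq; rewrite /=.
case: (leP (w p) (w m + 1)) => _; case: (leP (w (- p')) (w (- m') + 1)) => _ Eq.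
- by apply: (d0 (- m') m (side _ _ m'0 m0) em' em); lra.
- by apply: (dN1 (- p') m (side _ _ p'0 m0) ep' em); lra.
- by apply: (d1 (- m') p (side _ _ m'0 p0) em' ep); lra.
- by apply: (d0 (- p') p (side _ _ p'0 p0) ep' ep); lra.
Qed.

(** Since the minimum over [u, v] is attained at one point only, its position relative to c is read
    on minima over intervals, which are measurable in W. *)
Lemma right_argmin h rho u s t v mu eta kap (w : env_path R) c : 0 < h -> regular w ->
  right_valley h rho u s t v mu eta kap w ->
  (valley_bottom h w <= c <-> (v <= c \/ (u <= c /\ ext true u (Num.min c v) w <= ext true u v w))) /\
  (c <= valley_bottom h w <-> (c <= u \/ (c <= v /\ ext true (Num.max c u) v w <= ext true u v w))).
Proof.
move=> h0 [dw fw] rv; have cw := @env_continuous _ w.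
have [m [/andP[sm mt] bm mmin muniq]] := right_valley_bottom h0 cw dw fw rv.
rewrite (is_bottomE bm); case: rv => u0 s0 st tv *.
have [um mv] : u <= m /\ m <= v by split; lra.
have uv : u <= v by lra.
have Em : ext true u v w = w m.
  by apply: extE; [rewrite um|move=> y /mmin; rewrite expr1 !mulN1r lerN2].
have key a b : u <= a -> a <= b -> b <= v -> ext true a b w <= w m <-> a <= m <= b.
  move=> ua ab bv; split=> [|mab].
    have [x xab Hx] := ext_attained true cw ab.
    rewrite (extE xab Hx) => wx.
    have xuv : u <= x <= v by case/andP: xab => ax xb; rewrite (le_trans ua ax) (le_trans xb bv).
    by rewrite -(muniq x xuv wx).
  rewrite (extE mab) // => y /andP[ay yb]; rewrite expr1 !mulN1r lerN2; apply: mmin.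
  by rewrite (le_trans ua ay) (le_trans yb bv).
split; rewrite Em; split.
- move=> mc; have [vc|cv] := leP v c; [by left|right].
  have uc := le_trans um mc; split=> //.
  by apply/key => //; [exact: ltW|rewrite um].
- move=> [vc|[uc]]; first exact: le_trans vc.
  move/key => /(_ (lexx _)); rewrite le_min uc uv ge_min lexx orbT => /(_ isT isT)/andP[_].
  by rewrite le_min => /andP[].
- move=> cm; have [cu|uc] := leP c u; [by left|right].
  have cv := le_trans cm mv; split=> //.
  by apply/key => //; [exact: ltW|rewrite cm].
- move=> [cu|[cv]]; first exact: le_trans um.
  have l1 : u <= Num.max c u by rewrite le_max lexx orbT.
  have l2 : Num.max c u <= v by rewrite ge_max cv.
  by move/(key _ _ l1 l2 (lexx v)); rewrite ge_max => /andP[/andP[]].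
Qed.

Lemma bottom_refl h rho u s t v mu eta kap (w : env_path R) : 0 < h -> regular (refl w) ->
  right_valley h rho u s t v mu eta kap (refl w) ->
  valley_bottom h w = - valley_bottom h (refl w).
Proof.
move=> h0 [dw fw] rv.
have [m [_ bm _ _]] := right_valley_bottom h0 (@env_continuous _ (refl w)) dw fw rv.
by rewrite (is_bottomE bm); apply: is_bottomE; exact: is_bottom_refl.
Qed.

Lemma regular_refl (w : env_path R) : regular w -> regular (refl w).
Proof.
move=> [dw fw]; split.
  move=> x y xy /locext_refl ex /locext_refl ey /= E.
  by apply: (dw (- y) (- x)) => //; rewrite ltrN2.
move=> c x; split.
  by have [_ [y y1 y2]] := fw c (- x); exists (- y); [rewrite ltrNl|rewrite /= opprK].
by have [[y y1 y2] _] := fw c (- x); exists (- y); [rewrite ltrNr|rewrite /= opprK].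
Qed.

Lemma refl_aff al (w : env_path R) : refl (aff al 0 w) = aff al 0 (refl w).
Proof. by apply: env_path_eq => x; rewrite /= !add0r mulrN oppr0. Qed.

Lemma ae_aff_scale (P : probability (pathD (@setT R)) R) al (Q : env_path R -> Prop) :
  wiener P -> al != 0 ->
  (forall P' : probability (pathD (@setT R)) R, wiener P' -> {ae P', forall w, Q w}) ->
  {ae P, forall w, Q (aff al 0 w)}.
Proof.
move=> wP al0 h.
have Dt : (@setT R) 0 by [].
have DD : forall x, (@setT R) x -> (@setT R) (0 + al ^+ 2 * x) by [].
exact: ae_law (h _ (wiener_aff Dt DD al0 wP)).
Qed.

(** For each choice of parameters satisfied by the rescaled environment or by its reflection,
    [right_argmin] gives a measurable description of the event. Countably many choices cover almost
    every environment. *)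
Lemma valley_bottom_ray (P : probability (pathD (@setT R)) R) h c : wiener P -> 0 < h ->
  exists2 A : set pathT, measurable A &
    {ae P, forall w, valley_bottom h (env_fun w) <= c <-> A w}.
Proof.
move=> wP h0; have hn0 : h != 0 by rewrite gt_eqF.
pose hr (q : rat) : R := h ^+ 2 * ratr q.
pose V (th : valley_param) : set pathT := aff h 0 @^-1` rv_set 1 th.
pose V' (th : valley_param) : set pathT := refl @^-1` V th.
have mV th : measurable (V th).
  have := @measurable_aff R setT setT h 0 I (fun _ _ => I) measurableT _ (measurable_rv_set 1 th).
  by rewrite setTI.
have mV' th : measurable (V' th).
  by have := @measurable_refl R measurableT _ (mV th); rewrite setTI.
pose B (th : valley_param) : set pathT := let: (u, s, t, v, mu, eta, N) := th in
  [set w : pathT | hr v <= c \/ (hr u <= c /\ ext true (hr u) (Num.min c (hr v)) w <= ext true (hr u) (hr v) w)].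
pose B' (th : valley_param) : set pathT := let: (u, s, t, v, mu, eta, N) := th in
  refl @^-1` [set w : pathT | - c <= hr u \/ (- c <= hr v /\ ext true (Num.max (- c) (hr u)) (hr v) w <= ext true (hr u) (hr v) w)].
have mext a b : a <= b -> measurable_fun setT (fun w : pathT => ext true a b (env_fun w)).
  by move=> ab; apply: (measurable_ext (X := fun w : pathT => (w : env_path R))) => // x _; exact: measurable_evalT.
have mcase (p q : Prop) (a b a' b' : R) : (q -> a <= b) -> (q -> a' <= b') ->
    measurable [set w : pathT | p \/ (q /\ ext true a b w <= ext true a' b' w)].
  move=> ab ab'; have [hp|hp] := pselect p.
    by rewrite (_ : [set w | _] = setT)//; apply/seteqP; split=> // w _; left.
  have [hq|hq] := pselect q; last first.
    by rewrite (_ : [set w | _] = set0)//; apply/seteqP; split=> // w [|[]].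
  rewrite (_ : [set w | _] = [set w : pathT | ext true a b w - ext true a' b' w <= 0]).
    by apply: measurable_ray; apply: measurable_funB; apply: mext; auto.
  apply/seteqP; split=> w /=; last by rewrite subr_le0; right.
  by move=> [//|[_]]; rewrite subr_le0.
(* The intervals must be nonempty for [ext] to be known measurable; this is automatic when some path
   satisfies the parameters. *)
pose ok (th : valley_param) : Prop := let: (u, s, t, v, mu, eta, N) := th in (u <= v)%R.
have mB th : ok th -> measurable (B th) /\ measurable (B' th).
  move: th => [[[[[[u s] t] v] mu] eta] N] uv.
  have huv : hr u <= hr v by rewrite ler_pM2l ?exprn_gt0// ler_rat.
  split.
    by apply: mcase => // uc; rewrite le_min uc.
  rewrite /B' -[X in measurable X]setTI; apply: measurable_refl => //.
  by apply: mcase => // cv; rewrite ge_max cv.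
pose A : set pathT := (\bigcup_(th in ok) (V th `&` B th)) `|` (\bigcup_(th in ok) (V' th `&` B' th)).
exists A.
  apply: measurableU.
    by apply: measurable_bigcup_count => th o; apply: measurableI => //; exact: (mB th o).1.
  by apply: measurable_bigcup_count => th o; apply: measurableI => //; exact: (mB th o).2.
have h2 := ae_aff_scale wP hn0 (fun P' wP' => ae_rv_set wP' ltr01).
apply: ae_imp (ae_and (ae_regular wP) h2) => w [reg [th0 V0]].
have regr := regular_refl reg.
have okV th w' : rv_set 1 th w' -> ok th.
  move: th => [[[[[[u s] t] v] mu] eta] N] [u0 s0 st tv *].
  by rewrite /ok -(ler_rat R); lra.
have EB th : V th w -> valley_bottom h w <= c <-> B th w.
  move: th => [[[[[[u s] t] v] mu] eta] N] /(right_valley_scale h0) rv.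
  exact: (right_argmin c h0 reg rv).1.
have EB' th : V' th w -> valley_bottom h w <= c <-> B' th w.
  move: th => [[[[[[u s] t] v] mu] eta] N] /(right_valley_scale h0) rv.
  rewrite (bottom_refl h0 regr rv) lerNl.
  exact: (right_argmin (- c) h0 regr rv).2.
split=> [vc|].
  case: V0 => V0; [left|right]; exists th0; (try exact: okV V0); split => //.
  - exact: (EB _ V0).1.
  - by rewrite /V'/V/= -refl_aff.
  - by apply: (EB' _ _).1 => //; rewrite /V'/V/= -refl_aff.
by move=> [] [th _ [Vw Bw]]; [apply: (EB _ Vw).2|apply: (EB' _ Vw).2].
Qed.

Lemma prob_rv_set (P : probability (pathD (@setT R)) R) rho eps : wiener P -> 0 < rho -> 0 < eps ->
  exists n : nat, forall al, 0 < al -> (1 - eps%:E <= P (\bigcup_(k < n)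
    oapp (fun th => [set w : pathT | rv_set rho th (aff al 0 w) \/ rv_set rho th (aff al 0 (refl w))]) set0
      (unpickle k : option valley_param)))%E.
Proof.
move=> wP rho0 e0.
pose S (k : nat) : set pathT := oapp (fun th => rv_set rho th `|` refl @^-1` rv_set rho th) set0
  (unpickle k : option valley_param).
have mS k : measurable (S k).
  rewrite /S; case: unpickle => [th|] //=; apply: measurableU; first exact: measurable_rv_set.
  by have := @measurable_refl R measurableT _ (measurable_rv_set rho th); rewrite setTI.
pose E n := \bigcup_(k < n) S k.
have mE n : measurable (E n) by apply: bigcup_measurable.
have [n Hn] : exists n, (1 - eps%:E <= P (E n))%E.
  apply: contrapT => /forallNP h.
  have : (P (\bigcup_n E n) <= 1 - eps%:E)%E.
    apply: prob_bigcup_le => //.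
      by move=> k m km f [i /= ik Gi]; exists i => //=; lia.
    by move=> k; have /negP := h k; rewrite -ltNge => /ltW.
  have -> : P (\bigcup_n E n) = 1%E.
    apply: ae_prob1; first exact: bigcup_measurable.
    apply: ae_imp (ae_rv_set wP rho0) => w [th H].
    exists (pickle th).+1; first by [].
    exists (pickle th); first exact: ltnSn.
    by rewrite /S pickleK; exact: H.
  by rewrite -EFinB lee_fin; lra.
exists n => al al0.
have aln0 : al != 0 by rewrite gt_eqF.
have Dt : (@setT R) (0 : R) by [].
have DD : forall x : R, (@setT R) x -> (@setT R) (0 + al ^+ 2 * x) by [].
apply: le_trans Hn _.
apply: le_trans (lee_eq (wiener_unique I wP (wiener_aff Dt DD aln0 wP) (mE n))) _.
apply: lee_eq; rewrite /law /pushforward; congr (P _).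
apply/seteqP; split=> w [k kn] H; exists k; (try exact: kn); move: H; rewrite /S/=;
  case: (unpickle k) => [th|]; (try by []); by rewrite /= refl_aff.
Qed.

End random_valleys.

(** * The local time in a valley *)

Section brox_data.
Context {R : realType}.
Local Notation leb := (@lebesgue_measure R).

(* T is the clock of the diffusion in the environment W driven by beta, l its
   local time and lb the local time of beta. *)
Record brox_lt (W beta : env_path R) (l : R -> R -> R) (T : R -> R) (lb : R -> R -> R) : Prop := BroxLt {
  bx_cont : continuous T;
  bx_incr : forall s t, s < t -> T s < T t;
  bx_0 : T 0 = 0;
  bx_lt : is_lt beta lb;
  bx_l : forall u y, 0 <= u -> l (T u) y = expR (- W y) * lb u (scale W y);
  bx_T : forall u A B, 0 <= u -> A <= B ->
    (forall s, 0 <= s <= u -> scale W A <= beta s <= scale W B) -> T u = cint A B (l (T u)) }.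

Lemma brox_lt_intro (W beta : env_path R) (B : R -> R) (l : R -> R -> R) :
  (forall z, exists x, scale W x = z) -> (forall s, 0 <= s -> B s = beta s) ->
  {within [set p : R * R | 0 <= p.1], continuous (fun p : R * R => l p.1 p.2)} ->
  (forall (f : R -> R) (t : R), measurable_fun setT f -> [bounded f x | x in setT] -> 0 <= t ->
    (\int[leb]_(s in `[0%R, t]) (f (xpath W B s))%:E = \int[leb]_x (f x * l t x)%:E)%E) ->
  brox_lt W beta l (tclock W beta) (lbeta W beta l).
Proof.
move=> Ss BE lcont locc; split.
- exact: continuous_tclock.
- by move=> s t; exact: tclock_lt.
- exact: tclock0.
- exact: (lbeta_is_lt Ss BE lcont locc).
- move=> u y u0; rewrite /lbeta scaleK (max_idPr u0) mulrA -expRD addNr expR0 mul1r.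
  by [].
move=> u A C u0 AC range.
have t0 := tclock_ge0 Ss beta u0.
have cl := continuous_l_at lcont t0.
apply: EFin_inj; rewrite -cintE//.
(* The diffusion stays in [A, C] up to time T u, so the occupation formula for this indicator
   returns T u. *)
pose f : R -> R := \1_(`[A, C]%classic).
have mf : measurable_fun setT f by exact: measurable_indic.
have bf : [bounded f x | x in setT].
  exists 1; split; first exact: num_real.
  move=> M M1 x _ /=; rewrite /f indicE; apply: le_trans (ltW M1).
  by case: (x \in _); rewrite ?normr0 ?normr1.
have := locc f _ mf bf t0.
have -> : (\int[leb]_x (f x * l (tclock W beta u) x)%:E = \int[leb]_(x in `[A, C]) (l (tclock W beta u) x)%:E)%E.
  rewrite [RHS]integral_mkcond; apply: eq_integral => x _.
  by rewrite patchE /f indicE; case: (x \in _); rewrite ?mul1r ?mul0r.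
move=> <-.
rewrite (eq_integral (fun=> 1%E)); last first.
  move=> x; rewrite inE/= in_itv/= => xt.
  have [u' /andP[u'0 u'u] <-] := @tclock_range _ W Ss beta u x u0 xt.
  rewrite (xpathE Ss BE u'0) /f indicE mem_set//= in_itv/=.
  have /andP[r1 r2] := range u' ltac:(by rewrite u'0).
  by rewrite -(scale_le_iff W A) -(scale_le_iff W _ C) (scale_invK Ss) r1 r2.
by rewrite integral_cst//= mul1e lebesgue_measure_itv/= lte_fin; case: ltgtP t0 => // [_|<-] _; rewrite ?sube0 ?subr0.
Qed.

Lemma cint_opp (g : R -> R) a b : continuous g -> a <= b ->
  cint a b (fun x => g (- x)) = cint (- b) (- a) g.
Proof.
move=> cg ab.
have cgN : continuous (fun x => g (- x)) by apply: continuous_compo => // x; exact: cvgN.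
have d (x : R) : is_derive x (1 : R) (fun x => - prim g (- x)) (g (- x)).
  have dN : is_derive x (1 : R) (fun y : R => - y) (- 1).
    by apply: is_deriveN.
  have := is_derive_prim (- x) cg => dg.
  have h : is_derive x (1 : R) (- (prim g \o (fun y : R => - y))) (- (g (- x) * - 1)).
    by apply: is_deriveN; apply: is_derive1_comp.
  by move: h; rewrite mulrN1 opprK.
rewrite (cint_derive cgN d ab) prim_itv ?lerN2//.
by rewrite opprK addrC.
Qed.

Lemma refl_scale (W : env_path R) y : scale (refl W) y = - scale W (- y).
Proof.
have cW := @continuous_expW R W.
rewrite !scaleE /prim.
case: (leP 0 y) => y0; case: (leP 0 (- y)) => y1.
- have -> : y = 0 by lra.
  by rewrite oppr0 /cint set_itv1 !Rintegral_set1 oppr0.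
- by rewrite opprK; have := @cint_opp _ 0 y cW y0; rewrite oppr0; exact.
- by have := @cint_opp _ y 0 cW (ltW y0); rewrite oppr0 => E; congr (- _); exact: E.
- by lra.
Qed.

Lemma affN1 (beta : env_path R) x : aff (-1) 0 beta x = - beta x.
Proof. by rewrite aff0E invrN1 sqrrN expr1n !mul1r mulN1r. Qed.

(** Reflecting the environment and B together leaves the clock unchanged and reflects the diffusion,
    which reduces valleys on the left of 0 to those on the right. *)
Lemma brox_lt_refl (W beta : env_path R) l T lb : brox_lt W beta l T lb ->
  brox_lt (refl W) (aff (-1) 0 beta) (fun t x => l t (- x)) T (fun u z => lb u (- z)).
Proof.
move=> [h1 h2 h3 [h4 h4'] h5 h6].
have cT u : 0 <= u -> continuous (lb u) by move=> u0; exact: (@lt_continuous_z R beta lb (conj h4 h4') u u0).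
have cl u : 0 <= u -> continuous (l (T u)).
  move=> u0; have -> : l (T u) = fun y => expR (- W y) * lb u (scale W y) by apply/funext => y; exact: h5.
  apply: continuous_mul; last by apply: (continuous_compo (@continuous_scale R W)); exact: cT.
  by apply: continuous_expR_comp => y; apply: cvgN; exact: env_continuous.
split; [exact: h1|exact: h2|exact: h3| | |].
- split.
    apply: (continuous_compo (f := fun p : R * R => (p.1, - p.2)) (g := fun p : R * R => lb (Num.max 0 p.1) p.2)) => //.
    apply: continuous_pairing; first exact: continuous_fst.
    by apply: (continuous_compo (g := fun x : R => - x)); [exact: continuous_snd|move=> x; exact: cvgN].
  move=> u M phi u0 M0 cphi phi0.
  have cphiN : continuous (fun x => phi (- x)) by apply: continuous_compo => // x; exact: cvgN.
  have phiN0 z : M <= `|z| -> phi (- z) = 0 by move=> zM; apply: phi0; rewrite normrN.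
  have H := h4' u M (fun x => phi (- x)) u0 M0 cphiN phiN0.
  rewrite (@eq_cint _ _ ((fun x => phi (- x)) \o beta)); last first.
    by move=> s _; exact: (congr1 phi (affN1 beta s)).
  rewrite H.
  have := @cint_opp (fun z => phi (- z) * lb u z) (- M) M.
  rewrite opprK => <- //; last by lra.
    by apply: eq_cint => z _; rewrite opprK.
  by apply: continuous_mul => //; exact: cT.
- by move=> u y u0; rewrite h5//= refl_scale opprK.
move=> u A B u0 AB range; rewrite cint_opp//; last exact: cl.
have BA : - B <= - A by rewrite lerN2.
apply: (h6 u _ _ u0 BA).
move=> s su; have := range s su; rewrite !refl_scale affN1 !lerN2.
by rewrite andbC.
Qed.

End brox_data.

(** * Deterministic estimates in a valley *)

Section valley_geometry.
Context {R : realType}.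
Variables (h r u s t v mu eta kap : R) (W : env_path R).
Hypotheses (h0 : 0 < h) (r0 : 0 < r) (r1 : r < 1).
Hypothesis rv : right_valley h (h * r / 2) u s t v mu eta kap W.
Variable m : R.
Hypothesis smt : s < m < t.
Hypothesis mmin : forall x, u <= x <= v -> W m <= W x.
Hypothesis kap1 : 1 <= kap.
Local Notation S := (scale W).
Local Notation V := (recentered W m).
Local Notation a := (left_hit V (h * r)).
Local Notation b := (right_hit V (h * r)).
Local Notation D := (v - u).

Let sm : s < m. Proof. by case/andP: smt. Qed.
Let mt : m < t. Proof. by case/andP: smt. Qed.
Local Ltac lra0 := pose proof sm; pose proof mt; lra.
Let um : u < m. Proof. by case: rv => *; lra0. Qed.
Let mv : m < v. Proof. by case: rv => *; lra0. Qed.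
Let m0 : 0 <= m. Proof. by case: rv => *; lra0. Qed.
Let eta0 : 0 < eta. Proof. by case: rv. Qed.
Let kap0 : 0 < kap. Proof. by case: rv. Qed.
Local Ltac lra1 := pose proof um; pose proof mv; pose proof m0; pose proof eta0; pose proof kap0; pose proof kap1; pose proof h0; lra0.

Lemma bottom_mu : W m < mu + eta.
Proof.
case: rv => u0 s0 st tv _ _ _ [y /andP[sy yt] wy] *.
by apply: le_lt_trans wy; apply: mmin; apply/andP; split; lra1.
Qed.

Lemma mu_bottom : mu <= W m.
Proof. by case: rv => u0 s0 st tv _ _ lb *; apply: lb; apply/andP; split; lra1. Qed.

Lemma osc x y : u <= x -> x <= v -> x <= y -> y <= x + kap -> W y <= W x + eta /\ W x <= W y + eta.
Proof.
move=> ux xv xy yx; have := rv_osc rv (x := x) (z := y - x).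
rewrite ux xv subr_ge0 xy lerBlDl yx => /(_ isT isT).
by rewrite (_ : x + (y - x) = y); [rewrite ler_norml => /andP[? ?]; split; lra|ring].
Qed.

(** W is higher at s than at m by more than 3 eta, but varies by at most eta within distance kap.
    The next two lemmas follow the same pattern. *)
Lemma kap_ms : kap < m - s.
Proof.
rewrite ltNge; apply/negP => le; have bm := bottom_mu.
have us : u <= s by case: rv => *; lra1.
have sv : s <= v by lra1.
have [] := osc us sv (ltW sm) ltac:(lra1).
by have := rv_outl rv (x := s); rewrite us lexx => /(_ isT); lra1.
Qed.

Lemma kap_tm : kap < t - m.
Proof.
rewrite ltNge; apply/negP => le; have bm := bottom_mu.
have tv : t <= v by case: rv => *; lra1.
have [] := osc (ltW um) (ltW mv) (ltW mt) ltac:(lra1).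
by have := rv_outr rv (x := t); rewrite tv lexx => /(_ isT); lra1.
Qed.

Lemma kap_u : kap < - u.
Proof.
rewrite ltNge; apply/negP => le.
have u0 : u <= 0 by case: rv => *; lra1.
have uv : u <= v by lra1.
have [] := osc (lexx u) uv u0 ltac:(lra1).
by have := rv_left rv (x := 0); rewrite lexx (_ : 0 <= t) => [/(_ isT)|]; lra1.
Qed.

Lemma kap_vm : kap < v - m.
Proof. by have := kap_tm; case: rv => *; lra1. Qed.

Lemma eta_h : 3 * eta <= h.
Proof.
have := rv_draw rv (x := m) (y := m) (ltW um) (lexx m) (ltW mt); lra1.
Qed.

Lemma V0 : V 0 = 0. Proof. by rewrite /recentered addr0 subrr. Qed.

Lemma continuous_V : continuous V.
Proof.
move=> x; apply: cvgB; last exact: cvg_cst.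
apply: (continuous_compo (f := fun y => m + y) (g := W)); last exact: env_continuous.
by move=> y; apply: cvgD; [exact: cvg_cst|exact: cvg_id].
Qed.

Let hr0 : 0 < h * r. Proof. exact: mulr_gt0. Qed.
Let hrh : h * r < h. Proof. by rewrite gtr_pMr. Qed.

Local Ltac lra2 := pose proof hr0; pose proof hrh; lra1.
Let VE x : V (x - m) = W x - W m.
Proof. by rewrite /recentered (_ : m + (x - m) = x)//; ring. Qed.

Let Vin x : s <= x <= t -> V (x - m) < h * r.
Proof.
move=> /(rv_in rv); rewrite VE; have := mu_bottom.
have : h * r / 2 < h * r by lra2.
by lra2.
Qed.

(** On [s, t] the recentered environment stays within h r / 2, below the level h r, while it exceeds
    h > h r at u. *)
Lemma left_hit_props : [/\ u - m <= a, a <= s - m & forall x, a < x <= 0 -> V x < h * r].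
Proof.
pose A := [set x | x <= 0 /\ h * r <= V x].
have Au : A (u - m).
  split; first by lra2.
  rewrite VE; have := rv_Wu rv; have := bottom_mu; lra2.
have ubA : ubound A (s - m).
  move=> x [x0 Vx]; rewrite leNgt; apply/negP => sx.
  have smx : s <= m + x <= t by apply/andP; split; lra2.
  by have := Vin smx; rewrite addrAC subrr add0r => /(le_lt_trans Vx); rewrite ltxx.
have hA : has_sup A by split; [exists (u - m)|exists (s - m)].
split.
- exact: ub_le_sup hA.2 _ Au.
- by apply: ge_sup => //; exists (u - m).
- move=> x /andP[ax x0]; rewrite ltNge; apply/negP => Vx.
  have : x <= sup A by apply: ub_le_sup hA.2 _ _.
  by rewrite leNgt ax.
Qed.

Lemma right_hit_props : [/\ t - m <= b, b <= v - m & forall x, 0 <= x < b -> V x < h * r].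
Proof.
pose A := [set x | 0 <= x /\ h * r <= V x].
have Av : A (v - m).
  split; first by lra2.
  rewrite VE; have := rv_Wv rv; have := bottom_mu; lra2.
have lbA : lbound A (t - m).
  move=> x [x0 Vx]; rewrite leNgt; apply/negP => sx.
  have smx : s <= m + x <= t by apply/andP; split; lra2.
  by have := Vin smx; rewrite addrAC subrr add0r => /(le_lt_trans Vx); rewrite ltxx.
have hA : has_inf A by split; [exists (v - m)|exists (t - m)].
split.
- by apply: lb_le_inf => //; exists (v - m).
- exact: ge_inf hA.2 _ Av.
- move=> x /andP[x0 xb]; rewrite ltNge; apply/negP => Vx.
  have : inf A <= x by apply: ge_inf hA.2 _ _.
  by rewrite leNgt xb.
Qed.

Let ua : u - m <= a. Proof. by case: left_hit_props. Qed.
Let as_ : a <= s - m. Proof. by case: left_hit_props. Qed.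
Let tb : t - m <= b. Proof. by case: right_hit_props. Qed.
Let bv : b <= v - m. Proof. by case: right_hit_props. Qed.
Let a0 : a < - kap. Proof. by have := as_; have := kap_ms; lra2. Qed.
Let b0 : kap < b. Proof. by have := tb; have := kap_tm; lra2. Qed.

Local Ltac lra3 := pose proof ua; pose proof as_; pose proof tb; pose proof bv; pose proof a0; pose proof b0; lra2.
Lemma below_barrier x : a <= x <= b -> V x <= h * r.
Proof.
move=> /andP[ax xb]; have [_ _ la] := left_hit_props; have [_ _ lb] := right_hit_props.
rewrite leNgt; apply/negP => Vx.
have e0 : 0 < V x - h * r by lra3.
have [d d0 dh] := near_cont x continuous_V e0.
have [x0|x0] := leP x 0.
  pose y := Num.min 0 (x + d / 2).
  have y1 : x - d < y by rewrite lt_min; apply/andP; split; lra3.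
  have y2 : y < x + d by rewrite gt_min; apply/orP; right; lra3.
  have y3 : a < y by rewrite lt_min; apply/andP; split; lra3.
  have y4 : y <= 0 by rewrite ge_min lexx.
  by have [? _] := dh _ y1 y2; have := la y; rewrite y3 y4 => /(_ isT); lra3.
pose y := Num.max 0 (x - d / 2).
have y1 : x - d < y by rewrite lt_max; apply/orP; right; lra3.
have y2 : y < x + d by rewrite gt_max; apply/andP; split; lra3.
have y3 : y < b by rewrite gt_max; apply/andP; split; lra3.
have y4 : 0 <= y by rewrite le_max lexx.
by have [? _] := dh _ y1 y2; have := lb y; rewrite y3 y4 => /(_ isT); lra3.
Qed.

Definition valley_mass : R := cint a b (fun y => expR (- V y)).
Local Notation I := valley_mass.

Let continuous_eV : continuous (fun y => expR (- V y)).
Proof. by apply: continuous_expR_comp => y; apply: cvgN; exact: continuous_V. Qed.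

(** The interval [m, m + 1] suffices: W stays there within eta of its minimum, as 1 <= kap. *)
Lemma mass_ge : expR (- eta) <= I.
Proof.
have c1 : a <= 0 by lra3.
have c2 : 0 <= b by lra3.
have c3 : 0 <= 1 :> R by [].
have c4 : 1 <= b by lra3.
rewrite /I (cint_chasles continuous_eV c1 c2) (cint_chasles continuous_eV c3 c4).
have p1 : 0 <= cint a 0 (fun y => expR (- V y)) by apply: cint_ge0 => x _; exact: expR_ge0.
have p2 : 0 <= cint 1 b (fun y => expR (- V y)) by apply: cint_ge0 => x _; exact: expR_ge0.
have : expR (- eta) * (1 - 0) <= cint 0 1 (fun y => expR (- V y)); last by rewrite subr0 mulr1; lra3.
rewrite -cint_cst//; apply: cint_le => // [x|x /andP[x0 x1]]; first exact: cvg_cst.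
rewrite ler_expR lerN2 /recentered.
by have [? _] := osc (x := m) (y := m + x) (ltW um) (ltW mv) ltac:(lra3) ltac:(lra3); lra3.
Qed.

Lemma mass_valley_gt0 : 0 < I.
Proof. exact: lt_le_trans (expR_gt0 _) mass_ge. Qed.

Lemma mass_le : I <= D.
Proof.
have ab : a <= b by lra3.
apply: (@le_trans _ _ (1 * (b - a))); last by rewrite mul1r; lra3.
rewrite -cint_cst//; apply: cint_le => // [x|x /andP[ax xb]]; first exact: cvg_cst.
rewrite expR_le1 oppr_le0 /recentered subr_ge0; apply: mmin.
by apply/andP; split; lra3.
Qed.

Lemma mass_shift : cint (m + a) (m + b) (fun y => expR (- W y)) = expR (- W m) * I.
Proof.
have cW : continuous (fun y => expR (- W y)).
  by apply: continuous_expR_comp => y; apply: cvgN; exact: env_continuous.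
have ab : a <= b by lra3.
have mab : m + 1 * a <= m + 1 * b by rewrite !mul1r lerD2l.
have := cint_subst (F := fun x => m + 1 * x) (f := fun=> 1) (@continuous_cstR R 1) cW
  (is_derive_affine m 1) ab mab.
rewrite !mul1r => <-; rewrite /I -cintZ//; apply: eq_cint => x _.
by rewrite mulr1 mul1r -expRD /recentered opprB addrA addNr add0r.
Qed.

Definition entrance : R := Num.max 0 (m + a).
Local Notation xa := entrance.

Lemma entrance_props : [/\ 0 <= xa, xa <= m - kap, m + a <= xa & xa <= t].
Proof.
have xam : xa <= m - kap.
  by rewrite ge_max; have := kap_ms; case: rv => *; apply/andP; split; lra3.
by split=> //; [rewrite le_max lexx|rewrite le_max lexx orbT|lra3].
Qed.

Lemma out_valley y : u <= y <= v -> y <= m + a \/ m + b <= y -> W m + 3 * eta <= W y.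
Proof.
move=> /andP[uy yv] [ya|yb]; have := bottom_mu.
  by have := rv_outl rv (x := y); rewrite uy (_ : y <= s) => [/(_ isT)|]; lra3.
by have := rv_outr rv (x := y); rewrite yv (_ : t <= y) => [/(_ isT)|]; lra3.
Qed.

Let cW : continuous (fun y => expR (W y)). Proof. exact: continuous_expW. Qed.

Lemma scaleB x y : x <= y -> S y - S x = cint x y (fun z => expR (W z)).
Proof. by move=> xy; rewrite scaleE -prim_itv. Qed.

Lemma scaleB_ge x y x' y' c : x' <= x -> x + 1 <= y -> y <= y' ->
  (forall z, x <= z <= y -> c <= W z) -> expR c <= S y' - S x'.
Proof.
move=> xx xy yy h1; have xy' : x <= y by lra3.
have : expR c * (y - x) <= S y - S x.
  rewrite scaleB// -cint_cst//; apply: cint_le => // [z|z zxy]; first exact: cvg_cst.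
  by rewrite ler_expR; exact: h1.
have := scale_le W xx; have := scale_le W yy.
have : expR c * 1 <= expR c * (y - x) by rewrite ler_wpM2l ?expR_ge0//; lra3.
by lra3.
Qed.

Lemma scaleB_le x y c : x <= y -> y - x <= D ->
  (forall z, x <= z <= y -> W z <= c) -> S y - S x <= D * expR c.
Proof.
move=> xy yxD h1; apply: (@le_trans _ _ (expR c * (y - x))).
  rewrite scaleB// -cint_cst//; apply: cint_le => // [z|z zxy]; first exact: cvg_cst.
  by rewrite ler_expR; exact: h1.
by rewrite mulrC ler_wpM2r// expR_ge0.
Qed.

(** W is high on a whole unit interval next to u. After tau the path moves by at most N times
    [depth_scale], which will be no more than this distance. *)
Lemma left_room : expR (W m + h + 3 * eta) <= S xa - S u.
Proof.
have ku := kap_u; have [x0 _ _ _] := entrance_props.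
have uk1 : u + 1 <= u + kap by rewrite lerD2l.
have uk0 : u + kap <= xa by lra3.
apply: (scaleB_ge (lexx u) uk1 uk0).
move=> z /andP[uz zk]; have uv : u <= v by lra3.
have [_ ?] := osc (lexx u) uv uz zk.
by have := rv_Wu rv; have := bottom_mu; lra3.
Qed.

Lemma right_room : expR (W m + h + 3 * eta) <= S v - S xa.
Proof.
have kv := kap_vm; have [_ xm _ _] := entrance_props.
have vk1 : v - kap + 1 <= v by lra3.
have vk0 : xa <= v - kap by lra3.
apply: (scaleB_ge vk0 vk1 (lexx v)).
move=> z /andP[uz zk].
have [? _] := osc (x := z) (y := v) ltac:(lra3) zk zk ltac:(lra3).
by have := rv_Wv rv; have := bottom_mu; lra3.
Qed.

(** To be compared with [entrance_scale]: the gap of 2 eta between the exponents is what prevents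
    the path from reaching S u before tau. *)
Lemma left_room0 : expR (W u - eta) <= - S u.
Proof.
have ku := kap_u; have uk0 : u + kap <= 0 by lra3.
have uk1 : u + 1 <= u + kap by rewrite lerD2l.
have := @scaleB_ge u (u + kap) u 0 (W u - eta) (lexx u) uk1 uk0.
rewrite scale0 sub0r; apply.
move=> z /andP[uz zk]; have uv : u <= v by lra3.
by have [_ ?] := osc (lexx u) uv uz zk; lra3.
Qed.

Lemma entrance_scale : S xa <= D * expR (W u - 3 * eta).
Proof.
have [x0 xm _ xt] := entrance_props; rewrite -[S xa]subr0 -(scale0 W).
apply: scaleB_le => //.
  by case: rv => *; lra3.
move=> z /andP[z0 zx]; have := rv_left rv (x := z); rewrite z0 (le_trans zx xt) => /(_ isT).
by lra3.
Qed.

(** From y on, W rises by at most h - 3 eta; between yi and y it stays within eta of W y, by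
    oscillation. *)
Lemma block_scale y yi : u <= y -> y <= yi + kap -> 0 <= yi -> yi <= xa ->
  expR (- W y) * (S xa - S yi) <= D * expR (h - 2 * eta).
Proof.
move=> uy yk yi0 yix; have [x0 xm _ xt] := entrance_props.
have uyi : u <= yi by case: rv => *; lra3.
have : S xa - S yi <= D * expR (W y + (h - 2 * eta)).
  apply: scaleB_le => //; first by case: rv => *; lra3.
  move=> z /andP[yiz zx]; have [yz|zy] := leP y z.
    by have := rv_draw rv uy yz (le_trans zx xt); lra3.
  have [_ ?] := osc (x := z) (y := y) (le_trans uyi yiz) ltac:(lra3) (ltW zy) ltac:(lra3).
  by have := eta_h; lra3.
move=> hS; apply: le_trans (ler_wpM2l (expR_ge0 _) hS) _.
by rewrite mulrCA -expRD addrA addNr add0r.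
Qed.

(** The exponent is lower than that of [depth_scale] by h (1 - r), which makes the valley look like
    a point at that scale. *)
Lemma valley_scale y : m + a <= y <= m + b -> `|S y - S xa| <= D * expR (W m + h * r).
Proof.
move=> /andP[ay yb]; have [x0 xm ax xt] := entrance_props.
have Wle z : m + a <= z -> z <= m + b -> W z <= W m + h * r.
  move=> az zb; have zab : a <= z - m <= b by apply/andP; split; lra3.
  by have := below_barrier zab; rewrite VE; lra3.
have [yx|xy] := leP xa y.
  rewrite ger0_norm ?subr_ge0 ?scale_le//; apply: scaleB_le => //; first by lra3.
  by move=> z /andP[z1 z2]; apply: Wle; lra3.
have Sle : S y - S xa <= 0 by rewrite subr_le0 scale_le// ltW.
rewrite ler0_norm// opprB; apply: scaleB_le; [exact: ltW|lra3|].
by move=> z /andP[z1 z2]; apply: Wle; lra3.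
Qed.

End valley_geometry.

(** * The path between two hitting times *)

Section hitting_blocks.
Context {R : realType}.
Variables (beta : env_path R) (lb : R -> R -> R) (Vg : R) (N : nat) (delta : R).
Hypotheses (blb : is_lt beta lb) (Vg0 : 0 <= Vg) (bh : forall c, hits c beta).

Let cb := @env_continuous _ beta.

Lemma at_hit x : 0 <= x -> beta (hit x beta) = x.
Proof. exact: hitE (bh x). Qed.

Lemma below_hit x s : 0 <= x -> 0 <= s <= hit x beta -> beta s <= x.
Proof.
move=> x0 /andP[s0]; rewrite le_eqVlt => /predU1P[->|sh]; first by rewrite at_hit.
by apply: ltW; exact: lt_hit.
Qed.

Lemma lt_hit_above x z : 0 <= x -> x <= z -> lb (hit x beta) z = 0.
Proof.
move=> x0 xz; apply: (lt_above cb blb (hit_ge0' x beta) xz) => s; exact: below_hit.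
Qed.

Definition lpost (x d w z : R) : R :=
  d^-1 * (lb (hit x beta + d ^+ 2 * w) (x + d * z) - lb (hit x beta) (x + d * z)).

Lemma good_post x d : 0 <= x -> 0 < d -> good Vg N delta (post x d beta) ->
  good_lt Vg N delta (post x d beta) (lpost x d).
Proof.
move=> x0 d0; have h := lt_aff blb d0 (hit_ge0' x beta).
by move=> /(goodE _ _ Vg0 h); rewrite at_hit.
Qed.

Lemma lpostE x d w z : 0 < d -> lb (hit x beta + d ^+ 2 * w) z = lb (hit x beta) z + d * lpost x d w ((z - x) / d).
Proof.
move=> d0; have dn : d != 0 by rewrite gt_eqF.
have -> : lpost x d w ((z - x) / d) = d^-1 * (lb (hit x beta + d ^+ 2 * w) z - lb (hit x beta) z).
  by rewrite /lpost (_ : x + d * ((z - x) / d) = z)//; field.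
by field.
Qed.

Lemma lpost0 x d z : lpost x d 0 z = 0.
Proof. by rewrite /lpost mulr0 addr0 subrr mulr0. Qed.

Lemma lpost_mono x d w w' z : 0 < d -> 0 <= w -> w <= w' -> lpost x d w z <= lpost x d w' z.
Proof.
move=> d0 w0 ww; have d2 : 0 <= d ^+ 2 by exact: sqr_ge0.
rewrite /lpost ler_wpM2l ?invr_ge0 ?(ltW d0)// lerD2r; apply: (lt_mono cb blb).
  by rewrite addr_ge0 ?hit_ge0'// mulr_ge0.
by rewrite lerD2l ler_wpM2l.
Qed.

Lemma lpost_ge0 x d w z : 0 < d -> 0 <= w -> 0 <= lpost x d w z.
Proof. by move=> d0 w0; rewrite -(lpost0 x d z) lpost_mono. Qed.

Lemma post_range x d w : 0 <= x -> 0 < d -> good Vg N delta (post x d beta) ->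
  0 <= w <= Vg -> `|beta (hit x beta + d ^+ 2 * w) - x| <= d * N%:R.
Proof.
move=> x0 d0 /(good_post x0 d0)[_ h _ _ _] wV; have := h w wV.
by rewrite /post/= at_hit// normrM gtr0_norm ?invr_gt0// ler_pdivrMl.
Qed.

(** At scale d a good restarted path reaches 1 before time Vg, so x + d is hit within d^2 Vg; until
    then N bounds its rescaled displacement and local time. *)
Lemma block_bound x d : 0 <= x -> 0 < d -> good Vg N delta (post x d beta) ->
  (forall s, hit x beta <= s <= hit (x + d) beta -> `|beta s - x| <= d * N%:R) /\
  (forall z, lb (hit (x + d) beta) z <= lb (hit x beta) z + d * N%:R).
Proof.
move=> x0 d0 g; have [[w /andP[w0 wV] w1] _ h _ _] := good_post x0 d0 g.
have d2 : 0 < d ^+ 2 by rewrite exprn_gt0.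
have ht := hit_ge0' x beta.
have xd0 : 0 <= x + d by lra.
have tle : hit (x + d) beta <= hit x beta + d ^+ 2 * Vg.
  apply: (@le_trans _ _ (hit x beta + d ^+ 2 * w)); last by rewrite lerD2l ler_pM2l.
  apply/(hit_reaches (bh _)); exists (hit x beta + d ^+ 2 * w).
    by rewrite lexx andbT addr_ge0// mulr_ge0// ltW.
  by move: w1; rewrite /post/= at_hit// ler_pdivlMl// mulr1 lerBrDl.
split=> [s /andP[s1 s2]|z].
  have -> : s = hit x beta + d ^+ 2 * ((s - hit x beta) / d ^+ 2).
    by rewrite mulrC divfK ?gt_eqF// addrC subrK.
  apply: post_range => //; rewrite divr_ge0 ?subr_ge0 ?(ltW d2)//=.
  by rewrite ler_pdivrMr// lerBlDl mulrC (le_trans s2).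
apply: le_trans (lt_mono cb blb z (hit_ge0' _ _) tle) _.
by rewrite lpostE// lerD2l ler_pM2l//; exact: h.
Qed.

End hitting_blocks.

Lemma dist_one_le (R : realType) (x y d e : R) : `|x - y| <= d -> y - d <= 1 -> 1 <= y + d + e ->
  0 <= e -> `|x - 1| <= 2 * d + e.
Proof. rewrite !ler_norml => /andP[? ?] ? ? ?; apply/andP; split; lra. Qed.

(** * Clock and local time at the bottom of a valley *)

Section valley_core.
Context {R : realType}.
Variables (h r u s t v mu eta kap : R) (W : env_path R).
Hypotheses (h0 : 0 < h) (r0 : 0 < r) (r1 : r < 1).
Hypothesis rv : right_valley h (h * r / 2) u s t v mu eta kap W.
Variable m : R.
Hypothesis smt : s < m < t.
Hypothesis mmin : forall x, u <= x <= v -> W m <= W x.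
Hypothesis kap1 : 1 <= kap.
Local Notation S := (scale W).
Local Notation a := (left_hit (recentered W m) (h * r)).
Local Notation b := (right_hit (recentered W m) (h * r)).
Local Notation D := (v - u).
Local Notation I := (valley_mass h r W m).
Local Notation xa := (entrance h r W m).
Variables (beta : env_path R) (l : R -> R -> R) (T : R -> R) (lb : R -> R -> R).
Hypothesis bx : brox_lt W beta l T lb.
Hypothesis bh : forall c, hits c beta.
Variables (Vg delta eps K : R) (N M : nat).
Hypotheses (Vg0 : 0 <= Vg) (delta0 : 0 < delta) (eps0 : 0 < eps) (ed : eps + delta < 1).

Definition depth_scale : R := expR (h + W m) / I.
Local Notation lam := depth_scale.

Hypothesis gmain : good Vg N delta (post (S xa) lam beta).
Hypothesis gblk : forall i : nat, (i < M)%N -> i%:R * kap < xa ->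
  good Vg N delta (post (S (i%:R * kap)) (S xa - S (i%:R * kap)) beta).
Hypothesis vM : v <= M%:R * kap.
(** [C1] absorbs the factors N and D: what is spent outside the valley or before tau is at most eps
    e^h, and the path stays between S u and S v. [C2] puts the image of the valley within lam / (N +
    1) of S xa. *)
Hypothesis C1 : N%:R * (D + 1) ^+ 2 <= eps * expR (2 * eta).
Hypothesis C2 : N.+1%:R * D ^+ 2 <= expR (h * (1 - r)).
Hypothesis Kkap : K <= kap.

Let blb := bx_lt bx.
Let cb := @env_continuous _ beta.
Let I0 : 0 < I. Proof. exact: (mass_valley_gt0 h0 r0 r1 rv smt mmin kap1). Qed.
Let eta0 : 0 < eta. Proof. by case: rv. Qed.
Let u0 : u < 0. Proof. by case: rv. Qed.
Let geom : [/\ u <= m + a, m + a <= xa, xa <= m + b, m + b <= v & a <= b].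
Proof.
have [a1 a2 _] := left_hit_props h0 r0 r1 rv smt mmin kap1.
have [b1 b2 _] := right_hit_props h0 r0 r1 rv smt mmin kap1.
have [x0 xm ax xt] := entrance_props h0 r0 r1 rv smt mmin kap1.
have /andP[sm mt] := smt.
by split; lra.
Qed.
Let xa0 : 0 <= xa. Proof. by have [] := entrance_props h0 r0 r1 rv smt mmin kap1. Qed.
Let D0 : 0 < D.
Proof. by have [? ? ? ? ?] := geom; have := xa0; have := u0; lra. Qed.
Let v0 : 0 < v.
Proof.
by have := kap_vm h0 rv smt mmin kap1; have /andP[? ?] := smt; have := rv_s rv; have := kap1; lra.
Qed.
Let lam0 : 0 < lam. Proof. by rewrite divr_gt0 ?expR_gt0. Qed.
Let Sxa0 : 0 <= S xa. Proof. by rewrite -(scale0 W) scale_le. Qed.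
Let N0 : 0 <= N%:R :> R. Proof. exact: ler0n. Qed.

Let ND2 : N%:R * ((D + 1) * D) <= eps * expR (2 * eta).
Proof.
apply: le_trans C1; rewrite ler_wpM2l// expr2 ler_wpM2l//; have := D0; lra.
Qed.
Let NE : N%:R * (D + 1) <= expR (2 * eta).
Proof.
apply: (@le_trans _ _ (N%:R * (D + 1) ^+ 2)).
  by rewrite ler_wpM2l// expr2 ler_peMl//; have := D0; lra.
apply: le_trans C1 _; rewrite ler_piMl ?expR_ge0//.
by have := delta0; have := ed; lra.
Qed.
Let NE1 : N%:R <= expR (2 * eta).
Proof. apply: le_trans NE; rewrite ler_peMr//; have := D0; lra. Qed.
Let NED : N%:R * D <= expR (2 * eta).
Proof. apply: le_trans NE; rewrite ler_wpM2l//; lra. Qed.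

Let lam_le : lam <= expR (h + W m + eta).
Proof.
rewrite /depth_scale ler_pdivrMr// [expR (h + W m + eta)]expRD -mulrA.
have hm := mass_ge h0 r0 r1 rv smt mmin kap1.
have h1 : 1 <= expR eta * I.
  by have := ler_wpM2l (expR_ge0 eta) hm; rewrite -expRD addrN expR0.
exact: (ler_peMr (expR_ge0 _) h1).
Qed.

Let lamN : lam * N%:R <= expR (W m + h + 3 * eta).
Proof.
have -> : W m + h + 3 * eta = (h + W m + eta) + 2 * eta by ring.
rewrite expRD; apply: ler_pM; [exact: ltW|exact: N0|exact: lam_le|exact: NE1].
Qed.

Let tau := hit (S xa) beta.
Let tau0 : 0 <= tau. Proof. exact: hit_ge0'. Qed.

Let hit0 : hit 0 beta = 0.
Proof.
apply/eqP; rewrite eq_le hit_ge0' andbT; apply/(hit_reaches (bh 0)).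
by exists 0; rewrite ?lexx// env_at0.
Qed.

Let M0 : (0 < M)%N.
Proof.
rewrite lt0n; apply/eqP => E; move: vM; rewrite E mul0r; have := v0; lra.
Qed.

Let block0 : 0 < xa -> (forall x, 0 <= x <= tau -> `|beta x| <= S xa * N%:R) /\
  (forall z, lb tau z <= S xa * N%:R).
Proof.
move=> x0; have := gblk M0; rewrite mul0r scale0 subr0 => /(_ x0) g.
have Sx : 0 < S xa by rewrite -(scale0 W) scale_lt.
have [h1 h2] := block_bound blb Vg0 bh (lexx 0) Sx g.
rewrite add0r hit0 in h1 h2; split=> [x xt|z]; first by have := h1 x xt; rewrite subr0.
by have := h2 z; rewrite (lt_at0 blb) add0r.
Qed.

(** Nothing accumulates at S y until S (i kap) is hit, where i kap is the last grid point below y;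
    [block_bound] from there to S xa and [block_scale] conclude. For y < 0 the block starting at 0
    is used, and beyond xa the local time is null. *)
Let pre_bound y : u <= y <= v -> expR (- W y) * lb tau (S y) <= N%:R * (D * expR (h - 2 * eta)).
Proof.
move=> /andP[uy yv].
have rhs0 : 0 <= N%:R * (D * expR (h - 2 * eta)).
  by rewrite !mulr_ge0 ?expR_ge0// ltW// D0.
have [xy|yx] := leP xa y.
  by rewrite (lt_hit_above blb bh) ?mulr0// scale_le.
have blk (yi : R) : 0 <= yi -> yi <= xa -> y <= yi + kap ->
    lb tau (S y) <= (S xa - S yi) * N%:R -> expR (- W y) * lb tau (S y) <= N%:R * (D * expR (h - 2 * eta)).
  move=> yi0 yix yk hl; apply: le_trans (ler_wpM2l (expR_ge0 _) hl) _.
  rewrite (_ : expR (- W y) * _ = N%:R * (expR (- W y) * (S xa - S yi))); last by ring.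
  rewrite ler_wpM2l//; exact: (block_scale h0 r0 r1 rv smt mmin kap1 uy yk yi0 yix).
have [x0|x0] := leP xa 0.
  have xE : xa = 0 by apply/eqP; rewrite eq_le x0 xa0.
  by rewrite /tau xE scale0 hit0 (lt_at0 blb) mulr0.
have [y0|y0] := ltP y 0.
  apply: (blk 0) => //; first by have := kap1; lra.
  by rewrite scale0 subr0; exact: (block0 x0).2.
have kap0 : 0 < kap by have := kap1; lra.
pose i := Num.truncn (y / kap).
have yk0 : 0 <= y / kap by rewrite divr_ge0// ltW.
have /andP[iy yi] := truncn_itv yk0.
have iy' : i%:R * kap <= y by rewrite -ler_pdivlMr.
have yi' : y <= i%:R * kap + kap.
  by rewrite -[X in _ + X]mul1r -mulrDl -ler_pdivrMr// -natr1 in yi *; exact: ltW.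
have ix : i%:R * kap < xa by exact: le_lt_trans yx.
have iM : (i < M)%N.
  rewrite -(ltr_nat R) -(ltr_pM2r kap0); apply: le_lt_trans iy' _.
  apply: lt_le_trans vM; have [? ? ? ? ?] := geom; lra.
have ik0 : 0 <= i%:R * kap by rewrite mulr_ge0// ltW.
apply: (blk _ ik0 (ltW ix) yi').
have Si : 0 <= S (i%:R * kap) by rewrite -(scale0 W) scale_le.
have Sd : 0 < S xa - S (i%:R * kap) by rewrite subr_gt0 scale_lt.
have [_ h2] := block_bound blb Vg0 bh Si Sd (gblk iM ix).
have E : S (i%:R * kap) + (S xa - S (i%:R * kap)) = S xa by ring.
have z0 : lb (hit (S (i%:R * kap)) beta) (S y) = 0.
  by apply: (lt_hit_above blb bh) => //; rewrite scale_le.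
have := h2 (S y); rewrite E; move: z0; move: (lb (hit (S (i%:R * kap)) beta) (S y)) => q ->.
by rewrite add0r.
Qed.

Let pre_range x : 0 <= x <= tau -> S u <= beta x <= S xa.
Proof.
move=> /andP[x0 xt]; apply/andP; split; last by apply: below_hit => //; rewrite x0.
have [y0|y0] := leP xa 0.
  have xE : xa = 0 by apply/eqP; rewrite eq_le y0 xa0.
  move: xt; rewrite /tau xE scale0 hit0 => xt.
  have -> : x = 0 by apply/eqP; rewrite eq_le x0 xt.
  by rewrite env_at0 -(scale0 W) scale_le// ltW.
have := (block0 y0).1 x; rewrite x0 xt => /(_ isT) hx.
have e1 := left_room0 h0 r0 r1 rv smt mmin kap1.
have e2 := entrance_scale h0 r0 r1 rv smt mmin kap1.
have : S xa * N%:R <= expR (W u - eta).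
  have -> : W u - eta = (W u - 3 * eta) + 2 * eta by ring.
  rewrite expRD; apply: le_trans (ler_wpM2r N0 e2) _.
  rewrite (_ : D * _ * _ = expR (W u - 3 * eta) * (N%:R * D)); last by ring.
  by rewrite ler_wpM2l ?expR_ge0.
by move: hx; rewrite ler_norml => /andP[+ _]; lra.
Qed.

Let L' := lpost beta lb (S xa) lam.
Let gp := good_post blb Vg0 bh Sxa0 lam0 gmain.

Let post_rng w : 0 <= w <= Vg -> S u <= beta (tau + lam ^+ 2 * w) <= S v.
Proof.
move=> wV; have := post_range blb Vg0 bh Sxa0 lam0 gmain wV; rewrite -/tau => hb.
have e1 := left_room h0 r0 r1 rv smt mmin kap1.
have e2 := right_room h0 r0 r1 rv smt mmin kap1.
have e3 := lamN.
by move: hb; rewrite ler_norml => /andP[? ?]; apply/andP; split; lra.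
Qed.

(** Confinement between S u and S v lets [bx_T] write the clock as an integral over [u, v]. *)
Let rng w x : 0 <= w <= Vg -> 0 <= x <= tau + lam ^+ 2 * w -> S u <= beta x <= S v.
Proof.
move=> /andP[w0 wV] /andP[x0 xw]; have l2 : 0 < lam ^+ 2 by rewrite exprn_gt0.
have [xt|tx] := leP x tau.
  have := pre_range (x := x); rewrite x0 xt => /(_ isT)/andP[-> /= h1].
  by apply: le_trans h1 _; rewrite scale_le//; have [? ? ? ? ?] := geom; lra.
have -> : x = tau + lam ^+ 2 * ((x - tau) / lam ^+ 2).
  by rewrite mulrC divfK ?gt_eqF// addrC subrK.
apply: post_rng; rewrite divr_ge0 ?subr_ge0 ?(ltW tx) ?(ltW l2)//=.
apply: le_trans wV; rewrite ler_pdivrMr// lerBlDl mulrC; lra.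
Qed.

Let close y w : 0 <= w <= Vg -> m + a <= y <= m + b ->
  `|L' w ((S y - S xa) / lam) - L' w 0| <= delta.
Proof.
move=> wV yab; have [_ _ _ _ h5] := gp; apply: h5 => //.
rewrite -ler_norml normrM (gtr0_norm (_ : 0 < lam^-1)) ?invr_gt0// ler_pdivrMr//.
apply: le_trans (valley_scale h0 r0 r1 rv smt mmin kap1 yab) _.
rewrite ler_pdivlMl ?ltr0n// /lam ler_pdivlMr//.
have -> : h + W m = h * (1 - r) + (W m + h * r) by ring.
rewrite [expR (h * (1 - r) + (W m + h * r))]expRD.
rewrite (_ : N.+1%:R * _ * _ = N.+1%:R * (D * I) * expR (W m + h * r)); last by ring.
rewrite ler_wpM2r ?expR_ge0//; apply: le_trans C2.
rewrite ler_wpM2l ?ler0n// expr2 ler_wpM2l ?(ltW D0)//.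
exact: (mass_le h0 r0 r1 rv smt mmin kap1).
Qed.

Let cl x : 0 <= x -> continuous (l (T x)).
Proof.
move=> x0; have -> : l (T x) = fun y => expR (- W y) * lb x (S y) by apply/funext => y; exact: (bx_l bx).
apply: continuous_mul.
  by apply: continuous_expR_comp => y; apply: cvgN; exact: env_continuous.
apply: (continuous_compo (@continuous_scale R W)) => //; exact: (lt_continuous_z blb x0).
Qed.

Let lE w y : 0 <= w ->
  l (T (tau + lam ^+ 2 * w)) y = expR (- W y) * lb tau (S y) + lam * expR (- W y) * L' w ((S y - S xa) / lam).
Proof.
move=> w0; have x0 : 0 <= tau + lam ^+ 2 * w.
  by apply: addr_ge0; [exact: tau0|apply: mulr_ge0; [exact: sqr_ge0|exact: w0]].
rewrite (bx_l bx)//.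
have E := @lpostE R beta lb (S xa) lam w (S y) lam0.
by rewrite -/tau -/L' in E; rewrite E; ring.
Qed.

Let ceW : continuous (fun y => expR (- W y)).
Proof. by apply: continuous_expR_comp => y; apply: cvgN; exact: env_continuous. Qed.

Let lam_mass : lam * (expR (- W m) * I) = expR h.
Proof.
have nI : I != 0 by rewrite gt_eqF.
have nW : expR (W m) != 0 by rewrite gt_eqF// expR_gt0.
by rewrite /depth_scale expRD expRN; field; rewrite nI nW.
Qed.

(** Bounds the local time outside the valley as well as the part gathered before tau inside it. *)
Let Q := N%:R * (D + 1) * expR (h - 2 * eta).

Let out_bound w y : 0 <= w <= Vg -> u <= y <= v -> y <= m + a \/ m + b <= y ->
  0 <= l (T (tau + lam ^+ 2 * w)) y <= Q.
Proof.
move=> /andP[w0 wV] uyv yout; rewrite lE//; apply/andP; split.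
  apply: addr_ge0; first by apply: mulr_ge0; [exact: expR_ge0|exact: (lt_ge0 cb blb)].
  apply: mulr_ge0; last by apply: lpost_ge0.
  by apply: mulr_ge0; [exact: ltW|exact: expR_ge0].
have -> : Q = N%:R * (D * expR (h - 2 * eta)) + expR (h - 2 * eta) * N%:R by rewrite /Q; ring.
apply: lerD; first exact: pre_bound.
have [_ _ h3 _ _] := gp.
apply: ler_pM; [by apply: mulr_ge0; [exact: ltW|exact: expR_ge0]|by apply: lpost_ge0| |].
  have := out_valley h0 r0 r1 rv smt mmin kap1 uyv yout => wy.
  apply: (@le_trans _ _ (expR (h + W m + eta) * expR (- W y))).
    by rewrite ler_wpM2r// expR_ge0.
  by rewrite -expRD ler_expR; lra.
by apply: le_trans (h3 _); apply: lpost_mono.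
Qed.

Let QD : Q * D <= eps * expR h.
Proof.
have -> : expR h = expR (2 * eta) * expR (h - 2 * eta) by rewrite -expRD addrC subrK.
have -> : Q * D = N%:R * ((D + 1) * D) * expR (h - 2 * eta) by rewrite /Q; ring.
by rewrite [X in _ <= X]mulrA; apply: ler_wpM2r; [exact: expR_ge0|exact: ND2].
Qed.

(** Inside the valley l is lam e^(-W) L', with L' within delta of its value at 0, up to what came
    before tau. Since lam times the integral of e^(-W) over the valley is e^h, the main term is e^h
    L' w 0; the rest adds up to at most Q D <= eps e^h. *)
Lemma clock_bounds w : 0 <= w <= Vg ->
  expR h * (L' w 0 - delta) <= T (tau + lam ^+ 2 * w) <= expR h * (L' w 0 + delta + eps).
Proof.
move=> wV; have /andP[w0 wVg] := wV; set x := tau + lam ^+ 2 * w.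
have x0 : 0 <= x by rewrite addr_ge0// mulr_ge0 ?sqr_ge0.
have [g1 g2 g3 g4 g5] := geom.
have uv : u <= v by have := D0; lra.
have mab : m + a <= m + b by rewrite lerD2l.
rewrite (bx_T bx x0 uv (fun z => rng wV)).
have uab : u <= m + b := le_trans g1 mab.
rewrite (cint_chasles (cl x0) uab g4) (cint_chasles (cl x0) g1 mab).
have c k k' : continuous (fun y => k + k' * expR (- W y)).
  move=> y; apply: cvgD; first exact: cvg_cst.
  by apply: cvgM; [exact: cvg_cst|exact: ceW].
have midE k k' : cint (m + a) (m + b) (fun y => k + k' * expR (- W y)) =
    k * (b - a) + k' * (expR (- W m) * I).
  rewrite -(mass_shift h0 r0 r1 rv smt mmin kap1) -cintZ// -[b - a](_ : (m + b) - (m + a) = _); last by ring.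
  rewrite -cint_cst// /cint -RintegralD//.
  - by apply: cont_integrable; exact: continuous_cstR.
  - apply: cont_integrable; apply: continuous_mul => //; exact: continuous_cstR.
have mid y : m + a <= y <= m + b ->
    0 + lam * (L' w 0 - delta) * expR (- W y) <= l (T x) y <= Q + lam * (L' w 0 + delta) * expR (- W y).
  move=> yab; have := close wV yab; rewrite ler_norml => /andP[h1 h2].
  have yuv : u <= y <= v by case/andP: yab => ? ?; apply/andP; split; lra.
  have lw0 : 0 <= lam * expR (- W y) by rewrite mulr_ge0 ?expR_ge0// ltW.
  rewrite /x lE//; apply/andP; split.
    rewrite mulrAC; apply: lerD; last by rewrite ler_wpM2l//; lra.
    by rewrite mulr_ge0 ?expR_ge0//; exact: (lt_ge0 cb blb).
  rewrite [lam * _ * expR _]mulrAC; apply: lerD; last by rewrite ler_wpM2l//; lra.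
  apply: le_trans (pre_bound yuv) _; rewrite /Q -mulrA ler_wpM2l// ler_wpM2r ?expR_ge0//; lra.
have outl : 0 <= cint u (m + a) (l (T x)) <= Q * (m + a - u).
  have ob y : u <= y <= m + a -> 0 <= l (T x) y <= Q.
    move=> /andP[uy ya]; apply: out_bound => //; last by left.
    by rewrite uy/=; lra.
  rewrite cint_ge0/=; last by move=> y /ob/andP[].
  rewrite -cint_cst//; apply: cint_le => //; [exact: cl|exact: continuous_cstR|].
  by move=> y /ob/andP[].
have outr : 0 <= cint (m + b) v (l (T x)) <= Q * (v - (m + b)).
  have ob y : m + b <= y <= v -> 0 <= l (T x) y <= Q.
    move=> /andP[uy ya]; apply: out_bound => //; last by right.
    by rewrite ya andbT; lra.
  rewrite cint_ge0/=; last by move=> y /ob/andP[].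
  rewrite -cint_cst//; apply: cint_le => //; [exact: cl|exact: continuous_cstR|].
  by move=> y /ob/andP[].
have lo : expR h * (L' w 0 - delta) <= cint (m + a) (m + b) (l (T x)).
  have := midE 0 (lam * (L' w 0 - delta)).
  rewrite mul0r add0r (_ : _ * (_ * I) = expR h * (L' w 0 - delta)); last by rewrite -lam_mass; ring.
  move=> <-.
  by apply: cint_le => //; [exact: cl|move=> y /mid/andP[]].
have hi : cint (m + a) (m + b) (l (T x)) <= Q * (b - a) + expR h * (L' w 0 + delta).
  have := midE Q (lam * (L' w 0 + delta)).
  rewrite (_ : lam * _ * (_ * I) = expR h * (L' w 0 + delta)); last by rewrite -lam_mass; ring.
  move=> <-.
  by apply: cint_le => //; [exact: cl|move=> y /mid/andP[]].
have qd := QD.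
move: outl outr => /andP[p1 p2] /andP[p3 p4].
apply/andP; split; first by lra.
have -> : expR h * (L' w 0 + delta + eps) = expR h * (L' w 0 + delta) + eps * expR h by ring.
have E : Q * D = Q * (m + a - u) + Q * (b - a) + Q * (v - (m + b)) by ring.
by move: qd; rewrite E; lra.
Qed.

Lemma valley_local_time x : - K <= x <= K ->
  `|l (expR h) (m + x) / expR h *
    ((\int[lebesgue_measure]_(y in `[a, b]) expR (- recentered W m y)) / expR (- recentered W m x)) - 1|
  <= 2 * delta + eps.
Proof.
move=> /andP[xK Kx].
have l2 : 0 < lam ^+ 2 by rewrite exprn_gt0.
have eh := expR_gt0 h.
have [_ _ _ hV2 _] := gp.
have VV : 0 <= Vg <= Vg by rewrite Vg0 lexx.
have V00 : 0 <= (0 : R) <= Vg by rewrite lexx Vg0.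
have /andP[TV _] := clock_bounds VV.
have /andP[_ T0] := clock_bounds V00.
(* At w = Vg the rescaled local time is at least 2, at w = 0 it is null; with eps + delta < 1 the
   clock passes through e^h in between. *)
have TV' : expR h <= T (tau + lam ^+ 2 * Vg).
  apply: le_trans TV; rewrite ler_peMr ?(ltW eh)//.
  by move: hV2; rewrite -/L'; have := ed; have := eps0; lra.
have T0' : T tau <= expR h.
  move: T0; rewrite mulr0 addr0 /L' lpost0 add0r => T0; apply: le_trans T0 _.
  by rewrite ler_piMr ?(ltW eh)//; have := ed; lra.
have tV : tau <= tau + lam ^+ 2 * Vg by rewrite lerDl mulr_ge0// ltW.
have cT : {within `[tau, tau + lam ^+ 2 * Vg], continuous T} by apply: continuous_subspaceT; exact: (bx_cont bx).
have mm : Num.min (T tau) (T (tau + lam ^+ 2 * Vg)) <= expR h <= Num.max (T tau) (T (tau + lam ^+ 2 * Vg)).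
  by rewrite ge_min T0' le_max TV' orbT.
have [z] := IVT tV cT mm; rewrite in_itv/= => /andP[tz zV] Tz.
pose w := (z - tau) / lam ^+ 2.
have zE : z = tau + lam ^+ 2 * w by rewrite /w mulrC divfK ?gt_eqF// addrC subrK.
have wV : 0 <= w <= Vg.
  by rewrite divr_ge0 ?subr_ge0 ?(ltW l2)//= ler_pdivrMr// lerBlDl mulrC.
have [w0 _] := andP wV.
have /andP[c1 c2] := clock_bounds wV; rewrite -zE Tz in c1 c2.
have {}c1 : L' w 0 - delta <= 1 by move: c1; rewrite -[X in _ <= X]mulr1 ler_pM2l.
have {}c2 : 1 <= L' w 0 + delta + eps by move: c2; rewrite -[X in X <= _]mulr1 ler_pM2l.
have kms := kap_ms h0 rv smt mmin kap1; have ktm := kap_tm h0 rv smt mmin kap1.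
have [a1 a2 _] := left_hit_props h0 r0 r1 rv smt mmin kap1.
have [b1 b2 _] := right_hit_props h0 r0 r1 rv smt mmin kap1.
have [x0 xm _ _] := entrance_props h0 r0 r1 rv smt mmin kap1.
have kk := Kkap.
have xab : m + a <= m + x <= m + b by apply/andP; split; lra.
(* Hence m + x carries no local time before tau. *)
have xax : xa <= m + x by lra.
have cl' := close wV xab.
suff -> : l (expR h) (m + x) / expR h *
    ((\int[lebesgue_measure]_(y in `[a, b]) expR (- recentered W m y)) / expR (- recentered W m x)) =
    L' w ((S (m + x) - S xa) / lam).
  exact: dist_one_le cl' c1 c2 (ltW eps0).
rewrite -/I -Tz zE lE// (lt_hit_above blb bh) ?scale_le// mulr0 add0r.
set L0 := L' w _.
rewrite -[\int[_]_(_ in _) _]/I.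
have E1 : expR (- recentered W m x) = expR (- W (m + x)) * expR (W m).
  by rewrite -expRD /recentered opprB addrC.
rewrite -[T _]/(T (tau + lam ^+ 2 * w)) -?zE ?Tz E1 /lam expRD.
have n1 := expR_eq0 (- W (m + x)); have n2 := expR_eq0 (W m); have n3 := expR_eq0 h.
have n4 : I != 0 by rewrite gt_eqF.
by field; rewrite n4 n1 n2 n3.
Qed.

End valley_core.

(** * Measurability of the event *)

Section completion.
Context {R : realType} d (T : measurableType d).
Variable mu : {measure set T -> \bar R}.

Lemma completion_ae (A F : set T) : measurable F -> {ae mu, forall w, A w <-> F w} ->
  (mu^*)%mu.-cara.-measurable A /\ @completed_measure_extension _ _ R mu A = mu F.
Proof.
move=> mF [N [mN N0 AN]].
have AF w : ~ N w -> A w <-> F w by move=> nN; apply: contrapT => h; apply: nN; exact: AN.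
have subA (B : set T) : d.-measurable B -> (mu^*)%mu.-cara.-measurable B.
  by move=> mB; apply: sub_caratheodory; exact: sub_sigma_algebra.
have N0' : (mu^* N = 0)%mu by rewrite measurable_mu_extE.
have mAN : (mu^*)%mu.-cara.-measurable (A `&` N).
  apply: measure_is_complete_caratheodory; exists N; split; [exact: subA|exact: N0'|by move=> w []].
have AE : A = (F `\` N) `|` (A `&` N).
  apply/seteqP; split=> w.
    move=> Aw; have [Nw|Nw] := pselect (N w); first by right.
    by left; split=> //; exact/(AF _ Nw).
  by move=> [[Fw Nw]|[]//]; exact/(AF _ Nw).
split.
  rewrite AE; apply: measurableU => //; apply: subA; exact: measurableD.
rewrite /completed_measure_extension; apply/eqP; rewrite eq_le; apply/andP; split.
  apply: (@le_trans _ _ ((mu^*)%mu (F `|` N))).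
    apply: le_outer_measure => w Aw; have [Nw|Nw] := pselect (N w); first by right.
    by left; exact/(AF _ Nw).
  apply: le_trans (outer_measureU2 _ _ _) _.
  rewrite [X in (_ + X)%E]N0' adde0; exact: lee_eq (measurable_mu_extE _ mF).
rewrite -(measurable_mu_extE mu mF).
apply: (@le_trans _ _ ((mu^*)%mu (A `|` N))).
  apply: le_outer_measure => w Fw; have [Nw|Nw] := pselect (N w); first by right.
  by left; exact/(AF _ Nw).
by apply: le_trans (outer_measureU2 _ _ _) _; rewrite [X in (_ + X)%E]N0' adde0.
Qed.

End completion.

Section product_sections.
Context {R : realType} d1 d2 (T1 : measurableType d1) (T2 : measurableType d2).
Variables (P1 : probability T1 R) (P2 : probability T2 R).

Lemma ae_sections (Q : T1 * T2 -> Prop) : {ae (P1 \x P2)%E, forall w, Q w} ->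
  {ae P1, forall x, {ae P2, forall y, Q (x, y)}}.
Proof.
move=> [N [mN N0 QN]].
have mf : measurable_fun setT (P2 \o xsection N) by exact: measurable_fun_xsection.
have : ae_eq P1 setT (P2 \o xsection N) (cst 0%E).
  apply/ae_eq_integral_abs => //; rewrite -[RHS]N0; apply: eq_integral => x _.
  by rewrite gee0_abs.
apply: ae_imp => x /(_ I) /= h; exists (xsection N x); split=> //.
  exact: measurable_xsection.
by move=> y nQ; rewrite /xsection/= inE; exact: QN.
Qed.

Lemma ae_first (Q : T1 -> Prop) : {ae P1, forall x, Q x} ->
  {ae (P1 \x P2)%E, forall w, Q w.1}.
Proof.
move=> [N [mN N0 QN]]; exists (N `*` setT); split.
- exact: measurableX.
- apply: etrans (product_measure1E _ _ mN measurableT) _.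
  exact: etrans (congr1 (fun x => x * P2 setT)%E N0) (mul0e _).
- by move=> w nQ; split => //; exact: QN.
Qed.

Lemma ae_nonempty (Q : T1 -> Prop) : {ae P1, forall x, Q x} -> exists x, Q x.
Proof.
move=> [N [mN N0 QN]]; apply: contrapT => /forallNP nQ.
have NT : N = setT by apply/seteqP; split=> // x _; apply: QN; exact: nQ.
by move: N0; rewrite NT probability_setT => /eqP; rewrite onee_eq0.
Qed.

End product_sections.

Lemma measurable_mem d (T : measurableType d) (A : set T) : measurable A ->
  measurable_fun setT (fun x => x \in A).
Proof.
move=> mA; apply: (measurable_fun_bool true); rewrite setTI (_ : _ @^-1` _ = A)//.
by apply/seteqP; split=> x; [exact: set_mem|exact: mem_set].
Qed.

(** The modification is the infimum of the rationals q such that x belongs to the set attached to q,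
    with value +oo elsewhere. *)
Lemma measurable_modification (R : realType) d (T : measurableType d) (P : probability T R)
    (f : T -> R) :
  (forall c, exists2 A : set T, measurable A & {ae P, forall x, f x <= c <-> A x}) ->
  exists2 g : T -> R, measurable_fun setT g & {ae P, forall x, g x = f x}.
Proof.
move=> H.
have [A hA] : {A : rat -> set T & forall q, measurable (A q) /\ {ae P, forall x, f x <= ratr q <-> A q x}}.
  apply: (@choice _ _ (fun (q : rat) (B : set T) => measurable B /\ {ae P, forall x, f x <= ratr q <-> B x})) => q.
  by have [B mB hB] := H (ratr q); exists B.
pose u (n : nat) (x : T) : \bar R :=
  oapp (fun q : rat => if x \in A q then (ratr q : R)%:E else +oo%E) +oo%E (unpickle n).
have mu n : measurable_fun setT (u n).
  rewrite /u; case: unpickle => [q|] /=; last exact: measurable_cst.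
  apply: measurable_fun_ifT => //.
  exact: measurable_mem (hA q).1.
exists (fun x => fine (einfs (u ^~ x) 0)).
  by apply: measurableT_comp => //; exact: measurable_fun_einfs.
apply: ae_imp (ae_all_count (fun q => (hA q).2)) => x Ax.
suff -> : einfs (u ^~ x) 0 = (f x)%:E by [].
rewrite /einfs /sdrop; apply/eqP; rewrite eq_le; apply/andP; split.
  apply/lee_addgt0Pr => e e0.
  have fe : f x < f x + e by rewrite ltrDl.
  have [q /andP[q1 q2]] := rat_between fe.
  apply: (@le_trans _ _ (ratr q)%:E); last by rewrite -EFinD lee_fin ltW.
  apply: ereal_inf_lbound; exists (pickle q) => //.
  by rewrite /u pickleK /= mem_set//; apply/(Ax q); exact: ltW.
apply: le_ereal_inf_tmp => _ [n _ <-]; rewrite /u; case: unpickle => [q|] /=; last by rewrite leey.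
by case: ifPn => [/set_mem/(Ax q)|_]; rewrite ?lee_fin ?leey.
Qed.

(** * The scale function is onto *)

Section surjectivity.
Context {R : realType}.
Local Notation leb := (@lebesgue_measure R).

(** The integrand e^w is at least 1 on a set of infinite measure. *)
Lemma scale_unbounded (w : env_path R) :
  leb [set x | 0 <= x /\ 0 <= w x] = +oo%E -> forall c, exists2 x, 0 <= x & c <= scale w x.
Proof.
move=> loo c; apply: contrapT => no.
have bound x : 0 <= x -> scale w x <= c.
  by move=> x0; rewrite leNgt; apply/negP => h; apply: no; exists x => //; exact: ltW.
pose A : set R := [set x | 0 <= x /\ 0 <= w x].
pose I0 (n : nat) : set R := `[0, n%:R]%classic.
have mA : measurable A.
  rewrite (_ : A = `[0, +oo[%classic `&` [set x | - w x <= 0]).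
    apply: measurableI; first exact: measurable_itv.
    apply: measurable_ray; apply: continuous_measurable_fun => x; apply: cvgN; exact: env_continuous.
  by apply/seteqP; split=> x; rewrite /A/= in_itv/= andbT oppr_le0.
have mI n : measurable (I0 n) by exact: measurable_itv.
have mF n : measurable (A `&` I0 n) by exact: measurableI.
have AU : A = \bigcup_n (A `&` I0 n).
  apply/seteqP; split=> [x Ax|x [n _ []//]].
  exists (Num.truncn x).+1 => //; split=> //; rewrite /I0/= in_itv/= Ax.1/=.
  exact/ltW/truncnS_gt.
have nd : {homo (fun n => A `&` I0 n) : n m / (n <= m)%N >-> (n <= m)%O}.
  move=> n k nk; apply/subsetPset => x [Ax]; rewrite /I0/= !in_itv/= => /andP[-> xn]; split=> //=.
  by rewrite (le_trans xn)// ler_nat.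
have mU : measurable (\bigcup_n (A `&` I0 n)) by exact: bigcup_measurable.
have cv := @nondecreasing_cvg_mu _ _ _ leb _ mF mU nd.
have : (leb (\bigcup_n (A `&` I0 n)) <= c%:E)%E.
  rewrite -(cvg_lim _ cv)//; apply: lime_le; first by apply/cvg_ex; eexists; exact: cv.
  apply: nearW => n /=.
  have n0 : 0 <= n%:R :> R by [].
  apply: (@le_trans _ _ (scale w n%:R)%:E); last by rewrite lee_fin; exact: bound.
  rewrite /scale n0 -/(cint 0 n%:R (fun y => expR (w y))) -cintE; last exact: continuous_expW.
  rewrite -integral_indic//; last exact: measurable_itv.
  apply: ge0_le_integral => //; [exact: measurable_itv| | |].
  - by apply/measurable_EFinP; apply: measurable_funTS; exact: measurable_indic.
  - apply/measurable_EFinP; apply: measurable_funTS; apply: continuous_measurable_fun.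
    exact: continuous_expW.
  - move=> x _; rewrite lee_fin indicE; have [xA|xA] := boolP (x \in A).
      by rewrite -expR0 ler_expR; have [] := set_mem xA.
    exact: expR_ge0.
by rewrite -AU [X in (X <= _)%E]loo leye_eq.
Qed.

Lemma scale_surjective (w : env_path R) :
  leb [set x | 0 <= x /\ 0 <= w x] = +oo%E -> leb [set x | 0 <= x /\ 0 <= refl w x] = +oo%E ->
  forall z, exists x, scale w x = z.
Proof.
move=> h1 h2 z.
have [x x0 xz] := scale_unbounded h1 z.
have [y y0 yz] := scale_unbounded h2 (- z).
have yx : - y <= x by lra.
have cS : {within `[- y, x], continuous (scale w)} by apply: continuous_subspaceT; exact: continuous_scale.
have mm : Num.min (scale w (- y)) (scale w x) <= z <= Num.max (scale w (- y)) (scale w x).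
  move: yz; rewrite refl_scale lerN2 => yz.
  by rewrite ge_min yz le_max xz orbT.
by have [c _ cz] := IVT yx cS mm; exists c.
Qed.

Lemma ae_scale_surjective (P : probability (pathD (@setT R)) R) : wiener P ->
  {ae P, forall w, forall z, exists x, scale (env_fun w) x = z}.
Proof.
move=> wP.
have h (P' : probability (pathD (@setT R)) R) : wiener P' ->
    {ae P', forall w, leb [set x | 0 <= x /\ 0 <= env_fun w x] = +oo%E}.
  move=> wP'; apply: (ae_half_line0 wP' (Q := fun w => leb [set x | 0 <= x /\ 0 <= env_fun w x] = +oo%E)).
  by move=> P'' wP''; exact: ae_occupation_infinite.
have h2 := ae_refl wP (Q := fun w => leb [set x | 0 <= x /\ 0 <= env_fun w x] = +oo%E) h.
apply: ae_imp (ae_and (h _ wP) h2) => w [a1 a2]; exact: scale_surjective.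
Qed.

End surjectivity.

(** * A measurable event almost surely equal to that of the statement *)

Section event.
Context {R : realType}.
Local Notation leb := (@lebesgue_measure R).

Lemma left_hit_opp (V : R -> R) th : left_hit V th = - right_hit (fun x => V (- x)) th.
Proof.
rewrite /left_hit /right_hit /inf opprK; congr sup; apply/seteqP; split=> x /=.
  by move=> [x0 h]; exists (- x); rewrite ?opprK// oppr_ge0.
by move=> [y [y0 h] <-]; rewrite oppr_le0.
Qed.

Lemma measurable_half_setT d (T : measurableType d) (X : T -> env_path R) :
  (forall x, measurable_fun setT (fun w => X w x)) ->
  measurable_fun setT (X : T -> pathD (half_line R)).
Proof. by move=> h; apply: measurable_to_path => t _; exact: h. Qed.

Lemma measurable_right_hit d (T : measurableType d) (X : T -> env_path R) th :
  (forall x, measurable_fun setT (fun w => X w x)) ->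
  measurable_fun setT (fun w => right_hit (X w) th).
Proof.
move=> h; have := measurableT_comp (@measurable_hit R th) (measurable_half_setT h).
exact.
Qed.

Lemma measurable_left_hit d (T : measurableType d) (X : T -> env_path R) th :
  (forall x, measurable_fun setT (fun w => X w x)) ->
  measurable_fun setT (fun w => left_hit (X w) th).
Proof.
move=> h; rewrite (_ : (fun _ => _) = fun w => - right_hit (refl (X w)) th).
  apply: measurableT_comp => //; apply: measurable_right_hit => x; exact: h.
by apply/funext => w; rewrite left_hit_opp.
Qed.

Lemma measurable_joint_path d (T : measurableType d) (X : T -> env_path R) :
  (forall x, measurable_fun setT (fun w => X w x)) ->
  measurable_fun setT (fun p : T * measurableTypeR R => env_fun (X p.1) p.2).
Proof.
move=> h; apply: (measurable_eval_T (F := fun (p : T * measurableTypeR R) y => env_fun (X p.1) y)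
   (tau := fun p => p.2)).
- by move=> x; apply: (measurableT_comp (h x)); exact: measurable_fst.
- by move=> p; exact: env_continuous.
- exact: measurable_snd.
Qed.

Lemma measurable_valley_integral d (T : measurableType d) (X : T -> env_path R) (a b : T -> R) :
  (forall x, measurable_fun setT (fun w => X w x)) ->
  measurable_fun setT a -> measurable_fun setT b ->
  measurable_fun setT (fun w => \int[leb]_(y in `[a w, b w]) expR (- X w y)).
Proof.
move=> h ma mb.
pose D : set (T * measurableTypeR R) :=
  [set p | a p.1 - p.2 <= 0] `&` [set p | p.2 - b p.1 <= 0].
have m1 (f : T -> R) : measurable_fun setT f ->
    measurable_fun setT (fun p : T * measurableTypeR R => f p.1).
  by move=> mf; apply: (measurableT_comp mf); exact: measurable_fst.
have m2 : measurable_fun setT (fun p : T * measurableTypeR R => p.2 : R) by exact: measurable_snd.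
have mD : measurable D.
  by apply: measurableI; apply: measurable_ray; apply: measurable_funB => //; exact: m1.
have mg : measurable_fun setT (fun p : T * measurableTypeR R => expR (- X p.1 p.2)).
  apply: (measurableT_comp (f := expR)); first exact: measurable_expR.
  by apply: measurableT_comp => //; exact: measurable_joint_path.
have := measurable_param_Rintegral mD mg (fun p => expR_ge0 _).
congr (measurable_fun setT _); apply/funext => w; congr Rintegral.
by apply/seteqP; split=> y; rewrite /D/= in_itv/= subr_le0 subr_le0 => /andP.
Qed.

Lemma local_time_eventP (L : env R * omega R -> R -> R -> R) K r delta alpha w :
  local_time_event L K r delta alpha w <->
  forall x, - K <= x <= K -> `|normalized_local_time L r alpha w x - 1| <= delta.
Proof.
split=> [h x xK|h].
  rewrite -lee_fin; apply: le_trans h; apply: ereal_sup_ubound; exists x => //.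
apply: ge_ereal_sup => _ [x xK <-]; rewrite lee_fin; exact: h.
Qed.

Variables (PW : probability (env R) R) (PB : probability (omega R) R).
Hypothesis hPW : two_sided_wiener PW.
Variable L : env R * omega R -> R -> R -> R.
Hypothesis hL : is_local_time (PW \x PB)%E (@brox R) L.
Variables (K r delta alpha : R).
Hypotheses (hK : 0 < K) (alpha0 : 0 < alpha).

Lemma bottom_modification : exists2 mt : env R -> R, measurable_fun setT mt &
  {ae PW, forall W, mt W = valley_bottom alpha (env_fun W)}.
Proof.
apply: measurable_modification => c.
have [A mA hA] := valley_bottom_ray c (wiener_env hPW) alpha0.
exists (env_to_path @^-1` A).
  by have mp := @measurable_env_to_path R; have := mp measurableT _ mA; rewrite setTI.
exact: (ae_law hA).
Qed.

(** Replacing L by 0 on a measurable null set makes it continuous in space for every w, as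
    evaluation at a random point requires. *)
Lemma local_time_modification : exists2 Lt : env R * omega R -> R -> R -> R,
  (forall t x, 0 <= t -> measurable_fun setT (fun w => Lt w t x)) /\
  (forall w t, 0 <= t -> continuous (Lt w t)) &
  {ae (PW \x PB)%E, forall w, Lt w = L w}.
Proof.
have [mL [N [mN N0 LN]]] := hL.
exists (fun w t x => if w \in N then 0 else L w t x).
  split=> [t x t0|w t t0].
    apply: measurable_fun_ifT => //; last exact: mL.
    exact: measurable_mem.
  have [wN|wN] := pselect (N w).
    by rewrite (mem_set wN); exact: continuous_cstR.
  rewrite (memNset wN).
  have [lc _] : {within [set p : R * R | 0 <= p.1], continuous (fun p : R * R => L w p.1 p.2)} /\
    (forall (f : R -> R) (t : R), measurable_fun setT f -> [bounded f x | x in setT] -> 0 <= t ->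
    (\int[leb]_(s in `[0%R, t]) (f (@brox R w s))%:E = \int[leb]_x (f x * L w t x)%:E)%E).
    by apply: contrapT => h; apply: wN; exact: LN.
  by have := @continuous_l_at R _ lc t t0.
exists N; split=> // w; apply: contra_notP => wN.
by apply/funext => t; apply/funext => x; rewrite ifN//; apply/negP; rewrite inE.
Qed.

Lemma event_modification : exists2 F : set (env R * omega R), measurable F &
  {ae (PW \x PB)%E, forall w, local_time_event L K r delta alpha w <-> F w}.
Proof.
have [mt mmt hmt] := bottom_modification.
have [Lt [mLt cLt] hLt] := local_time_modification.
pose X (w : env R * omega R) : env_path R := aff 1 (mt w.1) w.1.
have mmt1 : measurable_fun setT (fun w : env R * omega R => mt w.1).
  by apply: (measurableT_comp mmt); exact: measurable_fst.
have mE (tau : env R * omega R -> R) : measurable_fun setT tau ->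
    measurable_fun setT (fun w : env R * omega R => env_fun w.1 (tau w)).
  move=> mtau; apply: (measurable_eval_T (F := fun w : env R * omega R => env_fun w.1)) => //.
    move=> x; apply: (measurableT_comp (f := fun W : env R => env_fun W x)); last exact: measurable_fst.
    exact: measurable_eval.
  by move=> w; exact: env_continuous.
have mX x : measurable_fun setT (fun w => X w x).
  rewrite /X/=; apply: measurable_funM; first exact: measurable_cst.
  apply: measurable_funB; apply: mE => //.
  by apply: measurable_funD => //; exact: measurable_cst.
have XE w x : X w x = recentered (env_fun w.1) (mt w.1) x.
  by rewrite /X/= invr1 mul1r expr1n mul1r.
pose I w := \int[leb]_(y in `[left_hit (X w) (alpha * r), right_hit (X w) (alpha * r)]) expR (- X w y).
have mI : measurable_fun setT I.
  apply: measurable_valley_integral => //; [exact: measurable_left_hit|exact: measurable_right_hit].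
pose G w x := `|Lt w (expR alpha) (mt w.1 + x) / expR alpha * (I w / expR (- X w x)) - 1|.
have mG x : measurable_fun setT (fun w => G w x).
  apply: measurableT_comp => //; apply: measurable_funB; last exact: measurable_cst.
  apply: measurable_funM.
    apply: measurable_funM; last exact: measurable_cst.
    apply: (measurable_eval_T (F := fun w => Lt w (expR alpha))).
    - by move=> y; apply: mLt; exact: expR_ge0.
    - by move=> w; apply: cLt; exact: expR_ge0.
    - by apply: measurable_funD => //; exact: measurable_cst.
  apply: measurable_funM => //.
  rewrite (_ : (fun _ => _) = fun w => expR (X w x)); last first.
    by apply/funext => w; rewrite expRN invrK.
  apply: (measurableT_comp (f := expR)) => //; exact: measurable_expR.
have cG w : continuous (G w).
  apply: continuous_normB; apply: continuous_mul.
    apply: continuous_mul; last exact: continuous_cstR.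
    apply: (continuous_compo (f := fun x => mt w.1 + x)); last by apply: cLt; exact: expR_ge0.
    by move=> x; apply: cvgD; [exact: cvg_cst|exact: cvg_id].
  apply: continuous_mul; first exact: continuous_cstR.
  rewrite (_ : (fun _ => _) = fun x => expR (X w x)); last first.
    by apply/funext => x; rewrite expRN invrK.
  by apply: continuous_expR_comp; exact: env_continuous.
have KK : - K <= K by rewrite ge0_cp// ltW.
exists (\bigcap_(q : rat) [set w | G w (clamp (- K) K (ratr q)) <= delta]).
  by apply: bigcapT_measurable_rat => q; exact: measurable_ray.
have hmt1 := ae_first PB hmt.
apply: ae_imp (ae_and hmt1 hLt) => w [mw Lw].
have NE x : `|normalized_local_time L r alpha w x - 1| = G w x.
  rewrite /normalized_local_time /G /I -mw -Lw.
  have -> : env_fun (X w) = recentered (env_fun w.1) (mt w.1) by apply/funext => y; exact: XE.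
  by [].
rewrite local_time_eventP; under eq_forall do rewrite NE.
by split=> [/(le_itv_rat delta (cG w) KK) h q _|h]; [exact: h|apply/(le_itv_rat delta (cG w) KK) => q; exact: h].
Qed.

End event.

(** * The limit *)

Section prob_lower_bounds.
Context {R : realType} d {T : measurableType d} (P : probability T R).

Lemma prob_setI_ge (A B : set T) (a b : R) : measurable A -> measurable B ->
  (1 - a%:E <= P A)%E -> (1 - b%:E <= P B)%E -> (1 - (a + b)%:E <= P (A `&` B))%E.
Proof.
move=> mA mB; have mAB : measurable (A `&` B) by exact: measurableI.
have h : (P (~` (A `&` B)) <= P (~` A) + P (~` B))%E.
  by rewrite setCI; apply: measureU2; exact: measurableC.
have fin (C : set T) : measurable C -> exists c : R, P C = c%:E.
  by move=> mC; exists (fine (P C)); rewrite fineK// fin_num_measure.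
have [x xE] := fin _ mA; have [y yE] := fin _ mB; have [z zE] := fin _ mAB.
move: h; rewrite !probability_setC// xE yE zE -!EFinB -EFinD !lee_fin; lra.
Qed.

Lemma prob_forall_ge (F : nat -> set T) (e : R) n :
  (forall i, measurable (F i)) -> (forall i, (1 - e%:E <= P (F i))%E) ->
  measurable [set x | forall i, (i < n)%N -> F i x] /\
  (1 - (n%:R * e)%:E <= P [set x | forall i, (i < n)%N -> F i x])%E.
Proof.
move=> mF hF; elim: n => [|n [mn hn]].
  rewrite (_ : [set _ | _] = setT); last by apply/seteqP; split.
  by rewrite mul0r sube0 probability_setT.
have -> : [set x | forall i, (i < n.+1)%N -> F i x] =
    [set x | forall i, (i < n)%N -> F i x] `&` F n.
  apply/seteqP; split=> x /= h; first by split=> [i i0|]; apply: h; lia.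
  by case: h => h1 h2 i; rewrite ltnS leq_eqVlt => /predU1P[->//|]; exact: h1.
split; first exact: measurableI.
by rewrite -natr1 mulrDl mul1r; exact: prob_setI_ge.
Qed.

End prob_lower_bounds.

Section valley_probability.
Context {R : realType}.
Local Notation half := (half_line R).

Definition deep (h r eps K : R) (N M : nat) (u v eta kap : R) : Prop :=
  [/\ 1 <= kap, K <= kap, v <= M%:R * kap, N%:R * (v - u + 1) ^+ 2 <= eps * expR (2 * eta) &
      N.+1%:R * (v - u) ^+ 2 <= expR (h * (1 - r))].

Definition close_local_time (h r K delta : R) (W : env_path R) (l : R -> R -> R) : Prop :=
  let m := valley_bottom h W in
  let V := recentered W m in
  forall x, - K <= x <= K -> `|l (expR h) (m + x) / expR h *
    ((\int[lebesgue_measure]_(y in `[left_hit V (h * r), right_hit V (h * r)]) expR (- V y)) / expR (- V x)) - 1|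
  <= delta.

Variable P : probability (pathD half) R.
Hypothesis wP : wiener P.
Variables (h r eps K delta Vg e : R) (N M : nat).
Hypotheses (h0 : 0 < h) (r0 : 0 < r) (r1 : r < 1) (eps0 : 0 < eps) (delta0 : 0 < delta).
Hypotheses (ed : eps + delta < 1) (Vg0 : 0 <= Vg).
Hypothesis Pgood : (1 - e%:E <= P (good Vg N delta))%E.
Variables (u s t v mu eta kap : R).

(** For a fixed environment, one restart at the entrance and one per block have to be good. By the
    strong Markov property each is so with the probability of [good], and the union bound asks for
    no independence. *)
Lemma right_valley_prob (W : env_path R) : regular W ->
  right_valley h (h * r / 2) u s t v mu eta kap W -> deep h r eps K N M u v eta kap ->
  exists G : set (pathD half), [/\ measurable G, (1 - (M.+1%:R * e)%:E <= P G)%E &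
    forall beta l T lb, G beta -> (forall c, hits c beta) -> brox_lt W beta l T lb ->
      close_local_time h r K (2 * delta + eps) W l].
Proof.
move=> [de fa] rv [kap1 Kk vM C1 C2].
have [m [smt bm mmin _]] := right_valley_bottom h0 (@env_continuous _ W) de fa rv.
have I0 := mass_valley_gt0 h0 r0 r1 rv smt mmin kap1.
have kap0 : 0 < kap by exact: lt_le_trans kap1.
pose xa := entrance h r W m; pose S := scale W.
(* Index 0 is the restart at the entrance and i + 1 is block i; blocks starting beyond the entrance
   are subject to no condition. *)
pose F (i : nat) : set (pathD half) := match i with
  | 0%N => post (S xa) (depth_scale h r W m) @^-1` (good Vg N delta)
  | i.+1 => if i%:R * kap < xa then post (S (i%:R * kap)) (S xa - S (i%:R * kap)) @^-1` (good Vg N delta)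
            else setT end.
have mg : measurable (good Vg N delta : set (pathD half)) by exact: measurable_good.
have mpost c lam : measurable (post c lam @^-1` (good Vg N delta) : set (pathD half)).
  by have := @measurable_post R c lam measurableT _ mg; rewrite setTI.
have Ppost c lam : lam != 0 -> (1 - e%:E <= P (post c lam @^-1` (good Vg N delta)))%E.
  move=> l0; apply: (le_trans Pgood); apply: lee_eq.
  exact: esym (strong_markov wP (prob_hits wP c) l0 mg).
have e0 : 0 <= e.
  have := le_trans Pgood (probability_le1 P mg); rewrite -EFinB lee_fin; lra.
have mF i : measurable (F i).
  case: i => [|i]; first exact: mpost.
  by rewrite /F; case: ifPn => _; [exact: mpost|exact: measurableT].
have PF i : (1 - e%:E <= P (F i))%E.
  case: i => [|i].
    apply: Ppost; rewrite gt_eqF//; exact: divr_gt0 (expR_gt0 _) I0.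
  rewrite /F; case: ifPn => [ix|_].
    by apply: Ppost; rewrite gt_eqF// subr_gt0; exact: scale_lt.
  by rewrite probability_setT -EFinB lee_fin lerBlDr lerDl.
have [mG PG] := prob_forall_ge M.+1 mF PF.
exists [set x | forall i, (i < M.+1)%N -> F i x]; split=> // beta l T lb GB bh bx.
have gm := GB 0%N isT.
have gb (i : nat) : (i < M)%N -> i%:R * kap < xa ->
    good Vg N delta (post (S (i%:R * kap)) (S xa - S (i%:R * kap)) beta).
  by move=> iM ix; have := GB i.+1 iM; rewrite /F ix.
rewrite /close_local_time (is_bottomE bm) => x xK.
exact: (@valley_local_time R h r u s t v mu eta kap W h0 r0 r1 rv m smt mmin kap1 beta l T lb bx bh
  Vg delta eps K N M Vg0 delta0 eps0 ed gm gb vM C1 C2 Kk x xK).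
Qed.

Lemma close_local_time_refl (W : env_path R) l d : regular W ->
  right_valley h (h * r / 2) u s t v mu eta kap (refl W) ->
  close_local_time h r K d (refl W) (fun t x => l t (- x)) -> close_local_time h r K d W l.
Proof.
move=> rW rv; rewrite /close_local_time.
rewrite (bottom_refl h0 (regular_refl rW) rv).
set m' := valley_bottom h (refl W).
have VE : recentered (refl W) m' = fun x => recentered W (- m') (- x).
  by apply/funext => x; rewrite /recentered/= opprD.
rewrite VE; set V := recentered W (- m') => H x xK.
have aE : left_hit (fun x => V (- x)) (h * r) = - right_hit V (h * r).
  by rewrite left_hit_opp; congr (- right_hit _ _); apply/funext => y; rewrite opprK.
have bE : right_hit (fun x => V (- x)) (h * r) = - left_hit V (h * r).
  by rewrite left_hit_opp opprK.
have xK' : - K <= - x <= K by rewrite lerN2 lerNl andbC.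
have := H _ xK'; rewrite aE bE opprD !(opprK x).
suff -> : \int[lebesgue_measure]_(y in `[- right_hit V (h * r), - left_hit V (h * r)]) expR (- V (- y)) =
    \int[lebesgue_measure]_(y in `[left_hit V (h * r), right_hit V (h * r)]) expR (- V y) by [].
have hit0 (U : R -> R) : 0 <= right_hit U (h * r).
  rewrite /right_hit; have [[z hz]|/set0P/negP/negPn/eqP ->] := pselect ([set x | 0 <= x /\ h * r <= U x] !=set0).
    by apply: lb_le_inf; [exists z|move=> y []].
  by rewrite inf0.
have b0 : 0 <= right_hit V (h * r) by exact: hit0.
have a0 : left_hit V (h * r) <= 0 by rewrite left_hit_opp oppr_le0; exact: hit0.
have cV : continuous (fun y => expR (- V y)).
  apply: continuous_expR_comp => y; apply: cvgN; apply: cvgB; last exact: cvg_cst.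
  apply: (continuous_compo (f := fun y => - m' + y)); last exact: env_continuous.
  by move=> z; apply: cvgD; [exact: cvg_cst|exact: cvg_id].
move: (left_hit V (h * r)) (right_hit V (h * r)) a0 b0 => a b a0 b0.
have ab : - b <= - a by rewrite lerN2 (le_trans a0).
by have := cint_opp cV ab; rewrite !opprK.
Qed.

Lemma left_valley_prob (W : env_path R) : regular W ->
  right_valley h (h * r / 2) u s t v mu eta kap (refl W) -> deep h r eps K N M u v eta kap ->
  exists G : set (pathD half), [/\ measurable G, (1 - (M.+1%:R * e)%:E <= P G)%E &
    forall beta l T lb, G beta -> (forall c, hits c (aff (-1) 0 beta)) -> brox_lt W beta l T lb ->
      close_local_time h r K (2 * delta + eps) W l].
Proof.
move=> rW rv dp.
have [G [mG PG hG]] := right_valley_prob (regular_refl rW) rv dp.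
have n1 : -1 != 0 :> R by rewrite oppr_eq0 oner_eq0.
exists (aff (-1) 0 @^-1` G); split.
- by have := @measurable_scale R (-1) measurableT _ mG; rewrite setTI.
- apply: (le_trans PG); apply: lee_eq; exact: esym (wiener_scale wP n1 mG).
move=> beta l T lb Gb bh bx; apply: (close_local_time_refl rW rv).
exact: (hG _ _ _ _ Gb bh (brox_lt_refl bx)).
Qed.

End valley_probability.

Section brox_local_time.
Context {R : realType}.
Variables (PW : probability (env R) R) (PB : probability (omega R) R).
Hypotheses (hPW : two_sided_wiener PW) (hPB : standard_wiener PB).
Variable L : env R * omega R -> R -> R -> R.
Hypothesis hL : is_local_time (PW \x PB)%E (@brox R) L.

Lemma ae_brox_lt : {ae PW, forall W : env R, {ae PB, forall B,
  brox_lt W (bev B) (L (W, B)) (tclock W (bev B)) (lbeta W (bev B) (L (W, B)))}}.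
Proof.
have hB : {ae PB, forall B, omega_eval B 0 = 0}.
  have mB : measurable [set B : omega R | omega_eval B 0 = 0].
    have := measurable_omega_eval (lexx 0) measurableT (measurable_set1 (0 : R)).
    by rewrite setTI.
  exact: (prob1_ae mB hPB.1).
have hS := ae_law (ae_scale_surjective (wiener_env hPW)).
apply: ae_imp (ae_and (ae_sections hL.2) hS) => W [hW Ssurj].
apply: ae_imp (ae_and hW hB) => B [[lc lo] B0].
apply: (brox_lt_intro (B := omega_eval B) Ssurj) => //.
by move=> s s0; rewrite bevE// B0 subr0.
Qed.

(** A single environment in which the diffusion has a local time is enough, as the conclusion
    concerns B only. *)
Lemma thick_local_time : thick (law PB (@measurable_bev R)) (fun f => exists l, is_lt (env_fun f) l).
Proof.
have [W hW] := ae_nonempty ae_brox_lt.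
by apply: thick_law; apply: ae_imp hW => B bx; eexists; exact: (bx_lt bx).
Qed.

Variables (h r eps K d Vg e : R) (N M : nat).
Hypotheses (h0 : 0 < h) (r0 : 0 < r) (r1 : r < 1) (eps0 : 0 < eps) (d0 : 0 < d).
Hypotheses (ed : eps + d < 1) (Vg0 : 0 <= Vg).
Hypothesis Pgood : (1 - e%:E <= law PB (@measurable_bev R) (good Vg N d))%E.
Variable delta : R.
Hypothesis dd : 2 * d + eps <= delta.

Lemma section_prob (W : env R) (F : set (env R * omega R)) u s t v mu eta kap :
  measurable F -> {ae PB, forall B, local_time_event L K r delta h (W, B) <-> F (W, B)} ->
  {ae PB, forall B, brox_lt W (bev B) (L (W, B)) (tclock W (bev B)) (lbeta W (bev B) (L (W, B)))} ->
  regular W ->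
  right_valley h (h * r / 2) u s t v mu eta kap W \/ right_valley h (h * r / 2) u s t v mu eta kap (refl W) ->
  deep h r eps K N M u v eta kap ->
  (1 - (M.+1%:R * e)%:E <= PB (xsection F W))%E.
Proof.
move=> mF hF hbx rW rv dp.
have wP := wiener_omega hPB.
have [G [mG PG hG]] : exists G : set (pathD (half_line R)), [/\ measurable G,
    (1 - (M.+1%:R * e)%:E <= law PB (@measurable_bev R) G)%E &
    forall beta l T lb, G beta -> (forall c, hits c beta) -> (forall c, hits c (aff (-1) 0 beta)) ->
    brox_lt W beta l T lb -> close_local_time h r K (2 * d + eps) W l].
  case: rv => rv.
    have [G [mG PG hG]] := right_valley_prob wP h0 r0 r1 eps0 d0 ed Vg0 Pgood rW rv dp.
    by exists G; split=> // beta l T lb Gb b1 _; exact: hG.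
  have [G [mG PG hG]] := left_valley_prob wP h0 r0 r1 eps0 d0 ed Vg0 Pgood rW rv dp.
  by exists G; split=> // beta l T lb Gb _; exact: hG.
have n1 : -1 != 0 :> R by rewrite oppr_eq0 oner_eq0.
have hits1 := ae_law (ae_hits wP).
have hits2 := ae_law (ae_scale wP n1 (ae_hits wP)).
apply: (le_trans PG); apply: (@prob_ae_le _ _ _ PB (@bev R @^-1` G) (xsection F W)).
- by have := @measurable_bev R measurableT _ mG; rewrite setTI.
- exact: measurable_xsection.
apply: ae_imp (ae_and hits1 (ae_and hits2 (ae_and hF hbx))) => B [b1 [b2 [FB bx]]] GB.
rewrite /xsection/= inE; apply/FB/local_time_eventP => x xK.
exact: le_trans (hG _ _ _ _ GB b1 b2 bx x xK) dd.
Qed.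

End brox_local_time.

(** * Deep valleys *)

Section large_depth.
Context {R : realType}.

(** With y = k al / 5, e^(5 y) is at least y^5, one power more than needed; this is where the
    constant c comes from. *)
Lemma near_exp (C k : R) : 0 < k -> \forall al \near +oo, C * al ^+ 4 <= expR (k * al).
Proof.
move=> k0; pose c := (k / 5) ^+ 5.
have c0 : 0 < c by rewrite exprn_gt0// divr_gt0.
near=> al.
have al0 : 0 < al by near: al; exact: nbhs_pinfty_gt.
have alC : C / c <= al by near: al; apply: nbhs_pinfty_ge; exact: num_real.
have -> : k * al = 5%:R * (k / 5 * al) by field.
rewrite expRM_natl; apply: (@le_trans _ _ ((k / 5 * al) ^+ 5)).
  have -> : (k / 5 * al) ^+ 5 = c * al * al ^+ 4 by rewrite /c; ring.
  have al4 : 0 <= al ^+ 4 by rewrite exprn_ge0// ltW.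
  by apply: (ler_wpM2r al4); rewrite mulrC -ler_pdivrMr.
have ka : 0 <= k / 5 * al by apply: mulr_ge0; [apply: divr_ge0|]; exact: ltW.
apply: lerXn2r; rewrite ?nnegrE ?expR_ge0//.
by apply: le_trans (expR_ge1Dx _); rewrite lerDr.
Unshelve. all: by end_near. Qed.

Lemma near_deep (r eps K : R) N M (u v eta kap : R) : r < 1 -> 0 < eps -> 0 < eta -> u <= v ->
  0 < kap -> v <= M%:R * kap ->
  \forall al \near +oo, deep al r eps K N M (al ^+ 2 * u) (al ^+ 2 * v) (al * eta) (al ^+ 2 * kap).
Proof.
move=> r1 eps0 eta0 uv kap0 vM.
have uv0 : 0 <= v - u by rewrite subr_ge0.
near=> al.
have al1 : 1 <= al by near: al; apply: nbhs_pinfty_ge; exact: num_real.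
have al0 : 0 < al by exact: lt_le_trans al1.
have al2 : al <= al ^+ 2 by rewrite expr2 ler_peMl// ltW.
have al21 : 1 <= al ^+ 2 by exact: le_trans al2.
have k1 : (1 + `|K|) / kap <= al by near: al; apply: nbhs_pinfty_ge; exact: num_real.
have k2 : 1 + `|K| <= al ^+ 2 * kap by rewrite -ler_pdivrMr// (le_trans k1).
split.
- by apply: le_trans k2; rewrite lerDl.
- by apply: le_trans k2; rewrite (le_trans (ler_norm K))// lerDr.
- by rewrite mulrCA ler_wpM2l// exprn_ge0// ltW.
- have e1 : N%:R * (v - u + 1) ^+ 2 / eps * al ^+ 4 <= expR (2 * eta * al).
    by near: al; apply: near_exp; rewrite mulr_gt0.
  have -> : 2 * (al * eta) = 2 * eta * al by ring.
  have {}e1 : N%:R * (v - u + 1) ^+ 2 * al ^+ 4 <= eps * expR (2 * eta * al).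
    rewrite -ler_pdivrMl//; apply: le_trans e1.
    by rewrite le_eqVlt; apply/orP; left; apply/eqP; ring.
  apply: le_trans e1; rewrite -mulrBr -mulrA ler_wpM2l//.
  have -> : (v - u + 1) ^+ 2 * al ^+ 4 = (al ^+ 2 * (v - u) + al ^+ 2) ^+ 2 by ring.
  have x0 : 0 <= al ^+ 2 * (v - u) by rewrite mulr_ge0// exprn_ge0// ltW.
  by rewrite lerXn2r ?nnegrE ?addr_ge0 ?exprn_ge0 ?(ltW al0)// lerD2l.
- have e2 : N.+1%:R * (v - u) ^+ 2 * al ^+ 4 <= expR ((1 - r) * al).
    by near: al; apply: near_exp; rewrite subr_gt0.
  have -> : al * (1 - r) = (1 - r) * al by ring.
  by apply: le_trans e2; rewrite le_eqVlt; apply/orP; left; apply/eqP; ring.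
Unshelve. all: by end_near. Qed.

Lemma near_all (T : Type) (F : set_system T) (FF : Filter F) (Q : nat -> T -> Prop) n :
  (forall k, \forall x \near F, Q k x) -> \forall x \near F, forall k, (k < n)%N -> Q k x.
Proof.
move=> H; elim: n => [|n IH]; first exact: nearW.
by apply: filterS2 IH (H n) => x h1 h2 k; rewrite ltnS leq_eqVlt => /predU1P[->|/h1].
Qed.

(** The number of blocks of length 1 / (N + 1) needed to cover [0, v]. Scaling multiplies both
    lengths by the same factor and leaves it unchanged. *)
Definition param_blocks (th : valley_param) : nat :=
  let: (u, s, t, v, mu, eta, N) := th in (Num.truncn (ratr v * N.+1%:R : R)).+1.

Definition param_deep (r eps K : R) (N M : nat) (th : valley_param) (al : R) : Prop :=
  let: (u, s, t, v, mu, eta, n) := th in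
  deep al r eps K N M (al ^+ 2 * ratr u) (al ^+ 2 * ratr v) (al * ratr eta) (al ^+ 2 * n.+1%:R^-1).

Lemma near_param_deep (r eps K rho : R) N M th : r < 1 -> 0 < eps -> (param_blocks th <= M)%N ->
  \forall al \near +oo, forall w : env_path R, rv_set rho th w -> param_deep r eps K N M th al.
Proof.
move: th => [[[[[[u s] t] v] mu] eta] n] r1 eps0; rewrite /param_blocks => bM.
have [w0|no] := pselect (exists w : env_path R, rv_set rho (u, s, t, v, mu, eta, n) w); last first.
  by apply: nearW => al w hw; exfalso; apply: no; exists w.
have [w rv] := w0; rewrite /rv_set/= in rv.
have h1 := rv_eta rv; have h2 := rv_u rv; have h3 := rv_s rv; have h4 := rv_st rv; have h5 := rv_tv rv.
have uv : (ratr u : R) <= ratr v by move: h2 h3 h4 h5; clear; lra.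
have k0 := rv_kap rv.
have vM : (ratr v : R) <= M%:R * n.+1%:R^-1.
  rewrite ler_pdivlMr//; apply: le_trans (ltW (truncnS_gt _)) _.
  by rewrite ler_nat.
by apply: filterS (@near_deep r eps K N M _ _ _ _ r1 eps0 h1 uv k0 vM) => al h' w' _.
Qed.

End large_depth.

Section large_depth_event.
Context {R : realType}.
Variables (PW : probability (env R) R) (PB : probability (omega R) R).
Hypotheses (hPW : two_sided_wiener PW) (hPB : standard_wiener PB).
Variable L : env R * omega R -> R -> R -> R.
Hypothesis hL : is_local_time (PW \x PB)%E (@brox R) L.
Variables (K r delta : R).
Hypotheses (hK : 0 < K) (hr0 : 0 < r) (hr1 : r < 1) (hdelta : 0 < delta).

Lemma measurable_scaled_valley al rho th : measurable
  [set w : pathD (@setT R) | rv_set rho th (aff al 0 w) \/ rv_set rho th (aff al 0 (refl w))].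
Proof.
have mA := @measurable_aff R setT setT al 0 I (fun _ _ => I).
have mR := @measurable_refl R.
have m1 := mA measurableT _ (measurable_rv_set rho th); rewrite setTI in m1.
have m2 := mR measurableT _ m1; rewrite setTI in m2.
exact: (measurableU _ _ m1 m2).
Qed.

Lemma prob_product_ge (F : set (env R * omega R)) (A : set (env R)) (c : R) :
  measurable F -> measurable A -> 0 <= c ->
  {ae PW, forall W, A W -> (c%:E <= PB (xsection F W))%E} ->
  (c%:E * PW A <= (PW \x PB)%E F)%E.
Proof.
move=> mF mA c0 h.
have mf : measurable_fun setT (PB \o xsection F) by exact: measurable_fun_xsection.
apply: (@le_trans _ _ (\int[PW]_(W in A) (PB \o xsection F) W)%E).
  rewrite -integral_cst//; apply: ae_ge0_le_integral => //.
  exact: measurable_funS mf.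
exact: ge0_subset_integral.
Qed.

Lemma prob_product_le1 (F : set (env R * omega R)) : measurable F ->
  exists2 p : R, (PW \x PB)%E F = p%:E & p <= 1.
Proof.
move=> mF.
have le1 : ((PW \x PB)%E F <= 1)%E.
  have <- : (PW \x PB)%E ([set: env R] `*` [set: omega R]) = 1%E.
    apply: etrans (product_measure1E _ _ measurableT measurableT) _.
    exact: etrans (congr2 mule (probability_setT PW) (probability_setT PB)) (mule1 _).
  apply: le_measure; rewrite ?inE//; exact: measurableX.
have ge0 : (0 <= (PW \x PB)%E F)%E by exact: measure_ge0.
exists (fine ((PW \x PB)%E F)).
  by rewrite fineK// ge0_fin_numE// (le_lt_trans le1)// ltry.
by rewrite -lee_fin fineK// ge0_fin_numE// (le_lt_trans le1)// ltry.
Qed.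

Lemma event_prob_large (eps : R) : 0 < eps ->
  \forall al \near +oo, forall F : set (env R * omega R), measurable F ->
    {ae (PW \x PB)%E, forall w, local_time_event L K r delta al w <-> F w} ->
    (1 - eps%:E <= (PW \x PB)%E F)%E.
Proof.
move=> eps0.
(* d plays the part of both errors of [valley_local_time]: this requires d + d < 1 and 3 d <=
   delta. *)
pose d : R := Num.min delta 1 / 4.
have m0 : 0 < Num.min delta 1 by rewrite lt_min hdelta ltr01.
have m1 : Num.min delta 1 <= 1 by rewrite ge_min lexx orbT.
have md : Num.min delta 1 <= delta by rewrite ge_min lexx.
have d0 : 0 < d by rewrite divr_gt0.
have dd : d + d < 1 by rewrite /d; move: m1; lra.
have ddelta : 2 * d + d <= delta.
  by apply: le_trans md; rewrite /d; move: m0; lra.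
have rho0 : 0 < r / 2 by rewrite divr_gt0.
have e20 : 0 < eps / 2 by rewrite divr_gt0.
have wP := wiener_env hPW.
have [n hn] := prob_rv_set wP rho0 e20.
pose th (k : nat) : option valley_param := unpickle k.
(* The block count is fixed by the finitely many parameters retained at level 1, so the precision e
   asked of [good] can be chosen before al. *)
pose M := \max_(k < n) oapp (@param_blocks R) 0%N (th k).
pose e := eps / 2 / M.+1%:R.
have e0 : 0 < e by rewrite divr_gt0.
have Me : M.+1%:R * e = eps / 2 by rewrite mulrC /e divfK// pnatr_eq0.
have [Vg [N PG]] := good_exists (wiener_omega hPB) (thick_local_time hPW hPB hL) d0 e0.
clearbody d e.
have {}PG : (1 - e%:E <= law PB (@measurable_bev R) (good Vg%:R N d))%E.
  by apply: (le_trans PG); apply: lee_eq.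
(* The condition k < n is repeated because [near_all] wants a property of every k, which must be
   trivial from n on. *)
have hdeep : \forall al \near +oo, forall k, (k < n)%N -> (k < n)%N ->
    oapp (fun t => forall w : env_path R, rv_set (r / 2) t w -> param_deep r d K N M t al) True (th k).
  apply: near_all => k; have [kn|kn] := ltnP k n; last by apply: nearW.
  case E : (th k) => [t|]; last by apply: nearW.
  have tM : (@param_blocks R t <= M)%N.
    have := @leq_bigmax _ (fun k : 'I_n => oapp (@param_blocks R) 0%N (th k)) (Ordinal kn).
    by rewrite /= E.
  by apply: filterS (@near_param_deep R r d K (r / 2) N M t hr1 d0 tM) => al h _.
have al0 : \forall al \near +oo, 0 < (al : R) by exact: nbhs_pinfty_gt.
apply: filterS2 al0 hdeep => al al0 hdeep F mF hF.
pose A : set (pathD (@setT R)) := \bigcup_(k < n)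
  oapp (fun th => [set w : pathD (@setT R) | rv_set (r / 2) th (aff al 0 w) \/ rv_set (r / 2) th (aff al 0 (refl w))])
    set0 (unpickle k : option valley_param).
have mA : measurable A.
  apply: bigcup_measurable => k _; case: unpickle => [t|] /=; last exact: measurable0.
  exact: measurable_scaled_valley.
have mA' : measurable (env_to_path @^-1` A : set (env R)).
  by have mp := @measurable_env_to_path R; have := mp measurableT _ mA; rewrite setTI.
have wreg := ae_law (ae_regular wP).
(* The maximum with 0 covers eps > 2, as [prob_product_ge] wants a nonnegative bound. *)
pose c : R := Num.max 0 (1 - eps / 2).
have c0 : 0 <= c by rewrite le_max lexx.
have PA : (1 - (eps / 2)%:E <= PW (env_to_path @^-1` A))%E := hn al al0.
apply: (@le_trans _ _ (c%:E * PW (env_to_path @^-1` A))%E).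
  have [p pE] : exists p : R, PW (env_to_path @^-1` A) = p%:E.
    by exists (fine (PW (env_to_path @^-1` A))); rewrite fineK// fin_num_measure.
  have p1 : 1 - eps / 2 <= p by rewrite -lee_fin EFinB -pE.
  have p0 : 0 <= p by rewrite -lee_fin -pE.
  rewrite pE -EFinM -EFinB lee_fin /c.
  have [h|h] := leP 0 (1 - eps / 2).
    apply: (@le_trans _ _ ((1 - eps / 2) * (1 - eps / 2))); last by rewrite ler_wpM2l.
    have := sqr_ge0 (eps / 2); nra.
  rewrite mul0r; move: h; lra.
apply: prob_product_ge => //.
have hev := ae_sections hF.
apply: ae_imp (ae_and hev (ae_and (ae_brox_lt hPW hPB hL) wreg)) => W [ev [bx rW]] [k /= kn].
have dk := hdeep k kn kn; move: dk; rewrite /th.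
case: unpickle => [[[[[[[u s] t] v] mu] eta] m]|] dk; last by case.
move=> hA; change (rv_set (r / 2) (u, s, t, v, mu, eta, m) (aff al 0 W) \/
  rv_set (r / 2) (u, s, t, v, mu, eta, m) (aff al 0 (refl W))) in hA.
have dp : param_deep r d K N M (u, s, t, v, mu, eta, m) al by case: hA => hA; exact: (dk _ hA).
have rv : right_valley al (al * r / 2) (al ^+ 2 * ratr u) (al ^+ 2 * ratr s) (al ^+ 2 * ratr t)
     (al ^+ 2 * ratr v) (al * ratr mu) (al * ratr eta) (al ^+ 2 * m.+1%:R^-1) W \/
   right_valley al (al * r / 2) (al ^+ 2 * ratr u) (al ^+ 2 * ratr s) (al ^+ 2 * ratr t)
     (al ^+ 2 * ratr v) (al * ratr mu) (al * ratr eta) (al ^+ 2 * m.+1%:R^-1) (refl W).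
  rewrite -(mulrA al); case: hA => hA; [left|right]; exact: right_valley_scale hA.
rewrite /param_deep in dp.
have PF := section_prob hPB al0 hr0 hr1 d0 d0 dd (ler0n _ Vg) PG ddelta mF ev bx rW rv dp.
rewrite Me -EFinB in PF.
by rewrite /c maxEge; case: ifPn => _; [exact: measure_ge0|exact: PF].
Qed.

End large_depth_event.

Theorem theorem1p3 (R : realType)
  (PW : probability (env R) R) (hPW : two_sided_wiener PW)
  (PB : probability (omega R) R) (hPB : standard_wiener PB)
  (L : env R * omega R -> R -> R -> R)
  (hL : is_local_time (PW \x PB)%E (@brox R) L)
  (K r : R) (hK : 0 < K) (hr0 : 0 < r) (hr1 : r < 1)
  (delta : R) (hdelta : 0 < delta) :
  (forall alpha : R, 0 < alpha ->
     ((PW \x PB)%E^*)%mu.-cara.-measurable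
       (local_time_event L K r delta alpha)) /\
  @completed_measure_extension _ _ R (PW \x PB)%E
    (local_time_event L K r delta alpha) @[alpha --> +oo] --> 1%E.
Proof.
have key alpha : 0 < alpha -> exists F, [/\ measurable F,
    {ae (PW \x PB)%E, forall w, local_time_event L K r delta alpha w <-> F w},
    ((PW \x PB)%E^*)%mu.-cara.-measurable (local_time_event L K r delta alpha) &
    @completed_measure_extension _ _ R (PW \x PB)%E (local_time_event L K r delta alpha) = (PW \x PB)%E F].
  move=> a0; have [F mF hF] := event_modification hPW hL r delta hK a0.
  have [h1 h2] := completion_ae mF hF.
  by exists F; split.
split=> [alpha a0|]; first by have [F []] := key _ a0.
apply/fine_cvgP; split.
  near=> al.
  have al0 : 0 < al by near: al; exact: nbhs_pinfty_gt.
  have [F [mF _ _ ->]] := key _ al0.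
  by have [p -> _] := @prob_product_le1 R PW PB F mF.
apply/cvgrPdist_le => e e0; near=> al.
have al0 : 0 < al by near: al; exact: nbhs_pinfty_gt.
have h : forall F : set (env R * omega R), measurable F ->
    {ae (PW \x PB)%E, forall w, local_time_event L K r delta al w <-> F w} ->
    (1 - e%:E <= (PW \x PB)%E F)%E.
  by near: al; exact: event_prob_large.
have [F [mF hF _ FE]] := key _ al0.
have := h F mF hF; rewrite /= FE.
have [p pE p1] := @prob_product_le1 R PW PB F mF.
rewrite pE -EFinB !lee_fin /= => pe.
rewrite ger0_norm; lra.
Unshelve. all: by end_near. Qed.
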